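(* Let $\Omega\subset\mathbb{C}$ be a bounded connected open set and $\varphi:\mathbb{D}\to\Omega$ an analytic covering map. Let $\alpha\in\partial\mathbb{D}$ be such that the radial limit $p=\lim_{r\to1^-}\varphi(r\alpha)$ exists (so $p\in\partial\Omega$). (1) If $p$ is not isolated in $\partial\Omega$, then for every sufficiently small simple closed curve $S$ in $\mathbb{C}$ containing $p$ in its interior (bounded complementary domain), there is a component $\widehat S$ of $\varphi^{-1}(S)$ whose closure in $\overline{\mathbb{D}}$ is an arc separating $\alpha$ from $0$ in $\overline{\mathbb{D}}$. (2) If $p$ is isolated in $\partial\Omega$, then for every sufficiently small simple closed curve $S\subset\Omega$ containing $p$ in its interior, there is a component $\widehat S$ of $\varphi^{-1}(S)$ whose closure is a simple closed curve meeting $\partial\mathbb{D}$ exactly in $\{\alpha\}$. Moreover, in both cases the diameter of $\widehat S$ can be made arbitrarily small by choosing $S$ sufficiently small.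
   Context: $\mathbb{D}$ is the open unit disk in $\mathbb{C}$. *)

(* Defs.v *)
From Stdlib Require Import Reals.
Open Scope R_scope.

Definition CC := (R * R)%type.
Definition C0 : CC := (0, 0).
Definition Csub (z w : CC) : CC := (fst z - fst w, snd z - snd w).
Definition Cmul (z w : CC) : CC :=
  (fst z * fst w - snd z * snd w, fst z * snd w + snd z * fst w).
Definition Cscale (r : R) (z : CC) : CC := (r * fst z, r * snd z).
Definition Cnorm (z : CC) : R := sqrt (fst z * fst z + snd z * snd z).
Definition Cdist (z w : CC) : R := Cnorm (Csub z w).

Definition unit_disk (z : CC) : Prop := Cnorm z < 1.
Definition closed_unit_disk (z : CC) : Prop := Cnorm z <= 1.
Definition unit_circle (z : CC) : Prop := Cnorm z = 1.

Definition is_open (U : CC -> Prop) : Prop :=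
  forall z, U z -> exists e, 0 < e /\ forall w, Cdist w z < e -> U w.
Definition is_bounded (A : CC -> Prop) : Prop :=
  exists M, forall z, A z -> Cnorm z <= M.
Definition is_connected (A : CC -> Prop) : Prop :=
  ~ exists U V : CC -> Prop,
      is_open U /\ is_open V /\
      (forall z, A z -> U z \/ V z) /\
      (exists z, A z /\ U z) /\ (exists z, A z /\ V z) /\
      (forall z, A z -> U z -> V z -> False).
(* the connected component of A containing z0 (empty if z0 is not in A) *)
Definition component (A : CC -> Prop) (z0 : CC) : CC -> Prop :=
  fun w => exists K : CC -> Prop,
    is_connected K /\ (forall z, K z -> A z) /\ K z0 /\ K w.
Definition closure (A : CC -> Prop) : CC -> Prop :=
  fun z => forall e, 0 < e -> exists w, A w /\ Cdist w z < e.
Definition boundary (A : CC -> Prop) : CC -> Prop :=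
  fun z => closure A z /\ ~ A z.
Definition isolated_in (A : CC -> Prop) (p : CC) : Prop :=
  A p /\ exists e, 0 < e /\ forall q, A q -> Cdist q p < e -> q = p.

Definition continuous_on (A : CC -> Prop) (f : CC -> CC) : Prop :=
  forall z, A z -> forall e, 0 < e -> exists d, 0 < d /\
    forall w, A w -> Cdist w z < d -> Cdist (f w) (f z) < e.
Definition holomorphic_on (U : CC -> Prop) (f : CC -> CC) : Prop :=
  forall z, U z -> exists L : CC, forall e, 0 < e -> exists d, 0 < d /\
    forall w, Cdist w z < d ->
      Cnorm (Csub (Csub (f w) (f z)) (Cmul L (Csub w z))) <= e * Cdist w z.
Definition covering_map (U Omega : CC -> Prop) (f : CC -> CC) : Prop :=
  continuous_on U f /\
  (forall z, U z -> Omega (f z)) /\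
  (forall q, Omega q -> exists z, U z /\ f z = q) /\
  (forall q, Omega q -> exists V : CC -> Prop,
     is_open V /\ V q /\ (forall w, V w -> Omega w) /\
     exists (I : Type) (W : I -> CC -> Prop),
       (forall i, is_open (W i)) /\
       (forall i z, W i z -> U z) /\
       (forall i j z, W i z -> W j z -> i = j) /\
       (forall z, U z -> V (f z) -> exists i, W i z) /\
       (forall i z, W i z -> V (f z)) /\
       (forall i, exists g : CC -> CC, continuous_on V g /\
          (forall w, V w -> W i (g w) /\ f (g w) = w) /\
          (forall z, W i z -> g (f z) = z))).

Definition path_continuous (g : R -> CC) : Prop :=
  forall t, 0 <= t <= 1 -> forall e, 0 < e -> exists d, 0 < d /\
    forall s, 0 <= s <= 1 -> Rabs (s - t) < d -> Cdist (g s) (g t) < e.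
Definition is_arc (A : CC -> Prop) : Prop :=
  exists g : R -> CC, path_continuous g /\
    (forall s t, 0 <= s <= 1 -> 0 <= t <= 1 -> g s = g t -> s = t) /\
    (forall z, A z <-> exists t, 0 <= t <= 1 /\ g t = z).
Definition is_simple_closed_curve (A : CC -> Prop) : Prop :=
  exists g : R -> CC, path_continuous g /\ g 0 = g 1 /\
    (forall s t, 0 <= s < 1 -> 0 <= t < 1 -> g s = g t -> s = t) /\
    (forall z, A z <-> exists t, 0 <= t <= 1 /\ g t = z).
Definition in_interior (S : CC -> Prop) (p : CC) : Prop :=
  ~ S p /\ is_bounded (component (fun z => ~ S z) p).
Definition separates (K X : CC -> Prop) (a b : CC) : Prop :=
  X a /\ X b /\ ~ K a /\ ~ K b /\
  ~ component (fun z => X z /\ ~ K z) a b.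

Definition radial_limit (f : CC -> CC) (alpha p : CC) : Prop :=
  forall e, 0 < e -> exists d, 0 < d /\
    forall r, 1 - d < r < 1 -> Cdist (f (Cscale r alpha)) p < e.

Definition disk_preimage (phi : CC -> CC) (S : CC -> Prop) : CC -> Prop :=
  fun z => unit_disk z /\ S (phi z).

(* Main.v *)
From Stdlib Require Import Reals ZArith Lra Lia Psatz Classical ClassicalEpsilon.
From Coquelicot Require Import Coquelicot.
Require Import Defs.
Open Scope R_scope.

(** The component of phi^-1(B) containing the end of the radius, where B is the component of p off S, is
    separated from 0 in the disk by one component Sh of phi^-1(S), by unicoherence.  Sh is the image of
    a maximal lift of a parametrisation of S, and Koebe's lemma makes its diameter small with S.
    If S leaves Omega, both ends of the lift are asymptotic paths of phi with values on S; by Lindelof's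
    theorem they do not end at alpha.  If S lies in Omega, the lift is injective (a closed lift would,
    by the maximum principle, force |phi 0 - p| < eps), it is proper, and the deck transformation along
    it is a self-map of the disk whose orbits converge to the two ends.
    When p is not isolated, an end at alpha would make phi automorphic under an affine map of the
    half-plane model at alpha, contradicting the radial limit p; and the two ends differ, again by the
    maximum principle.  When p is isolated, the universal covering w -> p + exp w of a punctured disk
    factors through phi, Koebe's lemma shows that the lifted half-plane map tends to alpha as
    Re w -> -oo, and Schwarz-Pick carries this limit over to both ends of the lift. *)

(* [ring] and [field] only recognise [C], not its alias [CC]. *)
Ltac toC := repeat match goal with
  | x : CC |- _ => change C in (type of x)
  | x : CC -> CC |- _ => change (C -> C) in (type of x)
  | x : R -> CC |- _ => change (R -> C) in (type of x)
  | |- @eq CC ?a ?b => change (@eq C a b)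
  end.

(** Enclosing and separating are expressed by continuous logarithms instead of winding numbers: a
    closed set K in the closed disk encloses an inner point a when z - a has no continuous logarithm
    on K. Koebe and Lindelof both apply this to a path completed by mirror images, where the
    symmetry forbids a logarithm, and then bound a product of reflected copies of f that has a small
    factor on every copy of the path. The maximum principle is used in a form that ignores one
    boundary point of a bounded function; this point absorbs the single place where nothing is
    known: the end of a path, a puncture, the point where a horodisk touches the circle, a common
    end of a lift. The difficulty is that phi does not see the ends of a lift when S lies in Omega,
    since its values run round S forever. Schwarz-Pick makes up for this: consecutive points of an
    orbit of the deck transformation stay at bounded hyperbolic distance, hence become close near
    the circle, and the horofunction |b - z|^2 / (1 - |z|^2) stays bounded along the lift, which
    pins down the limit b. *)

Lemma Cnorm_Cmod (z : C) : Cnorm z = Cmod z.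
Proof. unfold Cnorm, Cmod. f_equal. ring. Qed.

Lemma Cdist_Cmod (z w : C) : Cdist z w = Cmod (z - w)%C.
Proof. unfold Cdist. rewrite Cnorm_Cmod. reflexivity. Qed.

Lemma Cdist_sym z w : Cdist z w = Cdist w z.
Proof. rewrite !Cdist_Cmod, <- Cmod_opp. f_equal. ring. Qed.

Lemma Cdist_tri x y z : Cdist x z <= Cdist x y + Cdist y z.
Proof.
  rewrite !Cdist_Cmod.
  replace (x - z)%C with ((x - y) + (y - z))%C by ring. apply Cmod_triangle.
Qed.

Lemma Cdist_refl z : Cdist z z = 0.
Proof. rewrite Cdist_Cmod. replace (z - z)%C with (RtoC 0) by ring. apply Cmod_0. Qed.

Lemma Cdist_pos z w : 0 <= Cdist z w.
Proof. rewrite Cdist_Cmod. apply Cmod_ge_0. Qed.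

Lemma Cdist_eq0 (z w : C) : Cdist z w = 0 -> z = w.
Proof.
  rewrite Cdist_Cmod. intros H. apply Cmod_eq_0 in H. apply Ceq_minus. exact H.
Qed.

Lemma Cdist_neq_pos (z w : C) : z <> w -> 0 < Cdist z w.
Proof.
  intros H. destruct (Rle_lt_or_eq_dec _ _ (Cdist_pos z w)) as [h|h]; auto.
  exfalso. apply H, Cdist_eq0. auto.
Qed.

Lemma Cmod_fst (z : C) : Rabs (fst z) <= Cmod z.
Proof. eapply Rle_trans; [|apply Rmax_Cmod]. apply Rmax_l. Qed.

Lemma Cmod_snd (z : C) : Rabs (snd z) <= Cmod z.
Proof. eapply Rle_trans; [|apply Rmax_Cmod]. apply Rmax_r. Qed.

Lemma Cmod_sq (z : C) : Cmod z * Cmod z = fst z * fst z + snd z * snd z.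
Proof. unfold Cmod. rewrite sqrt_sqrt; [ring|nra]. Qed.

Lemma Cmod_le_fst_snd (z : C) : Cmod z <= Rabs (fst z) + Rabs (snd z).
Proof.
  pose proof (Cmod_sq z). pose proof (Cmod_ge_0 z).
  pose proof (Rabs_pos (fst z)). pose proof (Rabs_pos (snd z)).
  pose proof (Rsqr_abs (fst z)). pose proof (Rsqr_abs (snd z)). unfold Rsqr in *.
  nra.
Qed.

Lemma Cdist_fst z w : Rabs (fst z - fst w) <= Cdist z w.
Proof. rewrite Cdist_Cmod. apply (Cmod_fst (z - w)%C). Qed.

Lemma Cdist_snd z w : Rabs (snd z - snd w) <= Cdist z w.
Proof. rewrite Cdist_Cmod. apply (Cmod_snd (z - w)%C). Qed.

Lemma Cdist_le_fst_snd z w : Cdist z w <= Rabs (fst z - fst w) + Rabs (snd z - snd w).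
Proof. rewrite Cdist_Cmod. apply (Cmod_le_fst_snd (z - w)%C). Qed.

Lemma Cmod_sub_le (z w : C) : Cmod z - Cmod w <= Cmod (z - w)%C.
Proof.
  pose proof (Cmod_triangle (z - w) w). replace (z - w + w)%C with z in H by ring. lra.
Qed.

Lemma Cmod_dist_le (z w : C) : Rabs (Cmod z - Cmod w) <= Cdist z w.
Proof.
  pose proof (Cmod_sub_le z w). pose proof (Cmod_sub_le w z).
  rewrite <- !Cdist_Cmod in *. rewrite (Cdist_sym w z) in *.
  apply Rabs_le. lra.
Qed.

(** * Relative continuity *)

(** The condition inside [continuous_on], at one point. With [A := everywhere] it is ordinary
    continuity, so relative and absolute continuity share one calculus. *)
Definition cont_in (A : C -> Prop) (f : C -> C) (z : C) : Prop :=
  forall e, 0 < e -> exists d, 0 < d /\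
    forall w, A w -> Cdist w z < d -> Cdist (f w) (f z) < e.

Definition everywhere (z : C) : Prop := True.
Notation cont_at := (cont_in everywhere).

Lemma cont_in_sub (A B : C -> Prop) f z :
  (forall w, A w -> B w) -> cont_in B f z -> cont_in A f z.
Proof.
  intros H c e he. destruct (c e he) as [d [hd h]]. exists d; split; auto.
Qed.

Lemma cont_at_in A f z : cont_at f z -> cont_in A f z.
Proof. apply cont_in_sub. intros; exact I. Qed.

Lemma cont_in_local A f g z r : 0 < r -> A z ->
  (forall w, A w -> Cdist w z < r -> f w = g w) -> cont_in A g z -> cont_in A f z.
Proof.
  intros hr hz H c e he. destruct (c e he) as [d [hd h]].
  exists (Rmin d r). split; [apply Rmin_pos; auto|].
  intros w hw hwd. pose proof (Rmin_l d r). pose proof (Rmin_r d r).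
  rewrite !H; auto; try lra.
  - apply h; auto; lra.
  - rewrite Cdist_refl; auto.
Qed.

Lemma cont_in_ext A f g z : A z -> (forall w, A w -> f w = g w) -> cont_in A g z -> cont_in A f z.
Proof. intros hz H. apply (cont_in_local A f g z 1); auto; lra. Qed.

Lemma cont_in_const A c z : cont_in A (fun _ => c) z.
Proof. intros e he. exists 1. split; [lra|]. intros. rewrite Cdist_refl; auto. Qed.

Lemma cont_in_id A z : cont_in A (fun w => w) z.
Proof. intros e he. exists e. split; auto. Qed.

Lemma cont_in_comp A B f g z : (forall w, A w -> B (f w)) ->
  cont_in A f z -> cont_in B g (f z) -> cont_in A (fun w => g (f w)) z.
Proof.
  intros hB cf cg e he. destruct (cg e he) as [d [hd h]].
  destruct (cf d hd) as [d' [hd' h']]. exists d'. split; auto.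
Qed.

Lemma cont_in_comp_at A f g z :
  cont_in A f z -> cont_at g (f z) -> cont_in A (fun w => g (f w)) z.
Proof. apply cont_in_comp. intros; exact I. Qed.

Lemma cont_in_plus A f g z : cont_in A f z -> cont_in A g z ->
  cont_in A (fun w => f w + g w)%C z.
Proof.
  intros cf cg e he. destruct (cf (e/2)) as [d [hd h]]; [lra|].
  destruct (cg (e/2)) as [d' [hd' h']]; [lra|].
  exists (Rmin d d'). split; [apply Rmin_pos; auto|]. intros w hw hwd.
  pose proof (Rmin_l d d'). pose proof (Rmin_r d d').
  specialize (h w hw ltac:(lra)). specialize (h' w hw ltac:(lra)).
  rewrite Cdist_Cmod in *.
  replace (f w + g w - (f z + g z))%C with ((f w - f z) + (g w - g z))%C by ring.
  eapply Rle_lt_trans; [apply Cmod_triangle|]. lra.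
Qed.

Lemma cont_in_mult A f g z : cont_in A f z -> cont_in A g z ->
  cont_in A (fun w => f w * g w)%C z.
Proof.
  intros cf cg e he. set (M := Cmod (f z) + Cmod (g z) + 1).
  assert (hM : 0 < M) by (unfold M; pose proof (Cmod_ge_0 (f z)); pose proof (Cmod_ge_0 (g z)); lra).
  set (e' := Rmin 1 (e / (2 * M))).
  assert (he' : 0 < e') by (apply Rmin_pos; [lra|apply Rdiv_lt_0_compat; lra]).
  assert (he1 : e' <= 1) by apply Rmin_l.
  assert (he2 : e' * (2 * M) <= e).
  { apply Rle_trans with (e / (2 * M) * (2 * M)).
    apply Rmult_le_compat_r; [lra|apply Rmin_r]. right; field; lra. }
  destruct (cf e' he') as [d [hd h]]. destruct (cg e' he') as [d' [hd' h']].
  exists (Rmin d d'). split; [apply Rmin_pos; auto|]. intros w hw hwd.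
  pose proof (Rmin_l d d'). pose proof (Rmin_r d d').
  specialize (h w hw ltac:(lra)). specialize (h' w hw ltac:(lra)).
  rewrite Cdist_Cmod in *.
  replace (f w * g w - f z * g z)%C with
    ((f w - f z) * (g w - g z) + ((f w - f z) * g z + f z * (g w - g z)))%C by ring.
  eapply Rle_lt_trans; [apply Cmod_triangle|].
  eapply Rle_lt_trans; [apply Rplus_le_compat_l, Cmod_triangle|].
  rewrite !Cmod_mult. unfold M in *.
  pose proof (Cmod_ge_0 (f z)). pose proof (Cmod_ge_0 (g z)).
  pose proof (Cmod_ge_0 (f w - f z)). pose proof (Cmod_ge_0 (g w - g z)).
  set (a := Cmod (f w - f z)) in *. set (b := Cmod (g w - g z)) in *.
  set (x := Cmod (f z)) in *. set (y := Cmod (g z)) in *.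
  assert (a * b <= e' * 1) by (apply Rmult_le_compat; lra).
  assert (a * y <= e' * y) by (apply Rmult_le_compat_r; lra).
  assert (x * b <= x * e') by (apply Rmult_le_compat_l; lra). nra.
Qed.

Lemma cont_at_Cinv (z : C) : z <> 0 -> cont_at Cinv z.
Proof.
  intros hz e he. assert (hm : 0 < Cmod z) by (apply Cmod_gt_0; auto).
  set (m := Cmod z) in *.
  exists (Rmin (m / 2) (e * m * m / 2)). split.
  { apply Rmin_pos; [lra|]. assert (0 < e * m * m) by (repeat apply Rmult_lt_0_compat; auto). lra. }
  intros w _ hwd. pose proof (Rmin_l (m/2) (e * m * m / 2)). pose proof (Rmin_r (m/2) (e * m * m / 2)).
  rewrite Cdist_Cmod in *.
  assert (hw : m / 2 < Cmod w).
  { pose proof (Cmod_sub_le z w) as T. rewrite <- Cdist_Cmod, Cdist_sym, Cdist_Cmod in T.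
    fold m in T. lra. }
  assert (hw0 : w <> RtoC 0) by (apply Cmod_gt_0; lra).
  replace (/ w - / z)%C with (- ((w - z) * / (w * z)))%C by (field; auto).
  rewrite Cmod_opp, Cmod_mult, Cmod_inv by (apply Cmult_neq_0; auto).
  rewrite Cmod_mult. fold m.
  assert (0 < Cmod w * m) by (apply Rmult_lt_0_compat; lra).
  apply Rmult_lt_reg_r with (Cmod w * m); auto.
  rewrite Rmult_assoc, Rinv_l by lra.
  assert (e * (m / 2 * m) < e * (Cmod w * m)).
  { apply Rmult_lt_compat_l; [|apply Rmult_lt_compat_r]; lra. }
  lra.
Qed.

Lemma cont_in_inv A f z : f z <> RtoC 0 -> cont_in A f z -> cont_in A (fun w => / f w)%C z.
Proof. intros h c. apply (cont_in_comp_at A f Cinv); auto. apply cont_at_Cinv; auto. Qed.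

Lemma cont_in_opp A f z : cont_in A f z -> cont_in A (fun w => - f w)%C z.
Proof.
  intros c. intros e he. destruct (c e he) as [d [hd h]]. exists d. split; auto.
  intros w hw hd'. specialize (h w hw hd'). rewrite Cdist_Cmod in *.
  replace (- f w - - f z)%C with (- (f w - f z))%C by ring. rewrite Cmod_opp. auto.
Qed.

Lemma cont_in_minus A f g z : cont_in A f z -> cont_in A g z ->
  cont_in A (fun w => f w - g w)%C z.
Proof. intros. apply (cont_in_plus A f (fun w => - g w)%C); auto. apply cont_in_opp; auto. Qed.

Lemma cont_in_div A f g z : g z <> RtoC 0 -> cont_in A f z -> cont_in A g z ->
  cont_in A (fun w => f w / g w)%C z.
Proof. intros. apply cont_in_mult; auto. apply cont_in_inv; auto. Qed.

Lemma cont_in_conj A f z : cont_in A f z -> cont_in A (fun w => Cconj (f w)) z.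
Proof.
  intros c e he. destruct (c e he) as [d [hd h]]. exists d. split; auto.
  intros w hw hd'. specialize (h w hw hd'). rewrite Cdist_Cmod in *.
  rewrite <- Cminus_conj, Cmod_conj. auto.
Qed.

Lemma cont_in_pair A (u v : C -> R) z :
  cont_in A (fun w => RtoC (u w)) z -> cont_in A (fun w => RtoC (v w)) z ->
  cont_in A (fun w => (u w, v w)) z.
Proof.
  intros cu cv e he.
  destruct (cu (e/2)) as [d [hd h]]; [lra|]. destruct (cv (e/2)) as [d' [hd' h']]; [lra|].
  exists (Rmin d d'). split; [apply Rmin_pos; auto|]. intros w hw hwd.
  pose proof (Rmin_l d d'). pose proof (Rmin_r d d').
  specialize (h w hw ltac:(lra)). specialize (h' w hw ltac:(lra)).
  rewrite Cdist_Cmod in h, h'. rewrite <- RtoC_minus, Cmod_R in h, h'.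
  eapply Rle_lt_trans; [apply Cdist_le_fst_snd|]. simpl. lra.
Qed.

Lemma cont_in_fst A f z : cont_in A f z -> cont_in A (fun w => RtoC (fst (f w))) z.
Proof.
  intros c e he. destruct (c e he) as [d [hd h]]. exists d; split; auto. intros w hw hd'.
  eapply Rle_lt_trans; [|apply (h w hw hd')].
  rewrite Cdist_Cmod, <- RtoC_minus, Cmod_R. apply Cdist_fst.
Qed.

Lemma cont_in_snd A f z : cont_in A f z -> cont_in A (fun w => RtoC (snd (f w))) z.
Proof.
  intros c e he. destruct (c e he) as [d [hd h]]. exists d; split; auto. intros w hw hd'.
  eapply Rle_lt_trans; [|apply (h w hw hd')].
  rewrite Cdist_Cmod, <- RtoC_minus, Cmod_R. apply Cdist_snd.
Qed.

Lemma cont_in_Cmod A f z : cont_in A f z -> cont_in A (fun w => RtoC (Cmod (f w))) z.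
Proof.
  intros c e he. destruct (c e he) as [d [hd h]]. exists d; split; auto. intros w hw hd'.
  eapply Rle_lt_trans; [|apply (h w hw hd')].
  rewrite Cdist_Cmod, <- RtoC_minus, Cmod_R. apply Cmod_dist_le.
Qed.

Lemma continuity_pt_bound (u : R -> R) x : continuity_pt u x -> forall e, 0 < e ->
  exists d, 0 < d /\ forall y, Rabs (y - x) < d -> Rabs (u y - u x) < e.
Proof.
  intros c e he. destruct (c e he) as [d [hd h]]. exists d; split; auto. intros y hy.
  destruct (Req_dec y x) as [->|hne].
  - rewrite Rminus_diag, Rabs_R0; auto.
  - apply h. split; auto. split; [exact I|auto].
Qed.

Lemma cont_in_real A (u : R -> R) (f : C -> R) z : continuity_pt u (f z) ->
  cont_in A (fun w => RtoC (f w)) z -> cont_in A (fun w => RtoC (u (f w))) z.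
Proof.
  intros cu cf e he. destruct (continuity_pt_bound u _ cu e he) as [d [hd h]].
  destruct (cf d hd) as [d' [hd' h']]. exists d'; split; auto. intros w hw hwd.
  specialize (h' w hw hwd). rewrite Cdist_Cmod, <- RtoC_minus, Cmod_R in *. auto.
Qed.

Lemma cont_in_Rmult A (u v : C -> R) z :
  cont_in A (fun w => RtoC (u w)) z -> cont_in A (fun w => RtoC (v w)) z ->
  cont_in A (fun w => RtoC (u w * v w)) z.
Proof.
  intros hu hv. intros e he. destruct (cont_in_mult _ _ _ _ hu hv e he) as [d [hd h]].
  exists d; split; auto. intros w hw hwd. rewrite !RtoC_mult. auto.
Qed.

Lemma cont_in_Rplus A (u v : C -> R) z :
  cont_in A (fun w => RtoC (u w)) z -> cont_in A (fun w => RtoC (v w)) z ->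
  cont_in A (fun w => RtoC (u w + v w)) z.
Proof.
  intros hu hv. intros e he. destruct (cont_in_plus _ _ _ _ hu hv e he) as [d [hd h]].
  exists d; split; auto. intros w hw hwd. rewrite !RtoC_plus. auto.
Qed.

Lemma cont_in_Rdiv A (u v : C -> R) z : v z <> 0 ->
  cont_in A (fun w => RtoC (u w)) z -> cont_in A (fun w => RtoC (v w)) z ->
  cont_in A (fun w => RtoC (u w / v w)) z.
Proof.
  intros hz hu hv. apply cont_in_Rmult; auto.
  apply (cont_in_real A Rinv v); auto.
  apply continuity_pt_inv; auto. apply derivable_continuous_pt, derivable_pt_id.
Qed.

(** * Complex derivatives *)

(** Literally the inner clause of [holomorphic_on], so that [holomorphic_on U f] converts to the
    existence of some [L] with [is_cderiv f z L] at every point of [U]. *)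
Definition is_cderiv (f : C -> C) (z L : C) : Prop :=
  forall e, 0 < e -> exists d, 0 < d /\
    forall w, Cdist w z < d ->
      Cnorm (Csub (Csub (f w) (f z)) (Cmul L (Csub w z))) <= e * Cdist w z.

Lemma is_cderiv_Cmod f z L : is_cderiv f z L <->
  forall e, 0 < e -> exists d, 0 < d /\
    forall w : C, Cmod (w - z) < d -> Cmod (f w - f z - L * (w - z))%C <= e * Cmod (w - z).
Proof.
  split; intros H e he; destruct (H e he) as [d [hd h]]; exists d; split; auto; intros w hw.
  - rewrite <- Cdist_Cmod in hw. specialize (h w hw). rewrite Cnorm_Cmod, Cdist_Cmod in h. exact h.
  - rewrite Cdist_Cmod in hw. specialize (h w hw). rewrite Cnorm_Cmod, Cdist_Cmod. exact h.
Qed.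

(* Caratheodory's formulation: it reduces the rules of calculus to those of continuity. *)
Lemma cderiv_slope f z L : is_cderiv f z L <->
  exists q : C -> C, cont_at q z /\ q z = L /\ forall w, (f w - f z = q w * (w - z))%C.
Proof.
  rewrite is_cderiv_Cmod. split.
  - intros H.
    exists (fun w => if Ceq_dec w z then L else ((f w - f z) / (w - z))%C).
    repeat split.
    + intros e he. destruct (H (e/2)) as [d [hd h]]; [lra|].
      exists d; split; auto. intros w _ hw. rewrite Cdist_Cmod in *.
      destruct (Ceq_dec z z) as [_|n]; [|congruence].
      destruct (Ceq_dec w z) as [E|n].
      * replace (L - L)%C with (RtoC 0) by ring. rewrite Cmod_0; auto.
      * assert (hn : (w - z)%C <> 0) by (apply Cminus_eq_contra; auto).
        assert (hp : 0 < Cmod (w - z)) by (apply Cmod_gt_0; auto).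
        replace ((f w - f z) / (w - z) - L)%C with
          ((f w - f z - L * (w - z)) * / (w - z))%C by (field; auto).
        rewrite Cmod_mult, Cmod_inv by auto.
        apply Rmult_lt_reg_r with (Cmod (w - z)); auto.
        rewrite Rmult_assoc, Rinv_l by lra. specialize (h w hw). nra.
    + destruct (Ceq_dec z z) as [_|n]; congruence.
    + intros w. destruct (Ceq_dec w z) as [E|n].
      * rewrite E. ring.
      * field. apply Cminus_eq_contra; auto.
  - intros [q [cq [hq h]]] e he. destruct (cq e he) as [d [hd hd']].
    exists d; split; auto. intros w hw. rewrite h, <- hq.
    replace (q w * (w - z) - q z * (w - z))%C with ((q w - q z) * (w - z))%C by ring.
    rewrite Cmod_mult. apply Rmult_le_compat_r; [apply Cmod_ge_0|].
    left. rewrite <- Cdist_Cmod. apply hd'; [exact I|]. rewrite Cdist_Cmod; auto.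
Qed.

Lemma cderiv_cont f z L : is_cderiv f z L -> cont_at f z.
Proof.
  rewrite cderiv_slope. intros [q [cq [hq h]]].
  apply cont_in_ext with (fun w => f z + q w * (w - z))%C; [exact I| |].
  - intros w _. rewrite <- h. ring.
  - apply cont_in_plus; [apply cont_in_const|]. apply cont_in_mult; auto.
    apply cont_in_minus; [apply cont_in_id|apply cont_in_const].
Qed.

Lemma cderiv_local f g z L r : 0 < r -> (forall w, Cdist w z < r -> f w = g w) ->
  is_cderiv g z L -> is_cderiv f z L.
Proof.
  intros hr H hg. rewrite is_cderiv_Cmod in *. intros e he. destruct (hg e he) as [d [hd h]].
  exists (Rmin d r). split; [apply Rmin_pos; auto|]. intros w hw.
  pose proof (Rmin_l d r). pose proof (Rmin_r d r).
  rewrite !H; [apply h; lra| |]; [rewrite Cdist_refl; auto|rewrite Cdist_Cmod; lra].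
Qed.

Lemma cderiv_ext f g z L : (forall w, f w = g w) -> is_cderiv g z L -> is_cderiv f z L.
Proof. intros H. apply (cderiv_local f g z L 1); auto; lra. Qed.

Lemma cderiv_val f z L M : is_cderiv f z L -> L = M -> is_cderiv f z M.
Proof. intros h <-. exact h. Qed.

Lemma cderiv_const c z : is_cderiv (fun _ => c) z (RtoC 0).
Proof.
  apply cderiv_slope. exists (fun _ => RtoC 0). repeat split; [apply cont_in_const|].
  intros; ring.
Qed.

Lemma cderiv_id z : is_cderiv (fun w => w) z (RtoC 1).
Proof.
  apply cderiv_slope. exists (fun _ => RtoC 1). repeat split; [apply cont_in_const|].
  intros; ring.
Qed.

Lemma cderiv_plus f g z L M : is_cderiv f z L -> is_cderiv g z M ->
  is_cderiv (fun w => f w + g w)%C z (L + M)%C.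
Proof.
  rewrite !cderiv_slope. intros [q [c [hq h]]] [q' [c' [hq' h']]].
  exists (fun w => q w + q' w)%C. repeat split.
  - apply cont_in_plus; auto.
  - rewrite hq, hq'; auto.
  - intros w. replace (f w + g w - (f z + g z))%C with ((f w - f z) + (g w - g z))%C by ring.
    rewrite h, h'. ring.
Qed.

Lemma cderiv_mult f g z L M : is_cderiv f z L -> is_cderiv g z M ->
  is_cderiv (fun w => f w * g w)%C z (L * g z + f z * M)%C.
Proof.
  intros hf hg. pose proof (cderiv_cont _ _ _ hf) as cf. revert hf hg.
  rewrite !cderiv_slope. intros [q [c [hq h]]] [q' [c' [hq' h']]].
  exists (fun w => q w * g z + f w * q' w)%C. repeat split.
  - apply cont_in_plus; apply cont_in_mult; auto; apply cont_in_const.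
  - rewrite hq, hq'; auto.
  - intros w. replace (f w * g w - f z * g z)%C with ((f w - f z) * g z + f w * (g w - g z))%C by ring.
    rewrite h, h'. ring.
Qed.

Lemma cderiv_comp f g z L M : is_cderiv f z L -> is_cderiv g (f z) M ->
  is_cderiv (fun w => g (f w)) z (M * L)%C.
Proof.
  intros hf hg. pose proof (cderiv_cont _ _ _ hf) as cf. revert hf hg.
  rewrite !cderiv_slope. intros [q [c [hq h]]] [q' [c' [hq' h']]].
  exists (fun w => q' (f w) * q w)%C. repeat split.
  - apply cont_in_mult; auto. apply (cont_in_comp_at _ f q'); auto.
  - rewrite hq, hq'; auto.
  - intros w. rewrite h', h. ring.
Qed.

Lemma cderiv_Cinv (z : C) : z <> 0 -> is_cderiv Cinv z (- / (z * z))%C.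
Proof.
  (* The slope identity has to hold for every [w], including 0; the value of the inverse there is
     fixed to 0, and the slope takes the value 1 / z^2 that this forces. Neither matters near
     [z]. *)
  intros hz. apply cderiv_local with (g := fun w => (if Ceq_dec w 0 then RtoC 0 else / w)%C)
    (r := Cmod z).
  - apply Cmod_gt_0; auto.
  - intros w hw. destruct (Ceq_dec w 0) as [->|n]; auto.
    rewrite Cdist_Cmod in hw. replace (0 - z)%C with (- z)%C in hw by ring.
    rewrite Cmod_opp in hw. lra.
  - apply cderiv_slope.
    exists (fun w => if Ceq_dec w 0 then (/ (z * z))%C else (- / (w * z))%C). repeat split.
    + apply cont_in_local with (g := fun w => (- / (w * z))%C) (r := Cmod z).
      * apply Cmod_gt_0; auto.
      * exact I.
      * intros w _ hw. destruct (Ceq_dec w 0) as [->|n]; auto.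
        rewrite Cdist_Cmod in hw. replace (0 - z)%C with (- z)%C in hw by ring.
        rewrite Cmod_opp in hw. lra.
      * apply cont_in_opp, cont_in_inv; [apply Cmult_neq_0; auto|].
        apply cont_in_mult; [apply cont_in_id|apply cont_in_const].
    + destruct (Ceq_dec z 0); [congruence|auto].
    + intros w. destruct (Ceq_dec z 0) as [|_]; [congruence|].
      destruct (Ceq_dec w 0) as [->|n]; field; auto.
Qed.

Lemma cderiv_inv f z L : f z <> RtoC 0 -> is_cderiv f z L ->
  is_cderiv (fun w => / f w)%C z (- / (f z * f z) * L)%C.
Proof. intros h hf. apply (cderiv_comp f Cinv); auto. apply cderiv_Cinv; auto. Qed.

(** Conjugating before and after keeps a map holomorphic; this is how mirror images of [f] enter the
    products of Koebe and Lindelof. *)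
Lemma cderiv_conj_conj f z L : is_cderiv f (Cconj z) L ->
  is_cderiv (fun w => Cconj (f (Cconj w))) z (Cconj L).
Proof.
  rewrite !is_cderiv_Cmod. intros H e he. destruct (H e he) as [d [hd h]].
  exists d; split; auto. intros w hw.
  replace (Cconj (f (Cconj w)) - Cconj (f (Cconj z)) - Cconj L * (w - z))%C with
    (Cconj (f (Cconj w) - f (Cconj z) - L * (Cconj w - Cconj z)))%C.
  - rewrite Cmod_conj. rewrite <- (Cmod_conj (w - z)), Cminus_conj. apply h.
    rewrite <- Cminus_conj, Cmod_conj; auto.
  - rewrite !Cminus_conj, Cmult_conj, Cminus_conj, !Cconj_conj. auto.
Qed.

Lemma cderiv_unique f z L M : is_cderiv f z L -> is_cderiv f z M -> L = M.
Proof.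
  rewrite !is_cderiv_Cmod. intros H H'. apply NNPP. intros n.
  assert (hp : 0 < Cmod (L - M)) by (apply Cmod_gt_0, Cminus_eq_contra; auto).
  destruct (H (Cmod (L - M) / 4)) as [d [hd h]]; [lra|].
  destruct (H' (Cmod (L - M) / 4)) as [d' [hd' h']]; [lra|].
  set (r := Rmin d d' / 2).
  assert (hr : 0 < r) by (unfold r; pose proof (Rmin_pos d d' hd hd'); lra).
  pose proof (Rmin_l d d'). pose proof (Rmin_r d d').
  assert (E : Cmod (z + r - z)%C = r).
  { replace (z + r - z)%C with (RtoC r) by ring. rewrite Cmod_R. apply Rabs_right; lra. }
  specialize (h (z + r)%C). specialize (h' (z + r)%C). rewrite E in h, h'.
  specialize (h ltac:(unfold r; lra)). specialize (h' ltac:(unfold r; lra)).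
  pose proof (Cmod_triangle (- (f (z + r)%C - f z - L * (z + r - z))) (f (z + r)%C - f z - M * (z + r - z))) as T.
  rewrite Cmod_opp in T.
  replace (- (f (z + r)%C - f z - L * (z + r - z)) + (f (z + r)%C - f z - M * (z + r - z)))%C
    with ((L - M) * (z + r - z))%C in T by ring.
  rewrite Cmod_mult, E in T. nra.
Qed.

(** * The exponential *)

Definition cexp (z : C) : C := (exp (fst z) * cos (snd z), exp (fst z) * sin (snd z)).

Lemma cexp_plus z w : cexp (z + w)%C = (cexp z * cexp w)%C.
Proof.
  unfold cexp, Cplus, Cmult. simpl. rewrite exp_plus, cos_plus, sin_plus. f_equal; ring.
Qed.

Lemma Cmod_cexp z : Cmod (cexp z) = exp (fst z).
Proof.
  unfold Cmod, cexp. simpl.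
  replace (exp (fst z) * cos (snd z) * (exp (fst z) * cos (snd z) * 1) +
   exp (fst z) * sin (snd z) * (exp (fst z) * sin (snd z) * 1)) with
   ((exp (fst z) * exp (fst z)) * (Rsqr (sin (snd z)) + Rsqr (cos (snd z)))) by (unfold Rsqr; ring).
  rewrite sin2_cos2, Rmult_1_r. apply sqrt_square. left; apply exp_pos.
Qed.

Lemma cexp_neq0 z : cexp z <> RtoC 0.
Proof. apply Cmod_gt_0. rewrite Cmod_cexp. apply exp_pos. Qed.

Lemma cexp_0 : cexp (RtoC 0) = RtoC 1.
Proof. unfold cexp, RtoC. simpl. rewrite exp_0, cos_0, sin_0. f_equal; ring. Qed.

Lemma cexp_opp z : cexp (- z)%C = (/ cexp z)%C.
Proof.
  assert (H : (cexp (- z) * cexp z = 1)%C).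
  { rewrite <- cexp_plus. replace (- z + z)%C with (RtoC 0) by ring. apply cexp_0. }
  pose proof (cexp_neq0 z). rewrite <- (Cmult_1_l (/ cexp z)), <- H. field. auto.
Qed.

Lemma cexp_minus z w : cexp (z - w)%C = (cexp z / cexp w)%C.
Proof. unfold Cminus. rewrite cexp_plus, cexp_opp. auto. Qed.

Lemma derivable_pt_lim_bound (u : R -> R) x l : derivable_pt_lim u x l -> forall e, 0 < e ->
  exists d, 0 < d /\ forall h, Rabs h < d -> Rabs (u (x + h) - u x - l * h) <= e * Rabs h.
Proof.
  intros H e he. destruct (H e he) as [d h]. exists d. split; [apply cond_pos|].
  intros k hk. destruct (Req_dec k 0) as [->|n].
  - rewrite Rplus_0_r. replace (u x - u x - l * 0) with 0 by ring. rewrite Rabs_R0. lra.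
  - specialize (h k n hk).
    replace (u (x + k) - u x - l * k) with (((u (x + k) - u x) / k - l) * k) by (field; auto).
    rewrite Rabs_mult. apply Rmult_le_compat_r; [apply Rabs_pos|lra].
Qed.

Lemma mult_between a b A B : - A <= a <= A -> - B <= b <= B -> - (A * B) <= a * b <= A * B.
Proof.
  intros h1 h2. apply Rabs_le_between. rewrite Rabs_mult.
  apply Rmult_le_compat; try apply Rabs_pos; apply Rabs_le_between; auto.
Qed.

Lemma cderiv_cexp_0 : is_cderiv cexp (RtoC 0) (RtoC 1).
Proof.
  (* Each coordinate of the remainder comes out below [4 * e * Cmod w], hence the divisor 8;
     [e <= 1] keeps the products of small terms linear. *)
  apply is_cderiv_Cmod. intros e0 he0. set (e := Rmin 1 (e0 / 8)).
  assert (he : 0 < e) by (apply Rmin_pos; lra).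
  assert (he1 : e <= 1) by apply Rmin_l. assert (he2 : e <= e0 / 8) by apply Rmin_r.
  clearbody e.
  destruct (derivable_pt_lim_bound exp 0 _ (derivable_pt_lim_exp 0) e he) as [d1 [hd1 h1]].
  destruct (derivable_pt_lim_bound cos 0 _ (derivable_pt_lim_cos 0) e he) as [d2 [hd2 h2]].
  destruct (derivable_pt_lim_bound sin 0 _ (derivable_pt_lim_sin 0) e he) as [d3 [hd3 h3]].
  exists (Rmin e (Rmin d1 (Rmin d2 d3))). split; [repeat apply Rmin_pos; auto|].
  intros w hw. replace (w - 0)%C with w in * by ring.
  pose proof (Rmin_l e (Rmin d1 (Rmin d2 d3))). pose proof (Rmin_r e (Rmin d1 (Rmin d2 d3))).
  pose proof (Rmin_l d1 (Rmin d2 d3)). pose proof (Rmin_r d1 (Rmin d2 d3)).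
  pose proof (Rmin_l d2 d3). pose proof (Rmin_r d2 d3).
  pose proof (Cmod_fst w) as hx. pose proof (Cmod_snd w) as hy.
  specialize (h1 (fst w) ltac:(lra)). specialize (h2 (snd w) ltac:(lra)).
  specialize (h3 (snd w) ltac:(lra)).
  rewrite Rplus_0_l, exp_0 in h1. rewrite Rplus_0_l, cos_0, sin_0 in h2, h3.
  rewrite cexp_0.
  eapply Rle_trans; [apply Cmod_le_fst_snd|].
  unfold cexp, RtoC, Cminus, Cmult, Cplus, Copp; simpl.
  set (x := fst w) in *. set (y := snd w) in *. set (N := Cmod w) in *.
  assert (hN : 0 <= N) by apply Cmod_ge_0.
  assert (A1 : Rabs (exp x - 1 - x) <= e * N).
  { replace (exp x - 1 - x) with (exp x - 1 - 1 * x) by ring.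
    eapply Rle_trans; [exact h1|apply Rmult_le_compat_l; lra]. }
  assert (A2 : Rabs (cos y - 1) <= e * N).
  { replace (cos y - 1) with (cos y - 1 - - 0 * y) by ring.
    eapply Rle_trans; [exact h2|apply Rmult_le_compat_l; lra]. }
  assert (A3 : Rabs (sin y - y) <= e * N).
  { replace (sin y - y) with (sin y - 0 - 1 * y) by ring.
    eapply Rle_trans; [exact h3|apply Rmult_le_compat_l; lra]. }
  apply Rabs_le_between in A1. apply Rabs_le_between in A2. apply Rabs_le_between in A3.
  apply Rabs_le_between in hx. apply Rabs_le_between in hy.
  pose proof (COS_bound y). pose proof (SIN_bound y).
  assert (NN : N <= e) by lra.
  assert (B1 : - (4 * e * N) <= exp x * cos y - 1 - x <= 4 * e * N).
  { replace (exp x * cos y - 1 - x) with ((exp x - 1 - x) * cos y + (cos y - 1) * (1 + x)) by ring.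
    set (a := exp x - 1 - x) in *. set (b := cos y - 1) in *. set (c := cos y) in *.
    pose proof (mult_between a c (e * N) 1 ltac:(lra) ltac:(lra)).
    pose proof (mult_between b (1 + x) (e * N) 2 ltac:(lra) ltac:(lra)). lra. }
  assert (B2 : - (4 * e * N) <= exp x * sin y - y <= 4 * e * N).
  { replace (exp x * sin y - y) with ((exp x - 1 - x) * sin y + x * sin y + (sin y - y)) by ring.
    pose proof (mult_between (exp x - 1 - x) (sin y) (e * N) 1 ltac:(lra) ltac:(lra)).
    assert (e * N <= N) by nra.
    pose proof (mult_between x (sin y) N (2 * N) ltac:(lra) ltac:(lra)). nra. }
  assert (C1 : Rabs (exp x * cos y + - (1) + - (1 * x - 0 * y)) <= 4 * e * N).
  { apply Rabs_le. lra. }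
  assert (C2 : Rabs (exp x * sin y + - 0 + - (1 * y + 0 * x)) <= 4 * e * N).
  { apply Rabs_le. lra. }
  nra.
Qed.

Lemma cderiv_cexp z : is_cderiv cexp z (cexp z).
Proof.
  apply cderiv_ext with (fun w => cexp z * cexp (w - z))%C.
  - intros w. rewrite <- cexp_plus. f_equal. ring.
  - eapply cderiv_val.
    + apply (cderiv_mult (fun _ => cexp z) (fun w => cexp (w - z)%C)); [apply cderiv_const|].
      apply (cderiv_comp (fun w => w - z)%C cexp).
      * apply (cderiv_plus (fun w => w) (fun _ => (- z)%C)); [apply cderiv_id|apply cderiv_const].
      * replace (z - z)%C with (RtoC 0) by ring. apply cderiv_cexp_0.
    + ring.
Qed.

Lemma cexp_eq_1 z : cexp z = RtoC 1 -> fst z = 0 /\ exists k : Z, snd z = 2 * PI * IZR k.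
Proof.
  intros H. assert (E : exp (fst z) = 1) by (rewrite <- Cmod_cexp, H; apply Cmod_1).
  assert (hx : fst z = 0) by (apply exp_inv; rewrite exp_0; auto).
  split; auto. unfold cexp in H. rewrite E in H. injection H as h1 h2.
  rewrite Rmult_1_l in *.
  destruct (sin_eq_0_0 _ h2) as [k hk].
  destruct (Z.Even_or_Odd k) as [[m hm]|[m hm]].
  - exists m. rewrite hk, hm, mult_IZR. ring.
  - exfalso. rewrite hk, hm, plus_IZR, mult_IZR in h1.
    replace ((2 * IZR m + 1) * PI) with (PI + 2 * IZR m * PI) in h1 by ring.
    assert (cos (PI + 2 * IZR m * PI) = - 1).
    { destruct (Z.le_gt_cases 0 m) as [h|h].
      - rewrite <- (Z2Nat.id m h), <- INR_IZR_INZ, cos_period. apply cos_PI.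
      - rewrite <- (cos_period _ (Z.to_nat (- m))), INR_IZR_INZ, Z2Nat.id, opp_IZR by lia.
        replace (PI + 2 * IZR m * PI + 2 * - IZR m * PI) with PI by ring. apply cos_PI. }
    lra.
Qed.

Lemma cexp_2PI (k : Z) z : cexp (z + (0, (2 * PI * IZR k)%R))%C = cexp z.
Proof.
  rewrite cexp_plus. replace (cexp (0, 2 * PI * IZR k)) with (RtoC 1); [ring|].
  unfold cexp, RtoC; simpl. rewrite exp_0.
  assert (H : forall n, cos (2 * PI * INR n) = 1 /\ sin (2 * PI * INR n) = 0).
  { intros n. replace (2 * PI * INR n) with (0 + 2 * INR n * PI) by ring.
    rewrite cos_period, sin_period, cos_0, sin_0; auto. }
  destruct (Z.le_gt_cases 0 k) as [h|h].
  - rewrite <- (Z2Nat.id k h), <- INR_IZR_INZ. destruct (H (Z.to_nat k)) as [-> ->].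
    f_equal; ring.
  - destruct (H (Z.to_nat (- k))) as [h1 h2].
    rewrite INR_IZR_INZ, Z2Nat.id, opp_IZR in h1, h2 by lia.
    replace (2 * PI * - IZR k) with (- (2 * PI * IZR k)) in h1, h2 by ring.
    rewrite cos_neg in h1. rewrite sin_neg in h2. rewrite h1. f_equal; lra.
Qed.

Lemma cont_at_cexp z : cont_at cexp z.
Proof. eapply cderiv_cont, cderiv_cexp. Qed.

(** * Goursat's lemma and the maximum principle *)

Lemma nested_intervals (a : nat -> R) (s : R) :
  (forall n, a n <= a (S n) <= a n + s / 2 ^ S n) ->
  exists x, forall n, a n <= x <= a n + s / 2 ^ n.
Proof.
  intros H.
  assert (S1 : forall n, s / 2 ^ n = s / 2 ^ S n + s / 2 ^ S n).
  { intros n. simpl. field. apply pow_nonzero; lra. }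
  assert (M : forall n k, a n <= a (n + k)%nat <= a n + s / 2 ^ n - s / 2 ^ (n + k)).
  { intros n k. induction k as [|k IH].
    - rewrite Nat.add_0_r. lra.
    - rewrite Nat.add_succ_r. pose proof (H (n + k)%nat). pose proof (S1 (n + k)%nat). lra. }
  assert (s0 : 0 <= s).
  { pose proof (H 0%nat). simpl in *. lra. }
  assert (P : forall n, 0 <= s / 2 ^ n).
  { intros n. apply Rmult_le_pos; auto. left. apply Rinv_0_lt_compat, pow_lt; lra. }
  assert (U : forall n m, a m <= a n + s / 2 ^ n).
  { intros n m. destruct (Nat.le_ge_cases n m) as [h|h].
    - replace m with (n + (m - n))%nat by lia. pose proof (M n (m - n)%nat).
      pose proof (P (n + (m - n))%nat). lra.
    - pose proof (M m (n - m)%nat). replace (m + (n - m))%nat with n in H0 by lia.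
      pose proof (P n). lra. }
  destruct (completeness (fun y => exists n, y = a n)) as [x [h1 h2]].
  - exists (a 0%nat + s / 2 ^ 0). intros y [n ->]. apply U.
  - exists (a 0%nat). exists 0%nat; auto.
  - exists x. intros n. split.
    + apply h1. exists n; auto.
    + apply h2. intros y [m ->]. apply U.
Qed.

(* The integral of the closed form P dv + Q du along the boundary of the square
   [a, a+s] x [b, b+s]. *)
Definition square_period (P Q : R -> R -> R) (a b s : R) : R :=
  RInt (fun t => P (a + s) (b + t)) 0 s - RInt (fun t => P a (b + t)) 0 s
  - (RInt (fun t => Q (a + t) (b + s)) 0 s - RInt (fun t => Q (a + t) b) 0 s).

(** Total differentiability of both functions on the half-plane [x < X]. The shared coefficient [A]
    is the Cauchy-Riemann equation P_x = Q_y, which makes P dv + Q du closed. A half-plane is the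
    right domain because the exponential turns it into a punctured disk. *)
Definition conjugate_pair (X : R) (P Q : R -> R -> R) : Prop := forall x y, x < X -> exists A B D,
  forall e, 0 < e -> exists d, 0 < d /\ forall h k, Rabs h < d -> Rabs k < d ->
    Rabs (P (x + h) (y + k) - P x y - (A * h + B * k)) <= e * (Rabs h + Rabs k) /\
    Rabs (Q (x + h) (y + k) - Q x y - (D * h + A * k)) <= e * (Rabs h + Rabs k).

Lemma Rabs_add_le a b : Rabs (a + b) <= Rabs a + Rabs b.
Proof. apply Rabs_triang. Qed.

Lemma conjugate_pair_cont X P Q : conjugate_pair X P Q -> forall x y e, x < X -> 0 < e ->
  exists d, 0 < d /\ forall h k, Rabs h < d -> Rabs k < d ->
    Rabs (P (x + h) (y + k) - P x y) < e /\ Rabs (Q (x + h) (y + k) - Q x y) < e.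
Proof.
  intros H x y e hx he. destruct (H x y hx) as [A [B [D h]]].
  destruct (h 1 Rlt_0_1) as [d [hd h']].
  set (M := Rabs A + Rabs B + Rabs D + 1).
  assert (hM : 0 < M).
  { unfold M. pose proof (Rabs_pos A). pose proof (Rabs_pos B). pose proof (Rabs_pos D). lra. }
  set (r := Rmin d (e / (4 * M))).
  assert (hr : 0 < r) by (apply Rmin_pos; auto; apply Rdiv_lt_0_compat; lra).
  assert (hr1 : r <= d) by apply Rmin_l.
  assert (hr2 : r * (4 * M) <= e).
  { apply Rle_trans with (e / (4 * M) * (4 * M)).
    apply Rmult_le_compat_r; [lra|apply Rmin_r]. right; field; lra. }
  exists r. split; auto. intros u v hu hv.
  destruct (h' u v) as [h1 h2]; try lra.
  assert (K : forall a b, Rabs a <= M - 1 -> Rabs b <= M - 1 -> Rabs (a * u + b * v) + (Rabs u + Rabs v) < e).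
  { intros a b ha hb. pose proof (Rabs_add_le (a * u) (b * v)). rewrite !Rabs_mult in H0.
    pose proof (Rabs_pos a). pose proof (Rabs_pos b). pose proof (Rabs_pos u). pose proof (Rabs_pos v).
    assert (Rabs a * Rabs u <= (M - 1) * r) by (apply Rmult_le_compat; lra).
    assert (Rabs b * Rabs v <= (M - 1) * r) by (apply Rmult_le_compat; lra). nra. }
  pose proof (Rabs_pos A). pose proof (Rabs_pos B). pose proof (Rabs_pos D).
  split.
  - pose proof (K A B ltac:(unfold M; lra) ltac:(unfold M; lra)).
    replace (P (x + u) (y + v) - P x y) with
      ((P (x + u) (y + v) - P x y - (A * u + B * v)) + (A * u + B * v)) by ring.
    eapply Rle_lt_trans; [apply Rabs_add_le|]. lra.
  - pose proof (K D A ltac:(unfold M; lra) ltac:(unfold M; lra)).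
    replace (Q (x + u) (y + v) - Q x y) with
      ((Q (x + u) (y + v) - Q x y - (D * u + A * v)) + (D * u + A * v)) by ring.
    eapply Rle_lt_trans; [apply Rabs_add_le|]. lra.
Qed.

Lemma continuous_eps (f : R -> R) x :
  (forall e, 0 < e -> exists d, 0 < d /\ forall h, Rabs h < d -> Rabs (f (x + h) - f x) < e) ->
  continuous f x.
Proof.
  intros H. apply continuity_pt_filterlim. intros e he. destruct (H e he) as [d [hd h]].
  exists d; split; auto. intros y [_ hy]. unfold dist in *; simpl in *; unfold R_dist in *.
  replace y with (x + (y - x)) by ring. apply h; auto.
Qed.

Lemma conjugate_pair_sections X P Q : conjugate_pair X P Q -> forall x y,
  (x < X -> forall t, continuous (fun t => P x (y + t)) t) /\
  (forall t, x + t < X -> continuous (fun t => Q (x + t) y) t).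
Proof.
  intros H x y. split; [intros hx t|intros t hx]; apply continuous_eps; intros e he.
  - destruct (conjugate_pair_cont X P Q H x (y + t) e hx he) as [d [hd h]].
    exists d; split; auto. intros k hk. destruct (h 0 k) as [h1 _]; auto.
    + rewrite Rabs_R0; auto.
    + rewrite Rplus_0_r in h1. rewrite <- Rplus_assoc; auto.
  - destruct (conjugate_pair_cont X P Q H (x + t) y e hx he) as [d [hd h]].
    exists d; split; auto. intros k hk. destruct (h k 0) as [_ h1]; auto.
    + rewrite Rabs_R0; auto.
    + rewrite Rplus_0_r in h1. rewrite <- Rplus_assoc; auto.
Qed.

Lemma ex_RInt_cont (f : R -> R) a b : a <= b -> (forall t, a <= t <= b -> continuous f t) ->
  ex_RInt f a b.
Proof.
  intros h H. apply (ex_RInt_continuous (V := R_CompleteNormedModule)). intros t.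
  rewrite Rmin_left, Rmax_right by auto. apply H.
Qed.

Lemma RInt_double (f : R -> R) s : 0 <= s -> (forall t, 0 <= t <= s + s -> continuous f t) ->
  RInt f 0 (s + s) = RInt f 0 s + RInt (fun t => f (s + t)) 0 s.
Proof.
  intros hs H. rewrite <- (RInt_Chasles f 0 s (s + s));
    try (apply ex_RInt_cont; [lra|intros; apply H; lra]).
  change (RInt f 0 s + RInt f s (s + s) = RInt f 0 s + RInt (fun t => f (s + t)) 0 s). f_equal.
  pose proof (RInt_comp_lin f 1 s 0 s) as E.
  replace (1 * 0 + s) with s in E by ring. replace (1 * s + s) with (s + s) in E by ring.
  rewrite <- E.
  - apply RInt_ext. intros x _. change (1 * f (1 * x + s) = f (s + x)).
    rewrite !Rmult_1_l. f_equal. ring.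
  - apply ex_RInt_cont; [lra|intros; apply H; lra].
Qed.

Lemma conjugate_pair_ex_RInt X P Q x y s : conjugate_pair X P Q -> 0 <= s ->
  (x < X -> ex_RInt (fun t => P x (y + t)) 0 s) /\
  (x + s < X -> ex_RInt (fun t => Q (x + t) y) 0 s).
Proof.
  intros H hs. destruct (conjugate_pair_sections X P Q H x y) as [h1 h2].
  split; intros hx; apply ex_RInt_cont; auto. intros t ht. apply h2. lra.
Qed.

Lemma square_period_quarter X P Q a b s : conjugate_pair X P Q -> 0 <= s -> a + (s + s) < X ->
  square_period P Q a b (s + s) = square_period P Q a b s + square_period P Q (a + s) b s
    + square_period P Q a (b + s) s + square_period P Q (a + s) (b + s) s.
Proof.
  intros H hs hX. pose proof (conjugate_pair_sections X P Q H) as C.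
  unfold square_period.
  assert (EP : forall x y, x < X -> RInt (fun t => P x (y + t)) 0 (s + s) =
    RInt (fun t => P x (y + t)) 0 s + RInt (fun t => P x (y + s + t)) 0 s).
  { intros x y hx. rewrite RInt_double; auto. 2: intros; apply C; auto.
    f_equal. apply RInt_ext. intros t _. f_equal; ring. }
  assert (EQ : forall y, RInt (fun t => Q (a + t) y) 0 (s + s) =
    RInt (fun t => Q (a + t) y) 0 s + RInt (fun t => Q (a + s + t) y) 0 s).
  { intros y. rewrite RInt_double; auto. 2: intros; apply C; lra.
    f_equal. apply RInt_ext. intros t _. f_equal; ring. }
  rewrite !EP, !EQ by lra. rewrite <- !Rplus_assoc. ring.
Qed.

Lemma square_period_bound X P Q a b s K : conjugate_pair X P Q -> 0 <= s -> a + s < X ->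
  (forall t, 0 <= t <= s ->
     Rabs (P (a + s) (b + t) - P a (b + t) - (Q (a + t) (b + s) - Q (a + t) b)) <= K) ->
  Rabs (square_period P Q a b s) <= K * s.
Proof.
  intros H hs hX hK.
  assert (C1 : forall x, x < X -> ex_RInt (fun t => P x (b + t)) 0 s)
    by (intros x hx; apply (conjugate_pair_ex_RInt X P Q x b s H hs); auto).
  assert (C2 : forall y, ex_RInt (fun t => Q (a + t) y) 0 s)
    by (intros y; apply (conjugate_pair_ex_RInt X P Q a y s H hs); auto).
  assert (D1 : ex_RInt (fun t => P (a + s) (b + t) - P a (b + t)) 0 s)
    by (apply (ex_RInt_minus (V := R_NormedModule) (fun t => P (a + s) (b + t)) (fun t => P a (b + t)));
        apply C1; lra).
  assert (D2 : ex_RInt (fun t => Q (a + t) (b + s) - Q (a + t) b) 0 s)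
    by (apply (ex_RInt_minus (V := R_NormedModule) (fun t => Q (a + t) (b + s)) (fun t => Q (a + t) b));
        apply C2).
  assert (E : square_period P Q a b s =
    RInt (fun t => (P (a + s) (b + t) - P a (b + t)) - (Q (a + t) (b + s) - Q (a + t) b)) 0 s).
  { unfold square_period.
    rewrite (RInt_minus (fun t => P (a + s) (b + t) - P a (b + t)) (fun t => Q (a + t) (b + s) - Q (a + t) b));
      auto.
    rewrite (RInt_minus (fun t => P (a + s) (b + t)) (fun t => P a (b + t))) by (apply C1; lra).
    rewrite (RInt_minus (fun t => Q (a + t) (b + s)) (fun t => Q (a + t) b)) by apply C2.
    reflexivity. }
  rewrite E. replace (K * s) with ((s - 0) * K) by ring.
  apply abs_RInt_le_const; auto.
  apply (ex_RInt_minus (V := R_NormedModule) (fun t => P (a + s) (b + t) - P a (b + t))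
     (fun t => Q (a + t) (b + s) - Q (a + t) b)); auto.
Qed.

(** The linear parts contribute [A * s] to each of the two differences under the integral and
    cancel; what remains is small compared with [s], and the integration gives a second factor
    [s]. *)
Lemma square_period_small X P Q x y e : conjugate_pair X P Q -> x < X -> 0 < e ->
  exists d, 0 < d /\ forall a b s, 0 < s < d -> a + s < X -> a <= x <= a + s -> b <= y <= b + s ->
    Rabs (square_period P Q a b s) <= e * (s * s).
Proof.
  intros H hx he. destruct (H x y hx) as [A [B [D h]]].
  (* Four remainders of size [e / 8 * (2 * s)] add up to [e * s]. *)
  destruct (h (e / 8)) as [d [hd hd']]; [lra|].
  exists d. split; auto. intros a b s hs hX ha hb.
  rewrite <- Rmult_assoc. apply square_period_bound with X; auto; [lra|]. intros t ht.
  assert (L : forall u v, a <= u <= a + s -> b <= v <= b + s ->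
    Rabs (P u v - P x y - (A * (u - x) + B * (v - y))) <= e / 8 * (2 * s) /\
    Rabs (Q u v - Q x y - (D * (u - x) + A * (v - y))) <= e / 8 * (2 * s)).
  { intros u v hu hv. assert (h1 : Rabs (u - x) <= s) by (apply Rabs_le; lra).
    assert (h2 : Rabs (v - y) <= s) by (apply Rabs_le; lra).
    destruct (hd' (u - x) (v - y)) as [e1 e2]; try lra.
    replace (x + (u - x)) with u in * by ring. replace (y + (v - y)) with v in * by ring.
    split; eapply Rle_trans; eauto; apply Rmult_le_compat_l; lra. }
  destruct (L (a + s) (b + t)) as [h1 _]; try lra.
  destruct (L a (b + t)) as [h2 _]; try lra.
  destruct (L (a + t) (b + s)) as [_ h3]; try lra.
  destruct (L (a + t) b) as [_ h4]; try lra.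
  apply Rabs_le_between in h1. apply Rabs_le_between in h2.
  apply Rabs_le_between in h3. apply Rabs_le_between in h4.
  apply Rabs_le. nra.
Qed.

(** Goursat's bisection. If all four quarters of a square of side r had period at most e (r/2)^2,
    the square would have period at most e r^2. So a square exceeding this bound contains a quarter
    that does too, and the nested squares shrink to a point where [square_period_small] forbids
    it. *)
Lemma square_period_zero X P Q a b s : conjugate_pair X P Q -> 0 < s -> a + s < X -> square_period P Q a b s = 0.
Proof.
  intros H hs hX. apply NNPP. intros n.
  (* Half of the initial ratio of period to area, so that the strict inequality in [Bad] holds at
     the start. *)
  set (e := Rabs (square_period P Q a b s) / (2 * (s * s))).
  assert (hp : 0 < Rabs (square_period P Q a b s)) by (apply Rabs_pos_lt; auto).
  assert (hss : 0 < s * s) by nra.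
  assert (he : 0 < e) by (apply Rdiv_lt_0_compat; lra).
  set (Bad := fun (p : R * R) r => fst p + r <= a + s /\
    e * (r * r) < Rabs (square_period P Q (fst p) (snd p) r)).
  assert (B0 : Bad (a, b) s).
  { unfold Bad, e; simpl. split; [lra|]. replace (Rabs (square_period P Q a b s) / (2 * (s * s)) * (s * s))
      with (Rabs (square_period P Q a b s) / 2) by (field; lra). lra. }
  assert (step : forall p r, 0 <= r -> Bad p r -> exists p', Bad p' (r / 2) /\
    (fst p' = fst p \/ fst p' = fst p + r / 2) /\ (snd p' = snd p \/ snd p' = snd p + r / 2)).
  { intros [u v] r hr [hle hb]. simpl in hle. apply NNPP. intros N.
    assert (K : forall p', (fst p' = u \/ fst p' = u + r / 2) ->
       (snd p' = v \/ snd p' = v + r / 2) ->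
       Rabs (square_period P Q (fst p') (snd p') (r / 2)) <= e * ((r / 2) * (r / 2))).
    { intros p' h1 h2. apply Rnot_lt_le. intros hlt. apply N. exists p'. repeat split; auto.
      destruct h1 as [-> | ->]; lra. }
    simpl in hb.
    pose proof (square_period_quarter X P Q u v (r / 2) H ltac:(lra) ltac:(lra)) as E.
    replace (r / 2 + r / 2) with r in E by field.
    pose proof (K (u, v) ltac:(auto) ltac:(auto)) as K1.
    pose proof (K (u + r / 2, v) ltac:(auto) ltac:(auto)) as K2.
    pose proof (K (u, v + r / 2) ltac:(auto) ltac:(auto)) as K3.
    pose proof (K (u + r / 2, v + r / 2) ltac:(auto) ltac:(auto)) as K4.
    simpl in K1, K2, K3, K4. rewrite E in hb.
    revert hb K1 K2 K3 K4.
    generalize (square_period P Q u v (r / 2)) (square_period P Q (u + r / 2) v (r / 2))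
      (square_period P Q u (v + r / 2) (r / 2)) (square_period P Q (u + r / 2) (v + r / 2) (r / 2)).
    intros x1 x2 x3 x4 hb K1 K2 K3 K4.
    pose proof (Rabs_add_le (x1 + x2 + x3) x4). pose proof (Rabs_add_le (x1 + x2) x3).
    pose proof (Rabs_add_le x1 x2). lra. }
  set (next := fun p r => epsilon (inhabits (0, 0)) (fun p' => Bad p' (r / 2) /\
    (fst p' = fst p \/ fst p' = fst p + r / 2) /\ (snd p' = snd p \/ snd p' = snd p + r / 2))).
  set (sq := fix sq n := match n with O => (a, b) | S m => next (sq m) (s / 2 ^ m) end).
  assert (R2 : forall n, s / 2 ^ n / 2 = s / 2 ^ S n).
  { intros m. simpl. field. apply pow_nonzero; lra. }
  assert (pos : forall n, 0 < s / 2 ^ n).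
  { intros m. apply Rdiv_lt_0_compat; auto. apply pow_lt; lra. }
  assert (HB : forall n, Bad (sq n) (s / 2 ^ n)).
  { induction n0 as [|m IH].
    - simpl. replace (s / 1) with s by field. exact B0.
    - rewrite <- R2. simpl sq. apply (epsilon_spec (inhabits (0, 0)) _ (step _ _ (Rlt_le _ _ (pos m)) IH)). }
  assert (HS : forall n, (fst (sq (S n)) = fst (sq n) \/ fst (sq (S n)) = fst (sq n) + s / 2 ^ S n) /\
     (snd (sq (S n)) = snd (sq n) \/ snd (sq (S n)) = snd (sq n) + s / 2 ^ S n)).
  { intros m. rewrite <- R2. simpl sq. apply (epsilon_spec (inhabits (0, 0)) _ (step _ _ (Rlt_le _ _ (pos m)) (HB m))). }
  destruct (nested_intervals (fun n => fst (sq n)) s) as [x hx].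
  { intros m. pose proof (pos (S m)). destruct (HS m) as [[-> | ->] _]; lra. }
  destruct (nested_intervals (fun n => snd (sq n)) s) as [y hy].
  { intros m. pose proof (pos (S m)). destruct (HS m) as [_ [-> | ->]]; lra. }
  assert (hxX : x < X).
  { pose proof (hx 0%nat) as h0. simpl in h0. replace (s / 1) with s in h0 by field. lra. }
  destruct (square_period_small X P Q x y e H hxX he) as [d [hd h]].
  destruct (pow_lt_1_zero (/ 2) ltac:(rewrite Rabs_right; lra) (d / s)) as [N hN].
  { apply Rdiv_lt_0_compat; lra. }
  specialize (hN N (Nat.le_refl _)).
  assert (hsm : s / 2 ^ N < d).
  { rewrite Rabs_right in hN by (left; apply Rgt_lt, pow_lt; lra).
    rewrite pow_inv in hN.
    apply Rmult_lt_compat_l with (r := s) in hN; auto.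
    replace (s * (d / s)) with d in hN by (field; lra). exact hN. }
  destruct (HB N) as [b1 b0].
  specialize (h (fst (sq N)) (snd (sq N)) (s / 2 ^ N)). pose proof (pos N).
  specialize (h ltac:(lra) ltac:(lra) (hx N) (hy N)). lra.
Qed.

Lemma Cmod_R_sum (h k : R) : Cmod (h, k) <= Rabs h + Rabs k.
Proof. apply (Cmod_le_fst_snd (h, k)). Qed.

Lemma conjugate_pair_cderiv X (G : C -> C) :
  (forall w, fst w < X -> exists L, is_cderiv G w L) ->
  conjugate_pair X (fun u v => fst (G (u, v))) (fun u v => snd (G (u, v))).
Proof.
  intros H x y hx. destruct (H (x, y) hx) as [L hL]. rewrite is_cderiv_Cmod in hL.
  exists (fst L), (- snd L), (snd L). intros e he. destruct (hL e he) as [d [hd h]].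
  exists (d / 2). split; [lra|]. intros u v hu hv.
  pose proof (Cmod_R_sum u v) as hs.
  assert (E : ((x + u, y + v)%R - (x, y) = (u, v))%C) by (unfold Cminus, Cplus, Copp; simpl; f_equal; ring).
  specialize (h (x + u, y + v)). rewrite E in h. specialize (h ltac:(lra)).
  set (K := (G (x + u, y + v)%R - G (x, y) - L * (u, v))%C) in *.
  pose proof (Cmod_fst K). pose proof (Cmod_snd K).
  assert (B : e * Cmod (u, v) <= e * (Rabs u + Rabs v)) by (apply Rmult_le_compat_l; lra).
  split.
  - replace (fst (G (x + u, y + v)) - fst (G (x, y)) - (fst L * u + - snd L * v)) with (fst K)
      by (unfold K, Cminus, Cplus, Copp, Cmult; simpl; ring). lra.
  - replace (snd (G (x + u, y + v)) - snd (G (x, y)) - (snd L * u + fst L * v)) with (snd K)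
      by (unfold K, Cminus, Cplus, Copp, Cmult; simpl; ring). lra.
Qed.

(** In the coordinate z = z0 + exp w, circles about [z0] become vertical segments of length 2 PI,
    and the vanishing of the periods shows that the circle averages of Re H do not change when the
    circle shrinks to [z0]. *)
Lemma mean_le (H : C -> C) z0 r R0 c : 0 < r < R0 ->
  (forall z, Cdist z z0 < R0 -> exists L, is_cderiv H z L) ->
  (forall z, Cdist z z0 = r -> fst (H z) <= c) -> fst (H z0) <= c.
Proof.
  intros hr hH hc. set (G := fun w => H (z0 + cexp w)%C).
  assert (hd : forall w, Cdist (z0 + cexp w)%C z0 = exp (fst w)).
  { intros w. rewrite Cdist_Cmod, <- Cmod_cexp. f_equal. ring. }
  assert (hX : conjugate_pair (ln R0) (fun u v => fst (G (u, v))) (fun u v => snd (G (u, v)))).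
  { apply conjugate_pair_cderiv. intros w hw. destruct (hH (z0 + cexp w)%C) as [L hL].
    - rewrite hd. rewrite <- (exp_ln R0) by lra. apply exp_increasing; auto.
    - eexists. eapply (cderiv_comp (fun w => z0 + cexp w)%C H w); [|exact hL].
      apply (cderiv_plus (fun _ => z0) cexp); [apply cderiv_const|apply cderiv_cexp]. }
  (* [J u] is the integral of Re H over the circle of radius exp u. Periods are taken over squares,
     so [J] is compared at parameters that differ by the side 2 PI; the two horizontal sides cancel
     because exp has period 2 PI i. *)
  set (J := fun u => RInt (fun t => fst (G (u, 0 + t))) 0 (2 * PI)).
  pose proof PI_RGT_0 as hpi.
  assert (per : forall u, u + 2 * PI < ln R0 -> J (u + 2 * PI) = J u).
  { intros u hu. pose proof (square_period_zero _ _ _ u 0 (2 * PI) hX ltac:(lra) hu) as E.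
    unfold square_period in E. fold (J (u + 2 * PI)) in E. fold (J u) in E.
    assert (E2 : RInt (fun t => snd (G (u + t, 0 + 2 * PI))) 0 (2 * PI) =
                 RInt (fun t => snd (G (u + t, 0))) 0 (2 * PI)).
    { apply RInt_ext. intros t _. unfold G. do 3 f_equal.
      rewrite <- (cexp_2PI 1 (u + t, 0)). f_equal. unfold Cplus; simpl. f_equal; ring. }
    rewrite E2 in E. lra. }
  assert (hlr : ln r < ln R0) by (apply ln_increasing; lra).
  assert (pern : forall n, J (ln r - 2 * PI * INR n) = J (ln r)).
  { induction n as [|n IH].
    - f_equal. simpl. ring.
    - rewrite <- IH, S_INR. rewrite <- per.
      + f_equal. ring.
      + pose proof (pos_INR n). nra. }
  assert (ex : forall u, u < ln R0 -> ex_RInt (fun t => fst (G (u, 0 + t))) 0 (2 * PI)).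
  { intros u hu. apply (conjugate_pair_ex_RInt _ _ _ u 0 (2 * PI) hX); lra. }
  assert (up : J (ln r) <= 2 * PI * c).
  { replace (2 * PI * c) with (RInt (fun _ => c) 0 (2 * PI)).
    - apply RInt_le; auto; [lra|apply ex_RInt_const|]. intros t _. apply hc. rewrite hd. simpl.
      apply exp_ln; lra.
    - rewrite RInt_const. change ((2 * PI - 0) * c = 2 * PI * c). ring. }
  apply Rnot_lt_le. intros hlt. set (e := (fst (H z0) - c) / 2).
  assert (he : 0 < e) by (unfold e; lra).
  destruct (hH z0) as [L hL]; [rewrite Cdist_refl; lra|].
  destruct (cderiv_cont _ _ _ hL e he) as [d [hd0 h]].
  (* After [N] steps inward the radius is r exp(-2 PI N), at most r / N; the factor exp(-|ln r|)
     compensates r. *)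
  destruct (archimed_cor1 (exp (- Rabs (ln r) ) * Rmin d 1)) as [N [hN hN0]].
  { apply Rmult_lt_0_compat; [apply exp_pos|apply Rmin_pos; lra]. }
  assert (low : 2 * PI * (c + e) <= J (ln r - 2 * PI * INR N)).
  { replace (2 * PI * (c + e)) with (RInt (fun _ => c + e) 0 (2 * PI)).
    - apply RInt_le; [lra|apply ex_RInt_const|apply ex|].
      { assert (0 <= 2 * PI * INR N); [|lra]. apply Rmult_le_pos; [lra|apply pos_INR]. }
      intros t _. unfold G.
      assert (hclose : Cdist (z0 + cexp (ln r - 2 * PI * INR N, 0 + t)%R)%C z0 < d).
      { rewrite hd. simpl fst.
        apply Rle_lt_trans with (exp (ln r) * / INR N).
        - unfold Rminus. rewrite exp_plus. apply Rmult_le_compat_l; [left; apply exp_pos|].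
          rewrite exp_Ropp. assert (hNN : 0 < INR N) by (apply lt_0_INR; lia).
          apply Rinv_le_contravar; auto.
          pose proof (exp_ineq1_le (2 * PI * INR N)).
          pose proof PI2_1. nra.
        - apply Rlt_le_trans with (exp (ln r) * (exp (- Rabs (ln r)) * Rmin d 1)).
          + apply Rmult_lt_compat_l; [apply exp_pos|auto].
          + rewrite <- Rmult_assoc, <- exp_plus.
            apply Rle_trans with (1 * Rmin d 1).
            * apply Rmult_le_compat_r; [left; apply Rmin_pos; lra|].
              rewrite <- exp_0. destruct (Req_dec (ln r + - Rabs (ln r)) 0) as [->|n]; [lra|].
              left. apply exp_increasing. pose proof (Rle_abs (ln r)). lra.
            * rewrite Rmult_1_l. apply Rmin_l. }
      specialize (h _ I hclose).
      match type of h with Cdist ?a ?b < _ => pose proof (Cdist_fst a b) as hf end.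
      apply Rabs_le_between in hf. unfold e in *. lra.
    - rewrite RInt_const. change ((2 * PI - 0) * (c + e) = 2 * PI * (c + e)). ring. }
  rewrite pern in low. nra.
Qed.

(** * Cluster points and the maximum principle *)

Lemma bolzano_weierstrass (u : nat -> C) M : (forall n, Cmod (u n) <= M) ->
  exists z, forall e N, 0 < e -> exists n, (N <= n)%nat /\ Cdist (u n) z < e.
Proof.
  intros HM.
  assert (BW : forall v : nat -> R, (forall n, Rabs (v n) <= M) ->
    exists l, forall e N, 0 < e -> exists n, (N <= n)%nat /\ Rabs (v n - l) < e).
  { intros v hv. destruct (Bolzano_Weierstrass v (fun c => - M <= c <= M)) as [l hl].
    - apply compact_P3.
    - intros n. apply Rabs_le_between. auto.
    - exists l. intros e N he.
      destruct (hl (disc l (mkposreal e he)) N) as [n [h1 h2]].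
      + exists (mkposreal e he). intros x hx; exact hx.
      + exists n. split; auto. }
  destruct (BW (fun n => fst (u n))) as [x hx].
  { intros n. eapply Rle_trans; [apply Cmod_fst|auto]. }
  (* [sg k] is an index beyond [k] with real part within [/ INR (S k)] of [x]; a cluster value of
     the imaginary parts is then taken along these indices. *)
  set (sg := fun k : nat => epsilon (inhabits O) (fun n => (k <= n)%nat /\ Rabs (fst (u n) - x) < / INR (S k))).
  assert (hs : forall k, (k <= sg k)%nat /\ Rabs (fst (u (sg k)) - x) < / INR (S k)).
  { intros k. apply (epsilon_spec (inhabits O) (fun n => (k <= n)%nat /\ Rabs (fst (u n) - x) < / INR (S k))).
    apply hx. apply Rinv_0_lt_compat, lt_0_INR. lia. }
  destruct (BW (fun k => snd (u (sg k)))) as [y hy].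
  { intros n. eapply Rle_trans; [apply Cmod_snd|auto]. }
  exists (x, y). intros e N he.
  destruct (archimed_cor1 (e / 2)) as [K [hK hK0]]; [lra|].
  destruct (hy (e / 2) (N + K)%nat) as [k [hk1 hk2]]; [lra|].
  exists (sg k). destruct (hs k) as [h1 h2]. split; [lia|].
  eapply Rle_lt_trans; [apply Cdist_le_fst_snd|]. simpl.
  assert (/ INR (S k) <= / INR K).
  { apply Rinv_le_contravar; [apply lt_0_INR; lia|apply le_INR; lia]. }
  lra.
Qed.

(** The upper limit of |F| at [xi] along [G] is at most [m]; no value of [F] at [xi] enters. *)
Definition boundary_bound (G : C -> Prop) (F : C -> C) (m : R) (xi : C) : Prop :=
  forall e, 0 < e -> exists d, 0 < d /\ forall z, G z -> Cdist z xi < d -> Cmod (F z) <= m + e.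

Lemma real_sup_sequence (E : R -> Prop) x0 B : E x0 -> (forall x, E x -> x <= B) ->
  exists M, (forall x, E x -> x <= M) /\ forall e, 0 < e -> exists x, E x /\ M - e < x.
Proof.
  intros h0 hB. destruct (completeness E) as [M [h1 h2]].
  - exists B. exact hB.
  - exists x0; auto.
  - exists M. split; auto. intros e he. apply NNPP. intros n.
    assert (M <= M - e); [|lra]. apply h2. intros x hx. apply Rnot_lt_le. intros hl.
    apply n. exists x; auto.
Qed.

(* Maximising |F| + k |z|^2 instead of |F| makes the maximum strict. *)
Lemma max_principle (G : C -> Prop) (F : C -> C) m :
  is_open G -> is_bounded G -> holomorphic_on G F ->
  (forall xi, boundary G xi -> boundary_bound G F m xi) ->
  forall z, G z -> Cmod (F z) <= m.
Proof.
  intros oG [M0 bG] hF hb z0 hz0. apply Rnot_lt_le. intros hlt.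
  set (M := Rmax M0 1). assert (hM : 1 <= M) by apply Rmax_r.
  assert (bM : forall z, G z -> Cmod z <= M).
  { intros z hz. rewrite <- Cnorm_Cmod. eapply Rle_trans; [apply bG; auto|apply Rmax_l]. }
  (* The added term k |z|^2 is at most a quarter of the excess of |F z0| over [m], so the supremum
     of [u] cannot be approached at the boundary. *)
  set (k := (Cmod (F z0) - m) / (4 * (M * M))).
  assert (hk : 0 < k) by (apply Rdiv_lt_0_compat; nra).
  assert (hk2 : k * (M * M) = (Cmod (F z0) - m) / 4) by (unfold k; field; lra).
  set (u := fun z => Cmod (F z) + k * (Cmod z * Cmod z)).
  assert (sq : forall z, G z -> 0 <= k * (Cmod z * Cmod z) <= k * (M * M)).
  { intros z hz. pose proof (bM z hz). pose proof (Cmod_ge_0 z).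
    split; [apply Rmult_le_pos; nra|apply Rmult_le_compat_l; nra]. }
  assert (cF : forall z, G z -> cont_at F z).
  { intros z hz. destruct (hF z hz) as [L hL]. eapply cderiv_cont. exact hL. }
  assert (cl : forall w : nat -> C, (forall n, G (w n)) -> exists z,
     closure G z /\ forall e N, 0 < e -> exists n, (N <= n)%nat /\ Cdist (w n) z < e).
  { intros w hw. destruct (bolzano_weierstrass w M) as [z hz]; auto.
    exists z. split; auto. intros e he. destruct (hz e O he) as [n [_ h]]. exists (w n); auto. }
  assert (bdd : exists B, forall z, G z -> u z <= B).
  { apply NNPP. intros N.
    assert (W : forall n : nat, exists z, G z /\ INR n < u z).
    { intros n. apply NNPP. intros N'. apply N. exists (INR n). intros z hz.
      apply Rnot_lt_le. intros hl. apply N'. exists z; auto. }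
    set (w := fun n => epsilon (inhabits z0) (fun z => G z /\ INR n < u z)).
    assert (hw : forall n, G (w n) /\ INR n < u (w n)).
    { intros n. apply (epsilon_spec (inhabits z0) _ (W n)). }
    destruct (cl w) as [z [hz1 hz2]]; [apply hw|].
    assert (Q : exists d B, 0 < d /\ forall y, G y -> Cdist y z < d -> Cmod (F y) <= B).
    { destruct (classic (G z)) as [g|g].
      - destruct (cF z g 1 Rlt_0_1) as [d [hd h]]. exists d, (Cmod (F z) + 1). split; auto.
        intros y _ hy. specialize (h y I hy). pose proof (Cmod_dist_le (F y) (F z)) as T.
        apply Rabs_le_between in T. lra.
      - destruct (hb z (conj hz1 g) 1 Rlt_0_1) as [d [hd h]]. exists d, (m + 1). split; auto. }
    destruct Q as [d [B [hd hB]]].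
    destruct (INR_unbounded (B + k * (M * M))) as [N0 hN0].
    destruct (hz2 d N0 hd) as [n [hn1 hn2]]. destruct (hw n) as [g1 g2].
    specialize (hB _ g1 hn2). pose proof (sq _ g1). unfold u in g2. apply le_INR in hn1. lra. }
  destruct bdd as [B hB].
  destruct (real_sup_sequence (fun x => exists z, G z /\ x = u z) (u z0) B) as [S [hS1 hS2]].
  { exists z0; auto. } { intros x [z [hz ->]]; auto. }
  assert (hSup : forall z, G z -> u z <= S) by (intros z hz; apply hS1; exists z; auto).
  set (w := fun n => epsilon (inhabits z0) (fun z => G z /\ S - / INR (n + 1) < u z)).
  assert (hw : forall n, G (w n) /\ S - / INR (n + 1) < u (w n)).
  { intros n. apply (epsilon_spec (inhabits z0) (fun z => G z /\ S - / INR (n + 1) < u z)).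
    destruct (hS2 (/ INR (n + 1))) as [x [[z [hz ->]] h]]; [apply Rinv_0_lt_compat, lt_0_INR; lia|].
    exists z; auto. }
  destruct (cl w) as [z [hz1 hz2]]; [apply hw|].
  assert (near : forall d e, 0 < d -> 0 < e -> exists y, G y /\ Cdist y z < d /\ S - e < u y).
  { intros d e hd he. destruct (archimed_cor1 e he) as [N [hN hN0]].
    destruct (hz2 d N hd) as [n [h1 h2]]. destruct (hw n) as [g1 g2].
    exists (w n). repeat split; auto.
    assert (/ INR (n + 1) <= / INR N).
    { apply Rinv_le_contravar; [apply lt_0_INR; lia|apply le_INR; lia]. }
    lra. }
  assert (Sbig : m + 4 * (k * (M * M)) <= S).
  { pose proof (hSup z0 hz0). pose proof (sq _ hz0). unfold u in H. lra. }
  assert (kM : 0 < k * (M * M)) by (apply Rmult_lt_0_compat; nra).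
  destruct (classic (G z)) as [g|g].
  - assert (uz : u z = S).
    { apply Rle_antisym; auto. apply Rnot_lt_le. intros hl.
      set (e := (S - u z) / 4). assert (he : 0 < e) by (unfold e; lra).
      assert (cu : cont_at (fun z => RtoC (u z)) z).
      { unfold u. apply (cont_in_Rplus _ (fun z => Cmod (F z)) (fun z => k * (Cmod z * Cmod z))).
        - apply cont_in_Cmod. auto.
        - apply (cont_in_Rmult _ (fun _ => k)); [apply cont_in_const|].
          apply (cont_in_Rmult _ Cmod Cmod); apply (cont_in_Cmod _ (fun z => z)), cont_in_id. }
      destruct (cu e he) as [d [hd h]]. destruct (near d e hd he) as [y [_ [hy1 hy2]]].
      specialize (h y I hy1). rewrite Cdist_Cmod, <- RtoC_minus, Cmod_R in h.
      apply Rabs_lt_between in h. unfold e in *. lra. }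
    destruct (oG z g) as [r0 [hr0 hr]].
    (* c is the unimodular constant with c * F z = |F z| *)
    assert (exists c : C, Cmod c = 1 /\ (c * F z)%C = RtoC (Cmod (F z))) as [c [hc1 hc2]].
    { destruct (Ceq_dec (F z) 0) as [E|E].
      - exists (RtoC 1). rewrite Cmod_1, E, Cmod_0. split; auto. ring.
      - assert (0 < Cmod (F z)) by (apply Cmod_gt_0; auto).
        exists (Cmod (F z) / F z)%C. rewrite Cmod_div, Cmod_R, Rabs_right by (auto; lra).
        split; [field; lra|]. field; auto. }
    (* Re H is Re(c F) plus the variable part of the linearisation of k |y|^2 at [z]. On the circle
       of radius [r] about [z], |y|^2 exceeds its linearisation by r^2, so maximality of [u] at [z]
       gives Re H <= Re H(z) - k r^2 there, against the mean value inequality. *)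
    set (H := fun y => (c * F y + (2 * k)%R * Cconj z * (y - z))%C).
    set (r := r0 / 2).
    assert (hle : fst (H z) <= fst (H z) - k * (r * r)).
    { apply mean_le with (r := r) (R0 := r0); [unfold r; lra| |].
      - intros y hy. destruct (hF y (hr y hy)) as [L hL]. eexists.
        apply (cderiv_plus (fun y => c * F y)%C (fun y => (2 * k)%R * Cconj z * (y - z))%C).
        + apply (cderiv_mult (fun _ => c) F); [apply cderiv_const|exact hL].
        + apply (cderiv_mult (fun _ => (2 * k)%R * Cconj z)%C (fun y => y - z)%C); [apply cderiv_const|].
          apply (cderiv_plus (fun y => y) (fun _ => (- z)%C)); [apply cderiv_id|apply cderiv_const].
      - intros y hy.
        assert (gy : G y) by (apply hr; unfold r in hy; lra).
        pose proof (hSup y gy) as hu. rewrite <- uz in hu. unfold u in hu.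
        assert (E1 : fst (H z) = Cmod (F z)).
        { unfold H. rewrite hc2. replace (z - z)%C with (RtoC 0) by ring.
          unfold Cplus, Cmult, RtoC; simpl. ring. }
        assert (E2 : fst (c * F y)%C <= Cmod (F y)).
        { eapply Rle_trans; [apply Rle_abs|]. eapply Rle_trans; [apply Cmod_fst|].
          rewrite Cmod_mult, hc1. lra. }
        assert (E3 : Cmod y * Cmod y = Cmod z * Cmod z + r * r
           + 2 * (fst z * (fst y - fst z) + snd z * (snd y - snd z))).
        { rewrite <- hy, Cdist_Cmod, !Cmod_sq. unfold Cminus, Cplus, Copp; simpl. ring. }
        rewrite E1. unfold H.
        replace (fst (c * F y + (2 * k)%R * Cconj z * (y - z))%C) with
          (fst (c * F y)%C + 2 * k * (fst z * (fst y - fst z) + snd z * (snd y - snd z)))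
          by (unfold Cconj, Cminus, Cplus, Cmult, Copp, RtoC; simpl; ring).
        rewrite E3 in hu. nra. }
    assert (0 < k * (r * r)) by (apply Rmult_lt_0_compat; auto; unfold r; nra). lra.
  - destruct (hb z (conj hz1 g) (k * (M * M)) kM) as [d [hd h]].
    destruct (near d (k * (M * M)) hd kM) as [y [hy1 [hy2 hy3]]].
    specialize (h y hy1 hy2). pose proof (sq y hy1). unfold u in hy3. lra.
Qed.

Lemma holomorphic_pow G F n : holomorphic_on G F -> holomorphic_on G (fun z => Cpow (F z) n).
Proof.
  intros H z hz. destruct (H z hz) as [L hL].
  assert (E : exists M, is_cderiv (fun z => Cpow (F z) n) z M); [|exact E].
  induction n as [|n [M IH]].
  - eexists. apply (cderiv_const (RtoC 1)).
  - eexists. apply (cderiv_mult F (fun z => Cpow (F z) n)); [exact hL|exact IH].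
Qed.

(** Taking n-th roots with [K] fixed: if a > b, the powers of a / b would outgrow [K]. *)
Lemma pow_bounded_le a b K : 0 <= a -> 0 < b -> (forall n, a ^ n <= K * b ^ n) -> a <= b.
Proof.
  intros ha hb H. apply Rnot_lt_le. intros hl.
  destruct (Pow_x_infinity (a / b)) with (b := K + 1) as [N hN].
  { rewrite Rabs_right. apply Rmult_lt_reg_r with b; auto. unfold Rdiv. rewrite Rmult_assoc, Rinv_l; lra.
    apply Rle_ge, Rmult_le_pos; auto. left; apply Rinv_0_lt_compat; auto. }
  specialize (hN N (Nat.le_refl _)). rewrite Rabs_right in hN.
  2:{ apply Rle_ge, pow_le, Rmult_le_pos; auto. left; apply Rinv_0_lt_compat; auto. }
  unfold Rdiv in hN. rewrite Rpow_mult_distr, pow_inv in hN.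
  assert (hp : 0 < b ^ N) by (apply pow_lt; auto).
  specialize (H N). apply Rge_le in hN.
  apply Rmult_le_compat_r with (r := b ^ N) in hN; [|lra].
  rewrite Rmult_assoc, Rinv_l, Rmult_1_r in hN by lra. nra.
Qed.

(* A bounded function may misbehave at one boundary point b: apply the maximum principle to
   F^n (z - b) and let n go to infinity. *)
Lemma max_principle_except (G : C -> Prop) (F : C -> C) m M b : 0 < m ->
  is_open G -> is_bounded G -> holomorphic_on G F -> ~ G b ->
  (forall z, G z -> Cmod (F z) <= M) ->
  (forall xi, boundary G xi -> xi <> b -> boundary_bound G F m xi) ->
  forall z, G z -> Cmod (F z) <= m.
Proof.
  intros hm oG bG hF hGb hM hb z hz.
  destruct bG as [B0 bG]. set (B := Rmax B0 0 + Cmod b + 1).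
  assert (hB : forall z, G z -> Cmod (z - b)%C <= B).
  { intros y hy. pose proof (bG y hy). rewrite Cnorm_Cmod in H.
    pose proof (Cmod_triangle y (- b)%C). rewrite Cmod_opp in H0.
    pose proof (Rmax_l B0 0). unfold B. unfold Cminus. lra. }
  assert (hB1 : 1 <= B) by (unfold B; pose proof (Rmax_r B0 0); pose proof (Cmod_ge_0 b); lra).
  set (M' := Rmax M 1). assert (hM' : forall z, G z -> Cmod (F z) <= M').
  { intros y hy. eapply Rle_trans; [apply hM; auto|apply Rmax_l]. }
  assert (hM1 : 1 <= M') by apply Rmax_r.
  assert (hzb : 0 < Cmod (z - b)%C).
  { apply Cmod_gt_0, Cminus_eq_contra. intros ->. auto. }
  apply pow_bounded_le with (K := B / Cmod (z - b)%C); auto; [apply Cmod_ge_0|].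
  intros n.
  assert (Q : Cmod (Cpow (F z) n * (z - b))%C <= m ^ n * B).
  { apply (max_principle G (fun z => Cpow (F z) n * (z - b))%C); auto.
    - exists B0; auto.
    - intros y hy. destruct (holomorphic_pow G F n hF y hy) as [L hL]. eexists.
      apply (cderiv_mult (fun z => Cpow (F z) n) (fun z => (z - b)%C)); [exact hL|].
      apply (cderiv_plus (fun y => y) (fun _ => (- b)%C)); [apply cderiv_id|apply cderiv_const].
    - intros xi hxi e he. destruct (classic (xi = b)) as [->|hne].
      (* At the exceptional point the factor z - b beats the crude bound [M' ^ n]. *)
      + exists (e / M' ^ n). assert (hp : 0 < M' ^ n) by (apply pow_lt; lra).
        split; [apply Rdiv_lt_0_compat; auto|]. intros y hy hyb.
        rewrite Cmod_mult, Cmod_pow, <- Cdist_Cmod.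
        apply Rle_trans with (M' ^ n * (e / M' ^ n)).
        * apply Rmult_le_compat; [apply pow_le, Cmod_ge_0|apply Cdist_pos| |lra].
          apply pow_incr. split; [apply Cmod_ge_0|auto].
        * replace (M' ^ n * (e / M' ^ n)) with e by (field; lra).
          assert (0 <= m ^ n * B) by (apply Rmult_le_pos; [apply pow_le; lra|lra]). lra.
      + assert (cp : continuity_pt (fun x => x ^ n) m) by (apply derivable_continuous_pt, derivable_pt_pow).
        destruct (continuity_pt_bound _ _ cp (e / B)) as [d1 [hd1 h1]]; [apply Rdiv_lt_0_compat; lra|].
        destruct (hb xi hxi hne (d1 / 2)) as [d [hd h]]; [lra|].
        exists d; split; auto. intros y hy hyd. specialize (h y hy hyd).
        rewrite Cmod_mult, Cmod_pow.
        apply Rle_trans with ((m ^ n + e / B) * B).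
        * apply Rmult_le_compat; [apply pow_le, Cmod_ge_0|apply Cmod_ge_0| |auto].
          apply Rle_trans with ((m + d1 / 2) ^ n).
          -- apply pow_incr. split; [apply Cmod_ge_0|auto].
          -- specialize (h1 (m + d1 / 2)). replace (m + d1 / 2 - m) with (d1 / 2) in h1 by ring.
             rewrite Rabs_right in h1 by lra. specialize (h1 ltac:(lra)).
             apply Rabs_lt_between in h1. lra.
        * right. field. lra. }
  rewrite Cmod_mult, Cmod_pow in Q.
  apply Rmult_le_reg_r with (Cmod (z - b)%C); auto.
  replace (B / Cmod (z - b)%C * m ^ n * Cmod (z - b)%C) with (m ^ n * B) by (field; lra). auto.
Qed.

Lemma cont_on_in A f z : continuous_on A f -> A z -> cont_in A f z.
Proof. intros H h. exact (H z h). Qed.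

Lemma cont_on_intro A f : (forall z, A z -> cont_in A f z) -> continuous_on A f.
Proof. intros H z hz. exact (H z hz). Qed.

(** * Connectedness *)

Definition rconvex (J : R -> Prop) : Prop := forall a b t, J a -> J b -> a <= t <= b -> J t.

(** Continuity induction. The local hypothesis is an implication between any two neighbouring
    parameters, so one condition covers both openness and closedness of [P]; later arguments along
    paths are put in this form. *)
Lemma interval_locally_constant (J P : R -> Prop) : rconvex J ->
  (forall t, J t -> exists d, 0 < d /\ forall s s', J s -> J s' ->
     Rabs (s - t) < d -> Rabs (s' - t) < d -> P s -> P s') ->
  forall a b, J a -> J b -> P a -> P b.
Proof.
  intros hJ.
  (* The case [a <= b], by the supremum of the good parameters; the other case is its mirror image
     under t -> -t. *)
  assert (main : forall Q : R -> Prop, forall a b, a <= b ->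
    (forall t, a <= t <= b -> exists d, 0 < d /\ forall s s', a <= s <= b -> a <= s' <= b ->
     Rabs (s - t) < d -> Rabs (s' - t) < d -> Q s -> Q s') -> Q a -> Q b).
  { intros Q a b hab H h0.
    destruct (real_sup_sequence (fun t => a <= t <= b /\ Q t) a b) as [m [h1 h2]].
    { split; auto; lra. } { intros x [? _]; lra. }
    assert (hm : a <= m) by (apply h1; split; auto; lra).
    destruct (Rle_lt_dec m b) as [hmb|hmb].
    2:{ destruct (h2 (m - b)) as [x [[hx _] hx2]]; lra. }
    destruct (H m) as [d [hd h]]; [lra|]. destruct (h2 d hd) as [x [[hx1 hx2] hx3]].
    assert (hxm : x <= m) by (apply h1; auto).
    assert (K : forall s, a <= s <= b -> Rabs (s - m) < d -> Q s).
    { intros s hs hsd. apply (h x s); auto. apply Rabs_lt_between; lra. }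
    destruct (Rlt_le_dec m b) as [hlt|hle].
    - exfalso. set (s := Rmin b (m + d / 2)).
      assert (m < s) by (apply Rmin_glb_lt; lra).
      assert (s <= b) by apply Rmin_l. assert (s <= m + d / 2) by apply Rmin_r.
      assert (s <= m); [|lra]. apply h1. split; [lra|]. apply K; [lra|].
      apply Rabs_lt_between; lra.
    - apply K; [lra|]. apply Rabs_lt_between; lra. }
  intros H a b ha hb hP. destruct (Rle_dec a b) as [hab|hab].
  - apply (main P a b hab); auto. intros t ht.
    destruct (H t) as [d [hd h]]; [apply (hJ a b); auto|]. exists d; split; auto.
    intros s s' hs hs'. apply h; apply (hJ a b); auto.
    rewrite <- (Ropp_involutive b). apply (main (fun t => P (- t)) (- a) (- b)); [lra| |].
    + intros t ht. destruct (H (- t)) as [d [hd h]]; [apply (hJ b a); auto; lra|].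
      exists d; split; auto. intros s s' hs hs' h1 h2.
      apply h; try (apply (hJ b a); auto; lra).
      * replace (- s - - t) with (- (s - t)) by ring. rewrite Rabs_Ropp; auto.
      * replace (- s' - - t) with (- (s' - t)) by ring. rewrite Rabs_Ropp; auto.
    + rewrite Ropp_involutive; auto.
Qed.

(** Open sets in [is_connected] are open in the plane, so [P] and its negation are enlarged to the
    plane-open sets of points near which all of [K] satisfies them. *)
Lemma connected_locally_constant (K P : C -> Prop) : is_connected K ->
  (forall z, K z -> exists d, 0 < d /\ forall w w', K w -> K w' ->
     Cdist w z < d -> Cdist w' z < d -> P w -> P w') ->
  forall a b, K a -> K b -> P a -> P b.
Proof.
  intros hK H a b ha hb hP. apply NNPP. intros hn. apply hK.
  exists (fun z => exists d, 0 < d /\ forall w, K w -> Cdist w z < d -> P w).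
  exists (fun z => exists d, 0 < d /\ forall w, K w -> Cdist w z < d -> ~ P w).
  assert (op : forall Q : C -> Prop, is_open (fun z => exists d, 0 < d /\ forall w, K w -> Cdist w z < d -> Q w)).
  { intros Q z [d [hd h]]. exists (d / 2). split; [lra|]. intros w hw.
    exists (d / 2). split; [lra|]. intros y hy hyw. apply h; auto.
    pose proof (Cdist_tri y w z). lra. }
  assert (yes : forall z, K z -> P z -> exists d, 0 < d /\ forall w, K w -> Cdist w z < d -> P w).
  { intros z hz hp. destruct (H z hz) as [d [hd h]]. exists d; split; auto. intros w hw hd'.
    apply (h z w); auto. rewrite Cdist_refl; auto. }
  assert (no : forall z, K z -> ~ P z -> exists d, 0 < d /\ forall w, K w -> Cdist w z < d -> ~ P w).
  { intros z hz hp. destruct (H z hz) as [d [hd h]]. exists d; split; auto. intros w hw hd' hw'.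
    apply hp. apply (h w z); auto. rewrite Cdist_refl; auto. }
  repeat split.
  - apply op.
  - apply (op (fun w => ~ P w)).
  - intros z hz. destruct (classic (P z)); [left|right]; auto.
  - exists a; split; auto.
  - exists b; split; auto.
  - intros z hz [d [hd h]] [d' [hd' h']]. apply (h' z); auto; [rewrite Cdist_refl; auto|].
    apply h; auto. rewrite Cdist_refl; auto.
Qed.

Lemma connected_of_pairs (K : C -> Prop) :
  (forall a b, K a -> K b -> exists K', is_connected K' /\ (forall z, K' z -> K z) /\ K' a /\ K' b) ->
  is_connected K.
Proof.
  intros H [U [V [oU [oV [cov [[a [ha1 ha2]] [[b [hb1 hb2]] dis]]]]]]].
  destruct (H a b ha1 hb1) as [K' [hK [hs [h1 h2]]]]. apply hK.
  exists U, V. repeat split; auto.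
  - exists a; auto.
  - exists b; auto.
  - intros z hz. apply dis; auto.
Qed.

(** * Paths: continuity on a set of real parameters *)

Definition rcont (J : R -> Prop) (g : R -> C) (t : R) : Prop :=
  forall e, 0 < e -> exists d, 0 < d /\ forall s, J s -> Rabs (s - t) < d -> Cdist (g s) (g t) < e.

Lemma rcont_sub (J J' : R -> Prop) g t : (forall s, J' s -> J s) -> rcont J g t -> rcont J' g t.
Proof. intros H h e he. destruct (h e he) as [d [hd h']]. exists d; split; auto. Qed.

Lemma rcont_comp J A (g : R -> C) f t : (forall s, J s -> A (g s)) ->
  rcont J g t -> cont_in A f (g t) -> rcont J (fun s => f (g s)) t.
Proof.
  intros H hg hf e he. destruct (hf e he) as [d [hd h]]. destruct (hg d hd) as [d' [hd' h']].
  exists d'; split; auto.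
Qed.

Lemma rcont_of_cont J A f t : (forall s, J s -> A (s, 0)) ->
  cont_in A f (t, 0) -> rcont J (fun s => f (s, 0)) t.
Proof.
  intros H hf e he. destruct (hf e he) as [d [hd h]]. exists d; split; auto. intros s hs hst.
  apply h; auto. eapply Rle_lt_trans; [apply Cdist_le_fst_snd|]. simpl.
  rewrite Rminus_diag, Rabs_R0. lra.
Qed.

Lemma cont_of_rcont J (g : R -> C) z : rcont J g (fst z) ->
  cont_in (fun w => J (fst w)) (fun w => g (fst w)) z.
Proof.
  intros h e he. destruct (h e he) as [d [hd h']]. exists d; split; auto. intros w hw hwd.
  apply h'; auto. pose proof (Cdist_fst w z). lra.
Qed.

Lemma rcont_image_connected J g : rconvex J -> (forall t, J t -> rcont J g t) ->
  is_connected (fun z => exists t, J t /\ g t = z).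
Proof.
  intros hJ hg [U [V [oU [oV [cov [[a [[s [hs ha1]] ha2]] [[b [[t [ht hb1]] hb2]] dis]]]]]]].
  assert (cov' : forall r, J r -> U (g r) \/ V (g r)) by (intros r hr; apply cov; exists r; auto).
  assert (dis' : forall r, J r -> U (g r) -> V (g r) -> False) by (intros r hr; apply dis; exists r; auto).
  subst a b.
  assert (U (g t)); [|apply (dis' t); auto].
  apply (interval_locally_constant J (fun r => U (g r)) hJ) with s; auto.
  intros r hr. destruct (cov' r hr) as [h|h].
  - destruct (oU _ h) as [e [he h']]. destruct (hg r hr e he) as [d [hd hd']].
    exists d; split; auto.
  - destruct (oV _ h) as [e [he h']]. destruct (hg r hr e he) as [d [hd hd']].
    exists d; split; auto. intros x x' hx hx' h1 h2 hu. exfalso. apply (dis' x); auto.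
Qed.

(** * Segments, convex sets and balls *)

Definition seg (a b : C) (t : R) : C := (a + t * (b - a))%C.

Lemma seg_0 a b : seg a b 0 = a.
Proof. unfold seg. ring. Qed.

Lemma seg_1 a b : seg a b 1 = b.
Proof. unfold seg. ring. Qed.

Lemma seg_dist a b s t : Cdist (seg a b s) (seg a b t) = Rabs (s - t) * Cdist b a.
Proof.
  rewrite !Cdist_Cmod. unfold seg. rewrite <- Cmod_R, <- Cmod_mult, RtoC_minus. f_equal. ring.
Qed.

Lemma rcont_seg J a b t : rcont J (seg a b) t.
Proof.
  intros e he. exists (e / (Cdist b a + 1)). pose proof (Cdist_pos b a).
  split; [apply Rdiv_lt_0_compat; lra|]. intros s _ hs. rewrite seg_dist.
  apply Rle_lt_trans with (e / (Cdist b a + 1) * Cdist b a).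
  - apply Rmult_le_compat_r; lra.
  - apply Rmult_lt_reg_r with (Cdist b a + 1); [lra|].
    replace (e / (Cdist b a + 1) * Cdist b a * (Cdist b a + 1)) with (e * Cdist b a) by (field; lra).
    nra.
Qed.

Definition unit_interval (t : R) : Prop := 0 <= t <= 1.

Lemma rconvex_unit_interval : rconvex unit_interval.
Proof. intros a b t ha hb ht. unfold unit_interval in *. lra. Qed.

Definition convex (X : C -> Prop) : Prop := forall a b t, X a -> X b -> 0 <= t <= 1 -> X (seg a b t).

Lemma convex_connected X : convex X -> is_connected X.
Proof.
  intros hX. apply connected_of_pairs. intros a b ha hb.
  exists (fun z => exists t, unit_interval t /\ seg a b t = z). repeat split.
  - apply rcont_image_connected; [apply rconvex_unit_interval|]. intros; apply rcont_seg.
  - intros z [t [ht <-]]. apply hX; auto.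
  - exists 0. split; [unfold unit_interval; lra|apply seg_0].
  - exists 1. split; [unfold unit_interval; lra|apply seg_1].
Qed.

Lemma seg_ball c r a b t : Cdist a c < r -> Cdist b c < r -> 0 <= t <= 1 -> Cdist (seg a b t) c < r.
Proof.
  rewrite !Cdist_Cmod. intros ha hb ht. unfold seg.
  replace (a + t * (b - a) - c)%C with ((1 - t)%R * (a - c) + t * (b - c))%C
    by (rewrite RtoC_minus; ring).
  eapply Rle_lt_trans; [apply Cmod_triangle|].
  rewrite !Cmod_mult, !Cmod_R, !Rabs_right by lra.
  destruct (Req_dec t 0) as [->|]; nra.
Qed.

Lemma convex_ball c r : convex (fun z => Cdist z c < r).
Proof. intros a b t ha hb ht. apply seg_ball; auto. Qed.

Lemma unit_disk_ball (z : C) : unit_disk z <-> Cdist z (RtoC 0) < 1.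
Proof.
  unfold unit_disk. rewrite Cnorm_Cmod, Cdist_Cmod. replace (z - 0)%C with z by ring. tauto.
Qed.

Lemma unit_disk_Cmod (z : C) : unit_disk z <-> Cmod z < 1.
Proof. unfold unit_disk. rewrite Cnorm_Cmod. tauto. Qed.

Lemma convex_unit_disk : convex unit_disk.
Proof. intros a b t. rewrite !unit_disk_ball. apply convex_ball. Qed.

Lemma convex_inter X Y : convex X -> convex Y -> convex (fun z => X z /\ Y z).
Proof. intros hX hY a b t [h1 h2] [h3 h4] ht. split; auto. Qed.

Lemma open_ball c r : is_open (fun z => Cdist z c < r).
Proof.
  intros z hz. exists (r - Cdist z c). split; [lra|]. intros w hw.
  pose proof (Cdist_tri w z c). lra.
Qed.

Lemma open_unit_disk : is_open unit_disk.
Proof.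
  intros z hz. apply unit_disk_ball in hz. destruct (open_ball _ _ z hz) as [e [he h]].
  exists e. split; auto. intros w hw. apply unit_disk_ball; auto.
Qed.

Lemma connected_union (K L : C -> Prop) z : is_connected K -> is_connected L -> K z -> L z ->
  is_connected (fun w => K w \/ L w).
Proof.
  intros hK hL kz lz [U [V [oU [oV [cov [[a [ha1 ha2]] [[b [hb1 hb2]] dis]]]]]]].
  assert (K1 : (forall w, K w -> U w) \/ (forall w, K w -> V w)).
  { apply NNPP. intros n. apply not_or_and in n. destruct n as [n1 n2].
    apply not_all_ex_not in n1. apply not_all_ex_not in n2.
    destruct n1 as [x hx]. destruct n2 as [y hy]. apply imply_to_and in hx, hy.
    apply hK. exists U, V. repeat split; auto.
    - exists y. destruct hy. split; auto. destruct (cov y); auto; tauto.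
    - exists x. destruct hx. split; auto. destruct (cov x); auto; tauto.
    - intros w hw. apply dis; auto. }
  assert (L1 : (forall w, L w -> U w) \/ (forall w, L w -> V w)).
  { apply NNPP. intros n. apply not_or_and in n. destruct n as [n1 n2].
    apply not_all_ex_not in n1. apply not_all_ex_not in n2.
    destruct n1 as [x hx]. destruct n2 as [y hy]. apply imply_to_and in hx, hy.
    apply hL. exists U, V. repeat split; auto.
    - exists y. destruct hy. split; auto. destruct (cov y); auto; tauto.
    - exists x. destruct hx. split; auto. destruct (cov x); auto; tauto.
    - intros w hw. apply dis; auto. }
  destruct K1 as [K1|K1], L1 as [L1|L1].
  - apply (dis b); auto. destruct hb1; auto.
  - apply (dis z); auto.
  - apply (dis z); auto.
  - apply (dis a); auto. destruct ha1; auto.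
Qed.

Lemma connected_ext (K L : C -> Prop) : (forall z, K z <-> L z) -> is_connected K -> is_connected L.
Proof.
  intros H hK [U [V [oU [oV [cov [[a [ha1 ha2]] [[b [hb1 hb2]] dis]]]]]]]. apply hK.
  exists U, V. repeat split; auto.
  - intros z hz. apply cov, H; auto.
  - exists a. split; auto. apply H; auto.
  - exists b. split; auto. apply H; auto.
  - intros z hz. apply dis, H; auto.
Qed.

Lemma connected_singleton a : is_connected (fun z => z = a).
Proof.
  intros [U [V [oU [oV [cov [[x [-> ha2]] [[y [-> hb2]] dis]]]]]]]. apply (dis a); auto.
Qed.

Lemma connected_closure (K L : C -> Prop) : is_connected K -> (forall z, K z -> L z) ->
  (forall z, L z -> closure K z) -> is_connected L.
Proof.
  intros hK h1 h2 [U [V [oU [oV [cov [[a [ha1 ha2]] [[b [hb1 hb2]] dis]]]]]]]. apply hK.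
  exists U, V. repeat split; auto.
  - destruct (oU a ha2) as [e [he h]]. destruct (h2 a ha1 e he) as [w [hw hd]]. exists w; auto.
  - destruct (oV b hb2) as [e [he h]]. destruct (h2 b hb1 e he) as [w [hw hd]]. exists w; auto.
  - intros z hz. apply dis; auto.
Qed.

(** * Connected components *)

Lemma component_sub A z0 z : component A z0 z -> A z.
Proof. intros [K [_ [h [_ hz]]]]; auto. Qed.

Lemma component_self (A : C -> Prop) z0 : A z0 -> component A z0 z0.
Proof.
  intros h. exists (fun z => z = z0). repeat split; auto; [apply connected_singleton|].
  intros z ->; auto.
Qed.

Lemma component_base A z0 z : component A z0 z -> component A z0 z0.
Proof. intros [K [h1 [h2 [h3 h4]]]]. exists K; auto. Qed.

Lemma component_connected A z0 : is_connected (component A z0).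
Proof.
  apply connected_of_pairs. intros a b [K [hK1 [hK2 [hK3 hK4]]]] [L [hL1 [hL2 [hL3 hL4]]]].
  exists (fun w => K w \/ L w). repeat split; auto.
  - apply connected_union with z0; auto.
  - intros z [h|h]; [exists K|exists L]; auto.
Qed.

Lemma component_maximal A z0 (K : C -> Prop) z : component A z0 z -> is_connected K ->
  (forall w, K w -> A w) -> K z -> forall w, K w -> component A z0 w.
Proof.
  intros hz hK hKA Kz w hw.
  exists (fun y => component A z0 y \/ K y). repeat split; auto.
  - apply connected_union with z; auto. apply component_connected.
  - intros y [h|h]; auto. eapply component_sub; eauto.
  - left. eapply component_base; eauto.
Qed.

Lemma component_open A z0 : is_open A -> is_open (component A z0).
Proof.
  intros oA z hz. destruct (oA z (component_sub _ _ _ hz)) as [e [he h]].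
  exists e. split; auto. intros w hw.
  apply (component_maximal A z0 (fun y => Cdist y z < e) z); auto.
  - apply convex_connected, convex_ball.
  - rewrite Cdist_refl; auto.
Qed.

Lemma component_boundary A z0 z : is_open A -> boundary (component A z0) z -> ~ A z.
Proof.
  intros oA [h1 h2] hz. destruct (oA z hz) as [e [he h]]. destruct (h1 e he) as [w [hw hwz]].
  apply h2. apply (component_maximal A z0 (fun y => Cdist y z < e) w); auto.
  - apply convex_connected, convex_ball.
  - rewrite Cdist_refl; auto.
Qed.

(** * Lifting through a covering *)

(** The inner clause of [covering_map], with the neighbourhood, the index type and the sheets as
    parameters. *)
Definition evenly_covered (U : C -> Prop) (f : C -> C) (V : C -> Prop) (T : Type) (W : T -> C -> Prop) : Prop :=
  (forall i, is_open (W i)) /\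
  (forall i z, W i z -> U z) /\
  (forall i j z, W i z -> W j z -> i = j) /\
  (forall z, U z -> V (f z) -> exists i, W i z) /\
  (forall i z, W i z -> V (f z)) /\
  (forall i, exists g : C -> C, continuous_on V g /\
     (forall w, V w -> W i (g w) /\ f (g w) = w) /\
     (forall z, W i z -> g (f z) = z)).

Lemma covering_even U Om f q : covering_map U Om f -> Om q ->
  exists V T W, is_open V /\ V q /\ (forall w, V w -> Om w) /\ evenly_covered U f V T W.
Proof.
  intros [_ [_ [_ H]]] hq. destruct (H q hq) as [V [oV [hV [hVO [T [W h]]]]]].
  exists V, T, W. auto.
Qed.

(** Sheets are open and pairwise disjoint, so the sheet containing [L t] is locally constant in
    t. *)
Lemma sheet_stays U f V T W (J : R -> Prop) (L : R -> C) i : evenly_covered U f V T W ->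
  rconvex J -> (forall t, J t -> rcont J L t) -> (forall t, J t -> U (L t) /\ V (f (L t))) ->
  forall s t, J s -> J t -> W i (L s) -> W i (L t).
Proof.
  intros [oW [_ [dis [ex _]]]] hJ hc hL s t hs ht.
  apply (interval_locally_constant J (fun t => W i (L t)) hJ); auto.
  intros r hr. destruct (hL r hr) as [h1 h2]. destruct (ex _ h1 h2) as [j hj].
  destruct (oW j _ hj) as [e [he h]]. destruct (hc r hr e he) as [d [hd hd']].
  exists d; split; auto. intros a b ha hb h3 h4 hi.
  assert (hja : W j (L a)) by auto. rewrite (dis i j (L a) hi hja). auto.
Qed.

(** If the two lifts agree at one nearby parameter, they lie in the same sheet throughout the
    neighbourhood, and the section of that sheet identifies them. *)
Lemma lift_unique U Om f (J : R -> Prop) (L1 L2 : R -> C) : covering_map U Om f -> rconvex J ->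
  (forall t, J t -> rcont J L1 t) -> (forall t, J t -> rcont J L2 t) ->
  (forall t, J t -> U (L1 t)) -> (forall t, J t -> U (L2 t)) ->
  (forall t, J t -> f (L1 t) = f (L2 t)) ->
  forall s t, J s -> J t -> L1 s = L2 s -> L1 t = L2 t.
Proof.
  intros hc hJ c1 c2 u1 u2 e12 s t hs ht.
  apply (interval_locally_constant J (fun t => L1 t = L2 t) hJ); auto.
  intros r hr.
  assert (hOm : Om (f (L1 r))) by (apply hc; auto).
  destruct (covering_even U Om f _ hc hOm) as [V [T [W [oV [hV [_ E]]]]]].
  destruct E as [oW [WU [dis [ex [WV sec]]]]].
  destruct (ex _ (u1 r hr) hV) as [i hi].
  assert (hV2 : V (f (L2 r))) by (rewrite <- e12; auto).
  destruct (ex _ (u2 r hr) hV2) as [j hj].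
  destruct (oW i _ hi) as [e [he h]]. destruct (c1 r hr e he) as [d [hd hd']].
  destruct (oW j _ hj) as [e' [he' h']]. destruct (c2 r hr e' he') as [d2 [hd2 hd2']].
  exists (Rmin d d2). split; [apply Rmin_pos; auto|]. intros a b ha hb ra rb E.
  pose proof (Rmin_l d d2). pose proof (Rmin_r d d2).
  assert (A1 : W i (L1 a)) by (apply h, hd'; auto; lra).
  assert (A2 : W j (L2 a)) by (apply h', hd2'; auto; lra).
  rewrite E in A1. assert (ij := dis _ _ _ A1 A2). subst j.
  destruct (sec i) as [g [_ [_ hg]]].
  rewrite <- (hg (L1 b)) by (apply h, hd'; auto; lra).
  rewrite <- (hg (L2 b)) by (apply h', hd2'; auto; lra).
  rewrite e12; auto.
Qed.

(** Continuity induction on the end [s] of the interval already lifted; beyond [s] the lift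
    continues by the section of the sheet that contains its last point. *)
Lemma path_lift U Om f (q : R -> C) u0 : covering_map U Om f ->
  (forall t, unit_interval t -> rcont unit_interval q t) ->
  (forall t, unit_interval t -> Om (q t)) -> U u0 -> f u0 = q 0 ->
  exists L, (forall t, unit_interval t -> rcont unit_interval L t) /\ L 0 = u0 /\
    forall t, unit_interval t -> U (L t) /\ f (L t) = q t.
Proof.
  intros hc cq hq hu0 h0.
  set (Ex := fun s => exists L, (forall t, 0 <= t <= s -> rcont (fun r => 0 <= r <= s) L t) /\ L 0 = u0 /\
    forall t, 0 <= t <= s -> U (L t) /\ f (L t) = q t).
  assert (E1 : Ex 1); [|exact E1].
  apply (interval_locally_constant unit_interval Ex rconvex_unit_interval) with 0;
    [|unfold unit_interval; lra|unfold unit_interval; lra|].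
  - intros t ht. destruct (covering_even U Om f _ hc (hq t ht)) as [V [T [W [oV [hV [_ E]]]]]].
    destruct (oV _ hV) as [e [he h]]. destruct (cq t ht e he) as [d [hd hd']].
    exists d; split; auto. intros s s' hs hs' h1 h2 [L [cL [L0 hL]]].
    unfold unit_interval in *.
    destruct (Rle_lt_dec s' s) as [hle|hlt].
    + exists L. repeat split; auto; try (apply hL; lra). intros r hr.
      apply rcont_sub with (fun r => 0 <= r <= s); [intros; lra|]. apply cL; lra.
    + assert (inV : forall r, s <= r <= s' -> V (q r)).
      { intros r hr. apply h, hd'; [lra|]. apply Rabs_lt_between.
        apply Rabs_lt_between in h1, h2. lra. }
      destruct E as [oW [WU [dis [ex [WV sec]]]]].
      destruct (hL s) as [a1 a2]; [lra|].
      destruct (ex (L s) a1) as [i hi]; [rewrite a2; apply inV; lra|].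
      destruct (sec i) as [g [cg [hg1 hg2]]].
      assert (gs : g (q s) = L s) by (rewrite <- a2; auto).
      exists (fun r => if Rle_dec r s then L r else g (q r)). repeat split.
      * intros r hr e' he'.
        assert (left_part : r <= s -> exists d, 0 < d /\ forall x, 0 <= x <= s -> Rabs (x - r) < d -> Cdist (L x) (L r) < e').
        { intros hrs. apply (cL r); auto; lra. }
        assert (right_part : s <= r -> exists d, 0 < d /\ forall x, s <= x <= s' -> Rabs (x - r) < d -> Cdist (g (q x)) (g (q r)) < e').
        { intros hrs. destruct (cg (q r)) with (e := e') as [d1 [hd1 k1]]; auto.
          { apply inV; lra. }
          destruct (cq r) with (e := d1) as [d2 [hd2 k2]]; auto; [lra|].
          exists d2; split; auto. intros x hx hxr. apply k1; [apply inV; lra|]. apply k2; auto; lra. }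
        destruct (Rtotal_order r s) as [h3|[h3|h3]].
        -- destruct left_part as [d1 [hd1 k1]]; [lra|].
           exists (Rmin d1 (s - r)). split; [apply Rmin_pos; lra|]. intros x hx hxr.
           pose proof (Rmin_l d1 (s - r)). pose proof (Rmin_r d1 (s - r)).
           assert (x <= s) by (apply Rabs_lt_between in hxr; lra).
           destruct (Rle_dec x s); [|lra]. destruct (Rle_dec r s); [|lra]. apply k1; lra.
        -- subst r. destruct left_part as [d1 [hd1 k1]]; [lra|].
           destruct right_part as [d2 [hd2 k2]]; [lra|].
           exists (Rmin d1 d2). split; [apply Rmin_pos; lra|]. intros x hx hxr.
           pose proof (Rmin_l d1 d2). pose proof (Rmin_r d1 d2).
           destruct (Rle_dec s s); [|lra]. destruct (Rle_dec x s).
           ++ apply k1; lra.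
           ++ rewrite <- gs. apply k2; lra.
        -- destruct right_part as [d1 [hd1 k1]]; [lra|].
           exists (Rmin d1 (r - s)). split; [apply Rmin_pos; lra|]. intros x hx hxr.
           pose proof (Rmin_l d1 (r - s)). pose proof (Rmin_r d1 (r - s)).
           assert (s < x) by (apply Rabs_lt_between in hxr; lra).
           destruct (Rle_dec x s); [lra|]. destruct (Rle_dec r s); [lra|]. apply k1; lra.
      * destruct (Rle_dec 0 s); [auto|lra].
      * destruct (Rle_dec t0 s); [apply hL; lra|]. apply WU with i, hg1, inV; lra.
      * destruct (Rle_dec t0 s); [apply hL; lra|]. apply hg1, inV; lra.
  - exists (fun _ => u0). repeat split; auto.
    + intros t ht e he. exists 1. split; [lra|]. intros. rewrite Cdist_refl; auto.
    + intros. replace t with 0 by lra. auto.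
Qed.

Lemma seg_dist_end x0 x y s t : 0 <= s <= 1 ->
  Cdist (seg x0 y s) (seg x0 x t) <= Cdist y x + Rabs (s - t) * Cdist x x0.
Proof.
  intros hs. eapply Rle_trans; [apply Cdist_tri with (y := seg x0 x s)|].
  rewrite seg_dist. apply Rplus_le_compat_r.
  rewrite !Cdist_Cmod. unfold seg.
  replace (x0 + s * (y - x0) - (x0 + s * (x - x0)))%C with (s * (y - x))%C by ring.
  rewrite Cmod_mult, Cmod_R, Rabs_right by lra. pose proof (Cmod_ge_0 (y - x)). nra.
Qed.

(** Each point is reached along its segment from [x0], and [F x] is the end of the lifted segment.
    Logarithms, deck transformations and the lifts of curves and half-planes below are all
    instances. *)
Lemma convex_lift U Om f (X : C -> Prop) (q : C -> C) x0 u0 : covering_map U Om f ->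
  convex X -> continuous_on X q -> (forall x, X x -> Om (q x)) -> X x0 -> U u0 -> f u0 = q x0 ->
  exists F : C -> C, continuous_on X F /\ F x0 = u0 /\ forall x, X x -> U (F x) /\ f (F x) = q x.
Proof.
  intros hc hX cq hq hx0 hu0 h0.
  assert (cs : forall x, X x -> forall t, unit_interval t -> rcont unit_interval (fun s => q (seg x0 x s)) t).
  { intros x hx t ht. apply (rcont_comp unit_interval X (seg x0 x) q).
    - intros s hs. apply hX; auto.
    - apply rcont_seg.
    - apply cont_on_in; auto. }
  assert (exL : forall x, exists L, X x -> (forall t, unit_interval t -> rcont unit_interval L t) /\ L 0 = u0 /\
    forall t, unit_interval t -> U (L t) /\ f (L t) = q (seg x0 x t)).
  { intros x. destruct (classic (X x)) as [hx|hx].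
    - destruct (path_lift U Om f (fun s => q (seg x0 x s)) u0 hc (cs x hx)) as [L hL].
      + intros t ht. apply hq, hX; auto.
      + exact hu0.
      + rewrite seg_0; exact h0.
      + exists L; auto.
    - exists (fun _ => u0). tauto. }
  set (L := fun x => epsilon (inhabits (fun _ : R => u0)) (fun L => X x ->
     (forall t, unit_interval t -> rcont unit_interval L t) /\ L 0 = u0 /\
    forall t, unit_interval t -> U (L t) /\ f (L t) = q (seg x0 x t))).
  assert (hL : forall x, X x -> (forall t, unit_interval t -> rcont unit_interval (L x) t) /\ L x 0 = u0 /\
    forall t, unit_interval t -> U (L x t) /\ f (L x t) = q (seg x0 x t)).
  { intros x. apply (epsilon_spec (inhabits (fun _ : R => u0)) _ (exL x)). }
  assert (i0 : unit_interval 0) by (unfold unit_interval; lra).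
  assert (i1 : unit_interval 1) by (unfold unit_interval; lra).
  exists (fun x => L x 1). repeat split.
  - intros x hx.
    (* With [x] fixed, the property carried along s is continuity at [x] of y -> L y s; it is
       trivial at s = 0, where every lift is at [u0]. *)
    apply (interval_locally_constant unit_interval
      (fun s => forall e, 0 < e -> exists d, 0 < d /\ forall y, X y -> Cdist y x < d -> Cdist (L y s) (L x s) < e)
      rconvex_unit_interval) with 0; auto.
    + intros t ht. destruct (hL x hx) as [cLx [_ hLx]].
      assert (hOm : Om (q (seg x0 x t))) by (apply hq, hX; auto).
      destruct (covering_even U Om f _ hc hOm) as [V [T [W [oV [hV [_ E]]]]]].
      destruct (oV _ hV) as [e1 [he1 h1]].
      destruct (cq (seg x0 x t)) with (e := e1) as [d1 [hd1 k1]]; auto.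
      pose proof (Cdist_pos x x0) as hp.
      (* Half of [d1] is spent on moving [x] to [y], the other half on moving the parameter along
         the segment, whose speed is [Cdist x x0]. *)
      set (d := d1 / 2 / (Cdist x x0 + 1)).
      assert (hd : 0 < d) by (apply Rdiv_lt_0_compat; lra).
      assert (inV : forall y s, X y -> unit_interval s -> Cdist y x < d1 / 2 -> Rabs (s - t) < d -> V (q (seg x0 y s))).
      { intros y s hy hs hyx hst. apply h1, k1; [apply hX; auto|].
        eapply Rle_lt_trans; [apply seg_dist_end; auto|].
        assert (Rabs (s - t) * Cdist x x0 <= d * Cdist x x0) by (apply Rmult_le_compat_r; lra).
        assert (d * (Cdist x x0 + 1) = d1 / 2) by (unfold d; field; lra). nra. }
      exists d. split; auto. intros s s' hs hs' hst hst' Qs e he.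
      destruct (hLx s hs) as [a1 a2].
      pose proof E as [oW [WU [dis [ex [WV sec]]]]].
      destruct (ex (L x s) a1) as [i hi]; [rewrite a2; apply inV; auto; rewrite Cdist_refl; lra|].
      destruct (oW i _ hi) as [r [hr hr']]. destruct (Qs r hr) as [d2 [hd2 k2]].
      destruct (sec i) as [g [cg [hg1 hg2]]].
      assert (val : forall y, X y -> Cdist y x < d1 / 2 -> Cdist y x < d2 ->
        L y s' = g (q (seg x0 y s'))).
      { intros y hy hy1 hy2. destruct (hL y hy) as [cLy [_ hLy]].
        assert (wi : W i (L y s')).
        { apply (sheet_stays U f V T W (fun r => unit_interval r /\ Rabs (r - t) < d) (L y) i E) with (s := s); auto.
          - intros a b c [a1' a2'] [b1 b2] hc'. split; [apply (rconvex_unit_interval a b); auto|].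
            apply Rabs_lt_between in a2', b2. apply Rabs_lt_between. lra.
          - intros r0 [hr0 _]. apply rcont_sub with unit_interval; [tauto|]. auto.
          - intros r0 [hr0 hr1]. destruct (hLy r0 hr0) as [b1 b2]. split; auto. rewrite b2. apply inV; auto. }
        rewrite <- (hg2 _ wi). f_equal. apply hLy; auto. }
      destruct (cg (q (seg x0 x s'))) with (e := e) as [d3 [hd3 k3]]; auto.
      { apply inV; auto. rewrite Cdist_refl; lra. }
      destruct (cq (seg x0 x s')) with (e := d3) as [d4 [hd4 k4]]; auto.
      exists (Rmin (d1 / 2) (Rmin d2 d4)). split; [repeat apply Rmin_pos; lra|]. intros y hy hyx.
      pose proof (Rmin_l (d1 / 2) (Rmin d2 d4)). pose proof (Rmin_r (d1 / 2) (Rmin d2 d4)).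
      pose proof (Rmin_l d2 d4). pose proof (Rmin_r d2 d4).
      rewrite (val y) by (auto; lra). rewrite (val x) by (auto; rewrite Cdist_refl; lra).
      apply k3; [apply inV; auto; lra|]. apply k4; [apply hX; auto|].
      eapply Rle_lt_trans; [apply seg_dist_end; auto|]. rewrite Rminus_diag, Rabs_R0. lra.
    + intros e he. exists 1. split; [lra|]. intros y hy _.
      destruct (hL y hy) as [_ [-> _]]. destruct (hL x hx) as [_ [-> _]]. rewrite Cdist_refl; auto.
  - destruct (hL x0 hx0) as [cL [L0 hL0]].
    apply (lift_unique U Om f unit_interval (L x0) (fun _ => u0) hc rconvex_unit_interval) with (s := 0); auto.
    + intros t ht e he. exists 1. split; [lra|]. intros. rewrite Cdist_refl; auto.
    + intros t ht. apply hL0; auto.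
    + intros t ht. destruct (hL0 t ht) as [_ ->]. rewrite h0. f_equal. unfold seg. toC; ring.
  - apply hL; auto.
  - destruct (hL x H) as [_ [_ h]]. destruct (h 1 i1) as [_ ->]. rewrite seg_1; auto.
Qed.

Lemma convex_lift_unique U Om f (X : C -> Prop) (F1 F2 : C -> C) x0 : covering_map U Om f ->
  convex X -> continuous_on X F1 -> continuous_on X F2 ->
  (forall x, X x -> U (F1 x)) -> (forall x, X x -> U (F2 x)) ->
  (forall x, X x -> f (F1 x) = f (F2 x)) -> X x0 -> F1 x0 = F2 x0 ->
  forall x, X x -> F1 x = F2 x.
Proof.
  intros hc hX c1 c2 u1 u2 e12 hx0 h0 x hx.
  assert (iX : forall t, unit_interval t -> X (seg x0 x t)) by (intros; apply hX; auto).
  rewrite <- (seg_1 x0 x).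
  apply (lift_unique U Om f unit_interval (fun t => F1 (seg x0 x t)) (fun t => F2 (seg x0 x t)) hc
    rconvex_unit_interval) with (s := 0); auto.
  - intros t ht. apply (rcont_comp unit_interval X (seg x0 x) F1); auto; [apply rcont_seg|apply cont_on_in; auto].
  - intros t ht. apply (rcont_comp unit_interval X (seg x0 x) F2); auto; [apply rcont_seg|apply cont_on_in; auto].
  - unfold unit_interval; lra.
  - unfold unit_interval; lra.
  - rewrite seg_0; auto.
Qed.

(** * Logarithms *)

(* the principal logarithm; meaningful only on the right half-plane *)
Definition Log (z : C) : C := (ln (Cmod z), atan (snd z / fst z)).

Lemma Cmod_polar x y : 0 < x -> Cmod (x, y) = x * sqrt (1 + (y / x) ^ 2).
Proof.
  intros hx. unfold Cmod; simpl fst; simpl snd.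
  rewrite <- (sqrt_square x) at 2 by lra. rewrite <- sqrt_mult; [|nra|nra].
  f_equal. field. lra.
Qed.

Lemma cexp_Log z : 0 < fst z -> cexp (Log z) = z.
Proof.
  intros hx. destruct z as [x y]. simpl in hx. unfold cexp, Log; simpl fst; simpl snd.
  assert (hm : 0 < Cmod (x, y)) by (pose proof (Cmod_fst (x, y)); simpl in *; pose proof (Rle_abs x); lra).
  rewrite exp_ln by auto. rewrite cos_atan, sin_atan, Cmod_polar by auto.
  assert (hs : 0 < sqrt (1 + (y / x) ^ 2)) by (apply sqrt_lt_R0; pose proof (pow2_ge_0 (y / x)); lra).
  replace (1 + (y / x)²) with (1 + (y / x) ^ 2) by (unfold Rsqr; ring).
  f_equal; field; lra.
Qed.

Lemma Log_cexp z : - PI / 2 < snd z < PI / 2 -> Log (cexp z) = z.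
Proof.
  intros hz. destruct z as [x y]; simpl in hz. unfold Log. rewrite Cmod_cexp.
  unfold cexp; simpl. rewrite ln_exp. f_equal.
  assert (0 < cos y) by (apply cos_gt_0; lra).
  replace (exp x * sin y / (exp x * cos y)) with (tan y).
  - apply atan_tan; lra.
  - unfold tan. field. split; [lra|]. pose proof (exp_pos x). lra.
Qed.

Lemma Log_bound z : - PI / 2 < snd (Log z) < PI / 2.
Proof. simpl. pose proof (atan_bound (snd z / fst z)). lra. Qed.

Lemma cont_at_Log z : 0 < fst z -> cont_at Log z.
Proof.
  intros hz. unfold Log.
  apply (cont_in_pair _ (fun z => ln (Cmod z)) (fun z => atan (snd z / fst z))).
  - apply (cont_in_real _ ln Cmod).
    + apply continuity_pt_filterlim, continuous_ln.
      pose proof (Cmod_fst z). pose proof (Rle_abs (fst z)). lra.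
    + apply (cont_in_Cmod _ (fun z => z)), cont_in_id.
  - apply (cont_in_real _ atan (fun z => snd z / fst z)).
    + apply derivable_continuous_pt, derivable_pt_atan.
    + apply (cont_in_Rdiv _ snd fst); [lra| |].
      * apply (cont_in_snd _ (fun z => z)), cont_in_id.
      * apply (cont_in_fst _ (fun z => z)), cont_in_id.
Qed.

Lemma cexp_surj (z : C) : z <> 0 -> exists l, cexp l = z.
Proof.
  intros hz. destruct (Rtotal_order (fst z) 0) as [h|[h|h]].
  - exists (Log (- z) + (0%R, PI))%C. rewrite cexp_plus, cexp_Log by (simpl; lra).
    unfold cexp; simpl. rewrite exp_0, cos_PI, sin_PI.
    unfold Cmult, Copp; simpl. destruct z; simpl. f_equal; ring.
  - destruct (Rtotal_order (snd z) 0) as [k|[k|k]].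
    + exists (Log (z * Ci) + (0%R, (- (PI / 2))%R))%C.
      rewrite cexp_plus, cexp_Log by (unfold Cmult, Ci; simpl; lra).
      unfold cexp; simpl. rewrite exp_0, cos_neg, sin_neg, cos_PI2, sin_PI2.
      unfold Cmult, Ci; simpl. destruct z; simpl. f_equal; ring.
    + exfalso. apply hz. destruct z; simpl in *; subst; auto.
    + exists (Log (- (z * Ci)) + (0%R, (PI / 2)%R))%C.
      rewrite cexp_plus, cexp_Log by (unfold Cmult, Ci, Copp; simpl; lra).
      unfold cexp; simpl. rewrite exp_0, cos_PI2, sin_PI2.
      unfold Cmult, Ci, Copp; simpl. destruct z; simpl. f_equal; ring.
  - exists (Log z). apply cexp_Log; auto.
Qed.

(** Around q = exp l the evenly covered set is the half-plane Re(w / q) > 0; its sheets are the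
    horizontal strips of height PI centred at Im l + 2 PI k, with section l + 2 PI i k + Log(w /
    q). *)
Lemma covering_cexp : covering_map everywhere (fun z => z <> RtoC 0) cexp.
Proof.
  pose proof PI_RGT_0 as hpi.
  split; [|split; [|split]].
  - intros z _. apply (cont_at_in everywhere), cont_at_cexp.
  - intros z _. apply cexp_neq0.
  - intros q hq. destruct (cexp_surj q hq) as [l hl]. exists l. split; auto. exact I.
  - intros q hq. destruct (cexp_surj q hq) as [l hl].
    assert (cr : forall w, cont_at (fun w => w / q)%C w).
    { intros w. apply cont_in_mult; [apply cont_in_id|apply cont_in_const]. }
    exists (fun w => 0 < fst (w / q)%C). repeat split.
    + intros w hw. destruct (cr w (fst (w / q)%C) hw) as [d [hd h]]. exists d; split; auto.
      intros y hy. specialize (h y I hy).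
      pose proof (Cdist_fst (y / q)%C (w / q)%C) as T. apply Rabs_le_between in T. lra.
    + replace (q / q)%C with (RtoC 1) by (field; auto). simpl. lra.
    + intros w hw ->. replace (0 / q)%C with (RtoC 0) in hw by (field; auto). simpl in hw. lra.
    + assert (Vc : forall z, (cexp z / q)%C = cexp (z - l)%C).
      { intros z. rewrite cexp_minus, hl. auto. }
      exists Z, (fun k z => - (PI / 2) < snd z - snd l - 2 * PI * IZR k < PI / 2).
      repeat split.
      * intros k z hz. set (y := snd z - snd l - 2 * PI * IZR k) in *.
        exists (Rmin (PI / 2 - y) (y + PI / 2)). split; [apply Rmin_pos; lra|].
        intros w hw. pose proof (Rmin_l (PI / 2 - y) (y + PI / 2)). pose proof (Rmin_r (PI / 2 - y) (y + PI / 2)).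
        pose proof (Cdist_snd w z) as T. apply Rabs_le_between in T. unfold y in *. lra.
      * intros i j z h1 h2. apply eq_IZR.
        assert (hij : -1 < IZR (i - j) < 1).
        { rewrite minus_IZR. split; apply Rmult_lt_reg_l with (r := 2 * PI); lra. }
        destruct hij as [a b]. apply lt_IZR in a, b. f_equal. lia.
      * intros z _ hz. rewrite Vc in hz.
        assert (E : cexp (z - l - Log (cexp (z - l)))%C = RtoC 1).
        { rewrite cexp_minus, cexp_Log by auto. field. apply cexp_neq0. }
        destruct (cexp_eq_1 _ E) as [_ [k hk]]. exists k.
        pose proof (Log_bound (cexp (z - l)%C)) as B.
        unfold Cminus, Cplus, Copp in hk. simpl in hk. simpl in B.
        unfold Cminus, Cplus, Copp in B. simpl in B. lra.
      * intros k z hz. rewrite Vc. rewrite <- (cexp_2PI (- k)). unfold cexp, Cminus, Cplus, Copp; simpl.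
        apply Rmult_lt_0_compat; [apply exp_pos|]. rewrite opp_IZR. apply cos_gt_0; lra.
      * intros k. exists (fun w => l + (0%R, (2 * PI * IZR k)%R) + Log (w / q))%C.
        repeat split.
        -- intros w hw. apply (cont_at_in _ (fun w => l + (0%R, (2 * PI * IZR k)%R) + Log (w / q))%C).
           apply cont_in_plus; [apply cont_in_const|].
           apply (cont_in_comp_at _ (fun w => w / q)%C Log); auto. apply cont_at_Log; auto.
        -- pose proof (Log_bound (w / q)%C) as B. unfold Cplus; simpl. simpl in B. lra.
        -- pose proof (Log_bound (w / q)%C) as B. unfold Cplus; simpl. simpl in B. lra.
        -- rewrite cexp_plus, cexp_2PI, hl, cexp_Log by auto. toC. field; auto.
        -- intros z hz. rewrite Vc. rewrite <- (cexp_2PI (- k)).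
           rewrite Log_cexp.
           ++ destruct z as [zx zy], l as [lx ly]. unfold Cplus, Cminus, Copp; simpl. rewrite opp_IZR. f_equal; ring.
           ++ unfold Cplus, Cminus, Copp; simpl. rewrite opp_IZR. lra.
Qed.

Lemma convex_log (X : C -> Prop) (q : C -> C) : convex X -> continuous_on X q ->
  (forall x, X x -> q x <> RtoC 0) ->
  exists l, continuous_on X l /\ forall x, X x -> cexp (l x) = q x.
Proof.
  intros hX cq hq. destruct (classic (exists x0, X x0)) as [[x0 hx0]|n].
  - destruct (cexp_surj (q x0) (hq x0 hx0)) as [u0 hu0].
    destruct (convex_lift everywhere (fun z => z <> RtoC 0) cexp X q x0 u0 covering_cexp)
      as [F [h1 [_ h2]]]; auto; [exact I|].
    exists F. split; auto. intros x hx. apply h2; auto.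
  - exists (fun _ => RtoC 0). split.
    + intros z hz. exfalso. apply n. exists z; auto.
    + intros z hz. exfalso. apply n. exists z; auto.
Qed.

(** * Separation of the plane by closed sets *)

(** Plays the role of winding number zero: its failure certifies that [K] encloses [a]. *)
Definition has_log (K : C -> Prop) (a : C) : Prop :=
  exists l : C -> C, continuous_on K l /\ forall z, K z -> cexp (l z) = (z - a)%C.

Definition closed_set (K : C -> Prop) : Prop := is_open (fun z => ~ K z).

Lemma closed_closure K z : closed_set K -> closure K z -> K z.
Proof.
  intros hK hz. apply NNPP. intros n. destruct (hK z n) as [e [he h]].
  destruct (hz e he) as [w [hw hd]]. apply (h w); auto.
Qed.

Lemma closure_closed K : (forall z, closure K z -> K z) -> closed_set K.
Proof.
  intros H z hz. apply NNPP. intros n. apply hz, H. intros e he. apply NNPP. intros n'.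
  apply n. exists e. split; auto. intros w hw hk. apply n'. exists w; auto.
Qed.

(** z - b = (z - a)(1 - (b - a)/(z - a)), and the second factor stays in the right half-plane, where
    the principal logarithm applies. *)
Lemma has_log_near K a b d : (forall z, K z -> d <= Cdist z a) -> Cdist b a < d ->
  has_log K a -> has_log K b.
Proof.
  intros hK hb [l [cl hl]].
  assert (nz : forall z, K z -> (z - a)%C <> RtoC 0).
  { intros z hz E. pose proof (hK z hz). rewrite Cdist_Cmod, E, Cmod_0 in H.
    pose proof (Cdist_pos b a). lra. }
  assert (pos : forall z, K z -> 0 < fst (1 - (b - a) / (z - a))%C).
  { intros z hz. pose proof (hK z hz) as hd. pose proof (nz z hz) as hn.
    assert (hp : 0 < Cmod (z - a)%C) by (apply Cmod_gt_0; auto).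
    rewrite Cdist_Cmod in hd, hb.
    assert (B : Cmod ((b - a) / (z - a))%C < 1).
    { rewrite Cmod_div by auto. apply Rmult_lt_reg_r with (Cmod (z - a)%C); auto.
      unfold Rdiv. rewrite Rmult_assoc, Rinv_l; lra. }
    pose proof (Cmod_fst ((b - a) / (z - a))%C) as T. apply Rabs_le_between in T.
    replace (fst (1 - (b - a) / (z - a))%C) with (1 - fst ((b - a) / (z - a))%C); [lra|].
    reflexivity. }
  exists (fun z => l z + Log (1 - (b - a) / (z - a)))%C. split.
  - apply cont_on_intro. intros z hz. apply cont_in_plus; [apply cont_on_in; auto|].
    apply (cont_in_comp_at _ (fun z => 1 - (b - a) / (z - a))%C Log).
    + apply cont_in_minus; [apply cont_in_const|]. apply cont_in_div; auto; [apply cont_in_const|].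
      apply cont_in_minus; [apply cont_in_id|apply cont_in_const].
    + apply cont_at_Log; auto.
  - intros z hz. rewrite cexp_plus, hl, cexp_Log by auto. field. auto.
Qed.

Lemma has_log_connected K N a b : closed_set K -> is_connected N ->
  (forall z, N z -> ~ K z) -> N a -> N b -> has_log K a -> has_log K b.
Proof.
  intros cK hN dis ha hb. apply (connected_locally_constant N (has_log K) hN); auto.
  intros z hz. destruct (cK z (dis z hz)) as [e [he h]]. exists (e / 3). split; [lra|].
  intros w w' hw hw' h1 h2. apply (has_log_near K w w' (2 * e / 3)).
  - intros y hy. apply Rnot_lt_le. intros hl. apply (h y); auto.
    pose proof (Cdist_tri y w z). lra.
  - pose proof (Cdist_tri w' z w). rewrite (Cdist_sym z w) in H. lra.
Qed.

(** z - b = -b (1 - z / b). Since |z / b| <= 1 and z differs from b, the second factor has positive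
    real part; [b] on the unit circle is allowed. *)
Lemma has_log_outside (K : C -> Prop) b : (forall z, K z -> Cmod z <= 1) -> 1 <= Cmod b -> ~ K b ->
  has_log K b.
Proof.
  intros hK hb nb.
  assert (b0 : b <> RtoC 0) by (apply Cmod_gt_0; lra).
  destruct (cexp_surj (- b)%C) as [l hl].
  { intros E. apply b0. replace b with (- - b)%C by ring. rewrite E. ring. }
  assert (pos : forall z, K z -> 0 < fst (1 - z / b)%C).
  { intros z hz. pose proof (hK z hz) as hz1.
    assert (B : Cmod (z / b)%C <= 1).
    { rewrite Cmod_div by auto. apply Rmult_le_reg_r with (Cmod b); [lra|].
      unfold Rdiv. rewrite Rmult_assoc, Rinv_l; lra. }
    replace (fst (1 - z / b)%C) with (1 - fst (z / b)%C) by reflexivity.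
    apply Rnot_le_lt. intros hle. apply nb.
    pose proof (Cmod_sq (z / b)%C) as E. pose proof (Cmod_ge_0 (z / b)%C) as P.
    assert (h1 : fst (z / b)%C = 1) by nra. assert (h2 : snd (z / b)%C = 0) by nra.
    replace b with z; auto. replace z with ((z / b) * b)%C by (field; auto).
    replace (z / b)%C with (RtoC 1); [ring|].
    destruct (z / b)%C; simpl in *; subst; auto. }
  exists (fun z => l + Log (1 - z / b))%C. split.
  - apply cont_on_intro. intros z hz. apply cont_in_plus; [apply cont_in_const|].
    apply (cont_in_comp_at _ (fun z => 1 - z / b)%C Log).
    + apply cont_in_minus; [apply cont_in_const|]. apply cont_in_div; auto; [apply cont_in_id|apply cont_in_const].
    + apply cont_at_Log; auto.
  - intros z hz. rewrite cexp_plus, hl, cexp_Log by auto. field. auto.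
Qed.

(** Having a logarithm is constant on components of the complement and true outside the open disk;
    so the component of a point without one cannot reach the unit circle. *)
Lemma enclosed_component (K : C -> Prop) a : closed_set K -> (forall z, K z -> Cmod z <= 1) ->
  Cmod a < 1 -> ~ has_log K a ->
  forall z, component (fun z => ~ K z) a z -> Cmod z < 1.
Proof.
  intros cK hK ha nl z hz. apply Rnot_le_lt. intros hle. apply nl.
  pose proof (component_sub _ _ _ hz) as nz.
  apply (has_log_connected K (component (fun z => ~ K z) a) z a); auto.
  - apply component_connected.
  - intros w hw. apply (component_sub _ _ _ hw).
  - eapply component_base; eauto.
  - apply has_log_outside; auto.
Qed.

(** The difference takes values in 2 PI i Z, and two such values closer than 2 PI coincide. *)
Lemma log_difference (K : C -> Prop) (l1 l2 : C -> C) : is_connected K ->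
  continuous_on K l1 -> continuous_on K l2 -> (forall z, K z -> cexp (l1 z) = cexp (l2 z)) ->
  forall a b, K a -> K b -> (l1 a - l2 a = l1 b - l2 b)%C.
Proof.
  intros hK c1 c2 H a b ha hb. pose proof PI_RGT_0 as hpi.
  assert (int : forall z, K z -> fst (l1 z - l2 z)%C = 0 /\ exists k : Z, snd (l1 z - l2 z)%C = 2 * PI * IZR k).
  { intros z hz. apply cexp_eq_1. rewrite cexp_minus, H by auto. field. apply cexp_neq0. }
  symmetry. apply (connected_locally_constant K (fun z => (l1 z - l2 z = l1 a - l2 a)%C) hK) with a; auto.
  intros z hz.
  assert (c : cont_in K (fun z => l1 z - l2 z)%C z) by (apply cont_in_minus; apply cont_on_in; auto).
  destruct (c PI hpi) as [d [hd h]]. exists d; split; auto. intros w w' hw hw' h1 h2 <-.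
  specialize (h w hw h1) as k1. specialize (h w' hw' h2) as k2.
  destruct (int w hw) as [e1 [n1 m1]]. destruct (int w' hw') as [e2 [n2 m2]].
  pose proof (Cdist_tri (l1 w - l2 w) (l1 z - l2 z) (l1 w' - l2 w'))%C as T.
  rewrite (Cdist_sym (l1 z - l2 z)%C) in T.
  pose proof (Cdist_snd (l1 w - l2 w) (l1 w' - l2 w'))%C as T2. rewrite m1, m2 in T2.
  assert (n1 = n2).
  { assert (hij : Rabs (2 * PI * IZR n1 - 2 * PI * IZR n2) < 2 * PI) by lra.
    apply Rabs_lt_between in hij.
    assert (-1 < IZR (n1 - n2) < 1) as [a1 a2].
    { rewrite minus_IZR. split; apply Rmult_lt_reg_l with (r := 2 * PI); lra. }
    apply lt_IZR in a1, a2. lia. }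
  subst n2. destruct (l1 w - l2 w)%C, (l1 w' - l2 w')%C; simpl in *. congruence.
Qed.

(** * Koebe's lemma *)

(** Continuity induction takes the place of compactness of [0, 1]: a positive lower bound for the
    distance from [z] to the part of the path up to [s] is propagated in [s]. *)
Lemma path_image_closed (g : R -> C) : (forall t, unit_interval t -> rcont unit_interval g t) ->
  closed_set (fun z => exists t, unit_interval t /\ g t = z).
Proof.
  intros hg z hz.
  assert (K : forall t, unit_interval t -> 0 < Cdist (g t) z).
  { intros t ht. apply Cdist_neq_pos. intros E. apply hz. exists t; auto. }
  assert (Q : exists d, 0 < d /\ forall t, unit_interval t -> t <= 1 -> d <= Cdist (g t) z).
  { apply (interval_locally_constant unit_interval
      (fun s => exists d, 0 < d /\ forall t, unit_interval t -> t <= s -> d <= Cdist (g t) z)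
      rconvex_unit_interval) with 0; try (unfold unit_interval; lra).
    - intros t ht. specialize (K t ht). destruct (hg t ht (Cdist (g t) z / 2)) as [d [hd h]]; [lra|].
      exists d; split; auto. intros s s' hs hs' h1 h2 [d' [hd' h']].
      exists (Rmin d' (Cdist (g t) z / 2)). split; [apply Rmin_pos; lra|]. intros r hr hrs.
      pose proof (Rmin_l d' (Cdist (g t) z / 2)). pose proof (Rmin_r d' (Cdist (g t) z / 2)).
      destruct (Rle_lt_dec r s) as [hle|hlt].
      + specialize (h' r hr hle). lra.
      + assert (hr2 : Rabs (r - t) < d).
        { apply Rabs_lt_between in h1, h2. apply Rabs_lt_between. lra. }
        specialize (h r hr hr2). pose proof (Cdist_tri (g t) (g r) z).
        rewrite (Cdist_sym (g t) (g r)) in H1. lra.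
    - exists (Cdist (g 0) z). split; [apply K; unfold unit_interval; lra|].
      intros t ht h0. unfold unit_interval in ht. replace t with 0 by lra. lra. }
  destruct Q as [d [hd h]]. exists d; split; auto. intros w hw [t [ht E]]. subst w.
  specialize (h t ht). unfold unit_interval in ht. lra.
Qed.

Lemma closed_finite_union (A : nat -> C -> Prop) n : (forall j, (j < n)%nat -> closed_set (A j)) ->
  closed_set (fun z => exists j, (j < n)%nat /\ A j z).
Proof.
  induction n as [|n IH]; intros H z hz.
  - exists 1. split; [lra|]. intros w _ [j [hj _]]. lia.
  - destruct (IH (fun j hj => H j (Nat.lt_lt_succ_r _ _ hj)) z) as [e [he h]].
    { intros [j [hj hj']]. apply hz. exists j. split; auto. }
    destruct (H n (Nat.lt_succ_diag_r n) z) as [e' [he' h']].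
    { intros h1. apply hz. exists n. split; auto. }
    exists (Rmin e e'). split; [apply Rmin_pos; auto|]. intros w hw [j [hj hj']].
    pose proof (Rmin_l e e'). pose proof (Rmin_r e e').
    destruct (Nat.eq_dec j n) as [->|hne].
    + apply (h' w); auto; lra.
    + apply (h w); [lra|]. exists j. split; auto. lia.
Qed.

Lemma Cmod_pow_1 (z : C) n : Cmod z = 1 -> Cmod (Cpow z n) = 1.
Proof. intros h. rewrite Cmod_pow, h. apply pow1. Qed.

Lemma rcont_cont_at (g : R -> C) J f t : rcont J g t -> cont_at f (g t) -> rcont J (fun s => f (g s)) t.
Proof. intros. apply (rcont_comp J everywhere); auto. intros; exact I. Qed.

Fixpoint cprod (a : nat -> C) (n : nat) : C :=
  match n with O => RtoC 1 | S k => (cprod a k * a k)%C end.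

Lemma cprod_le (a : nat -> C) M n : 0 <= M -> (forall j, (j < n)%nat -> Cmod (a j) <= M) ->
  Cmod (cprod a n) <= M ^ n.
Proof.
  intros hM. induction n as [|n IH]; intros H; simpl.
  - rewrite Cmod_1; lra.
  - rewrite Cmod_mult, (Rmult_comm M). apply Rmult_le_compat; try apply Cmod_ge_0; auto.
Qed.

Lemma cprod_small (a : nat -> C) M e n : 1 <= M -> 0 <= e ->
  (forall j, (j < n)%nat -> Cmod (a j) <= M) ->
  (exists j, (j < n)%nat /\ Cmod (a j) <= e) -> Cmod (cprod a n) <= e * M ^ n.
Proof.
  intros hM he. induction n as [|n IH]; intros H [j [hj hje]]; [lia|]. simpl. rewrite Cmod_mult.
  assert (P : 0 < M ^ n) by (apply pow_lt; lra).
  destruct (Nat.eq_dec j n) as [->|hne].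
  - pose proof (cprod_le a M n ltac:(lra) ltac:(auto)) as B.
    apply Rle_trans with (M ^ n * e).
    + apply Rmult_le_compat; try apply Cmod_ge_0; auto.
    + assert (0 <= e * M ^ n) by (apply Rmult_le_pos; lra). nra.
  - replace (e * (M * M ^ n)) with (e * M ^ n * M) by ring.
    apply Rmult_le_compat; try apply Cmod_ge_0; auto. apply IH; auto. exists j. split; auto; lia.
Qed.

Lemma cderiv_cprod (a : nat -> C -> C) z n :
  (forall j, (j < n)%nat -> exists L, is_cderiv (a j) z L) ->
  exists L, is_cderiv (fun w => cprod (fun j => a j w) n) z L.
Proof.
  induction n as [|n IH]; intros H; simpl.
  - eexists. apply (cderiv_const (RtoC 1)).
  - destruct IH as [L hL]; auto. destruct (H n) as [L' hL']; auto.
    eexists. apply (cderiv_mult (fun w => cprod (fun j => a j w) n) (a n)); [exact hL|exact hL'].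
Qed.

Lemma cderiv_scal (c z : C) : is_cderiv (fun w => c * w)%C z c.
Proof.
  eapply cderiv_val; [apply (cderiv_mult (fun _ => c) (fun w => w)); [apply cderiv_const|apply cderiv_id]|].
  ring.
Qed.

(* The orbit of the path under the dihedral group generated by the reflections z -> u^2 conj z and
   z -> zt u^2 conj z is connected and invariant under multiplication by zt, which forbids a
   logarithm of z on it; so the orbit encloses 0. *)
Lemma koebe_dihedral (f : C -> C) M e m (zt u : C) (g : R -> C) : (0 < m)%nat ->
  holomorphic_on unit_disk f -> (forall z, unit_disk z -> Cmod (f z) <= M) -> 1 <= M -> 0 <= e ->
  Cmod u = 1 -> Cmod zt = 1 -> Cpow zt m = RtoC 1 -> zt <> RtoC 1 ->
  (forall t, unit_interval t -> rcont unit_interval g t) ->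
  (forall t, unit_interval t -> unit_disk (g t) /\ g t <> RtoC 0 /\ Cmod (f (g t)) <= e) ->
  (exists t, unit_interval t /\ (u * u * Cconj (g t))%C = g t) ->
  (exists t, unit_interval t /\ (zt * (u * u * Cconj (g t)))%C = g t) ->
  (Cmod (f (RtoC 0)) * Cmod (f (RtoC 0))) ^ m <= e * M * (M * M) ^ m.
Proof.
  intros m0 hf hM hM1 he hu hz hzm hz1 cg hg [t0 [ht0 E0]] [t1 [ht1 E1]].
  (* The dihedral group: the rotations by powers of [zt], and these after the reflection in the line
     through [u]. *)
  set (r1 := fun (j : nat) (z : C) => (Cpow zt j * z)%C).
  set (r2 := fun (j : nat) (z : C) => (Cpow zt j * (u * u * Cconj z))%C).
  set (K := fun z => exists j, (j < m)%nat /\ ((exists t, unit_interval t /\ r1 j (g t) = z) \/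
                                             (exists t, unit_interval t /\ r2 j (g t) = z))).
  assert (md : forall j z, Cmod (r1 j z) = Cmod z /\ Cmod (r2 j z) = Cmod z).
  { intros j z. unfold r1, r2. rewrite !Cmod_mult, Cmod_conj, (Cmod_pow_1 zt) by auto. rewrite hu. lra. }
  assert (c1 : forall j z, cont_at (r1 j) z).
  { intros j z. apply cont_in_mult; [apply cont_in_const|apply cont_in_id]. }
  assert (c2 : forall j z, cont_at (r2 j) z).
  { intros j z. apply cont_in_mult; [apply cont_in_const|]. apply cont_in_mult; [apply cont_in_const|].
    apply (cont_in_conj _ (fun z => z)), cont_in_id. }
  assert (rc1 : forall j t, unit_interval t -> rcont unit_interval (fun t => r1 j (g t)) t)
    by (intros; apply rcont_cont_at; auto).
  assert (rc2 : forall j t, unit_interval t -> rcont unit_interval (fun t => r2 j (g t)) t)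
    by (intros; apply rcont_cont_at; auto).
  assert (modj : forall j, exists i, (i < m)%nat /\ Cpow zt j = Cpow zt i).
  { intros j. exists (j mod m)%nat. split; [apply Nat.mod_upper_bound; lia|].
    rewrite (Nat.div_mod j m) at 1 by lia. rewrite Cpow_add_r, Cpow_mult_r, hzm, Cpow_1_l. ring. }
  assert (K1 : forall j t, unit_interval t -> K (r1 j (g t))).
  { intros j t ht. destruct (modj j) as [i [hi E]]. exists i. split; auto. left. exists t.
    split; auto. unfold r1. rewrite E; auto. }
  assert (K2 : forall j t, unit_interval t -> K (r2 j (g t))).
  { intros j t ht. destruct (modj j) as [i [hi E]]. exists i. split; auto. right. exists t.
    split; auto. unfold r2. rewrite E; auto. }
  assert (Kdisk : forall z, K z -> Cmod z < 1 /\ z <> RtoC 0).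
  { intros z [j [_ [[t [ht <-]]|[t [ht <-]]]]]; destruct (hg t ht) as [h1 [h2 _]];
      apply unit_disk_Cmod in h1; (split; [rewrite ?(proj1 (md _ _)), ?(proj2 (md _ _)); auto|]);
      apply Cmod_gt_0; rewrite ?(proj1 (md _ _)), ?(proj2 (md _ _)); apply Cmod_gt_0; auto. }
  assert (cK : closed_set K).
  { apply closed_finite_union. intros j _ z hz'. apply not_or_and in hz'. destruct hz' as [h1 h2].
    destruct (path_image_closed _ (rc1 j) z h1) as [d1 [hd1 k1]].
    destruct (path_image_closed _ (rc2 j) z h2) as [d2 [hd2 k2]].
    exists (Rmin d1 d2). split; [apply Rmin_pos; auto|]. intros w hw.
    pose proof (Rmin_l d1 d2). pose proof (Rmin_r d1 d2).
    intros [h|h]; [apply (k1 w)|apply (k2 w)]; auto; lra. }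
  assert (conn : is_connected K).
  { assert (I1 : forall j, is_connected (fun z => exists t, unit_interval t /\ r1 j (g t) = z))
      by (intros j; apply rcont_image_connected; auto; apply rconvex_unit_interval).
    assert (I2 : forall j, is_connected (fun z => exists t, unit_interval t /\ r2 j (g t) = z))
      by (intros j; apply rcont_image_connected; auto; apply rconvex_unit_interval).
    (* Neighbouring copies of the path meet: [r1 j] and [r2 j] at the parameter [t0], since the
       first reflection fixes [g t0]; [r1 j] and [r2 (S j)] at [t1], since the second fixes
       [g t1]. *)
    assert (J : forall j, (forall t, unit_interval t -> component K (g t0) (r1 j (g t))) /\
       (forall t, unit_interval t -> component K (g t0) (r2 j (g t)))).
    { assert (S1 : forall j t, component K (g t0) (r1 j (g t)) -> unit_interval t ->
         forall s, unit_interval s -> component K (g t0) (r1 j (g s))).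
      { intros j t h ht s hs.
        apply (component_maximal K (g t0) (fun z => exists t, unit_interval t /\ r1 j (g t) = z) (r1 j (g t))); auto.
        - intros w [x [hx <-]]; auto.
        - exists t; auto.
        - exists s; auto. }
      assert (S2 : forall j t, component K (g t0) (r2 j (g t)) -> unit_interval t ->
         forall s, unit_interval s -> component K (g t0) (r2 j (g s))).
      { intros j t h ht s hs.
        apply (component_maximal K (g t0) (fun z => exists t, unit_interval t /\ r2 j (g t) = z) (r2 j (g t))); auto.
        - intros w [x [hx <-]]; auto.
        - exists t; auto.
        - exists s; auto. }
      assert (T : forall j, (forall t, unit_interval t -> component K (g t0) (r1 j (g t))) ->
         forall t, unit_interval t -> component K (g t0) (r2 j (g t))).
      { intros j h. apply (S2 j t0); auto.
        replace (r2 j (g t0)) with (r1 j (g t0)) by (unfold r1, r2; rewrite E0; auto). auto. }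
      induction j as [|j [IH1 IH2]].
      - assert (h : forall t, unit_interval t -> component K (g t0) (r1 O (g t))).
        { apply (S1 0%nat t0); auto.
          replace (r1 0%nat (g t0)) with (g t0) by (unfold r1; simpl; ring).
          apply component_self. replace (g t0) with (r1 0%nat (g t0)) by (unfold r1; simpl; ring). auto. }
        split; auto.
      - assert (h : forall t, unit_interval t -> component K (g t0) (r2 (S j) (g t))).
        { apply (S2 (S j) t1); auto.
          replace (r2 (S j) (g t1)) with (r1 j (g t1)); auto.
          unfold r1, r2. rewrite Cpow_S. rewrite <- E1 at 1. ring. }
        split; auto. apply (S1 (S j) t0); auto.
        replace (r1 (S j) (g t0)) with (r2 (S j) (g t0)) by (unfold r1, r2; rewrite E0; auto). auto. }
    apply connected_ext with (component K (g t0)); [|apply component_connected].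
    intros z. split; [apply component_sub|]. intros [j [_ [[t [ht <-]]|[t [ht <-]]]]]; apply J; auto. }
  assert (inv : forall z, K z -> K (zt * z)%C).
  { intros z [j [_ [[t [ht <-]]|[t [ht <-]]]]].
    - replace (zt * r1 j (g t))%C with (r1 (S j) (g t)) by (unfold r1; rewrite Cpow_S; ring). auto.
    - replace (zt * r2 j (g t))%C with (r2 (S j) (g t)) by (unfold r2; rewrite Cpow_S; ring). auto. }
  assert (nolog : ~ has_log K (RtoC 0)).
  { intros [l [cl hl]].
    assert (hl' : forall z, K z -> cexp (l z) = z) by (intros z hz'; rewrite hl by auto; ring).
    destruct (cexp_surj zt) as [k hk]; [apply Cmod_gt_0; lra|].
    set (z0 := g t0). assert (hz0 : K z0).
    { unfold z0. replace (g t0) with (r1 0%nat (g t0)) by (unfold r1; simpl; ring). auto. }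
    (* Multiplication by [zt] changes the logarithm by a constant on the connected set [K]. After
       [m] steps the point returns, so m kap = 0; hence zt z0 = z0, against zt <> 1. *)
    set (kap := (l (zt * z0) - l z0)%C).
    assert (D : forall z, K z -> (l (zt * z) = l z + kap)%C).
    { intros z hz'.
      pose proof (log_difference K (fun z => l (Cmult zt z)) (fun z => Cplus (l z) k) conn) as L.
      assert (E : (l (zt * z) - (l z + k) = l (zt * z0) - (l z0 + k))%C).
      { apply L; auto.
        - apply cont_on_intro. intros w hw. apply (cont_in_comp K K (fun w => zt * w)%C l); auto.
          + apply cont_in_mult; [apply cont_in_const|apply cont_in_id].
          + apply cont_on_in; auto.
        - apply cont_on_intro. intros w hw. apply cont_in_plus; [apply cont_on_in; auto|apply cont_in_const].
        - intros w hw. rewrite cexp_plus, hk, !hl' by auto. ring. }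
      unfold kap. replace (l (zt * z)%C) with ((l (zt * z) - (l z + k)) + (l z + k))%C by ring.
      rewrite E. ring. }
    assert (P : forall n, K (Cpow zt n * z0)%C /\ (l (Cpow zt n * z0) = l z0 + INR n * kap)%C).
    { induction n as [|n [IH1 IH2]].
      - simpl. replace (1 * z0)%C with z0 by ring. split; auto. ring.
      - rewrite Cpow_S. replace (zt * Cpow zt n * z0)%C with (zt * (Cpow zt n * z0))%C by ring.
        split; auto. rewrite D, IH2, S_INR, RtoC_plus by auto. ring. }
    destruct (P m) as [_ Pm]. rewrite hzm in Pm. replace (1 * z0)%C with z0 in Pm by ring.
    assert (kap0 : kap = RtoC 0).
    { assert (hm : RtoC (INR m) <> 0) by (intros E; apply RtoC_inj in E; apply (not_0_INR m) in E; auto; lia).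
      replace kap with ((l z0 + INR m * kap - l z0) / INR m)%C by (field; auto).
      rewrite <- Pm. field; auto. }
    assert (E : (zt * z0)%C = z0).
    { rewrite <- (hl' (zt * z0)%C), D, kap0 by auto. replace (l z0 + 0)%C with (l z0) by ring. auto. }
    apply hz1. destruct (Kdisk z0 hz0) as [_ nz].
    replace zt with (zt * z0 / z0)%C by (field; auto). rewrite E. field; auto. }
  set (N := component (fun z => ~ K z) (RtoC 0)).
  assert (N0 : N (RtoC 0)).
  { apply component_self. intros h. apply Kdisk in h. tauto. }
  assert (ND : forall z, N z -> Cmod z < 1).
  { apply enclosed_component; auto.
    - intros z h. apply Kdisk in h. lra.
    - rewrite Cmod_0; lra. }
  (* The product over the orbit: at every point of [K] one of the 2m factors has the modulus of a
     value of [f] on the path itself, hence at most [e], and the others are at most [M]. The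
     reflected factors are conjugated so as to be holomorphic. *)
  set (fac := fun j z => (f (r1 j z) * Cconj (f (r2 j z)))%C).
  assert (md2 : forall j z, Cmod z < 1 -> unit_disk (r1 j z) /\ unit_disk (r2 j z)).
  { intros j z h. rewrite !unit_disk_Cmod, (proj1 (md j z)), (proj2 (md j z)). auto. }
  assert (hfac : forall j z, Cmod z < 1 -> exists L, is_cderiv (fac j) z L).
  { intros j z h. destruct (md2 j z h) as [a1 a2]. destruct (hf _ a1) as [L1 H1].
    destruct (hf _ a2) as [L2 H2]. eexists.
    apply (cderiv_mult (fun z => f (r1 j z)) (fun z => Cconj (f (r2 j z)))).
    - apply (cderiv_comp (r1 j) f); [apply cderiv_scal|exact H1].
    - apply cderiv_ext with (fun z => Cconj ((fun w => f (Cpow zt j * (u * u) * w)%C) (Cconj z))).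
      + intros w. unfold r2. do 2 f_equal. ring.
      + apply (cderiv_conj_conj (fun w => f (Cpow zt j * (u * u) * w)%C)).
        apply (cderiv_comp (fun w => Cpow zt j * (u * u) * w)%C f); [apply cderiv_scal|].
        replace (Cpow zt j * (u * u) * Cconj z)%C with (r2 j z) by (unfold r2; ring). exact H2. }
  set (F := fun z => cprod (fun j => fac j z) m).
  assert (hF : forall z, Cmod z < 1 -> exists L, is_cderiv F z L).
  { intros z h. apply cderiv_cprod. auto. }
  assert (facM : forall j z, Cmod z < 1 -> Cmod (fac j z) <= M * M).
  { intros j z h. destruct (md2 j z h) as [a1 a2]. unfold fac. rewrite Cmod_mult, Cmod_conj.
    apply Rmult_le_compat; try apply Cmod_ge_0; auto. }
  assert (FK : forall z, K z -> Cmod (F z) <= e * M * (M * M) ^ m).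
  { intros z hz'. destruct (Kdisk z hz') as [h1 _]. apply cprod_small; auto; [nra|nra|].
    destruct hz' as [j [hj [[t [ht E]]|[t [ht E]]]]]; destruct (hg t ht) as [_ [_ ft]].
    (* The inverse rotation; the remainder brings m - 0 back into range. *)
    - exists ((m - j) mod m)%nat. split; [apply Nat.mod_upper_bound; lia|].
      assert (E2 : r1 ((m - j) mod m)%nat z = g t).
      { unfold r1. assert (E3 : Cpow zt ((m - j) mod m) = Cpow zt (m - j)).
        { rewrite (Nat.div_mod (m - j) m) at 2 by lia. rewrite Cpow_add_r, Cpow_mult_r, hzm, Cpow_1_l. ring. }
        rewrite E3, <- E. unfold r1. rewrite Cmult_assoc, <- Cpow_add_r.
        replace (m - j + j)%nat with m by lia. rewrite hzm. ring. }
      unfold fac. rewrite E2, Cmod_mult, Cmod_conj.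
      apply Rmult_le_compat; try apply Cmod_ge_0; auto. apply hM, md2; auto.
    - exists j. split; auto.
      assert (E2 : r2 j z = g t).
      { rewrite <- E. unfold r2. rewrite !Cmult_conj, Cconj_conj.
        assert (cj : forall x, Cmod x = 1 -> (x * Cconj x)%C = RtoC 1).
        { intros x hx. rewrite <- Cmod2_conj, hx. f_equal. ring. }
        replace (Cpow zt j * (u * u * (Cconj (Cpow zt j) * (Cconj u * Cconj u * g t))))%C with
          ((Cpow zt j * Cconj (Cpow zt j)) * (u * Cconj u) * (u * Cconj u) * g t)%C by ring.
        rewrite !cj by (auto; apply Cmod_pow_1; auto). ring. }
      unfold fac. rewrite E2, Cmod_mult, Cmod_conj, (Rmult_comm e).
      apply Rmult_le_compat; try apply Cmod_ge_0; auto. apply hM, md2; auto. }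
  assert (F0 : Cmod (F (RtoC 0)) = (Cmod (f (RtoC 0)) * Cmod (f (RtoC 0))) ^ m).
  { assert (E : forall j, fac j (RtoC 0) = (f (RtoC 0) * Cconj (f (RtoC 0)))%C).
    { intros j. unfold fac, r1, r2.
      replace (Cpow zt j * 0)%C with (RtoC 0) by ring.
      replace (Cpow zt j * (u * u * Cconj 0))%C with (RtoC 0); auto.
      replace (Cconj 0) with (RtoC 0) by (unfold Cconj, RtoC; simpl; f_equal; ring). ring. }
    unfold F. generalize m. intros n. induction n as [|n IH]; simpl.
    - apply Cmod_1.
    - rewrite Cmod_mult, IH, E, Cmod_mult, Cmod_conj. ring. }
  rewrite <- F0.
  apply (max_principle N F); auto.
  - apply component_open. exact cK.
  - exists 1. intros z h. rewrite Cnorm_Cmod. left. auto.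
  - intros z h. apply hF; auto.
  - intros xi hxi e' he'.
    assert (hxiK : K xi) by (apply NNPP; apply (component_boundary _ _ _ cK hxi)).
    destruct (Kdisk xi hxiK) as [d1 _]. destruct (hF xi d1) as [L hL].
    destruct (cderiv_cont _ _ _ hL e' he') as [d [hd h]]. exists d; split; auto. intros z _ hzd.
    specialize (h z I hzd). pose proof (Cmod_dist_le (F z) (F xi)) as T. apply Rabs_le_between in T.
    specialize (FK xi hxiK). lra.
Qed.

Lemma path_ivt (J : R -> Prop) (g : R -> C) a b : rconvex J -> (forall t, J t -> rcont J g t) ->
  J a -> J b -> snd (g a) <= 0 -> 0 <= snd (g b) -> exists t, J t /\ snd (g t) = 0.
Proof.
  intros hJ cg ha hb h0 h1. apply NNPP. intros n.
  assert (nz : forall t, J t -> snd (g t) <> 0) by (intros t ht E; apply n; exists t; auto).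
  assert (snd (g b) < 0); [|lra].
  apply (interval_locally_constant J (fun t => snd (g t) < 0) hJ) with a; auto.
  - intros t ht. specialize (nz t ht).
    destruct (cg t ht (Rabs (snd (g t)))) as [d [hd h]]; [apply Rabs_pos_lt; auto|].
    exists d; split; auto. intros s s' hs hs' k1 k2.
    specialize (h s hs k1) as e1. specialize (h s' hs' k2) as e2.
    pose proof (Cdist_snd (g s) (g t)) as T1. pose proof (Cdist_snd (g s') (g t)) as T2.
    apply Rabs_le_between in T1, T2. unfold Rabs in *. destruct (Rcase_abs (snd (g t))); lra.
  - specialize (nz a ha). lra.
Qed.

Lemma unit_conj (x : C) : Cmod x = 1 -> (x * Cconj x)%C = RtoC 1.
Proof. intros hx. rewrite <- Cmod2_conj, hx. f_equal. ring. Qed.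

Lemma Cpow_cexp z n : Cpow (cexp z) n = cexp (INR n * z)%C.
Proof.
  induction n as [|n IH].
  - simpl. rewrite <- cexp_0. f_equal. ring.
  - rewrite Cpow_S, IH, <- cexp_plus. f_equal. rewrite S_INR, RtoC_plus. ring.
Qed.

(** The angle is an exact fraction PI / m because the rotation by twice the angle must have finite
    order. From m = 3 on the cosine is at least 1/2, and PI / m <= k / 2 bounds the sine. *)
Lemma small_angle k : 0 < k -> exists m, (0 < m)%nat /\ 0 < PI / INR m < PI / 2 /\
  sin (PI / INR m) <= k * cos (PI / INR m).
Proof.
  intros hk. pose proof PI_RGT_0 as hpi.
  destruct (INR_unbounded (2 * PI / k + 3)) as [m hm].
  assert (hk2 : 0 < 2 * PI / k) by (apply Rdiv_lt_0_compat; lra).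
  assert (hm0 : 0 < INR m) by lra.
  exists m. split; [apply INR_lt; simpl; lra|].
  assert (p0 : 0 < PI / INR m) by (apply Rdiv_lt_0_compat; auto).
  assert (E : PI / INR m * INR m = PI) by (field; lra).
  assert (h3 : PI / INR m <= PI / 3) by nra.
  assert (hk3 : PI / INR m <= k / 2).
  { assert (2 * PI / k * k = 2 * PI) by (field; lra).
    apply Rmult_le_reg_r with (INR m); auto. rewrite E. nra. }
  assert (c : 1 / 2 <= cos (PI / INR m)).
  { rewrite <- cos_PI3. apply cos_decr_1; lra. }
  assert (s : sin (PI / INR m) < PI / INR m) by (apply sin_lt_x; auto).
  split; [lra|]. nra.
Qed.

Lemma compact_lower_bound (K : C -> Prop) (f : C -> C) B : closed_set K ->
  (forall z, K z -> Cmod z <= B) -> (forall z, K z -> cont_in K f z) ->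
  (forall z, K z -> f z <> RtoC 0) -> exists m, 0 < m /\ forall z, K z -> m <= Cmod (f z).
Proof.
  intros cK hB cf nz. apply NNPP. intros n.
  assert (W : forall k : nat, exists z, K z /\ Cmod (f z) < / INR (k + 1)).
  { intros k. apply NNPP. intros n'. apply n. exists (/ INR (k + 1)).
    split; [apply Rinv_0_lt_compat, lt_0_INR; lia|]. intros z hz. apply Rnot_lt_le. intros h.
    apply n'. exists z; auto. }
  set (w := fun k => epsilon (inhabits (RtoC 0)) (fun z => K z /\ Cmod (f z) < / INR (k + 1))).
  assert (hw : forall k, K (w k) /\ Cmod (f (w k)) < / INR (k + 1))
    by (intros k; apply (epsilon_spec (inhabits (RtoC 0)) _ (W k))).
  destruct (bolzano_weierstrass w B) as [z hz]; [intros; apply hB, hw|].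
  assert (Kz : K z).
  { apply closed_closure; auto. intros e he. destruct (hz e O he) as [k [_ hk]].
    exists (w k). split; auto. apply hw. }
  assert (hp : 0 < Cmod (f z)) by (apply Cmod_gt_0, nz; auto).
  destruct (cf z Kz (Cmod (f z) / 2)) as [d [hd h]]; [lra|].
  destruct (archimed_cor1 (Cmod (f z) / 2)) as [N [hN hN0]]; [lra|].
  destruct (hz d N hd) as [k [hk1 hk2]]. destruct (hw k) as [h1 h2].
  specialize (h (w k) h1 hk2). pose proof (Cmod_dist_le (f (w k)) (f z)) as T. apply Rabs_le_between in T.
  assert (/ INR (k + 1) <= / INR N) by (apply Rinv_le_contravar; [apply lt_0_INR; lia|apply le_INR; lia]).
  lra.
Qed.

Lemma closed_ball_closed c r : closed_set (fun z => Cdist z c <= r).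
Proof.
  apply closure_closed. intros z hz. apply le_epsilon. intros e he.
  destruct (hz e he) as [w [h1 hw]]. pose proof (Cdist_tri z w c). rewrite (Cdist_sym z w) in *. lra.
Qed.

Lemma zero_free_lower_bound (f : C -> C) rho : (forall z, unit_disk z -> cont_at f z) ->
  (forall z, unit_disk z -> f z <> RtoC 0) -> rho < 1 ->
  exists m, 0 < m /\ forall z, Cmod z <= rho -> m <= Cmod (f z).
Proof.
  intros cf nz hr.
  assert (D : forall z, Cdist z (RtoC 0) <= rho -> unit_disk z) by (intros z hz; apply unit_disk_ball; lra).
  destruct (compact_lower_bound (fun z => Cdist z (RtoC 0) <= rho) f (rho + Cmod (RtoC 0))) as [m [hm k]].
  - apply closed_ball_closed.
  - intros z hz. pose proof (Cmod_dist_le z (RtoC 0)) as T. apply Rabs_le_between in T. lra.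
  - intros z hz. apply cont_at_in. auto.
  - auto.
  - exists m. split; auto. intros z hz. apply k. rewrite Cdist_Cmod. replace (z - 0)%C with z by ring. auto.
Qed.

(** A path on which |f| is small lies near the circle, because [f] is bounded below on smaller
    disks. If its ends are far apart, it crosses the line that makes a fixed small angle PI / m with
    the radius through [g 0]. The reflections in these two lines then have fixed points on the path,
    and [koebe_dihedral] bounds |f 0| by a quantity that vanishes with [eps]. *)
Lemma koebe (f : C -> C) M : holomorphic_on unit_disk f ->
  (forall z, unit_disk z -> Cmod (f z) <= M) -> (forall z, unit_disk z -> f z <> RtoC 0) ->
  forall eta, 0 < eta -> exists eps, 0 < eps /\ forall g : R -> C,
    (forall t, unit_interval t -> rcont unit_interval g t) ->
    (forall t, unit_interval t -> unit_disk (g t) /\ Cmod (f (g t)) < eps) ->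
    Cdist (g 0) (g 1) < eta.
Proof.
  intros hf hM0 nz eta0 heta0.
  set (M1 := Rmax M 1). assert (hM1 : 1 <= M1) by apply Rmax_r.
  assert (hM : forall z, unit_disk z -> Cmod (f z) <= M1).
  { intros z hz. eapply Rle_trans; [apply hM0; auto|apply Rmax_l]. }
  set (eta := Rmin eta0 1). assert (heta : 0 < eta) by (apply Rmin_pos; lra).
  assert (heta1 : eta <= 1) by apply Rmin_r. assert (heta2 : eta <= eta0) by apply Rmin_l.
  clearbody eta M1.
  destruct (small_angle (eta / 4)) as [m [hm0 [hth hsc]]]; [lra|].
  set (th := PI / INR m) in *.
  assert (cf : forall z, unit_disk z -> cont_at f z).
  { intros z hz. destruct (hf z hz) as [L hL]. eapply cderiv_cont. exact hL. }
  destruct (zero_free_lower_bound f (1 - eta / 8) cf nz) as [mu [hmu hmu']]; [lra|].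
  assert (d0 : unit_disk (RtoC 0)) by (apply unit_disk_Cmod; rewrite Cmod_0; lra).
  set (A := Cmod (f (RtoC 0))). assert (hA : 0 < A) by (apply Cmod_gt_0; auto).
  set (B := M1 * (M1 * M1) ^ m). assert (hB : 0 < B).
  { apply Rmult_lt_0_compat; [lra|]. apply pow_lt. nra. }
  assert (hAm : 0 < (A * A) ^ m) by (apply pow_lt; nra).
  (* Half of the threshold of [koebe_dihedral], whose inequality then reads (A A)^m <= (A A)^m /
     2. *)
  set (e1 := (A * A) ^ m / (2 * B)).
  assert (he1 : 0 < e1) by (apply Rdiv_lt_0_compat; lra).
  exists (Rmin mu e1). split; [apply Rmin_pos; auto|]. intros g cg hg.
  pose proof (Rmin_l mu e1). pose proof (Rmin_r mu e1).
  apply Rlt_le_trans with eta; auto. apply Rnot_le_lt. intros hle.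
  assert (big : forall t, unit_interval t -> 1 - eta / 8 < Cmod (g t) < 1).
  { intros t ht. destruct (hg t ht) as [h1 h2]. apply unit_disk_Cmod in h1. split; auto.
    apply Rnot_le_lt. intros h. specialize (hmu' _ h). lra. }
  assert (i0 : unit_interval 0) by (unfold unit_interval; lra).
  assert (i1 : unit_interval 1) by (unfold unit_interval; lra).
  set (a := Cmod (g 0)). pose proof (big 0 i0) as ha. fold a in ha.
  set (u := (g 0 / a)%C).
  assert (a0 : RtoC a <> 0) by (intros E; apply RtoC_inj in E; lra).
  assert (hu : Cmod u = 1).
  { unfold u. rewrite Cmod_div by auto. rewrite Cmod_R, Rabs_right by lra. fold a. field. lra. }
  assert (gu : g 0 = (a * u)%C) by (unfold u; field; auto).
  pose proof (unit_conj u hu) as uu.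
  (* Coordinates are rotated so that [g 0] becomes the positive real [a] and [g 1] becomes [b]. *)
  set (b := (g 1 * Cconj u)%C).
  assert (gb : g 1 = (b * u)%C).
  { unfold b. transitivity (g 1 * (u * Cconj u))%C; [rewrite uu; ring|ring]. }
  assert (mb : Cmod b = Cmod (g 1)) by (unfold b; rewrite Cmod_mult, Cmod_conj, hu; ring).
  pose proof (big 1 i1) as hb. rewrite <- mb in hb.
  clearbody b u.
  assert (dist : eta * eta <= (fst b - a) * (fst b - a) + snd b * snd b).
  { assert (E : Cdist (g 0) (g 1) = Cmod (b - a)%C).
    { rewrite Cdist_sym, Cdist_Cmod, gu, gb. replace (b * u - a * u)%C with ((b - a) * u)%C by ring.
      rewrite Cmod_mult, hu. ring. }
    rewrite E in hle. pose proof (Cmod_sq (b - a)%C) as E2.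
    set (q := Cmod (b - a)%C) in *. clearbody q.
    unfold Cminus, Cplus, Copp, RtoC in E2; simpl in E2.
    replace (fst b - a) with (fst b + - a) by ring.
    replace (snd b * snd b) with ((snd b + - 0) * (snd b + - 0)) by ring. rewrite <- E2.
    apply Rmult_le_compat; lra. }
  (* the sign of the rotation that turns the direction of g 0 towards g 1 *)
  assert (exists s, (s = 1 \/ s = -1) /\ 0 <= s * snd b) as [s [hs hsb]].
  { destruct (Rle_lt_dec 0 (snd b)); [exists 1|exists (-1)]; split; auto; lra. }
  set (om := cexp (0, s * th)).
  assert (ss : s * s = 1) by (destruct hs as [-> | ->]; ring).
  assert (hom : Cmod om = 1) by (unfold om; rewrite Cmod_cexp; apply exp_0).
  assert (omE : om = (cos th, s * sin th)).
  { unfold om, cexp; simpl. rewrite exp_0. destruct hs as [-> | ->].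
    - rewrite !Rmult_1_l. auto.
    - replace (-1 * th) with (- th) by ring. rewrite cos_neg, sin_neg. f_equal; ring. }
  pose proof (unit_conj om hom) as oo.
  assert (cth : 0 < cos th) by (apply cos_gt_0; lra).
  assert (sth : 0 < sin th) by (apply sin_gt_0; lra).
  assert (cross : exists t, unit_interval t /\ snd (s * (g t * Cconj (u * om)))%C = 0).
  { apply (path_ivt unit_interval (fun t => s * (g t * Cconj (u * om)))%C 0 1); auto.
    - apply rconvex_unit_interval.
    - intros t ht. apply (rcont_cont_at g unit_interval (fun z => s * (z * Cconj (u * om)))%C); auto.
      apply cont_in_mult; [apply cont_in_const|]. apply cont_in_mult; [apply cont_in_id|apply cont_in_const].
    - rewrite gu, Cmult_conj. replace (s * (a * u * (Cconj u * Cconj om)))%C with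
        (s * (a * ((u * Cconj u) * Cconj om)))%C by ring. rewrite uu, omE.
      unfold Cconj, Cmult, RtoC; simpl. destruct hs as [-> | ->]; nra.
    - rewrite gb, Cmult_conj. replace (s * (b * u * (Cconj u * Cconj om)))%C with
        (s * (b * ((u * Cconj u) * Cconj om)))%C by ring. rewrite uu, omE.
      unfold Cconj, Cmult, RtoC; simpl.
      (* [b] lies beyond the line of angle [th]: otherwise its imaginary part would be at most eta /
         4 in size, and with both moduli above 1 - eta / 8 this would give |b - a| < eta. *)
      assert (G : 0 <= s * snd b * cos th - fst b * sin th).
      { destruct (Rle_lt_dec (fst b) 0) as [hx|hx]; [nra|].
        apply Rnot_lt_le. intros hlt.
        set (y := s * snd b) in *.
        assert (y2 : y * y = snd b * snd b) by (unfold y; nra).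
        pose proof (Cmod_sq b) as Eb.
        assert (hx1 : fst b < 1) by nra.
        assert (yk : y <= eta / 4).
        { apply Rmult_le_reg_r with (cos th); auto. nra. }
        assert (x2 : (1 - eta / 8) * (1 - eta / 8) - eta / 4 * (eta / 4) <= fst b * fst b) by nra.
        assert (xb : 1 - eta / 2 <= fst b) by nra.
        assert (- (eta / 2) <= fst b - a <= eta / 2) by lra. nra. }
      match goal with |- 0 <= ?e => replace e with (s * snd b * cos th - (s * s) * (fst b * sin th)) by ring end.
      rewrite ss. lra. }
  destruct cross as [t1 [ht1 E1]].
  (* The composite of the reflections in two lines at angle [th] is, up to the sign [s], the
     rotation by 2 th = 2 PI / m, whose m-th power is 1. *)
  set (zt := (om * om)%C).
  assert (key : (A * A) ^ m <= e1 * M1 * (M1 * M1) ^ m).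
  { apply (koebe_dihedral f M1 e1 m zt u g); auto; try lra.
    - unfold zt. rewrite Cmod_mult, hom. ring.
    - unfold zt, om. rewrite <- cexp_plus, Cpow_cexp.
      rewrite <- cexp_0. destruct hs as [-> | ->].
      + rewrite <- (cexp_2PI 1 (RtoC 0)). f_equal. unfold Cplus, Cmult, RtoC, th; simpl. f_equal; field;
        apply not_0_INR; lia.
      + rewrite <- (cexp_2PI (-1) (RtoC 0)). f_equal. unfold Cplus, Cmult, RtoC, th; simpl. f_equal; field;
        apply not_0_INR; lia.
    - unfold zt. rewrite omE. intros E. injection E as h1 h2.
      assert (s * (cos th * sin th) = 0) by lra.
      assert (0 < cos th * sin th) by (apply Rmult_lt_0_compat; auto).
      destruct hs as [-> | ->]; lra.
    - intros t ht. destruct (hg t ht) as [h1 h2]. repeat split; auto.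
      + apply Cmod_gt_0. pose proof (big t ht). lra.
      + lra.
    - exists 0. split; auto. rewrite gu, Cmult_conj.
      replace (Cconj a) with (RtoC a) by (unfold Cconj, RtoC; simpl; f_equal; ring).
      replace (u * u * (a * Cconj u))%C with ((u * Cconj u) * (a * u))%C by ring. rewrite uu. ring.
    - exists t1. split; auto.
      set (x := (g t1 * Cconj (u * om))%C).
      assert (gx : g t1 = (x * (u * om))%C).
      { unfold x. rewrite Cmult_conj.
        transitivity (g t1 * (u * Cconj u) * (om * Cconj om))%C; [rewrite uu, oo; ring|ring]. }
      assert (xr : Cconj x = x).
      { assert (snd x = 0).
        { assert (E2 : s * snd x = 0).
          { rewrite <- E1. fold x. unfold Cmult, RtoC; simpl. ring. }
          destruct hs as [-> | ->]; lra. }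
        destruct x as [x1 x2]; simpl in *. subst. unfold Cconj; simpl. f_equal; ring. }
      rewrite gx, !Cmult_conj, xr. unfold zt.
      replace (om * om * (u * u * (x * (Cconj u * Cconj om))))%C with
        ((u * Cconj u) * (om * Cconj om) * (x * (u * om)))%C by ring.
      rewrite uu, oo. ring. }
  assert (e1 * M1 * (M1 * M1) ^ m = (A * A) ^ m / 2).
  { rewrite Rmult_assoc. fold B. unfold e1. field. lra. }
  lra.
Qed.

(** * Lindelof's theorem *)

Lemma cexp_conj z : cexp (Cconj z) = Cconj (cexp z).
Proof. unfold cexp, Cconj; simpl. rewrite cos_neg, sin_neg. f_equal; ring. Qed.

Lemma mult_le_contract p q x : 0 <= p <= q -> 0 <= x <= 1 -> p * x <= q.
Proof. intros h1 h2. nra. Qed.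

Lemma closed_union K L : closed_set K -> closed_set L -> closed_set (fun z => K z \/ L z).
Proof.
  intros hK hL z hz. apply not_or_and in hz. destruct hz as [h1 h2].
  destruct (hK z h1) as [d1 [hd1 k1]]. destruct (hL z h2) as [d2 [hd2 k2]].
  exists (Rmin d1 d2). split; [apply Rmin_pos; auto|]. intros w hw.
  pose proof (Rmin_l d1 d2). pose proof (Rmin_r d1 d2).
  intros [h|h]; [apply (k1 w)|apply (k2 w)]; auto; lra.
Qed.

(** The cut that joins the start of a path ending at 1 to the start of its mirror image, and so
    closes the two into a set enclosing the end of the radius. *)
Definition lens_arc (d : R) (z : C) : Prop := Cdist z (RtoC 1) = d /\ Cmod z <= 1.

Lemma lens_arc_closed d : closed_set (lens_arc d).
Proof.
  apply closure_closed. intros z hz. split.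
  - apply cond_eq. intros e he. destruct (hz e he) as [w [[h1 _] hw]].
    pose proof (Cdist_tri z w (RtoC 1)). pose proof (Cdist_tri w z (RtoC 1)).
    rewrite (Cdist_sym z w) in *. apply Rabs_lt_between. lra.
  - apply le_epsilon. intros e he. destruct (hz e he) as [w [[_ h1] hw]].
    pose proof (Cmod_dist_le w z) as T. apply Rabs_le_between in T. lra.
Qed.

(** The parameter is the sine of the angle at 1; lying in the closed disk amounts to a cosine of at
    least d / 2. *)
Lemma lens_arc_connected d : 0 < d -> is_connected (lens_arc d).
Proof.
  intros hd. set (J := fun y => y * y <= 1 - d * d / 4).
  set (g := fun y => (1 - d * sqrt (1 - y * y), d * y) : C).
  apply connected_ext with (fun z => exists y, J y /\ g y = z).
  - intros z. split.
    + intros [y [hy <-]]. unfold J in hy. pose proof (sqrt_sqrt (1 - y * y)) as S.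
      pose proof (sqrt_pos (1 - y * y)). specialize (S ltac:(nra)).
      set (s := sqrt (1 - y * y)) in *.
      assert (hs : d / 2 <= s) by nra.
      split.
      * rewrite Cdist_Cmod. apply Rsqr_inj; [apply Cmod_ge_0|lra|]. unfold Rsqr. rewrite Cmod_sq.
        unfold g, Cminus, Cplus, Copp, RtoC; simpl. fold s. nra.
      * apply Rsqr_incr_0_var; [|lra]. unfold Rsqr. rewrite Cmod_sq. unfold g; simpl. fold s. nra.
    + intros [h1 h2]. exists (snd z / d). rewrite Cdist_Cmod in h1.
      pose proof (Cmod_sq (z - 1)%C) as E1. pose proof (Cmod_sq z) as E2. rewrite h1 in E1.
      unfold Cminus, Cplus, Copp, RtoC in E1; simpl in E1. pose proof (Cmod_ge_0 z).
      assert (Ex : d * d / 2 <= 1 - fst z) by nra.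
      assert (Ey : snd z / d * (snd z / d) = 1 - ((1 - fst z) / d) * ((1 - fst z) / d)).
      { apply Rmult_eq_reg_r with (d * d); [|nra]. field_simplify; [|lra|lra]. nra. }
      split.
      * unfold J. rewrite Ey.
        assert (d / 2 <= (1 - fst z) / d).
        { apply Rmult_le_reg_r with d; auto. unfold Rdiv at 2. rewrite Rmult_assoc, Rinv_l by lra. lra. }
        nra.
      * unfold g. rewrite Ey.
        replace (1 - (1 - (1 - fst z) / d * ((1 - fst z) / d))) with ((1 - fst z) / d * ((1 - fst z) / d)) by ring.
        rewrite sqrt_square.
        -- destruct z as [x y]; simpl. f_equal; field; lra.
        -- apply Rmult_le_pos; [nra|left; apply Rinv_0_lt_compat; auto].
  - apply rcont_image_connected.
    + intros a b t ha hb ht. unfold J in *. destruct (Rle_dec 0 t); nra.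
    + intros y hy. unfold J in hy. unfold g.
      apply (rcont_of_cont J (fun z => J (fst z)) (fun z => (1 - d * sqrt (1 - fst z * fst z), d * fst z)));
        [auto|].
      assert (cf : forall A z, cont_in A (fun w => RtoC (fst w)) z)
        by (intros; apply (cont_in_fst _ (fun z => z)), cont_in_id).
      apply (cont_in_pair _ (fun z => 1 - d * sqrt (1 - fst z * fst z)) (fun z => d * fst z)).
      * apply (cont_in_real _ (fun x => 1 - d * sqrt (1 - x * x)) fst); auto. simpl.
        apply continuity_pt_minus; [apply continuity_pt_const; intros ? ?; auto|].
        apply continuity_pt_mult; [apply continuity_pt_const; intros ? ?; auto|].
        apply (continuity_pt_comp (fun x => 1 - x * x) sqrt).
        -- apply continuity_pt_minus; [apply continuity_pt_const; intros ? ?; auto|].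
           apply continuity_pt_mult; apply derivable_continuous_pt, derivable_pt_id.
        -- apply continuity_pt_sqrt. nra.
      * apply (cont_in_Rmult _ (fun _ => d) fst); auto. apply cont_in_const.
Qed.

(** The path from [g 0] to 1, its mirror image in the real axis and the lens arc through [g 0]
    enclose [x]. The product (f z - a) conj(f(conj z) - a) exp(k (z - 1)) is at most e M on the path
    and its image, where one of the first two factors is at most e, and satisfies the same bound at
    the lens arc, where Re z <= 1 - d^2 / 2 and the exponential pays for M^2. The point 1 is the
    exceptional point. *)
Lemma lindelof_core (f : C -> C) a M e k (g : R -> C) x :
  holomorphic_on unit_disk f -> (forall z, unit_disk z -> Cmod (f z - a)%C <= M) -> 0 < e -> 0 < M ->
  (forall t, unit_interval t -> rcont unit_interval g t) -> g 1 = RtoC 1 ->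
  (forall t, 0 <= t < 1 -> unit_disk (g t) /\ snd (g t) <> 0 /\ Cmod (f (g t) - a)%C <= e) ->
  0 <= k -> M * M * exp (- (k * (Cdist (g 0) (RtoC 1) * Cdist (g 0) (RtoC 1) / 2))) <= e * M ->
  1 - Cdist (g 0) (RtoC 1) < x < 1 -> Cmod (RtoC x) < 1 ->
  Cmod (f x - a)%C * Cmod (f x - a)%C <= e * M * exp (k * (1 - x)).
Proof.
  intros hf hM he hM0 cg g1 hg hk hkd hx hxD.
  set (d := Cdist (g 0) (RtoC 1)) in *.
  assert (hd : 0 < d) by lra.
  set (gc := fun t => Cconj (g t)).
  assert (cgc : forall t, unit_interval t -> rcont unit_interval gc t).
  { intros t ht. apply (rcont_cont_at g unit_interval Cconj); auto.
    apply (cont_in_conj _ (fun z => z)), cont_in_id. }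
  set (K1 := fun z => exists t, unit_interval t /\ g t = z).
  set (K2 := fun z => exists t, unit_interval t /\ gc t = z).
  set (K := fun z => (K1 z \/ K2 z) \/ lens_arc d z).
  assert (i0 : unit_interval 0) by (unfold unit_interval; lra).
  assert (i1 : unit_interval 1) by (unfold unit_interval; lra).
  assert (cK : closed_set K).
  { apply closed_union; [apply closed_union|apply lens_arc_closed]; apply path_image_closed; auto. }
  assert (c1 : Cconj (RtoC 1) = RtoC 1) by (unfold Cconj, RtoC; simpl; f_equal; ring).
  assert (gc1 : gc 1 = RtoC 1) by (unfold gc; rewrite g1; auto).
  assert (closedD : forall t, unit_interval t -> Cmod (g t) <= 1).
  { intros t ht. destruct (Req_dec t 1) as [->|n]; [rewrite g1, Cmod_1; lra|].
    destruct (hg t) as [h _]; [unfold unit_interval in ht; lra|]. apply unit_disk_Cmod in h. lra. }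
  assert (cl : forall z, Cdist (Cconj z) (RtoC 1) = Cdist z (RtoC 1)).
  { intros z. rewrite !Cdist_Cmod, <- c1, <- Cminus_conj, Cmod_conj, c1. auto. }
  assert (A0 : lens_arc d (g 0)) by (split; auto).
  assert (Kconn : is_connected K).
  { apply connected_union with (g 0).
    - apply connected_union with (RtoC 1).
      + apply rcont_image_connected; auto; apply rconvex_unit_interval.
      + apply rcont_image_connected; auto; apply rconvex_unit_interval.
      + exists 1; auto.
      + exists 1; auto.
    - apply lens_arc_connected; auto.
    - left. exists 0; auto.
    - auto. }
  assert (Ksym : forall z, K z -> K (Cconj z)).
  { intros z [[[t [ht E]]|[t [ht E]]]|[h1 h2]].
    - left; right. exists t. split; auto. unfold gc. rewrite E; auto.
    - left; left. exists t. split; auto. rewrite <- E. unfold gc. rewrite Cconj_conj; auto.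
    - right. split; [rewrite cl; auto|rewrite Cmod_conj; auto]. }
  assert (Kdisk : forall z, K z -> Cmod z <= 1).
  { intros z [[[t [ht <-]]|[t [ht <-]]]|[h1 h2]]; auto. unfold gc. rewrite Cmod_conj; auto. }
  assert (Kone : K (RtoC 1)) by (left; left; exists 1; auto).
  assert (d2 : d < 2).
  { pose proof (Cdist_tri (g 0) (RtoC 0) (RtoC 1)) as T. fold d in T.
    destruct (hg 0) as [h _]; [lra|]. apply unit_disk_ball in h.
    assert (Cdist (RtoC 0) (RtoC 1) = 1).
    { rewrite Cdist_Cmod, <- RtoC_minus, Cmod_R. rewrite Rabs_left; lra. }
    lra. }
  assert (Kneg : K (RtoC (1 - d))).
  { right. split.
    - rewrite Cdist_Cmod, <- RtoC_minus, Cmod_R. replace (1 - d - 1) with (- d) by ring.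
      rewrite Rabs_Ropp, Rabs_right; lra.
    - rewrite Cmod_R. apply Rabs_le. lra. }
  assert (nx : ~ K (RtoC x)).
  { assert (Q : forall t, unit_interval t -> snd (g t) = 0 -> g t = RtoC 1).
    { intros t ht E. destruct (Req_dec t 1) as [->|n]; auto.
      destruct (hg t) as [_ [h _]]; [unfold unit_interval in ht; lra|]. tauto. }
    intros [[[t [ht E]]|[t [ht E]]]|[h1 h2]].
    - assert (g t = RtoC 1) by (apply Q; auto; rewrite E; auto). rewrite E in H. apply RtoC_inj in H. lra.
    - unfold gc in E. assert (E2 : g t = RtoC x).
      { rewrite <- (Cconj_conj (g t)), E. unfold Cconj, RtoC; simpl. f_equal; ring. }
      assert (g t = RtoC 1) by (apply Q; auto; rewrite E2; auto). rewrite E2 in H. apply RtoC_inj in H. lra.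
    - rewrite Cdist_Cmod, <- RtoC_minus, Cmod_R, Rabs_left in h1; lra. }
  (* On the symmetric connected set the difference of l(conj z) and conj(l z) is constant, so [l]
     has the same imaginary part at the real points 1 and 1 - d. But 1 - x and 1 - d - x have
     opposite signs. *)
  assert (nolog : ~ has_log K (RtoC x)).
  { intros [l [cl' hl]].
    assert (E : (l (Cconj (RtoC 1)) - Cconj (l (RtoC 1)) =
                 l (Cconj (RtoC (1 - d))) - Cconj (l (RtoC (1 - d))))%C).
    { apply (log_difference K (fun z => l (Cconj z)) (fun z => Cconj (l z))); auto.
      - apply cont_on_intro. intros z hz. apply (cont_in_comp K K Cconj l); auto.
        + apply (cont_in_conj _ (fun z => z)), cont_in_id.
        + apply cont_on_in; auto.
      - apply cont_on_intro. intros z hz. apply cont_in_conj. apply cont_on_in; auto.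
      - intros z hz. rewrite cexp_conj, !hl, Cminus_conj by auto.
        f_equal. f_equal. unfold Cconj, RtoC; simpl. f_equal; ring. }
    assert (cd : forall r : R, Cconj (RtoC r) = RtoC r) by (intros; unfold Cconj, RtoC; simpl; f_equal; ring).
    rewrite !cd in E. pose proof (hl _ Kone) as H1. pose proof (hl _ Kneg) as H2.
    set (y1 := l (RtoC 1)) in *. set (y2 := l (RtoC (1 - d))) in *. clearbody y1 y2.
    destruct y1 as [a1 b1], y2 as [a2 b2]. unfold Cminus, Cplus, Copp, Cconj in E; simpl in E.
    injection E as _ Eb. assert (b1 = b2) by lra. subst b2.
    unfold cexp, Cminus, Cplus, Copp, RtoC in H1, H2; simpl in H1, H2.
    injection H1 as H1 _. injection H2 as H2 _.
    pose proof (exp_pos a1). pose proof (exp_pos a2).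
    assert (0 < cos b1) by (apply Rmult_lt_reg_l with (exp a1); auto; lra).
    assert (0 < exp a2 * cos b1) by (apply Rmult_lt_0_compat; auto). lra. }
  set (N := component (fun z => ~ K z) (RtoC x)).
  assert (ND : forall z, N z -> Cmod z < 1) by (apply enclosed_component; auto).
  assert (Nx : N (RtoC x)) by (apply component_self; auto).
  set (F := fun z => ((f z - a) * Cconj (f (Cconj z) - a) * cexp (k * (z - 1)))%C).
  assert (hF : forall z, Cmod z < 1 -> exists L, is_cderiv F z L).
  { intros z hz.
    assert (u1 : unit_disk z) by (apply unit_disk_Cmod; auto).
    assert (u2 : unit_disk (Cconj z)) by (apply unit_disk_Cmod; rewrite Cmod_conj; auto).
    destruct (hf _ u1) as [L1 H1]. destruct (hf _ u2) as [L2 H2]. eexists.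
    apply (cderiv_mult (fun z => (f z - a) * Cconj (f (Cconj z) - a))%C (fun z => cexp (k * (z - 1))%C)).
    - apply (cderiv_mult (fun z => f z - a)%C (fun z => Cconj (f (Cconj z) - a))).
      + apply (cderiv_plus f (fun _ => (- a)%C)); [exact H1|apply cderiv_const].
      + apply (cderiv_conj_conj (fun w => f w - a)%C).
        apply (cderiv_plus f (fun _ => (- a)%C)); [exact H2|apply cderiv_const].
    - apply (cderiv_comp (fun z => k * (z - 1))%C cexp); [|apply cderiv_cexp].
      apply (cderiv_mult (fun _ => RtoC k) (fun z => z - 1)%C); [apply cderiv_const|].
      apply (cderiv_plus (fun z => z) (fun _ => (- RtoC 1)%C)); [apply cderiv_id|apply cderiv_const]. }
  assert (FE : forall z, Cmod (F z) = Cmod (f z - a)%C * Cmod (f (Cconj z) - a)%C * exp (k * (fst z - 1))).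
  { intros z. unfold F. rewrite !Cmod_mult, Cmod_conj, Cmod_cexp. do 2 f_equal.
    unfold Cmult, Cminus, Cplus, Copp, RtoC; simpl. ring. }
  assert (bnd : forall z, Cmod z < 1 -> Cmod (f z - a)%C * Cmod (f (Cconj z) - a)%C <= M * M).
  { intros z hz. apply Rmult_le_compat; try apply Cmod_ge_0; apply hM; apply unit_disk_Cmod; auto.
    rewrite Cmod_conj; auto. }
  assert (ex1 : forall z, Cmod z <= 1 -> exp (k * (fst z - 1)) <= 1).
  { intros z hz. pose proof (Cmod_fst z) as T. apply Rabs_le_between in T.
    apply Rle_trans with (exp 0); [|rewrite exp_0; lra].
    destruct (Req_dec (k * (fst z - 1)) 0) as [->|n]; [lra|]. left. apply exp_increasing. nra. }
  assert (main : Cmod (F (RtoC x)) <= e * M).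
  { apply (max_principle_except N F (e * M) (M * M) (RtoC 1)); auto.
    - nra.
    - apply component_open. exact cK.
    - exists 1. intros z h. rewrite Cnorm_Cmod. left; auto.
    - intros z h. apply hF; auto.
    - intros h. apply (component_sub _ _ _ h). auto.
    - intros z h. rewrite FE. pose proof (bnd z (ND z h)).
      pose proof (ex1 z (Rlt_le _ _ (ND z h))). pose proof (exp_pos (k * (fst z - 1))).
      assert (0 <= Cmod (f z - a) * Cmod (f (Cconj z) - a))%C by (apply Rmult_le_pos; apply Cmod_ge_0).
      apply mult_le_contract; lra.
    - intros xi hxi hne e' he'.
      assert (hxiK : K xi) by (apply NNPP; apply (component_boundary _ _ _ cK hxi)).
      assert (inner : Cmod xi < 1 -> Cmod (F xi) <= e * M -> exists d0, 0 < d0 /\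
         forall z, N z -> Cdist z xi < d0 -> Cmod (F z) <= e * M + e').
      { intros h1 h2. destruct (hF xi h1) as [L hL].
        destruct (cderiv_cont _ _ _ hL e' he') as [d0 [hd0 h]]. exists d0; split; auto. intros z _ hzd.
        specialize (h z I hzd). pose proof (Cmod_dist_le (F z) (F xi)) as T. apply Rabs_le_between in T. lra. }
      destruct hxiK as [[[t [ht E]]|[t [ht E]]]|[h1 h2]].
      + assert (t <> 1) by (intros ->; apply hne; rewrite <- E; auto).
        unfold unit_interval in ht. destruct (hg t) as [q1 [q2 q3]]; [lra|]. rewrite E in *.
        apply unit_disk_Cmod in q1. apply inner; auto. rewrite FE.
        assert (Cmod (f (Cconj xi) - a)%C <= M) by (apply hM, unit_disk_Cmod; rewrite Cmod_conj; auto).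
        pose proof (ex1 xi (Rlt_le _ _ q1)). pose proof (exp_pos (k * (fst xi - 1))).
        assert (Cmod (f xi - a) * Cmod (f (Cconj xi) - a) <= e * M)%C by (apply Rmult_le_compat; auto; apply Cmod_ge_0).
        assert (0 <= Cmod (f xi - a) * Cmod (f (Cconj xi) - a))%C by (apply Rmult_le_pos; apply Cmod_ge_0).
        apply mult_le_contract; lra.
      + assert (t <> 1) by (intros ->; apply hne; rewrite <- E; auto).
        unfold unit_interval in ht. destruct (hg t) as [q1 [q2 q3]]; [lra|].
        assert (E2 : g t = Cconj xi) by (rewrite <- E; unfold gc; rewrite Cconj_conj; auto).
        rewrite E2 in *. apply unit_disk_Cmod in q1. rewrite Cmod_conj in q1. apply inner; auto. rewrite FE.
        assert (Cmod (f xi - a)%C <= M) by (apply hM, unit_disk_Cmod; auto).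
        pose proof (ex1 xi (Rlt_le _ _ q1)). pose proof (exp_pos (k * (fst xi - 1))).
        assert (Cmod (f xi - a) * Cmod (f (Cconj xi) - a) <= M * e)%C by (apply Rmult_le_compat; auto; apply Cmod_ge_0).
        assert (0 <= Cmod (f xi - a) * Cmod (f (Cconj xi) - a))%C by (apply Rmult_le_pos; apply Cmod_ge_0).
        apply mult_le_contract; lra.
      + assert (R1 : fst xi - 1 <= - (d * d / 2)).
        { rewrite Cdist_Cmod in h1. pose proof (Cmod_sq (xi - 1)%C) as E1. pose proof (Cmod_sq xi) as E2.
          rewrite h1 in E1. unfold Cminus, Cplus, Copp, RtoC in E1; simpl in E1. pose proof (Cmod_ge_0 xi). nra. }
        assert (cc : cont_at (fun z => RtoC (exp (k * (fst z - 1)))) xi).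
        { apply (cont_in_real _ (fun x => exp (k * (x - 1))) fst).
          - apply (continuity_pt_comp (fun x => k * (x - 1)) exp).
            + apply continuity_pt_mult; [apply continuity_pt_const; intros ? ?; auto|].
              apply continuity_pt_minus; [apply derivable_continuous_pt, derivable_pt_id|].
              apply continuity_pt_const; intros ? ?; auto.
            + apply derivable_continuous_pt, derivable_pt_exp.
          - apply (cont_in_fst _ (fun z => z)), cont_in_id. }
        assert (MM : 0 < M * M) by nra.
        destruct (cc (e' / (M * M))) as [d0 [hd0 h]]; [apply Rdiv_lt_0_compat; auto|].
        exists d0; split; auto. intros z hz hzd. specialize (h z I hzd).
        rewrite Cdist_Cmod, <- RtoC_minus, Cmod_R in h. apply Rabs_lt_between in h.
        rewrite FE. pose proof (bnd z (ND z hz)). pose proof (exp_pos (k * (fst z - 1))).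
        assert (exp (k * (fst xi - 1)) <= exp (- (k * (d * d / 2)))).
        { destruct (Req_dec (k * (fst xi - 1)) (- (k * (d * d / 2)))) as [->|n]; [lra|].
          left. apply exp_increasing. nra. }
        apply Rle_trans with (M * M * exp (k * (fst z - 1))); [apply Rmult_le_compat_r; lra|].
        apply Rle_trans with (M * M * (exp (- (k * (d * d / 2))) + e' / (M * M))).
        * apply Rmult_le_compat_l; lra.
        * rewrite Rmult_plus_distr_l. replace (M * M * (e' / (M * M))) with e' by (field; lra). lra. }
  rewrite FE in main.
  replace (Cconj (RtoC x)) with (RtoC x) in main by (unfold Cconj, RtoC; simpl; f_equal; ring).
  simpl fst in main.
  apply Rmult_le_reg_r with (exp (k * (x - 1))); [apply exp_pos|].
  rewrite (Rmult_assoc (e * M)), <- exp_plus. replace (k * (1 - x) + k * (x - 1)) with 0 by ring.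
  rewrite exp_0, Rmult_1_r. exact main.
Qed.

Definition ends_at (g : R -> C) (l : C) : Prop :=
  forall e, 0 < e -> exists d, 0 < d /\ forall t, 1 - d < t < 1 -> Cdist (g t) l < e.

Definition halfopen (t : R) : Prop := 0 <= t < 1.

(** If a <> p, a tail of the path cannot meet the radius, since [f] is near a on the former and near
    p on the latter. So the tail lies off the real axis and [lindelof_core] applies to it. *)
Lemma lindelof_1 (f : C -> C) M a p (g : R -> C) :
  holomorphic_on unit_disk f -> (forall z, unit_disk z -> Cmod (f z) <= M) ->
  radial_limit f (RtoC 1) p ->
  (forall t, halfopen t -> rcont halfopen g t) -> (forall t, halfopen t -> unit_disk (g t)) ->
  ends_at g (RtoC 1) -> ends_at (fun t => f (g t)) a -> a = p.
Proof.
  intros hf hM hr cg hg lg la. apply NNPP. intros hne.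
  set (e0 := Cdist a p). assert (he0 : 0 < e0) by (apply Cdist_neq_pos; auto).
  set (M1 := Rmax M 0 + Cmod a + 1).
  assert (hM1 : 1 <= M1) by (unfold M1; pose proof (Rmax_r M 0); pose proof (Cmod_ge_0 a); lra).
  assert (hMa : forall z, unit_disk z -> Cmod (f z - a)%C <= M1).
  { intros z hz. pose proof (hM z hz). pose proof (Cmod_triangle (f z) (- a)%C). rewrite Cmod_opp in H0.
    pose proof (Rmax_l M 0). unfold M1, Cminus. lra. }
  assert (Sc : forall x, Cscale x (RtoC 1) = RtoC x) by (intros x; unfold Cscale, RtoC; simpl; f_equal; ring).
  (* [e0 / 3] keeps the path off the radius; e M1 <= e0^2 / 8 makes the final bound on |f x - a|^2
     smaller than (3 e0 / 4)^2. *)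
  set (e := Rmin 1 (Rmin (e0 / 3) (e0 * e0 / (8 * M1)))).
  assert (he : 0 < e) by (repeat apply Rmin_pos; try lra; apply Rdiv_lt_0_compat; nra).
  assert (e1 : e <= 1) by apply Rmin_l.
  assert (e2 : e <= e0 / 3) by (eapply Rle_trans; [apply Rmin_r|apply Rmin_l]).
  assert (e3 : e * M1 <= e0 * e0 / 8).
  { apply Rle_trans with (e0 * e0 / (8 * M1) * M1).
    - apply Rmult_le_compat_r; [lra|]. eapply Rle_trans; [apply Rmin_r|apply Rmin_r].
    - right. field. lra. }
  clearbody e.
  destruct (hr (e0 / 3)) as [d1 [hd1 h1]]; [lra|].
  destruct (la e he) as [d2 [hd2 h2]].
  destruct (lg d1 hd1) as [d3 [hd3 h3]].
  set (ts := Rmax (1 - Rmin d2 d3 / 2) 0).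
  assert (hts : 0 <= ts < 1).
  { split; [apply Rmax_r|]. apply Rmax_lub_lt; [|lra]. pose proof (Rmin_pos d2 d3 hd2 hd3). lra. }
  assert (hts2 : 1 - Rmin d2 d3 < ts).
  { eapply Rlt_le_trans; [|apply Rmax_l]. pose proof (Rmin_pos d2 d3 hd2 hd3). lra. }
  pose proof (Rmin_l d2 d3). pose proof (Rmin_r d2 d3).
  set (tau := fun s => ts + s * (1 - ts)).
  set (g' := fun s => if Rlt_dec s 1 then g (tau s) else RtoC 1).
  assert (htau : forall s, 0 <= s < 1 -> ts <= tau s < 1) by (intros s hs; unfold tau; nra).
  assert (g'E : forall s, s < 1 -> g' s = g (tau s)) by (intros s hs; unfold g'; destruct (Rlt_dec s 1); auto; lra).
  assert (g'1 : g' 1 = RtoC 1) by (unfold g'; destruct (Rlt_dec 1 1); auto; lra).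
  assert (cg' : forall t, unit_interval t -> rcont unit_interval g' t).
  { intros t ht e' he'. unfold unit_interval in *. destruct (Rlt_dec t 1) as [hlt|hge].
    - destruct (cg (tau t)) with (e := e') as [d [hd h]]; auto.
      { unfold halfopen. pose proof (htau t). lra. }
      exists (Rmin d (1 - t)). split; [apply Rmin_pos; lra|]. intros s hs hst.
      pose proof (Rmin_l d (1 - t)). pose proof (Rmin_r d (1 - t)).
      assert (s < 1) by (apply Rabs_lt_between in hst; lra).
      rewrite !g'E by auto. apply h.
      + unfold halfopen. pose proof (htau s). lra.
      + unfold tau. replace (ts + s * (1 - ts) - (ts + t * (1 - ts))) with ((s - t) * (1 - ts)) by ring.
        rewrite Rabs_mult, (Rabs_right (1 - ts)) by lra. pose proof (Rabs_pos (s - t)). nra.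
    - replace t with 1 in * by lra. destruct (lg e' he') as [d [hd h]]. exists d; split; auto.
      intros s hs hst. rewrite g'1. destruct (Rlt_dec s 1) as [hl|hg0].
      + rewrite g'E by auto. apply h. pose proof (htau s). split; [|lra].
        apply Rabs_lt_between in hst. unfold tau. nra.
      + replace s with 1 by lra. rewrite g'1, Cdist_refl; auto. }
  assert (hg' : forall t, 0 <= t < 1 -> unit_disk (g' t) /\ snd (g' t) <> 0 /\ Cmod (f (g' t) - a)%C <= e).
  { intros t ht. rewrite g'E by lra. pose proof (htau t ht) as ht2.
    assert (B : Cdist (f (g (tau t))) a < e) by (apply h2; lra).
    assert (u : unit_disk (g (tau t))) by (apply hg; unfold halfopen; lra).
    repeat split; auto.
    - intros E. specialize (h3 (tau t) ltac:(lra)).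
      assert (gE : g (tau t) = RtoC (fst (g (tau t)))).
      { destruct (g (tau t)) as [x y]; simpl in *; subst; auto. }
      set (x := fst (g (tau t))) in *.
      rewrite gE, Cdist_Cmod, <- RtoC_minus, Cmod_R in h3. apply Rabs_lt_between in h3.
      rewrite gE in u. apply unit_disk_Cmod in u. rewrite Cmod_R in u. apply Rabs_lt_between in u.
      specialize (h1 x ltac:(lra)). rewrite Sc, <- gE in h1.
      pose proof (Cdist_tri a (f (g (tau t))) p) as T. fold e0 in T. rewrite (Cdist_sym a) in T. lra.
    - rewrite <- Cdist_Cmod. lra. }
  set (d := Cdist (g' 0) (RtoC 1)).
  assert (hd : 0 < d).
  { apply Cdist_neq_pos. intros E. destruct (hg' 0) as [_ [h _]]; [lra|]. apply h. rewrite E; auto. }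
  (* The value at which M1^2 exp(-k d^2 / 2) equals e M1, as [lindelof_core] requires on the lens
     arc. *)
  set (k := 2 / (d * d) * ln (M1 / e)).
  assert (hk1 : 1 <= M1 / e).
  { apply Rmult_le_reg_r with e; auto. unfold Rdiv. rewrite Rmult_assoc, Rinv_l by lra. lra. }
  assert (hk0 : 0 <= k).
  { apply Rmult_le_pos; [left; apply Rdiv_lt_0_compat; nra|]. rewrite <- ln_1. apply ln_le; lra. }
  assert (hkd : M1 * M1 * exp (- (k * (d * d / 2))) <= e * M1).
  { replace (k * (d * d / 2)) with (ln (M1 / e)) by (unfold k; field; lra).
    rewrite exp_Ropp, exp_ln by lra. right. field. lra. }
  (* as x -> 1 along the radius, |f x - a|^2 <= e M1 exp (k (1 - x)) tends to e M1 < |p - a|^2 *)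
  assert (cE : continuity_pt (fun y => exp (k * y)) 0).
  { apply (continuity_pt_comp (fun y => k * y) exp).
    - apply continuity_pt_mult; [apply continuity_pt_const; intros ? ?; auto|].
      apply derivable_continuous_pt, derivable_pt_id.
    - apply derivable_continuous_pt, derivable_pt_exp. }
  destruct (continuity_pt_bound _ _ cE 1 Rlt_0_1) as [d4 [hd4 h4]].
  destruct (hr (e0 / 4)) as [d5 [hd5 h5]]; [lra|].
  set (y := Rmin (Rmin d4 d5) (Rmin d 1) / 2).
  assert (hy : 0 < y) by (unfold y; pose proof (Rmin_pos _ _ (Rmin_pos _ _ hd4 hd5) (Rmin_pos _ _ hd Rlt_0_1)); lra).
  assert (y4 : y < d4 /\ y < d5 /\ y < d /\ y < 1).
  { unfold y in *. pose proof (Rmin_l (Rmin d4 d5) (Rmin d 1)). pose proof (Rmin_r (Rmin d4 d5) (Rmin d 1)).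
    pose proof (Rmin_l d4 d5). pose proof (Rmin_r d4 d5). pose proof (Rmin_l d 1). pose proof (Rmin_r d 1). lra. }
  pose proof (lindelof_core f a M1 e k g' (1 - y) hf hMa he ltac:(lra) cg' g'1 hg' hk0 hkd) as L.
  fold d in L. specialize (L ltac:(lra)). rewrite Cmod_R in L.
  specialize (L ltac:(apply Rabs_lt_between; lra)).
  replace (1 - (1 - y)) with y in L by ring.
  specialize (h4 y). rewrite Rminus_0_r, Rmult_0_r, exp_0, Rabs_right in h4 by lra.
  specialize (h4 ltac:(lra)). apply Rabs_lt_between in h4.
  specialize (h5 (1 - y) ltac:(lra)). rewrite Sc in h5.
  pose proof (Cdist_tri a (f (RtoC (1 - y))) p) as T. fold e0 in T.
  rewrite (Cdist_sym a), Cdist_Cmod in T.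
  set (q := Cmod (f (RtoC (1 - y)) - a)%C) in *.
  assert (e * M1 * exp (k * y) <= e0 * e0 / 8 * 2).
  { apply Rmult_le_compat; [nra|left; apply exp_pos|lra|lra]. }
  nra.
Qed.

Lemma lindelof (f : C -> C) M alpha a p (g : R -> C) : Cmod alpha = 1 ->
  holomorphic_on unit_disk f -> (forall z, unit_disk z -> Cmod (f z) <= M) ->
  radial_limit f alpha p ->
  (forall t, halfopen t -> rcont halfopen g t) -> (forall t, halfopen t -> unit_disk (g t)) ->
  ends_at g alpha -> ends_at (fun t => f (g t)) a -> a = p.
Proof.
  intros ha hf hM hr cg hg lg la.
  assert (a0 : alpha <> RtoC 0) by (apply Cmod_gt_0; lra).
  assert (md : forall z, unit_disk z -> unit_disk (alpha * z)%C).
  { intros z. rewrite !unit_disk_Cmod, Cmod_mult, ha, Rmult_1_l. auto. }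
  apply (lindelof_1 (fun z => f (alpha * z)%C) M a p (fun t => g t / alpha)%C).
  - intros z hz. destruct (hf _ (md z hz)) as [L hL]. eexists.
    apply (cderiv_comp (fun z => alpha * z)%C f); [apply cderiv_scal|exact hL].
  - intros z hz. auto.
  - intros e he. destruct (hr e he) as [d [hd h]]. exists d; split; auto. intros r hr'.
    replace (alpha * Cscale r (RtoC 1))%C with (Cscale r alpha); auto.
    unfold Cscale, Cmult, RtoC; simpl. f_equal; ring.
  - intros t ht. apply (rcont_cont_at g halfopen (fun z => z / alpha)%C); auto.
    apply cont_in_div; auto; [apply cont_in_id|apply cont_in_const].
  - intros t ht. specialize (hg t ht). apply unit_disk_Cmod in hg. apply unit_disk_Cmod.
    rewrite Cmod_div, ha by auto. lra.
  - intros e he. destruct (lg e he) as [d [hd h]]. exists d; split; auto. intros t ht.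
    specialize (h t ht). rewrite Cdist_Cmod in *.
    replace (g t / alpha - 1)%C with ((g t - alpha) / alpha)%C by (field; auto).
    rewrite Cmod_div, ha by auto. lra.
  - intros e he. destruct (la e he) as [d [hd h]]. exists d; split; auto. intros t ht.
    replace (alpha * (g t / alpha))%C with (g t) by (field; auto). auto.
Qed.

(** * Derivatives of injective maps and of lifts *)

Lemma sphere_closed c r : closed_set (fun z => Cdist z c = r).
Proof.
  apply closure_closed. intros z hz. apply cond_eq. intros e he.
  destruct (hz e he) as [w [h1 hw]]. pose proof (Cdist_tri z w c). pose proof (Cdist_tri w z c).
  rewrite (Cdist_sym z w) in *. apply Rabs_lt_between. lra.
Qed.

Lemma ball_bounded c r z : Cdist z c <= r -> Cmod z <= r + Cmod c.
Proof. intros h. pose proof (Cmod_dist_le z c) as T. apply Rabs_le_between in T. lra. Qed.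

Lemma cderiv_zero_const (f : C -> C) c r : (forall z, Cdist z c < r -> is_cderiv f z (RtoC 0)) ->
  forall a b, Cdist a c < r -> Cdist b c < r -> f a = f b.
Proof.
  intros H a b ha hb.
  assert (L : forall (u : C -> R), (forall z w, Rabs (u z - u w) <= Cdist z w) -> u (f b) = u (f a)).
  { intros u hu.
    destruct (MVT_cor2 (fun t => u (f (seg a b t))) (fun _ => 0) 0 1 Rlt_0_1) as [t [ht _]].
    - intros t ht e he.
      assert (hz : Cdist (seg a b t) c < r) by (apply seg_ball; auto).
      pose proof (proj1 (is_cderiv_Cmod _ _ _) (H _ hz)) as D.
      set (l := Cdist b a). assert (hl : 0 <= l) by apply Cdist_pos.
      destruct (D (e / (2 * (l + 1)))) as [d [hd h]]; [apply Rdiv_lt_0_compat; lra|].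
      assert (hd' : 0 < d / (l + 1)) by (apply Rdiv_lt_0_compat; lra).
      exists (mkposreal _ hd'). simpl. intros s hs0 hs.
      assert (S1 : Cdist (seg a b (t + s)) (seg a b t) = Rabs s * l).
      { rewrite seg_dist. f_equal. f_equal. ring. }
      assert (S2 : Rabs s * l < d).
      { apply Rle_lt_trans with (d / (l + 1) * l); [apply Rmult_le_compat_r; lra|].
        apply Rmult_lt_reg_r with (l + 1); [lra|].
        replace (d / (l + 1) * l * (l + 1)) with (d * l) by (field; lra). nra. }
      specialize (h (seg a b (t + s))). rewrite <- Cdist_Cmod, S1 in h. specialize (h S2).
      replace (f (seg a b (t + s)) - f (seg a b t) - 0 * (seg a b (t + s) - seg a b t))%C with
        (f (seg a b (t + s)) - f (seg a b t))%C in h by ring.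
      pose proof (hu (f (seg a b (t + s))) (f (seg a b t))) as hU. rewrite Cdist_Cmod in hU.
      rewrite Rminus_0_r. unfold Rdiv. rewrite Rabs_mult, Rabs_inv.
      assert (hsp : 0 < Rabs s) by (apply Rabs_pos_lt; auto).
      apply Rmult_lt_reg_r with (Rabs s); auto. rewrite Rmult_assoc, Rinv_l by lra.
      apply Rle_lt_trans with (e / (2 * (l + 1)) * (Rabs s * l)); [lra|].
      assert (E : e / (2 * (l + 1)) * (Rabs s * l) * (2 * (l + 1)) = e * (Rabs s * l)) by (field; lra).
      apply Rmult_lt_reg_r with (2 * (l + 1)); [lra|]. rewrite E.
      assert (0 < e * Rabs s) by (apply Rmult_lt_0_compat; auto). nra.
    - rewrite seg_0, seg_1 in ht. lra. }
  assert (E1 := L fst Cdist_fst). assert (E2 := L snd Cdist_snd).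
  destruct (f a), (f b); simpl in *; congruence.
Qed.

(* If f'(z0) = 0, compare 1/Q with Q z = (f z - f zt)/(z - zt) at z0 and on a circle, for a point zt
   close to z0 with f'(zt) <> 0: Q has no zero by injectivity, and it is small at z0. *)
Lemma injective_deriv_nonzero (f : C -> C) z0 r L : 0 < r ->
  (forall z, Cdist z z0 < r -> exists L, is_cderiv f z L) ->
  (forall z w, Cdist z z0 < r -> Cdist w z0 < r -> f z = f w -> z = w) ->
  is_cderiv f z0 L -> L <> RtoC 0.
Proof.
  intros hr hf inj hL L0. subst L.
  assert (cf : forall z, Cdist z z0 < r -> cont_at f z).
  { intros z hz. destruct (hf z hz) as [L' h]. eapply cderiv_cont; eauto. }
  set (r1 := r / 2).
  assert (ball0 : Cdist z0 z0 < r) by (rewrite Cdist_refl; auto).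
  destruct (compact_lower_bound (fun z => Cdist z z0 = r1) (fun z => f z - f z0)%C (r1 + Cmod z0))
    as [m [hm hm']].
  - apply sphere_closed.
  - intros z hz. apply ball_bounded. lra.
  - intros z hz. apply cont_at_in, cont_in_minus; [|apply cont_in_const]. apply cf. unfold r1 in hz; lra.
  - intros z hz E. apply Ceq_minus in E. apply inj in E; auto; [|unfold r1 in hz; lra].
    subst. rewrite Cdist_refl in hz. unfold r1 in hz; lra.
  (* The comparison will give |F z0| <= 4 r1 / m, while |f zt - f z0| <= e |zt - z0|; their product
     would have to be |zt - z0| but is at most half of it. *)
  - set (e := m / (8 * r1)). assert (he : 0 < e) by (apply Rdiv_lt_0_compat; unfold r1; lra).
    destruct (proj1 (is_cderiv_Cmod _ _ _) hL e he) as [d [hd h]].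
    destruct (cf z0 ball0 (m / 2)) as [d' [hd' h']]; [lra|].
    set (rho := Rmin d (Rmin d' (r1 / 2))).
    assert (hrho : 0 < rho) by (repeat apply Rmin_pos; auto; unfold r1; lra).
    assert (k1 : rho <= d) by apply Rmin_l.
    assert (k2 : rho <= d') by (eapply Rle_trans; [apply Rmin_r|apply Rmin_l]).
    assert (k3 : rho <= r1 / 2) by (eapply Rle_trans; [apply Rmin_r|apply Rmin_r]).
    clearbody rho.
    (* If the derivative vanished all around [z0], [f] would be constant there and not injective. *)
    assert (exists zt Lt, Cdist zt z0 < rho /\ is_cderiv f zt Lt /\ Lt <> RtoC 0) as [zt [Lt [hzt [hLt nLt]]]].
    { apply NNPP. intros n.
      assert (K : forall z, Cdist z z0 < rho -> is_cderiv f z (RtoC 0)).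
      { intros z hz. destruct (hf z) as [L' h1]; [unfold r1 in *; lra|].
        destruct (Ceq_dec L' 0) as [E|E]; [rewrite <- E; auto|]. exfalso. apply n. exists z, L'; auto. }
      set (y := (z0 + (rho / 2)%R)%C).
      assert (hy : Cdist y z0 = rho / 2).
      { rewrite Cdist_Cmod. unfold y. replace (z0 + (rho / 2)%R - z0)%C with (RtoC (rho / 2)) by ring.
        rewrite Cmod_R, Rabs_right; lra. }
      assert (E : y = z0).
      { apply inj; auto; [unfold r1 in *; lra|].
        apply (cderiv_zero_const f z0 rho); auto; [lra|rewrite Cdist_refl; lra]. }
      rewrite E, Cdist_refl in hy. lra. }
    assert (hztr : Cdist zt z0 < r) by (unfold r1 in *; lra).
    assert (hne : zt <> z0).
    { intros ->. apply nLt. apply (cderiv_unique f z0); auto. }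
    pose proof hLt as hS. apply cderiv_slope in hS. destruct hS as [q [cq [hq Eq]]].
    assert (qE : forall z, z <> zt -> q z = ((f z - f zt) / (z - zt))%C).
    { intros z hz. rewrite Eq. field. apply Cminus_eq_contra; auto. }
    assert (qnz : forall z, Cdist z z0 < r -> q z <> RtoC 0).
    { intros z hz E. destruct (Ceq_dec z zt) as [->|n]; [congruence|].
      apply n. apply inj; auto. apply Ceq_minus. rewrite Eq, E. ring. }
    assert (cqz : forall z, Cdist z z0 < r -> cont_at q z).
    { intros z hz. destruct (Ceq_dec z zt) as [->|n]; auto.
      apply cont_in_local with (g := fun z => ((f z - f zt) / (z - zt))%C) (r := Cdist z zt).
      - apply Cdist_neq_pos; auto.
      - exact I.
      - intros w _ hw. apply qE. intros ->. rewrite Cdist_sym in hw. lra.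
      - apply cont_in_div; [apply Cminus_eq_contra; auto| |].
        + apply cont_in_minus; [auto|apply cont_in_const].
        + apply cont_in_minus; [apply cont_in_id|apply cont_in_const]. }
    destruct (compact_lower_bound (fun z => Cdist z z0 <= r1) q (r1 + Cmod z0)) as [mu [hmu hmu']].
    + apply closed_ball_closed.
    + intros z hz. apply ball_bounded. auto.
    + intros z hz. apply cont_at_in, cqz. unfold r1 in *; lra.
    + intros z hz. apply qnz. unfold r1 in *; lra.
    + set (G := fun z => Cdist z z0 < r1 /\ z <> zt).
      set (F := fun z => (/ ((f z - f zt) / (z - zt)))%C).
      assert (Fd : forall z, Cdist z z0 < r -> z <> zt -> exists L, is_cderiv F z L).
      { intros z hz n. destruct (hf z hz) as [L1 h1]. eexists.
        apply (cderiv_inv (fun z => (f z - f zt) / (z - zt))%C).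
        - rewrite <- qE by auto. apply qnz; auto.
        - apply (cderiv_mult (fun z => f z - f zt)%C (fun z => / (z - zt))%C).
          + apply (cderiv_plus f (fun _ => - f zt)%C); [exact h1|apply cderiv_const].
          + apply (cderiv_inv (fun z => z - zt)%C); [apply Cminus_eq_contra; auto|].
            apply (cderiv_plus (fun z => z) (fun _ => - zt)%C); [apply cderiv_id|apply cderiv_const]. }
      assert (FE : forall z, z <> zt -> Cdist z z0 < r ->
        Cmod (F z) * Cmod (f z - f zt)%C = Cmod (z - zt)%C).
      { intros z n hz. rewrite <- Cmod_mult. f_equal. unfold F. field. split; [apply Cminus_eq_contra; auto|].
        intros E. apply n, inj; auto. apply Ceq_minus; auto. }
      assert (key : Cmod (F z0) <= 4 * r1 / m).
      { apply (max_principle_except G F (4 * r1 / m) (/ mu) zt).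
        - apply Rdiv_lt_0_compat; unfold r1; lra.
        - intros z [h1 h2]. destruct (open_ball _ _ z h1) as [e1 [he1 he1']].
          exists (Rmin e1 (Cdist z zt)). split; [apply Rmin_pos; auto; apply Cdist_neq_pos; auto|].
          intros w hw. pose proof (Rmin_l e1 (Cdist z zt)). pose proof (Rmin_r e1 (Cdist z zt)).
          split; [apply he1'; lra|]. intros ->. rewrite Cdist_sym in hw. lra.
        - exists (r1 + Cmod z0). intros z [h1 _]. rewrite Cnorm_Cmod. apply ball_bounded. lra.
        - intros z [h1 h2]. apply Fd; auto. unfold r1 in *; lra.
        - intros [_ h1]. auto.
        - intros z [h1 h2]. unfold F. rewrite <- qE by auto.
          rewrite Cmod_inv by (apply qnz; unfold r1 in *; lra).
          apply Rinv_le_contravar; auto. apply hmu'. lra.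
        - intros xi [hx1 hx2] hxne e' he'.
          assert (hxr : Cdist xi z0 = r1).
          { apply Rle_antisym.
            - apply (closed_closure (fun z => Cdist z z0 <= r1)); [apply closed_ball_closed|].
              intros e1 he1. destruct (hx1 e1 he1) as [w [[hw _] hw2]]. exists w. split; auto. lra.
            - apply Rnot_lt_le. intros hlt. apply hx2. split; auto. }
          assert (bd : Cmod (F xi) <= 4 * r1 / m).
          { assert (Cdist xi z0 < r) by (unfold r1 in *; lra).
            pose proof (FE xi hxne H) as E. rewrite <- (Cdist_Cmod xi zt) in E.
            assert (m / 2 <= Cmod (f xi - f zt)%C).
            { pose proof (hm' xi hxr) as hx. rewrite <- Cdist_Cmod in hx |- *.
              specialize (h' zt I ltac:(lra)). pose proof (Cdist_tri (f xi) (f zt) (f z0)). lra. }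
            assert (Cdist xi zt <= 2 * r1).
            { pose proof (Cdist_tri xi z0 zt). rewrite (Cdist_sym z0 zt) in *. lra. }
            pose proof (Cmod_ge_0 (F xi)).
            apply Rmult_le_reg_r with (m / 2); [lra|].
            replace (4 * r1 / m * (m / 2)) with (2 * r1) by (field; lra).
            apply Rle_trans with (Cmod (F xi) * Cmod (f xi - f zt)%C); [apply Rmult_le_compat_l; lra|lra]. }
          destruct (Fd xi) as [L1 h1]; auto; [unfold r1 in *; lra|].
          destruct (cderiv_cont _ _ _ h1 e' he') as [d0 [hd0 h0]]. exists d0; split; auto. intros z _ hz.
          specialize (h0 z I hz). pose proof (Cmod_dist_le (F z) (F xi)) as T. apply Rabs_le_between in T. lra.
        - split; auto. rewrite Cdist_refl. unfold r1; lra. }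
      assert (ball0' : Cdist z0 z0 < r) by auto.
      pose proof (FE z0 (not_eq_sym hne) ball0') as E.
      rewrite <- !Cdist_Cmod, (Cdist_sym (f z0)), (Cdist_sym z0), !Cdist_Cmod in E.
      rewrite Cdist_Cmod in hzt.
      specialize (h zt ltac:(lra)).
      replace (f zt - f z0 - 0 * (zt - z0))%C with (f zt - f z0)%C in h by ring.
      assert (hp : 0 < Cmod (zt - z0)%C) by (apply Cmod_gt_0, Cminus_eq_contra; auto).
      pose proof (Cmod_ge_0 (F z0)).
      assert (Cmod (F z0) * Cmod (f zt - f z0)%C <= 4 * r1 / m * (e * Cmod (zt - z0)%C))
        by (apply Rmult_le_compat; auto; apply Cmod_ge_0).
      assert (4 * r1 / m * (e * Cmod (zt - z0)%C) = Cmod (zt - z0)%C / 2)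
        by (unfold e; field; unfold r1; lra). lra.
Qed.

Lemma covering_deriv_nonzero U Om f z : is_open U -> holomorphic_on U f -> covering_map U Om f -> U z ->
  exists L, is_cderiv f z L /\ L <> RtoC 0.
Proof.
  intros oU hf hc hz. destruct (hf z hz) as [L hL]. exists L. split; auto.
  assert (hOm : Om (f z)) by (apply hc; auto).
  destruct (covering_even U Om f _ hc hOm) as [V [T [W [oV [hV [_ E]]]]]].
  destruct E as [oW [WU [dis [ex [WV sec]]]]].
  destruct (ex z hz hV) as [i hi]. destruct (oW i z hi) as [r [hr h]].
  destruct (sec i) as [g [_ [_ hg]]].
  apply (injective_deriv_nonzero f z r L hr); auto.
  - intros w hw. apply hf. apply WU with i; auto.
  - intros a b ha hb E. rewrite <- (hg a), <- (hg b), E by auto. auto.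
Qed.

(** The slope of [f] at [F x], evaluated along [F], is continuous and nonzero near [x]; dividing the
    slope of [q] by it gives a slope of [F]. *)
Lemma cderiv_lift (f F q : C -> C) x L Q r : 0 < r -> is_cderiv f (F x) L -> L <> RtoC 0 ->
  is_cderiv q x Q -> cont_at F x -> (forall y, Cdist y x < r -> f (F y) = q y) ->
  is_cderiv F x (Q / L)%C.
Proof.
  intros hr hf nL hq cF H. apply cderiv_slope in hf, hq.
  destruct hf as [s [cs [sL hs]]]. destruct hq as [t [ct [tQ ht]]].
  assert (csF : cont_at (fun y => s (F y)) x) by (apply (cont_in_comp_at _ F s); auto).
  assert (pL : 0 < Cmod L) by (apply Cmod_gt_0; auto).
  destruct (csF (Cmod L) pL) as [d [hd h]].
  apply cderiv_local with (g := fun y => (F x + t y / s (F y) * (y - x))%C) (r := Rmin r d).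
  - apply Rmin_pos; auto.
  - intros y hy. pose proof (Rmin_l r d). pose proof (Rmin_r r d).
    assert (nz : s (F y) <> RtoC 0).
    { intros E. specialize (h y I ltac:(lra)). rewrite E, sL, Cdist_Cmod in h.
      replace (0 - L)%C with (- L)%C in h by ring. rewrite Cmod_opp in h. lra. }
    assert (E : (s (F y) * (F y - F x) = t y * (y - x))%C).
    { rewrite <- hs, <- ht, !H; auto; [rewrite Cdist_refl; auto|lra]. }
    replace (t y / s (F y) * (y - x))%C with (t y * (y - x) / s (F y))%C by (field; auto).
    rewrite <- E. field; auto.
  - apply cderiv_slope. exists (fun y => t y / s (F y))%C. repeat split.
    + apply cont_in_div; auto. rewrite sL; auto.
    + rewrite sL, tQ; auto.
    + intros w. ring.
Qed.

Lemma covering_lift_holomorphic U Om f X q F : is_open U -> holomorphic_on U f -> covering_map U Om f ->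
  is_open X -> holomorphic_on X q -> continuous_on X F ->
  (forall x, X x -> U (F x) /\ f (F x) = q x) -> holomorphic_on X F.
Proof.
  intros oU hf hc oX hq cF hF x hx. destruct (hF x hx) as [ux _].
  destruct (covering_deriv_nonzero U Om f _ oU hf hc ux) as [L [hL nL]].
  destruct (hq x hx) as [Q hQ]. destruct (oX x hx) as [r [hr h]].
  exists (Q / L)%C. apply (cderiv_lift f F q x L Q r); auto.
  - intros e he. destruct (cF x hx e he) as [d [hd h']].
    exists (Rmin d r). split; [apply Rmin_pos; auto|]. intros w _ hw.
    pose proof (Rmin_l d r). pose proof (Rmin_r d r). apply h'; [apply h|]; lra.
  - intros y hy. apply hF. auto.
Qed.

(** * The Schwarz-Pick lemma *)

Lemma pick_identity (w b : C) : Cmod (1 - Cconj b * w)%C * Cmod (1 - Cconj b * w)%C =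
  Cmod (w - b)%C * Cmod (w - b)%C + (1 - Cmod b * Cmod b) * (1 - Cmod w * Cmod w).
Proof.
  rewrite !Cmod_sq. destruct w as [x y], b as [u v].
  unfold Cminus, Cplus, Copp, Cmult, Cconj, RtoC; simpl. ring.
Qed.

Lemma Cmod_1_minus_pos (w b : C) : Cmod w <= 1 -> Cmod b < 1 -> 0 < Cmod (1 - Cconj b * w)%C.
Proof.
  intros hw hb. pose proof (Cmod_sub_le 1 (Cconj b * w)%C) as T.
  rewrite Cmod_1, Cmod_mult, Cmod_conj in T. pose proof (Cmod_ge_0 b). pose proof (Cmod_ge_0 w). nra.
Qed.

(** The quotient [H] of the pseudo-hyperbolic factors of T w and of w has upper limit at most 1 at
    the circle, where |1 - conj a w| = |w - a|; the centre [a] is the exceptional point. *)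
Lemma schwarz_pick (T : C -> C) a z : holomorphic_on unit_disk T ->
  (forall z, unit_disk z -> unit_disk (T z)) -> unit_disk a -> unit_disk z ->
  Cmod (T z - T a)%C * Cmod (1 - Cconj a * z)%C <= Cmod (z - a)%C * Cmod (1 - Cconj (T a) * T z)%C.
Proof.
  intros hT hTD ha hz. set (b := T a).
  assert (ma : Cmod a < 1) by (apply unit_disk_Cmod; auto).
  assert (mb : Cmod b < 1) by (apply unit_disk_Cmod; apply hTD; auto).
  destruct (Ceq_dec z a) as [->|hne].
  { fold b. replace (b - b)%C with (RtoC 0) by ring. replace (a - a)%C with (RtoC 0) by ring.
    rewrite Cmod_0. lra. }
  assert (TD : forall w, unit_disk w -> Cmod (T w) < 1) by (intros w hw; apply unit_disk_Cmod; auto).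
  assert (den : forall w, unit_disk w -> (1 - Cconj b * T w)%C <> RtoC 0).
  { intros w hw. apply Cmod_gt_0, Cmod_1_minus_pos; auto. left; auto. }
  set (H := fun w => ((T w - b) / (1 - Cconj b * T w) * ((1 - Cconj a * w) / (w - a)))%C).
  set (G := fun w => unit_disk w /\ w <> a).
  assert (HE : forall w, G w -> Cmod (H w) * (Cmod (1 - Cconj b * T w)%C * Cmod (w - a)%C) =
     Cmod (T w - b)%C * Cmod (1 - Cconj a * w)%C).
  { intros w [h1 h2]. rewrite <- !Cmod_mult. f_equal. unfold H. field. split.
    - apply Cminus_eq_contra; auto.
    - apply den; auto. }
  assert (key : Cmod (H z) <= 1).
  { destruct (hT a ha) as [La hLa]. apply cderiv_slope in hLa. destruct hLa as [q [cq [_ hq]]]. fold b in hq.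
    destruct (cq 1 Rlt_0_1) as [d [hd hd']].
    (* Near [a] the quotient (T w - b) / (w - a) is bounded by the slope of [T]; at distance [d] or
       more from [a] it is at most 2 / d. *)
    set (M := 2 * (Cmod (q a) + 1 + 2 / d) / (1 - Cmod b)).
    apply (max_principle_except G H 1 M a); [lra| | | | | | |split; auto].
    - intros w [h1 h2]. destruct (open_unit_disk w h1) as [e1 [he1 he1']].
      exists (Rmin e1 (Cdist w a)). split; [apply Rmin_pos; auto; apply Cdist_neq_pos; auto|].
      intros y hy. pose proof (Rmin_l e1 (Cdist w a)). pose proof (Rmin_r e1 (Cdist w a)).
      split; [apply he1'; lra|]. intros ->. rewrite Cdist_sym in hy. lra.
    - exists 1. intros w [h1 _]. left; auto.
    - intros w [h1 h2]. destruct (hT w h1) as [L hL]. eexists.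
      apply (cderiv_mult (fun w => (T w - b) / (1 - Cconj b * T w))%C (fun w => (1 - Cconj a * w) / (w - a))%C).
      + apply (cderiv_mult (fun w => T w - b)%C (fun w => / (1 - Cconj b * T w))%C).
        * apply (cderiv_plus T (fun _ => - b)%C); [exact hL|apply cderiv_const].
        * apply (cderiv_inv (fun w => 1 - Cconj b * T w)%C); [apply den; auto|].
          apply cderiv_ext with (fun w => 1 + - Cconj b * T w)%C; [intros; ring|].
          apply (cderiv_plus (fun _ => RtoC 1) (fun w => - Cconj b * T w)%C); [apply cderiv_const|].
          apply (cderiv_mult (fun _ => - Cconj b)%C T); [apply cderiv_const|exact hL].
      + apply (cderiv_mult (fun w => 1 - Cconj a * w)%C (fun w => / (w - a))%C).
        * apply cderiv_ext with (fun w => 1 + - Cconj a * w)%C; [intros; ring|].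
          apply (cderiv_plus (fun _ => RtoC 1) (fun w => - Cconj a * w)%C); [apply cderiv_const|].
          apply cderiv_scal.
        * apply (cderiv_inv (fun w => w - a)%C); [apply Cminus_eq_contra; auto|].
          apply (cderiv_plus (fun w => w) (fun _ => - a)%C); [apply cderiv_id|apply cderiv_const].
    - intros [_ h]. auto.
    - intros w [h1 h2]. pose proof (HE w (conj h1 h2)) as E.
      assert (p1 : 1 - Cmod b <= Cmod (1 - Cconj b * T w)%C).
      { pose proof (Cmod_sub_le 1 (Cconj b * T w)%C) as Q. rewrite Cmod_1, Cmod_mult, Cmod_conj in Q.
        pose proof (TD w h1). pose proof (Cmod_ge_0 b). pose proof (Cmod_ge_0 (T w)). nra. }
      assert (p2 : Cmod (1 - Cconj a * w)%C <= 2).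
      { pose proof (Cmod_triangle 1 (- (Cconj a * w))%C) as Q. rewrite Cmod_opp, Cmod_1, Cmod_mult, Cmod_conj in Q.
        apply unit_disk_Cmod in h1. pose proof (Cmod_ge_0 a). pose proof (Cmod_ge_0 w). unfold Cminus. nra. }
      assert (p3 : 0 < Cmod (w - a)%C) by (apply Cmod_gt_0, Cminus_eq_contra; auto).
      assert (p4 : Cmod (T w - b)%C <= (Cmod (q a) + 1 + 2 / d) * Cmod (w - a)%C).
      { assert (0 < 2 / d) by (apply Rdiv_lt_0_compat; lra). pose proof (Cmod_ge_0 (q a)).
        destruct (Rlt_le_dec (Cdist w a) d) as [hlt|hle].
        - rewrite hq, Cmod_mult. apply Rmult_le_compat_r; [lra|]. specialize (hd' w I hlt).
          pose proof (Cmod_dist_le (q w) (q a)) as Q. apply Rabs_le_between in Q. lra.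
        - rewrite Cdist_Cmod in hle. pose proof (TD w h1).
          pose proof (Cmod_triangle (T w) (- b)%C) as Q. rewrite Cmod_opp in Q.
          assert (2 <= 2 / d * Cmod (w - a)%C).
          { apply Rle_trans with (2 / d * d); [right; field; lra|]. apply Rmult_le_compat_l; lra. }
          unfold Cminus in *. nra. }
      apply Rmult_le_reg_r with ((1 - Cmod b) * Cmod (w - a)%C); [apply Rmult_lt_0_compat; lra|].
      apply Rle_trans with (Cmod (H w) * (Cmod (1 - Cconj b * T w)%C * Cmod (w - a)%C)).
      + apply Rmult_le_compat_l; [apply Cmod_ge_0|]. apply Rmult_le_compat_r; lra.
      + rewrite E. unfold M.
        replace (2 * (Cmod (q a) + 1 + 2 / d) / (1 - Cmod b) * ((1 - Cmod b) * Cmod (w - a)%C)) with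
          ((Cmod (q a) + 1 + 2 / d) * Cmod (w - a)%C * 2) by (field; lra).
        apply Rmult_le_compat; auto; apply Cmod_ge_0.
    - intros xi [hx1 hx2] hxne e he.
      assert (hx : Cmod xi = 1).
      { apply Rle_antisym.
        - apply le_epsilon. intros e1 he1. destruct (hx1 e1 he1) as [w [[hw _] hw2]].
          apply unit_disk_Cmod in hw. pose proof (Cmod_dist_le w xi) as Q. apply Rabs_le_between in Q. lra.
        - apply Rnot_lt_le. intros hlt. apply hx2. split; auto. apply unit_disk_Cmod; auto. }
      assert (p3 : 0 < Cmod (xi - a)%C) by (apply Cmod_gt_0, Cminus_eq_contra; auto).
      assert (E1 : Cmod ((1 - Cconj a * xi) / (xi - a))%C = 1).
      { rewrite Cmod_div by (apply Cminus_eq_contra; auto).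
        assert (E : Cmod (1 - Cconj a * xi)%C = Cmod (xi - a)%C).
        { apply Rsqr_inj; try apply Cmod_ge_0. unfold Rsqr. rewrite pick_identity, hx. ring. }
        rewrite E. field. lra. }
      assert (cc : cont_at (fun w => (1 - Cconj a * w) / (w - a))%C xi).
      { apply cont_in_div; [apply Cminus_eq_contra; auto| |].
        - apply cont_in_minus; [apply cont_in_const|]. apply cont_in_mult; [apply cont_in_const|apply cont_in_id].
        - apply cont_in_minus; [apply cont_in_id|apply cont_in_const]. }
      destruct (cc e he) as [d0 [hd0 h0]]. exists d0; split; auto. intros w [h1 h2] hw.
      specialize (h0 w I hw).
      pose proof (Cmod_dist_le ((1 - Cconj a * w) / (w - a))%C ((1 - Cconj a * xi) / (xi - a))%C) as Q.
      apply Rabs_le_between in Q. rewrite E1 in Q.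
      unfold H. rewrite Cmod_mult.
      assert (Cmod ((T w - b) / (1 - Cconj b * T w))%C <= 1).
      { rewrite Cmod_div by (apply den; auto).
        assert (0 < Cmod (1 - Cconj b * T w)%C) by (apply Cmod_gt_0, den; auto).
        apply Rmult_le_reg_r with (Cmod (1 - Cconj b * T w)%C); auto.
        unfold Rdiv. rewrite Rmult_assoc, Rinv_l, Rmult_1_r, Rmult_1_l by lra.
        apply Rsqr_incr_0_var; [|lra]. unfold Rsqr. rewrite (pick_identity (T w) b).
        pose proof (TD w h1). pose proof (Cmod_ge_0 b). pose proof (Cmod_ge_0 (T w)).
        assert (0 <= (1 - Cmod b * Cmod b) * (1 - Cmod (T w) * Cmod (T w))) by (apply Rmult_le_pos; nra). lra. }
      pose proof (Cmod_ge_0 ((T w - b) / (1 - Cconj b * T w))%C).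
      pose proof (Cmod_ge_0 ((1 - Cconj a * w) / (w - a))%C). nra. }
  pose proof (HE z (conj hz hne)) as E. rewrite <- E.
  rewrite (Rmult_comm (Cmod (z - a)%C)).
  assert (0 <= Cmod (1 - Cconj b * T z)%C * Cmod (z - a)%C) by (apply Rmult_le_pos; apply Cmod_ge_0).
  nra.
Qed.

(** In terms of the pseudo-hyperbolic distance rho, (1 - |a|^2)(1 - |z|^2) / |1 - conj a z|^2 is 1 -
    rho^2, by [pick_identity]; this is the quantity that [T] does not decrease. *)
Lemma schwarz_pick_ratio (T : C -> C) a z : holomorphic_on unit_disk T ->
  (forall z, unit_disk z -> unit_disk (T z)) -> unit_disk a -> unit_disk z ->
  (1 - Cmod a * Cmod a) * (1 - Cmod z * Cmod z) *
    (Cmod (1 - Cconj (T a) * T z)%C * Cmod (1 - Cconj (T a) * T z)%C) <=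
  (1 - Cmod (T a) * Cmod (T a)) * (1 - Cmod (T z) * Cmod (T z)) *
    (Cmod (1 - Cconj a * z)%C * Cmod (1 - Cconj a * z)%C).
Proof.
  intros hT hTD ha hz. pose proof (schwarz_pick T a z hT hTD ha hz) as S.
  pose proof (pick_identity z a) as E1. pose proof (pick_identity (T z) (T a)) as E2.
  pose proof (Cmod_ge_0 (T z - T a)%C) as p1. pose proof (Cmod_ge_0 (1 - Cconj a * z)%C) as p2.
  pose proof (Cmod_ge_0 (z - a)%C) as p3. pose proof (Cmod_ge_0 (1 - Cconj (T a) * T z)%C) as p4.
  set (A := Cmod (T z - T a)%C) in *. set (B := Cmod (1 - Cconj (T a) * T z)%C) in *.
  set (c := Cmod (z - a)%C) in *. set (d := Cmod (1 - Cconj a * z)%C) in *.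
  replace ((1 - Cmod a * Cmod a) * (1 - Cmod z * Cmod z)) with (d * d - c * c) by lra.
  replace ((1 - Cmod (T a) * Cmod (T a)) * (1 - Cmod (T z) * Cmod (T z))) with (B * B - A * A) by lra.
  assert ((A * d) * (A * d) <= (c * B) * (c * B)) by (apply Rmult_le_compat; auto; apply Rmult_le_pos; auto).
  nra.
Qed.

(** * Unicoherence of the disk *)

Lemma set_distance (A : C -> Prop) a0 : A a0 -> exists D : C -> R,
  (forall z w, Rabs (D z - D w) <= Cdist z w) /\ (forall z, A z -> D z = 0) /\
  (forall z, 0 <= D z) /\ (forall z, D z = 0 -> closure A z).
Proof.
  intros h0.
  assert (E : forall z, exists r, (forall a, A a -> r <= Cdist z a) /\ forall e, 0 < e -> exists a, A a /\ Cdist z a < r + e).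
  { intros z. destruct (real_sup_sequence (fun x => exists a, A a /\ x = - Cdist z a) (- Cdist z a0) 0) as [M [h1 h2]].
    - exists a0; auto.
    - intros x [a [_ ->]]. pose proof (Cdist_pos z a). lra.
    - exists (- M). split.
      + intros a ha. assert (- Cdist z a <= M) by (apply h1; exists a; auto). lra.
      + intros e he. destruct (h2 e he) as [x [[a [ha ->]] hx]]. exists a. split; auto. lra. }
  set (D := fun z => epsilon (inhabits 0) (fun r => (forall a, A a -> r <= Cdist z a) /\
     forall e, 0 < e -> exists a, A a /\ Cdist z a < r + e)).
  assert (hD : forall z, (forall a, A a -> D z <= Cdist z a) /\ forall e, 0 < e -> exists a, A a /\ Cdist z a < D z + e)
    by (intros z; apply (epsilon_spec (inhabits 0) _ (E z))).
  clearbody D.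
  assert (pos : forall z, 0 <= D z).
  { intros z. apply le_epsilon. intros e he. destruct (hD z) as [_ h]. destruct (h e he) as [a [_ ha]].
    pose proof (Cdist_pos z a). lra. }
  assert (lip : forall z w, D z <= D w + Cdist z w).
  { intros z w. apply le_epsilon. intros e he. destruct (hD w) as [_ h]. destruct (h e he) as [a [ha1 ha2]].
    destruct (hD z) as [h' _]. specialize (h' a ha1). pose proof (Cdist_tri z w a). lra. }
  exists D. repeat split; auto.
  - intros z w. pose proof (lip z w). pose proof (lip w z). rewrite (Cdist_sym w z) in *. apply Rabs_le. lra.
  - intros z hz. destruct (hD z) as [h _]. specialize (h z hz). rewrite Cdist_refl in h. specialize (pos z). lra.
  - intros z hz e he. destruct (hD z) as [_ h]. destruct (h e he) as [a [ha1 ha2]]. exists a. split; auto.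
    rewrite Cdist_sym. lra.
Qed.

Definition closed_in (D A : C -> Prop) : Prop := forall z, D z -> closure A z -> A z.

(* With u = 0 on A and u = 1 on B, the map exp(i pi u) on X and exp(-i pi u) on Y has a continuous
   logarithm on D, whose variation from A to B along X and along Y differ by 2 pi i. *)
Lemma unicoherence (D X Y A B : C -> Prop) a b : convex D ->
  (forall z, X z -> D z) -> (forall z, Y z -> D z) -> (forall z, D z -> X z \/ Y z) ->
  closed_in D X -> closed_in D Y -> is_connected X -> is_connected Y ->
  closed_in D A -> closed_in D B -> (forall z, A z -> B z -> False) ->
  (forall z, X z -> Y z -> A z \/ B z) -> X a -> Y a -> A a -> X b -> Y b -> B b -> False.
Proof.
  intros hD XD YD cov cX cY conX conY cA cB dis XY Xa Ya Aa Xb Yb Bb.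
  destruct (set_distance A a Aa) as [dA [lA [zA [pA nA]]]].
  destruct (set_distance B b Bb) as [dB [lB [zB [pB nB]]]].
  assert (den : forall z, D z -> 0 < dA z + dB z).
  { intros z hz. specialize (pA z) as h1. specialize (pB z) as h2.
    destruct (Rle_lt_or_eq_dec 0 (dA z + dB z)) as [h|h]; [lra|auto|].
    exfalso. apply (dis z); [apply cA|apply cB]; auto; [apply nA|apply nB]; lra. }
  set (u := fun z => dA z / (dA z + dB z)).
  assert (lip : forall (d : C -> R) P z, (forall z w, Rabs (d z - d w) <= Cdist z w) -> cont_in P (fun z => RtoC (d z)) z).
  { intros d P z h e he. exists e. split; auto. intros w _ hw. rewrite Cdist_Cmod, <- RtoC_minus, Cmod_R.
    eapply Rle_lt_trans; [apply h|auto]. }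
  assert (cu : forall P z, D z -> cont_in P (fun z => RtoC (u z)) z).
  { intros P z hz. apply (cont_in_Rdiv P dA (fun z => dA z + dB z)).
    - specialize (den z hz). lra.
    - auto.
    - apply (cont_in_Rplus P dA dB); auto. }
  assert (uA : forall z, A z -> u z = 0) by (intros z hz; unfold u, Rdiv; rewrite zA by auto; apply Rmult_0_l).
  assert (uB : forall z, B z -> D z -> u z = 1).
  { intros z hz hz'. unfold u. specialize (den z hz'). rewrite zB in * by auto. field. lra. }
  pose proof PI_RGT_0 as hpi.
  set (e1 := fun z => (0, PI * u z) : C). set (e2 := fun z => (0, - (PI * u z)) : C).
  assert (ce1 : forall P z, D z -> cont_in P e1 z).
  { intros P z hz. apply (cont_in_pair P (fun _ => 0) (fun z => PI * u z)); [apply cont_in_const|].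
    apply (cont_in_Rmult P (fun _ => PI)); auto. apply cont_in_const. }
  assert (ce2 : forall P z, D z -> cont_in P e2 z).
  { intros P z hz. apply (cont_in_pair P (fun _ => 0) (fun z => - (PI * u z))); [apply cont_in_const|].
    apply (cont_in_real P Ropp (fun z => PI * u z)).
    - apply continuity_pt_opp, derivable_continuous_pt, derivable_pt_id.
    - apply (cont_in_Rmult P (fun _ => PI)); auto. apply cont_in_const. }
  assert (agree : forall z, X z -> Y z -> cexp (e1 z) = cexp (e2 z)).
  { intros z h1 h2. unfold e1, e2, cexp; simpl. destruct (XY z h1 h2) as [h|h].
    - rewrite (uA z h). rewrite Rmult_0_r, Ropp_0. auto.
    - rewrite (uB z h (XD z h1)), Rmult_1_r, cos_neg, sin_neg, sin_PI. f_equal. ring. }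
  set (f := fun z => if excluded_middle_informative (X z) then cexp (e1 z) else cexp (e2 z)).
  assert (fX : forall z, X z -> f z = cexp (e1 z)).
  { intros z hz. unfold f. destruct (excluded_middle_informative (X z)); tauto. }
  assert (fY : forall z, Y z -> f z = cexp (e2 z)).
  { intros z hz. unfold f. destruct (excluded_middle_informative (X z)); auto. }
  assert (away : forall P z, closed_in D P -> D z -> ~ P z -> exists d, 0 < d /\ forall w, Cdist w z < d -> ~ P w).
  { intros P z hP hz hn. apply NNPP. intros n. apply hn, hP; auto. intros e he. apply NNPP. intros n'.
    apply n. exists e. split; auto. intros w hw hPw. apply n'. exists w; auto. }
  assert (cf : continuous_on D f).
  { apply cont_on_intro. intros z hz.
    assert (k1 : cont_in D (fun z => cexp (e1 z)) z) by (apply (cont_in_comp_at D e1 cexp); auto; apply cont_at_cexp).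
    assert (k2 : cont_in D (fun z => cexp (e2 z)) z) by (apply (cont_in_comp_at D e2 cexp); auto; apply cont_at_cexp).
    destruct (classic (X z)) as [hX|hX], (classic (Y z)) as [hY|hY].
    - intros e he. destruct (k1 e he) as [d1 [hd1 h1]]. destruct (k2 e he) as [d2 [hd2 h2]].
      exists (Rmin d1 d2). split; [apply Rmin_pos; auto|]. intros w hw hwz.
      pose proof (Rmin_l d1 d2). pose proof (Rmin_r d1 d2).
      destruct (cov w hw) as [h|h].
      + rewrite !fX by auto. apply h1; auto; lra.
      + rewrite !fY by auto. apply h2; auto; lra.
    - destruct (away Y z cY hz hY) as [d [hd h]].
      apply (cont_in_local D f (fun z => cexp (e1 z)) z d); auto.
      intros w hw hwz. apply fX. destruct (cov w hw) as [h'|h']; auto. exfalso. apply (h w hwz h').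
    - destruct (away X z cX hz hX) as [d [hd h]].
      apply (cont_in_local D f (fun z => cexp (e2 z)) z d); auto.
      intros w hw hwz. apply fY. destruct (cov w hw) as [h'|h']; auto. exfalso. apply (h w hwz h').
    - destruct (cov z hz); tauto. }
  destruct (convex_log D f hD cf) as [l [cl hl]].
  { intros z hz. destruct (cov z hz) as [h|h]; [rewrite fX|rewrite fY]; auto; apply cexp_neq0. }
  assert (sub : forall P, (forall z, P z -> D z) -> continuous_on P l).
  { intros P hP. apply cont_on_intro. intros z hz. apply cont_in_sub with D; auto. apply cont_on_in; auto. }
  assert (E1 : (l a - e1 a = l b - e1 b)%C).
  { apply (log_difference X l e1 conX); auto.
    - apply cont_on_intro. auto.
    - intros z hz. rewrite hl, fX; auto. }
  assert (E2 : (l a - e2 a = l b - e2 b)%C).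
  { apply (log_difference Y l e2 conY); auto.
    - apply cont_on_intro. auto.
    - intros z hz. rewrite hl, fY; auto. }
  unfold e1, e2 in E1, E2. rewrite (uA a Aa), (uB b Bb (XD b Xb)) in E1, E2.
  destruct (l a) as [x1 y1], (l b) as [x2 y2]. unfold Cminus, Cplus, Copp in E1, E2; simpl in E1, E2.
  injection E1 as _ E1. injection E2 as _ E2. lra.
Qed.

(** Equivalently, the components of [F] are relatively open in [F]; this is what splits pieces of
    [F] into disjoint closed sets. *)
Definition locally_connected_set (F : C -> Prop) : Prop :=
  forall z, F z -> exists d, 0 < d /\ forall w, F w -> Cdist w z < d -> component F z w.

Lemma component_trans F x y z : component F x y -> component F y z -> component F x z.
Proof.
  intros h1 h2. apply (component_maximal F x (component F y) y); auto.
  - apply component_connected.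
  - intros w. apply component_sub.
  - eapply component_base; eauto.
Qed.

Lemma component_sym F x y : component F x y -> component F y x.
Proof. intros [K [h1 [h2 [h3 h4]]]]. exists K; auto. Qed.

Lemma closure_mono (A B : C -> Prop) z : (forall w, A w -> B w) -> closure A z -> closure B z.
Proof. intros H h e he. destruct (h e he) as [w [hw hd]]. exists w; auto. Qed.

Lemma closure_idem (A : C -> Prop) z : closure (closure A) z -> closure A z.
Proof.
  intros h e he. destruct (h (e / 2)) as [w [hw hd]]; [lra|]. destruct (hw (e / 2)) as [y [hy hd']]; [lra|].
  exists y. split; auto. pose proof (Cdist_tri y w z). lra.
Qed.

Lemma closure_self (A : C -> Prop) z : A z -> closure A z.
Proof. intros h e he. exists z. rewrite Cdist_refl. auto. Qed.

(** [O] is the component of [c] in the disk minus the closure of [U]. Its closure X and its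
    complement Y are both connected, and they meet inside [F]. If they met in two components of [F],
    splitting the intersection into one component and the rest would contradict unicoherence; so the
    whole relative boundary of [O] lies in one component. *)
Lemma separating_component (F U : C -> Prop) u0 c :
  (forall z, F z -> unit_disk z) -> closed_in unit_disk F -> locally_connected_set F ->
  is_open U -> is_connected U -> U u0 -> (forall z, U z -> unit_disk z) -> (forall z, U z -> ~ F z) ->
  (forall z, unit_disk z -> closure U z -> U z \/ F z) ->
  unit_disk c -> ~ U c -> ~ F c ->
  exists z0 O, F z0 /\ is_open O /\ O c /\ (forall z, O z -> unit_disk z) /\ (forall z, O z -> ~ U z) /\
    (forall z, unit_disk z -> closure O z -> ~ O z -> component F z0 z).
Proof.
  intros FD cF lF oU conU hu0 UD UF clU Dc nUc nFc.
  set (A := fun z => unit_disk z /\ ~ closure U z).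
  assert (oA : is_open A).
  { intros z [h1 h2]. destruct (open_unit_disk z h1) as [e1 [he1 k1]].
    assert (exists e, 0 < e /\ forall w, Cdist w z < e -> ~ closure U w) as [e2 [he2 k2]].
    { apply NNPP. intros n. apply h2, closure_idem. intros e he. apply NNPP. intros n'. apply n.
      exists e; split; auto. intros w hw hc. apply n'. exists w; auto. }
    exists (Rmin e1 e2). split; [apply Rmin_pos; auto|]. intros w hw.
    pose proof (Rmin_l e1 e2). pose proof (Rmin_r e1 e2). split; [apply k1|apply k2]; lra. }
  assert (Ac : A c).
  { split; auto. intros h. destruct (clU c Dc h); auto. }
  assert (AU : forall z, A z -> ~ U z) by (intros z [_ h] hu; apply h, closure_self; auto).
  set (O := component A c).
  assert (oO : is_open O) by (apply component_open; auto).
  assert (Oc : O c) by (apply component_self; auto).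
  assert (OA : forall z, O z -> A z) by (intros z; apply component_sub).
  assert (conD : is_connected unit_disk) by (apply convex_connected, convex_unit_disk).
  assert (Du0 : unit_disk u0) by auto.
  (* a component of A is never closed in the disk *)
  assert (touch : forall y, A y -> exists w, unit_disk w /\ closure (component A y) w /\ closure U w).
  { intros y hy. apply NNPP. intros n.
    assert (component A y u0).
    { apply (connected_locally_constant unit_disk (component A y) conD) with y; auto.
      - intros z hz. destruct (classic (component A y z)) as [h|h].
        + destruct (component_open A y oA z h) as [e [he k]]. exists e; split; auto.
        + assert (nc : ~ closure (component A y) z).
          { intros hc. apply n. exists z. repeat split; auto. apply NNPP. intros hU.
            apply (component_boundary A y z oA (conj hc h)). split; auto. }
          apply not_all_ex_not in nc. destruct nc as [e nc]. apply imply_to_and in nc. destruct nc as [he nc].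
          exists e; split; auto. intros w w' hw hw' h1 h2 hcw. exfalso. apply nc. exists w; auto.
      - apply hy.
      - apply component_self; auto. }
    apply component_sub in H. apply (AU u0 H); auto. }
  set (Y := fun z => unit_disk z /\ ~ O z).
  set (X := fun z => unit_disk z /\ closure O z).
  assert (cUD : is_connected (fun z => unit_disk z /\ closure U z)).
  { apply connected_closure with U; auto.
    - intros z hz. split; auto. apply closure_self; auto.
    - intros z [_ h]; auto. }
  assert (UY : forall z, unit_disk z /\ closure U z -> Y z).
  { intros z [h1 h2]. split; auto. intros hO. apply (OA z hO); auto. }
  (* [Y] consists of the closure of [U] in the disk and of the other components of [A], each of
     which touches that closure. *)
  assert (conY : is_connected Y).
  { assert (base : forall y, Y y -> component Y u0 y).
    { intros y [hy1 hy2].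
      assert (hu : Y u0) by (apply UY; split; auto; apply closure_self; auto).
      assert (cu : component Y u0 u0) by (apply component_self; auto).
      assert (inU : forall z, unit_disk z -> closure U z -> component Y u0 z).
      { intros z hz1 hz2. apply (component_maximal Y u0 (fun z => unit_disk z /\ closure U z) u0); auto.
        split; auto. apply closure_self; auto. }
      destruct (classic (closure U y)) as [hc|hc]; auto.
      assert (Ay : A y) by (split; auto).
      destruct (touch y Ay) as [w [hw1 [hw2 hw3]]].
      assert (KY : forall z, component A y z -> Y z).
      { intros z hz. split; [apply (component_sub A y z hz)|]. intros hO. apply hy2.
        unfold O. apply component_trans with z; auto. apply component_sym; auto. }
      apply (component_maximal Y u0 (fun z => component A y z \/ z = w) w); auto.
      - apply connected_closure with (component A y); auto.
        + apply component_connected.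
        + intros z [hz| ->]; auto. apply closure_self; auto.
      - intros z [hz| ->]; auto.
      - left. apply component_self; auto. }
    apply connected_ext with (component Y u0); [|apply component_connected].
    intros z. split; [apply component_sub|apply base]. }
  assert (conX : is_connected X).
  { apply connected_closure with O.
    - apply component_connected.
    - intros z hz. split; [apply (OA z hz)|apply closure_self; auto].
    - intros z [_ h]; auto. }
  assert (bdF : forall z, X z -> Y z -> F z).
  { intros z [h1 h2] [_ h3].
    assert (hn : ~ A z) by (apply (component_boundary A c z oA); split; auto).
    assert (hcl : closure U z) by (apply NNPP; intros h; apply hn; split; auto).
    destruct (clU z h1 hcl) as [hU|hF]; auto. exfalso.
    destruct (oU z hU) as [e [he k]]. destruct (h2 e he) as [w [hw1 hw2]].
    apply (AU w (OA w hw1)). apply k; auto. }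
  destruct (touch c Ac) as [z0 [hz1 [hz2 hz3]]]. fold O in hz2.
  assert (Xz0 : X z0) by (split; auto). assert (Yz0 : Y z0) by auto.
  assert (Fz0 : F z0) by auto.
  exists z0, O. repeat split; auto.
  { intros z hz. apply (OA z hz). }
  intros z hz1' hz2' hz3'. apply NNPP. intros hn.
  assert (Xz : X z) by (split; auto). assert (Yz : Y z) by (split; auto).
  assert (cX : closed_in unit_disk X).
  { intros w hw h. split; auto. apply closure_idem. apply closure_mono with X; auto. intros y [_ hy]; auto. }
  assert (cY : closed_in unit_disk Y).
  { intros w hw h. split; auto. intros hO. destruct (oO w hO) as [e [he k]].
    destruct (h e he) as [y [[_ hy1] hy2]]. auto. }
  assert (cXY : closed_in unit_disk (fun w => X w /\ Y w)).
  { intros w hw h. split; [apply cX|apply cY]; auto; (eapply closure_mono; [|exact h]); simpl; tauto. }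
  apply (unicoherence unit_disk X Y (fun w => (X w /\ Y w) /\ component F z0 w)
    (fun w => (X w /\ Y w) /\ ~ component F z0 w) z0 z); auto.
  - apply convex_unit_disk.
  - intros w [h _]; auto.
  - intros w [h _]; auto.
  - intros w hw. destruct (classic (O w)) as [h|h]; [left|right]; split; auto. apply closure_self; auto.
  - intros w hw h. assert (hXY : X w /\ Y w) by (apply cXY; auto; eapply closure_mono; [|exact h]; simpl; tauto).
    split; auto. destruct (lF w) as [d [hd k]]; [apply bdF; tauto|].
    destruct (h d hd) as [y [[hy1 hy2] hy3]]. apply component_trans with y; auto. apply component_sym.
    apply k; auto. apply bdF; tauto.
  - intros w hw h. assert (hXY : X w /\ Y w) by (apply cXY; auto; eapply closure_mono; [|exact h]; simpl; tauto).
    split; auto. intros hcw. destruct (lF w) as [d [hd k]]; [apply bdF; tauto|].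
    destruct (h d hd) as [y [[hy1 hy2] hy3]]. apply hy2. apply component_trans with w; auto.
    apply k; auto. apply bdF; tauto.
  - intros w [_ h1] [_ h2]; auto.
  - intros w h1 h2. destruct (classic (component F z0 w)); [left|right]; auto.
  - split; auto. apply component_self; auto.
Qed.

(** Extends membership in [O] to points of the unit circle, so that sides can be compared along
    connected sets of the closed disk. *)
Definition near_in (O : C -> Prop) (z : C) : Prop :=
  exists d, 0 < d /\ forall w, unit_disk w -> Cdist w z < d -> O w.

Lemma unit_disk_dense z d : Cmod z <= 1 -> 0 < d -> exists w, unit_disk w /\ Cdist w z < d.
Proof.
  intros hz hd. set (s := Rmin (d / 2) (1 / 2)).
  assert (hs : 0 < s) by (apply Rmin_pos; lra). assert (s <= d / 2) by apply Rmin_l.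
  assert (s <= 1 / 2) by apply Rmin_r.
  exists ((1 - s)%R * z)%C. pose proof (Cmod_ge_0 z). split.
  - apply unit_disk_Cmod. rewrite Cmod_mult, Cmod_R, Rabs_right by lra. nra.
  - rewrite Cdist_Cmod. replace ((1 - s)%R * z - z)%C with ((- s)%R * z)%C
      by (rewrite RtoC_minus, RtoC_opp; ring).
    rewrite Cmod_mult, Cmod_R, Rabs_Ropp, Rabs_right by lra. nra.
Qed.

(** The part of a ball in the disk is convex, and the relative boundary of [O] lies in [Sh], which
    the ball misses. *)
Lemma ball_same_side (O Sh : C -> Prop) z d : is_open O ->
  (forall z, unit_disk z -> closure O z -> ~ O z -> Sh z) ->
  (forall w, Cdist w z < d -> ~ Sh w) ->
  forall a b, unit_disk a -> unit_disk b -> Cdist a z < d -> Cdist b z < d -> O a -> O b.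
Proof.
  intros oO bd hd a b ha hb ha' hb'.
  apply (connected_locally_constant (fun w => unit_disk w /\ Cdist w z < d) O); auto.
  - apply convex_connected, convex_inter; [apply convex_unit_disk|apply convex_ball].
  - intros w [hw1 hw2]. destruct (classic (O w)) as [h|h].
    + destruct (oO w h) as [e [he k]]. exists e; split; auto.
    + assert (nc : ~ closure O w) by (intros hc; apply (hd w hw2), bd; auto).
      apply not_all_ex_not in nc. destruct nc as [e nc]. apply imply_to_and in nc. destruct nc as [he nc].
      exists e; split; auto. intros x y hx hy h1 h2 hO. exfalso. apply nc. exists x; auto.
Qed.

Lemma side_constant (O Sh K : C -> Prop) : is_open O ->
  (forall z, unit_disk z -> closure O z -> ~ O z -> Sh z) ->
  is_connected K -> (forall z, K z -> Cmod z <= 1 /\ ~ closure Sh z) ->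
  forall a b, K a -> K b -> near_in O a -> near_in O b.
Proof.
  intros oO bd conK hK a b ha hb.
  apply (connected_locally_constant K (near_in O) conK); auto.
  intros z hz. destruct (hK z hz) as [h1 h2].
  apply not_all_ex_not in h2. destruct h2 as [d h2]. apply imply_to_and in h2. destruct h2 as [hd h2].
  exists (d / 2). split; [lra|]. intros w w' hw hw' k1 k2 [d1 [hd1 hO]].
  destruct (hK w hw) as [hw1 _].
  destruct (unit_disk_dense w (Rmin d1 (d / 2)) hw1) as [y [hy1 hy2]]; [apply Rmin_pos; lra|].
  pose proof (Rmin_l d1 (d / 2)). pose proof (Rmin_r d1 (d / 2)).
  assert (Oy : O y) by (apply hO; auto; lra).
  exists (d / 2). split; [lra|]. intros x hx1 hx2.
  apply (ball_same_side O Sh z d) with y; auto.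
  - intros v hv hs. apply h2. exists v; auto.
  - pose proof (Cdist_tri y w z). lra.
  - pose proof (Cdist_tri x w' z). lra.
Qed.

(** * Lifting a simple closed curve *)

Definition allR (t : R) : Prop := True.

(** A closed curve is unrolled to a 1-periodic map of the line, injective modulo integers, because
    its lifts need not close up. *)
Definition periodic_param (S : C -> Prop) (g : R -> C) : Prop :=
  (forall t, rcont allR g t) /\ (forall t (k : Z), g (t + IZR k) = g t) /\
  (forall s t, g s = g t -> exists k : Z, s = t + IZR k) /\ (forall z, S z <-> exists t, g t = z).

Lemma simple_closed_curve_param S : is_simple_closed_curve S -> exists g, periodic_param S g.
Proof.
  intros [g [cg [g01 [inj hS]]]].
  set (gt := fun t => g (t - IZR (Int_part t))).
  assert (ip : forall t, IZR (Int_part t) <= t < IZR (Int_part t) + 1).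
  { intros t. pose proof (base_Int_part t). lra. }
  (* Valid at both ends of the interval, because [g 0 = g 1]; this gives continuity at the integers
     from each side. *)
  assert (gE : forall t (n : Z), IZR n <= t <= IZR n + 1 -> gt t = g (t - IZR n)).
  { intros t n h. pose proof (ip t) as h'. unfold gt.
    assert (c : (n <= Int_part t <= n + 1)%Z).
    { assert (IZR (n - 1) < IZR (Int_part t)) by (rewrite minus_IZR; lra).
      assert (IZR (Int_part t) < IZR (n + 2)) by (rewrite plus_IZR; lra).
      apply lt_IZR in H, H0. lia. }
    assert (Int_part t = n \/ Int_part t = (n + 1)%Z) as [E|E] by lia; rewrite E in *; auto.
    rewrite plus_IZR in *. replace (t - (IZR n + 1)) with 0 by lra. replace (t - IZR n) with 1 by lra. auto. }
  exists gt. repeat split.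
  - intros t e he. set (n := Int_part t). pose proof (ip t) as hn. fold n in hn.
    destruct (cg (t - IZR n)) with (e := e) as [d [hd h]]; auto; [lra|].
    destruct (cg 1) with (e := e) as [d1 [hd1 h1]]; auto; [lra|].
    destruct (Rle_lt_or_eq_dec _ _ (proj1 hn)) as [hlt|heq].
    + exists (Rmin d (Rmin (t - IZR n) (IZR n + 1 - t))). split; [repeat apply Rmin_pos; lra|].
      intros s _ hs. pose proof (Rmin_l d (Rmin (t - IZR n) (IZR n + 1 - t))).
      pose proof (Rmin_r d (Rmin (t - IZR n) (IZR n + 1 - t))).
      pose proof (Rmin_l (t - IZR n) (IZR n + 1 - t)). pose proof (Rmin_r (t - IZR n) (IZR n + 1 - t)).
      pose proof hs as hs'. apply Rabs_lt_between in hs'.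
      rewrite (gE s n), (gE t n) by lra. apply h; [lra|].
      replace (s - IZR n - (t - IZR n)) with (s - t) by ring. lra.
    + exists (Rmin (Rmin d d1) 1). split; [repeat apply Rmin_pos; lra|].
      intros s _ hs. pose proof (Rmin_l (Rmin d d1) 1). pose proof (Rmin_r (Rmin d d1) 1).
      pose proof (Rmin_l d d1). pose proof (Rmin_r d d1).
      pose proof hs as hs'. apply Rabs_lt_between in hs'.
      destruct (Rle_lt_dec t s) as [hle|hlt].
      * rewrite (gE s n), (gE t n) by lra. apply h; [lra|].
        replace (s - IZR n - (t - IZR n)) with (s - t) by ring. lra.
      * rewrite (gE s (n - 1)%Z), (gE t (n - 1)%Z) by (rewrite minus_IZR; lra). rewrite minus_IZR.
        replace (t - (IZR n - 1)) with 1 by lra. apply h1; [lra|].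
        replace (s - (IZR n - 1) - 1) with (s - t) by lra. lra.
  - intros t k. pose proof (ip t). rewrite (gE (t + IZR k) (Int_part t + k)%Z).
    + unfold gt. f_equal. rewrite plus_IZR. ring.
    + rewrite plus_IZR. lra.
  - intros s t E. unfold gt in E. pose proof (ip s). pose proof (ip t).
    apply inj in E; try lra. exists (Int_part s - Int_part t)%Z. rewrite minus_IZR. lra.
  - intros h. apply hS in h. destruct h as [t [ht E]]. exists t. rewrite (gE t 0%Z) by lra.
    rewrite Rminus_0_r. auto.
  - intros [t E]. apply hS. exists (t - IZR (Int_part t)). pose proof (ip t). split; [lra|]. auto.
Qed.

Lemma periodic_param_closed S g : periodic_param S g -> closed_set S.
Proof.
  intros [cg [per [_ hS]]].
  pose proof (path_image_closed g) as H.
  intros z hz. destruct (H (fun t _ => rcont_sub allR unit_interval g t (fun _ _ => I) (cg t)) z) as [e [he k]].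
  - intros [t [_ E]]. apply hz, hS. exists t; auto.
  - exists e; split; auto. intros w hw hSw. apply (k w hw). apply hS in hSw. destruct hSw as [t E].
    exists (t - IZR (Int_part t)). pose proof (base_Int_part t). split; [unfold unit_interval; lra|].
    rewrite <- E. unfold Rminus. rewrite <- opp_IZR. apply per.
Qed.

(** The inverse of the parametrisation is continuous modulo integers: the parameters at distance at
    least [d'] from [t] modulo integers form an arc with closed image, which misses [g t]. *)
Lemma periodic_param_local S g t d : periodic_param S g -> 0 < d ->
  exists e, 0 < e /\ forall s, Cdist (g s) (g t) < e -> exists k : Z, Rabs (s + IZR k - t) < d.
Proof.
  intros [cg [per [inj hS]]] hd. set (d' := Rmin (d / 2) (1 / 3)).
  assert (hd' : 0 < d') by (apply Rmin_pos; lra). assert (d' <= d / 2) by apply Rmin_l.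
  assert (d' <= 1 / 3) by apply Rmin_r. clearbody d'.
  set (h := fun x => g (t + d' + x * (1 - 2 * d'))).
  assert (ch : forall x, unit_interval x -> rcont unit_interval h x).
  { intros x _ e he. destruct (cg (t + d' + x * (1 - 2 * d')) e he) as [r [hr k]].
    exists r; split; auto. intros y _ hy. apply k; [exact I|].
    replace (t + d' + y * (1 - 2 * d') - (t + d' + x * (1 - 2 * d'))) with ((y - x) * (1 - 2 * d')) by ring.
    rewrite Rabs_mult, (Rabs_right (1 - 2 * d')) by lra. pose proof (Rabs_pos (y - x)). nra. }
  destruct (path_image_closed h ch (g t)) as [e [he k]].
  { intros [x [hx E]]. unfold h in E. apply inj in E. destruct E as [n E]. unfold unit_interval in hx.
    assert (0 < IZR n < 1) as [a b] by (split; nra). apply lt_IZR in a, b. lia. }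
  exists e; split; auto. intros s hs.
  set (n := Int_part (s - t + d')). pose proof (base_Int_part (s - t + d')) as hn. fold n in hn.
  exists (- n)%Z. rewrite opp_IZR. apply NNPP. intros hno. apply (k (g s) hs).
  exists ((s + - IZR n - t - d') / (1 - 2 * d')).
  assert (hlow : d' <= s + - IZR n - t).
  { apply Rnot_lt_le. intros hl. apply hno. apply Rabs_lt_between. lra. }
  split.
  - unfold unit_interval. split.
    + apply Rmult_le_pos; [lra|]. left. apply Rinv_0_lt_compat. lra.
    + apply Rmult_le_reg_r with (1 - 2 * d'); [lra|]. unfold Rdiv. rewrite Rmult_assoc, Rinv_l by lra. lra.
  - unfold h. replace (t + d' + (s + - IZR n - t - d') / (1 - 2 * d') * (1 - 2 * d')) with (s + - IZR n) by (field; lra).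
    rewrite <- opp_IZR. apply per.
Qed.

(** Near [z] the preimage of [S] lies on the single arc [lam], the image of [g] under a local
    inverse of [phi]. The structure of the components of the preimage is read off from such
    boxes. *)
Lemma flow_box Om phi S g z t : covering_map unit_disk Om phi -> periodic_param S g ->
  unit_disk z -> phi z = g t ->
  exists d (lam : R -> C) r, 0 < d /\ 0 < r /\ lam t = z /\
    (forall s, Rabs (s - t) < d -> rcont (fun s => Rabs (s - t) < d) lam s /\ unit_disk (lam s) /\
        phi (lam s) = g s /\ Om (g s)) /\
    (forall w, unit_disk w -> S (phi w) -> Cdist w z < r -> exists s, Rabs (s - t) < d /\ lam s = w).
Proof.
  intros hc hg hz E. pose proof hg as [cg [per [inj hS]]].
  assert (hOm : Om (phi z)) by (apply hc; auto).
  destruct (covering_even unit_disk Om phi _ hc hOm) as [V [T [W [oV [hV [VO [oW [WU [dis [ex [WV sec]]]]]]]]]]].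
  destruct (ex z hz hV) as [i hi]. destruct (sec i) as [sg [csg [hsg1 hsg2]]].
  destruct (oV _ hV) as [e [he k]]. rewrite E in k.
  destruct (cg t e he) as [d [hd h]].
  assert (inV : forall s, Rabs (s - t) < d -> V (g s)) by (intros s hs; apply k, h; auto; exact I).
  destruct (periodic_param_local S g t d hg hd) as [e2 [he2 h2]].
  destruct (oW i z hi) as [r1 [hr1 k1]].
  assert (cphi : continuous_on unit_disk phi) by apply hc.
  destruct (cphi z hz e2 he2) as [r2 [hr2 k2]].
  exists d, (fun s => sg (g s)), (Rmin r1 r2). repeat split; auto.
  - apply Rmin_pos; auto.
  - rewrite <- E; auto.
  - apply (rcont_comp _ V g sg); auto.
    + apply rcont_sub with allR; [intros; exact I|auto].
    + apply cont_on_in; auto.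
  - apply WU with i, hsg1; auto.
  - apply hsg1; auto.
  - intros w hw hSw hwz. pose proof (Rmin_l r1 r2). pose proof (Rmin_r r1 r2).
    apply hS in hSw. destruct hSw as [s0 hs0].
    assert (Wi : W i w) by (apply k1; lra).
    assert (dd : Cdist (g s0) (g t) < e2) by (rewrite hs0, <- E; apply k2; auto; lra).
    destruct (h2 s0 dd) as [n hn]. exists (s0 + IZR n). split; auto.
    rewrite per, hs0. auto.
Qed.

Lemma preimage_locally_connected Om phi S g : covering_map unit_disk Om phi -> periodic_param S g ->
  locally_connected_set (disk_preimage phi S).
Proof.
  intros hc hg z [hz1 hz2]. pose proof hg as [_ [_ [_ hS]]].
  pose proof (proj1 (hS _) hz2) as [t E].
  destruct (flow_box Om phi S g z t hc hg hz1 (eq_sym E)) as [d [lam [r [hd [hr [l0 [h1 h2]]]]]]].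
  exists r; split; auto. intros w [hw1 hw2] hwz. destruct (h2 w hw1 hw2 hwz) as [s [hs <-]].
  apply (component_maximal _ z (fun y => exists s, Rabs (s - t) < d /\ lam s = y) z); auto.
  - apply component_self. split; auto.
  - apply rcont_image_connected.
    + intros a b x ha hb hx. apply Rabs_lt_between in ha, hb. apply Rabs_lt_between. lra.
    + intros x hx. apply h1; auto.
  - intros y [x [hx <-]]. destruct (h1 x hx) as [_ [u [v _]]]. split; auto. apply hS. exists x; auto.
  - exists t. split; auto. rewrite Rminus_diag, Rabs_R0; auto.
Qed.

Lemma preimage_closed Om phi S g : covering_map unit_disk Om phi -> periodic_param S g ->
  closed_in unit_disk (disk_preimage phi S).
Proof.
  intros hc hg z hz hcl. split; auto.
  apply (closed_closure S); [eapply periodic_param_closed; eauto|].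
  intros e he. assert (cphi : continuous_on unit_disk phi) by apply hc.
  destruct (cphi z hz e he) as [d [hd h]]. destruct (hcl d hd) as [w [[hw1 hw2] hw3]].
  exists (phi w). split; auto.
Qed.

(** The maximal interval about [t0] on which [g] stays in Omega, in both directions at once. *)
Definition lift_dom (Om : C -> Prop) (g : R -> C) (t0 t : R) : Prop :=
  forall x, (t0 <= x <= t \/ t <= x <= t0) -> Om (g x).

Lemma lift_dom_convex Om g t0 : rconvex (lift_dom Om g t0).
Proof.
  intros a b t ha hb ht x hx. destruct hx as [hx|hx].
  - apply hb. left. lra.
  - apply ha. right. lra.
Qed.

Lemma lift_dom_ext Om g t0 s t : lift_dom Om g t0 s ->
  (forall x, (s <= x <= t \/ t <= x <= s) -> Om (g x)) -> lift_dom Om g t0 t.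
Proof.
  intros h1 h2 x hx. destruct (Rle_lt_dec s x) as [hle|hlt]; destruct hx as [hx|hx].
  - apply h2. left. lra.
  - destruct (Rle_lt_dec t0 s); [apply h2; lra|]. apply h1. right. lra.
  - destruct (Rle_lt_dec s t0); [apply h2; lra|]. apply h1. left. lra.
  - apply h2. right. lra.
Qed.

Definition max_lift (Om : C -> Prop) (phi : C -> C) (g : R -> C) (t0 : R) (z0 : C) (gh : R -> C) : Prop :=
  gh t0 = z0 /\ (forall t, lift_dom Om g t0 t -> rcont (lift_dom Om g t0) gh t) /\
  (forall t, lift_dom Om g t0 t -> unit_disk (gh t) /\ phi (gh t) = g t).

Lemma max_lift_exists Om phi S g z0 t0 : covering_map unit_disk Om phi -> periodic_param S g ->
  unit_disk z0 -> phi z0 = g t0 -> exists gh, max_lift Om phi g t0 z0 gh.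
Proof.
  intros hc [cg _] hz E.
  (* The path is regarded as a map on a vertical strip of the plane, constant on vertical lines, so
     that lifting from convex sets applies; the lift is read on the real axis. *)
  destruct (convex_lift unit_disk Om phi (fun z => lift_dom Om g t0 (fst z)) (fun z => g (fst z)) (t0, 0) z0)
    as [F [cF [F0 hF]]]; auto.
  - intros a b t ha hb ht. unfold seg, Cplus, Cmult, Cminus, RtoC, Copp; simpl.
    destruct (Rle_lt_dec (fst a) (fst b)).
    + apply (lift_dom_convex Om g t0 (fst a) (fst b)); auto. nra.
    + apply (lift_dom_convex Om g t0 (fst b) (fst a)); auto. nra.
  - apply cont_on_intro. intros z hz'. apply (cont_of_rcont (lift_dom Om g t0) g).
    apply rcont_sub with allR; [intros; exact I|auto].
  - intros x hx. apply hx. lra.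
  - simpl. intros x hx. replace x with t0 by lra. rewrite <- E. apply hc; auto.
  - exists (fun t => F (t, 0)). repeat split; auto.
    + intros t ht. apply (rcont_of_cont _ (fun z => lift_dom Om g t0 (fst z)) F); auto.
      apply cont_on_in; auto.
    + apply (hF (t, 0)); auto.
    + apply (hF (t, 0)); auto.
Qed.

Lemma lift_dom_t0 Om phi g t0 z0 : covering_map unit_disk Om phi -> unit_disk z0 -> phi z0 = g t0 ->
  lift_dom Om g t0 t0.
Proof. intros hc hz E x hx. replace x with t0 by lra. rewrite <- E. apply hc; auto. Qed.

(** Where the maximal lift meets a flow box it runs through the whole box, up to an integer shift of
    the parameter. *)
Lemma max_lift_shift Om phi S g t0 z0 gh t d lam : covering_map unit_disk Om phi -> periodic_param S g ->
  max_lift Om phi g t0 z0 gh ->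
  (forall s, Rabs (s - t) < d -> rcont (fun s => Rabs (s - t) < d) lam s /\ unit_disk (lam s) /\
        phi (lam s) = g s /\ Om (g s)) ->
  forall x s, lift_dom Om g t0 x -> Rabs (s - t) < d -> gh x = lam s ->
  exists k : Z, x = s + IZR k /\
   forall y, Rabs (y - t) < d -> lift_dom Om g t0 (y + IZR k) /\ gh (y + IZR k) = lam y.
Proof.
  intros hc [cg [per [inj hS]]] [_ [cgh hgh]] hl x s hx hs E.
  destruct (hgh x hx) as [_ E1]. destruct (hl s hs) as [_ [_ [E2 _]]].
  assert (E3 : g x = g s) by (rewrite <- E1, <- E2, E; auto).
  destruct (inj _ _ E3) as [k hk]. exists k. split; auto.
  assert (dom : forall y, Rabs (y - t) < d -> lift_dom Om g t0 (y + IZR k)).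
  { intros y hy. apply lift_dom_ext with x; auto. intros v hv.
    replace v with ((v - IZR k) + IZR k) by ring. rewrite per. apply hl.
    apply Rabs_lt_between in hs, hy. apply Rabs_lt_between. lra. }
  intros y hy. split; auto.
  apply (lift_unique unit_disk Om phi (fun s => Rabs (s - t) < d) (fun y => gh (y + IZR k)) lam hc) with (s := s); auto.
  - intros a b v ha hb hv. apply Rabs_lt_between in ha, hb. apply Rabs_lt_between. lra.
  - intros v hv e he. destruct (cgh (v + IZR k) (dom v hv) e he) as [r [hr h]].
    exists r; split; auto. intros w hw hwv. apply h; auto.
    replace (w + IZR k - (v + IZR k)) with (w - v) by ring. auto.
  - intros v hv. apply hl; auto.
  - intros v hv. apply hgh; auto.
  - intros v hv. apply hl; auto.
  - intros v hv. destruct (hgh _ (dom v hv)) as [_ ->]. destruct (hl v hv) as [_ [_ [-> _]]]. apply per.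
  - rewrite <- hk. auto.
Qed.

(** By flow boxes, lying on the maximal lift is a locally constant property of points of the
    preimage, and the image of the lift is connected. *)
Lemma max_lift_component Om phi S g t0 z0 gh : covering_map unit_disk Om phi -> periodic_param S g ->
  unit_disk z0 -> phi z0 = g t0 -> max_lift Om phi g t0 z0 gh ->
  forall w, component (disk_preimage phi S) z0 w <-> exists t, lift_dom Om g t0 t /\ gh t = w.
Proof.
  intros hc hg hz0 E0 hm w. pose proof hm as [gh0 [cgh hgh]]. pose proof hg as [cg [per [inj hS]]].
  assert (dom0 : lift_dom Om g t0 t0) by (eapply lift_dom_t0; eauto).
  split.
  - intros [K [conK [KF [Kz0 Kw]]]].
    apply (connected_locally_constant K (fun w => exists t, lift_dom Om g t0 t /\ gh t = w) conK) with z0; auto.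
    + intros z Kz. destruct (KF z Kz) as [hz1 hz2]. pose proof (proj1 (hS _) hz2) as [t E].
      destruct (flow_box Om phi S g z t hc hg hz1 (eq_sym E)) as [d [lam [r [hd [hr [l0 [h1 h2]]]]]]].
      exists r; split; auto. intros a b Ka Kb ha hb [x [hx Ex]].
      destruct (KF a Ka) as [ka1 ka2]. destruct (KF b Kb) as [kb1 kb2].
      destruct (h2 a ka1 ka2 ha) as [s [hs Es]]. destruct (h2 b kb1 kb2 hb) as [s' [hs' Es']].
      destruct (max_lift_shift Om phi S g t0 z0 gh t d lam hc hg hm h1 x s hx hs) as [k [hk hk']]; [congruence|].
      destruct (hk' s' hs') as [h3 h4]. exists (s' + IZR k). split; auto. congruence.
    + exists t0; auto.
  - intros [t [ht <-]].
    apply (component_maximal _ z0 (fun y => exists t, lift_dom Om g t0 t /\ gh t = y) z0); auto.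
    + apply component_self. split; auto. apply hS. exists t0; auto.
    + apply rcont_image_connected; auto. apply lift_dom_convex.
    + intros y [x [hx <-]]. destruct (hgh x hx) as [u v]. split; auto. apply hS. exists x; auto.
    + exists t0; auto.
    + exists t; auto.
Qed.

(** Integer translates of [x0] leave Omega too, so both ends are finite; b <= a + 1 because [g] is
    again outside Omega at a + 1. *)
Lemma lift_dom_interval Om S g t0 x0 : is_open Om -> periodic_param S g -> Om (g t0) -> ~ Om (g x0) ->
  exists a b, a < t0 < b /\ b <= a + 1 /\ ~ Om (g a) /\ ~ Om (g b) /\
    forall t, lift_dom Om g t0 t <-> a < t < b.
Proof.
  intros oOm [cg [per [inj hS]]] h0 hx0.
  assert (oP : forall t, Om (g t) -> exists d, 0 < d /\ forall s, Rabs (s - t) < d -> Om (g s)).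
  { intros t ht. destruct (oOm _ ht) as [e [he k]]. destruct (cg t e he) as [d [hd h]].
    exists d; split; auto. intros s hs. apply k, h; auto. exact I. }
  assert (bad : forall t, exists x, t <= x < t + 1 /\ ~ Om (g x)).
  { intros t. pose proof (base_Int_part (t - x0)) as hn. set (n := Int_part (t - x0)) in *.
    destruct (Req_dec (IZR n) (t - x0)) as [hE|hE].
    - exists (x0 + IZR n). split; [lra|]. rewrite per; auto.
    - exists (x0 + IZR (n + 1)). split; [rewrite plus_IZR; lra|]. rewrite per; auto. }
  assert (right_end : exists b, t0 < b /\ ~ Om (g b) /\ forall t, t0 <= t < b -> Om (g t)).
  { destruct (bad t0) as [x1 [hx1 nx1]].
    destruct (real_sup_sequence (fun t => t0 <= t <= x1 /\ forall s, t0 <= s <= t -> Om (g s)) t0 x1) as [b [h1 h2]].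
    - split; [lra|]. intros s hs. replace s with t0 by lra. auto.
    - intros t [ht _]. lra.
    - assert (hb : t0 <= b).
      { apply h1. split; [lra|]. intros s hs. replace s with t0 by lra; auto. }
      assert (all : forall t, t0 <= t < b -> Om (g t)).
      { intros t ht. destruct (h2 (b - t)) as [y [[hy1 hy2] hy3]]; [lra|]. apply hy2. lra. }
      assert (nb : ~ Om (g b)).
      { intros hOb. destruct (oP b hOb) as [d [hd k]].
        assert (b <= x1).
        { apply Rnot_lt_le. intros hl. apply nx1, all. lra. }
        destruct (Rle_lt_or_eq_dec _ _ H) as [hl|hl]; [|subst; auto].
        set (y := Rmin x1 (b + d / 2)). assert (b < y) by (apply Rmin_glb_lt; lra).
        assert (y <= x1) by apply Rmin_l. assert (y <= b + d / 2) by apply Rmin_r.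
        assert (y <= b); [|lra]. apply h1. split; [lra|]. intros s hs.
        destruct (Rlt_le_dec s b); [apply all; lra|]. apply k. apply Rabs_lt_between. lra. }
      exists b. repeat split; auto. destruct (Rle_lt_or_eq_dec _ _ hb) as [hl|hl]; auto. subst. tauto. }
  assert (left_end : exists a, a < t0 /\ ~ Om (g a) /\ forall t, a < t <= t0 -> Om (g t)).
  { destruct (bad (t0 - 1)) as [x1 [hx1 nx1]].
    (* The argument for the right end, applied to the reflected parameter 2 t0 - t. *)
    destruct (real_sup_sequence (fun t => t0 <= t <= 2 * t0 - x1 /\ forall s, t0 <= s <= t -> Om (g (2 * t0 - s))) t0 (2 * t0 - x1)) as [b [h1 h2]].
    - split; [lra|]. intros s hs. replace (2 * t0 - s) with t0 by lra. auto.
    - intros t [ht _]. lra.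
    - assert (hb : t0 <= b).
      { apply h1. split; [lra|]. intros s hs. replace (2 * t0 - s) with t0 by lra; auto. }
      assert (all : forall t, t0 <= t < b -> Om (g (2 * t0 - t))).
      { intros t ht. destruct (h2 (b - t)) as [y [[hy1 hy2] hy3]]; [lra|]. apply hy2. lra. }
      assert (nb : ~ Om (g (2 * t0 - b))).
      { intros hOb. destruct (oP _ hOb) as [d [hd k]].
        assert (b <= 2 * t0 - x1).
        { apply Rnot_lt_le. intros hl. apply nx1. replace x1 with (2 * t0 - (2 * t0 - x1)) by ring. apply all. lra. }
        destruct (Rle_lt_or_eq_dec _ _ H) as [hl|hl].
        2:{ apply nx1. replace x1 with (2 * t0 - b) by lra. auto. }
        set (y := Rmin (2 * t0 - x1) (b + d / 2)). assert (b < y) by (apply Rmin_glb_lt; lra).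
        assert (y <= 2 * t0 - x1) by apply Rmin_l. assert (y <= b + d / 2) by apply Rmin_r.
        assert (y <= b); [|lra]. apply h1. split; [lra|]. intros s hs.
        destruct (Rlt_le_dec s b); [apply all; lra|]. apply k. apply Rabs_lt_between. lra. }
      exists (2 * t0 - b). repeat split; auto.
      + destruct (Rle_lt_or_eq_dec _ _ hb) as [hl|hl]; [lra|]. subst b.
        replace (2 * t0 - t0) with t0 in nb by ring. tauto.
      + intros t ht. replace t with (2 * t0 - (2 * t0 - t)) by ring. apply all. lra. }
  destruct right_end as [b [hb [nb allb]]]. destruct left_end as [a [ha [na alla]]].
  exists a, b. repeat split; auto.
  - apply Rnot_lt_le. intros hl.
    assert (E : g (a + 1) = g a) by (apply (per a 1%Z)).
    apply na. rewrite <- E. destruct (Rle_lt_dec t0 (a + 1)); [apply allb|apply alla]; lra.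
  - apply Rnot_le_lt. intros hle. apply na. apply H. lra.
  - apply Rnot_le_lt. intros hle. apply nb. apply H. lra.
  - intros [h1 h2] x hx. destruct (Rle_lt_dec t0 x); [apply allb|apply alla]; lra.
Qed.

(** * Ends of open arcs in the disk *)

Definition open_interval (t : R) : Prop := 0 < t < 1.

Lemma ends_at_cauchy (G : R -> C) M : (forall t, open_interval t -> Cmod (G t) <= M) ->
  (forall eta, 0 < eta -> exists d, 0 < d /\ forall s t, open_interval s -> open_interval t ->
     1 - d < s -> 1 - d < t -> Cdist (G s) (G t) < eta) ->
  exists b, ends_at G b.
Proof.
  intros hM hc. set (x := fun n : nat => 1 - / INR (n + 2)).
  assert (hx : forall n, open_interval (x n)).
  { intros n. unfold x, open_interval. assert (1 < INR (n + 2)) by (rewrite plus_INR; simpl; pose proof (pos_INR n); lra).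
    assert (0 < / INR (n + 2)) by (apply Rinv_0_lt_compat; lra).
    assert (/ INR (n + 2) < 1) by (rewrite <- Rinv_1; apply Rinv_lt_contravar; lra). lra. }
  destruct (bolzano_weierstrass (fun n => G (x n)) M) as [b hb]; [auto|].
  exists b. intros e he. destruct (hc (e / 2)) as [d [hd h]]; [lra|].
  exists (Rmin d 1). split; [apply Rmin_pos; lra|]. pose proof (Rmin_l d 1). pose proof (Rmin_r d 1).
  intros t ht. destruct (archimed_cor1 d hd) as [N [hN hN0]].
  destruct (hb (e / 2) N) as [n [hn1 hn2]]; [lra|].
  assert (/ INR (n + 2) <= / INR N) by (apply Rinv_le_contravar; [apply lt_0_INR; lia|apply le_INR; lia]).
  assert (k : Cdist (G t) (G (x n)) < e / 2).
  { apply h; auto; [unfold open_interval; lra|lra|]. unfold x. lra. }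
  pose proof (Cdist_tri (G t) (G (x n)) b). lra.
Qed.

Lemma ends_at_Cmod_le (G : R -> C) b : (forall t, open_interval t -> unit_disk (G t)) -> ends_at G b -> Cmod b <= 1.
Proof.
  intros hG hb. apply le_epsilon. intros e he. destruct (hb e he) as [d [hd h]].
  set (t := 1 - Rmin d 1 / 2). pose proof (Rmin_l d 1). pose proof (Rmin_r d 1).
  pose proof (Rmin_pos d 1 hd Rlt_0_1).
  assert (u : unit_disk (G t)) by (apply hG; unfold open_interval, t; lra).
  apply unit_disk_Cmod in u. specialize (h t ltac:(unfold t; lra)).
  pose proof (Cmod_dist_le (G t) b) as T. apply Rabs_le_between in T. lra.
Qed.

Lemma ends_at_unique (G : R -> C) a b : ends_at G a -> ends_at G b -> a = b.
Proof.
  intros ha hb. apply Cdist_eq0. apply Rle_antisym; [|apply Cdist_pos].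
  apply le_epsilon. intros e he. destruct (ha (e / 2)) as [d [hd h]]; [lra|]. destruct (hb (e / 2)) as [d' [hd' h']]; [lra|].
  set (t := 1 - Rmin d d' / 2). pose proof (Rmin_l d d'). pose proof (Rmin_r d d').
  pose proof (Rmin_pos d d' hd hd').
  specialize (h t ltac:(unfold t; lra)). specialize (h' t ltac:(unfold t; lra)).
  pose proof (Cdist_tri a (G t) b). rewrite (Cdist_sym a (G t)) in *. lra.
Qed.

Lemma ends_at_comp (G : R -> C) f b : ends_at G b -> cont_at f b -> ends_at (fun t => f (G t)) (f b).
Proof.
  intros hG cf e he. destruct (cf e he) as [d [hd h]]. destruct (hG d hd) as [d' [hd' h']].
  exists d'. split; auto. intros t ht. apply h; [exact I|auto].
Qed.

(* Koebe's lemma makes the end of G Cauchy. *)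
Lemma asymptotic_end (f : C -> C) M (G : R -> C) : holomorphic_on unit_disk f ->
  (forall z, unit_disk z -> Cmod (f z) <= M) -> (forall z, unit_disk z -> f z <> RtoC 0) ->
  (forall t, open_interval t -> rcont open_interval G t) -> (forall t, open_interval t -> unit_disk (G t)) ->
  ends_at (fun t => f (G t)) (RtoC 0) -> exists b, Cmod b = 1 /\ ends_at G b.
Proof.
  intros hf hM nz cG hG h0.
  destruct (ends_at_cauchy G 1) as [b hb].
  - intros t ht. left. apply unit_disk_Cmod; auto.
  - intros eta heta. destruct (koebe f M hf hM nz eta heta) as [eps [heps hk]].
    destruct (h0 eps heps) as [d [hd h]]. exists d; split; auto. intros s t hs ht hs' ht'.
    unfold open_interval in *.
    assert (K : forall x, unit_interval x -> 0 < s + x * (t - s) < 1 /\ 1 - d < s + x * (t - s)).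
    { intros x hx. unfold unit_interval in hx. destruct (Rle_lt_dec s t).
      - assert (0 <= x * (t - s) <= t - s) by nra. lra.
      - assert (t - s <= x * (t - s) <= 0) by nra. lra. }
    replace (G s) with (G (s + 0 * (t - s))) by (f_equal; ring).
    replace (G t) with (G (s + 1 * (t - s))) by (f_equal; ring).
    apply (hk (fun x => G (s + x * (t - s)))).
    + intros x hx e he. destruct (cG (s + x * (t - s)) (proj1 (K x hx)) e he) as [r [hr k]].
      exists (r / (Rabs (t - s) + 1)). pose proof (Rabs_pos (t - s)).
      split; [apply Rdiv_lt_0_compat; lra|]. intros y hy hyx. apply k; [apply K; auto|].
      replace (s + y * (t - s) - (s + x * (t - s))) with ((y - x) * (t - s)) by ring.
      rewrite Rabs_mult. apply Rle_lt_trans with (r / (Rabs (t - s) + 1) * Rabs (t - s)).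
      * apply Rmult_le_compat_r; lra.
      * apply Rmult_lt_reg_r with (Rabs (t - s) + 1); [lra|].
        replace (r / (Rabs (t - s) + 1) * Rabs (t - s) * (Rabs (t - s) + 1)) with (r * Rabs (t - s)) by (field; lra).
        nra.
    + intros x hx. destruct (K x hx) as [k1 k2]. split; [apply hG; auto|].
      specialize (h (s + x * (t - s)) ltac:(lra)). rewrite Cdist_Cmod in h.
      match type of h with Cmod (Cminus ?a _) < _ =>
        replace (a - RtoC 0)%C with a in h by ring end. auto.
  (* The limit is on the circle: at an inner point [f] would vanish by continuity. *)
  - exists b. split; auto. apply Rle_antisym; [eapply ends_at_Cmod_le; eauto|].
    apply Rnot_lt_le. intros hl. assert (ub : unit_disk b) by (apply unit_disk_Cmod; auto).
    apply (nz b ub). destruct (hf b ub) as [L hL].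
    apply (ends_at_unique (fun t => f (G t))); auto. apply ends_at_comp; auto. eapply cderiv_cont; exact hL.
Qed.

(** The parametrisation is extended by its two ends to [0, 1]. An end is never an inner value, by
    its modulus, so the only possible coincidence is b0 = b1; the image of the extension is
    closed. *)
Lemma open_arc_closure (A : C -> Prop) (G : R -> C) b0 b1 :
  (forall t, open_interval t -> rcont open_interval G t) -> (forall t, open_interval t -> unit_disk (G t)) ->
  (forall s t, open_interval s -> open_interval t -> G s = G t -> s = t) ->
  ends_at G b1 -> ends_at (fun t => G (1 - t)) b0 -> Cmod b0 = 1 -> Cmod b1 = 1 ->
  (forall z, A z <-> exists t, open_interval t /\ G t = z) ->
  (forall z, closure A z <-> A z \/ z = b0 \/ z = b1) /\
  (b0 <> b1 -> is_arc (closure A)) /\ (b0 = b1 -> is_simple_closed_curve (closure A)).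
Proof.
  intros cG hG inj e1 e0 m0 m1 hA.
  set (h := fun t => if Rle_dec t 0 then b0 else if Rle_dec 1 t then b1 else G t).
  assert (h0 : h 0 = b0) by (unfold h; destruct (Rle_dec 0 0); auto; lra).
  assert (h1 : h 1 = b1).
  { unfold h. destruct (Rle_dec 1 0); [lra|]. destruct (Rle_dec 1 1); auto; lra. }
  assert (hI : forall t, open_interval t -> h t = G t).
  { intros t ht. unfold h, open_interval in *. destruct (Rle_dec t 0); [lra|]. destruct (Rle_dec 1 t); auto; lra. }
  assert (ch : forall t, unit_interval t -> rcont unit_interval h t).
  { intros t ht e he. unfold unit_interval in *.
    destruct (Req_dec t 0) as [->|n0]; [|destruct (Req_dec t 1) as [->|n1]].
    - destruct (e0 e he) as [d [hd k]]. exists (Rmin d 1). split; [apply Rmin_pos; lra|].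
      pose proof (Rmin_l d 1). pose proof (Rmin_r d 1). intros s hs hst. rewrite h0.
      apply Rabs_lt_between in hst. destruct (Req_dec s 0) as [->|ns]; [rewrite h0, Cdist_refl; auto|].
      rewrite hI by (unfold open_interval; lra). replace s with (1 - (1 - s)) by ring. apply k. lra.
    - destruct (e1 e he) as [d [hd k]]. exists (Rmin d 1). split; [apply Rmin_pos; lra|].
      pose proof (Rmin_l d 1). pose proof (Rmin_r d 1). intros s hs hst. rewrite h1.
      apply Rabs_lt_between in hst. destruct (Req_dec s 1) as [->|ns]; [rewrite h1, Cdist_refl; auto|].
      rewrite hI by (unfold open_interval; lra). apply k. lra.
    - assert (ot : open_interval t) by (unfold open_interval; lra).
      destruct (cG t ot e he) as [d [hd k]]. exists (Rmin d (Rmin t (1 - t))). split; [repeat apply Rmin_pos; lra|].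
      intros s hs hst. pose proof (Rmin_l d (Rmin t (1 - t))). pose proof (Rmin_r d (Rmin t (1 - t))).
      pose proof (Rmin_l t (1 - t)). pose proof (Rmin_r t (1 - t)). pose proof hst as hst'. apply Rabs_lt_between in hst'.
      assert (os : open_interval s) by (unfold open_interval; lra). rewrite !hI by auto. apply k; auto. lra. }
  assert (cl : forall z, closure A z <-> exists t, unit_interval t /\ h t = z).
  { intros z. split.
    - intros hz. apply (closed_closure (fun z => exists t, unit_interval t /\ h t = z)).
      + apply path_image_closed; auto.
      + apply closure_mono with A; auto. intros w hw. apply hA in hw. destruct hw as [t [ht <-]].
        exists t. split; [unfold open_interval, unit_interval in *; lra|auto].
    - intros [t [ht <-]]. unfold unit_interval in ht.
      destruct (Req_dec t 0) as [->|n0]; [|destruct (Req_dec t 1) as [->|n1]].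
      + rewrite h0. intros e he. destruct (e0 e he) as [d [hd k]].
        set (s := 1 - Rmin d 1 / 2). pose proof (Rmin_l d 1). pose proof (Rmin_r d 1).
        pose proof (Rmin_pos d 1 hd Rlt_0_1).
        exists (G (1 - s)). split; [|apply k; unfold s; lra]. apply hA. exists (1 - s). split; auto.
        unfold open_interval, s; lra.
      + rewrite h1. intros e he. destruct (e1 e he) as [d [hd k]].
        set (s := 1 - Rmin d 1 / 2). pose proof (Rmin_l d 1). pose proof (Rmin_r d 1).
        pose proof (Rmin_pos d 1 hd Rlt_0_1).
        exists (G s). split; [|apply k; unfold s; lra]. apply hA. exists s. split; auto.
        unfold open_interval, s; lra.
      + assert (ot : open_interval t) by (unfold open_interval; lra). rewrite hI by auto.
        apply closure_self. apply hA. exists t; auto. }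
  assert (nG : forall t b, open_interval t -> Cmod b = 1 -> G t <> b).
  { intros t b ht hb E. specialize (hG t ht). apply unit_disk_Cmod in hG. rewrite E in hG. lra. }
  assert (pc : path_continuous h).
  { intros t ht e he. apply (ch t ht e he). }
  assert (dich : forall t, unit_interval t -> t = 0 \/ t = 1 \/ open_interval t).
  { intros t ht. unfold unit_interval, open_interval in *.
    destruct (Req_dec t 0); auto. destruct (Req_dec t 1); auto. right; right; lra. }
  repeat split.
  - intros hz. apply cl in hz. destruct hz as [t [ht <-]].
    destruct (dich t ht) as [->|[->|ot]]; auto. left. rewrite hI by auto. apply hA. exists t; auto.
  - intros [hz|[->| ->]]; [apply closure_self; auto| |]; apply cl.
    + exists 0. split; auto. unfold unit_interval; lra.
    + exists 1. split; auto. unfold unit_interval; lra.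
  - intros hne. exists h. repeat split; auto.
    + intros s t hs ht E. destruct (dich s hs) as [->|[->|os]], (dich t ht) as [->|[->|ot]]; auto;
        rewrite ?h0, ?h1 in E; try rewrite (hI s) in E by auto; try rewrite (hI t) in E by auto;
        first [congruence | apply inj; auto; fail | exfalso; eapply nG; [| |exact E]; auto; fail
              | exfalso; eapply nG; [| |symmetry; exact E]; auto; fail].
    + apply cl.
    + apply cl.
  - intros <-. exists h. repeat split; auto.
    + rewrite h0, h1; auto.
    + intros s t hs ht E.
      destruct (dich s) as [->|[->|os]]; [unfold unit_interval; lra| |lra|];
      destruct (dich t) as [->|[->|ot]]; try (unfold unit_interval; lra); auto; try lra;
        rewrite ?h0, ?h1 in E; try rewrite (hI s) in E by auto; try rewrite (hI t) in E by auto;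
        first [congruence | apply inj; auto; fail | exfalso; eapply nG; [| |exact E]; auto; fail
              | exfalso; eapply nG; [| |symmetry; exact E]; auto; fail].
    + apply cl.
    + apply cl.
Qed.

(** * The component of the preimage separating 0 from the radius *)

Lemma circle_minus_point_connected (b : C) : Cmod b = 1 -> is_connected (fun z => Cmod z = 1 /\ z <> b).
Proof.
  intros hb. assert (b0 : b <> RtoC 0) by (apply Cmod_gt_0; lra).
  (* stereographic parametrisation from b *)
  set (st := fun s => (((s * s - 1) / (s * s + 1), 2 * s / (s * s + 1)) : C)).
  apply connected_ext with (fun z => exists s, allR s /\ (b * st s)%C = z).
  - intros z. split.
    + intros [s [_ <-]]. split.
      * rewrite Cmod_mult, hb, Rmult_1_l. apply Rsqr_inj; [apply Cmod_ge_0|lra|]. unfold Rsqr.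
        rewrite Cmod_sq. unfold st; simpl. field. nra.
      * intros E. assert (E2 : st s = RtoC 1).
        { replace (st s) with ((b * st s) / b)%C by (field; auto). rewrite E. field; auto. }
        unfold st, RtoC in E2. injection E2 as E3 _.
        assert (s * s + 1 <> 0) by nra.
        apply (f_equal (fun x => x * (s * s + 1))) in E3. unfold Rdiv in E3.
        rewrite Rmult_assoc, Rinv_l in E3 by auto. lra.
    + intros [hz hne]. set (w := (z / b)%C).
      assert (hw : Cmod w = 1) by (unfold w; rewrite Cmod_div, hz, hb by auto; field).
      assert (zw : z = (b * w)%C) by (unfold w; field; auto).
      pose proof (Cmod_sq w) as E. rewrite hw in E.
      assert (hx : fst w <> 1).
      { intros h. apply hne. assert (snd w = 0) by nra. rewrite zw.
        replace w with (RtoC 1); [toC; ring|]. destruct w; simpl in *; subst; auto. }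
      exists (snd w / (1 - fst w)). split; [exact I|]. rewrite zw. f_equal. unfold st.
      assert (h2 : 2 - 2 * fst w <> 0) by lra.
      assert (h1 : 1 - fst w <> 0) by lra.
      assert (D : snd w / (1 - fst w) * (snd w / (1 - fst w)) = (1 + fst w) / (1 - fst w)).
      { apply Rmult_eq_reg_r with ((1 - fst w) * (1 - fst w)); [|nra]. field_simplify; auto. nra. }
      rewrite D. clearbody w. destruct w as [x y]; simpl in *. f_equal; field; lra.
  - apply rcont_image_connected; [intros ? ? ? _ _ _; exact I|]. intros s _.
    apply (rcont_of_cont allR everywhere (fun z => b * st (fst z))%C); [intros; exact I|].
    apply cont_in_mult; [apply cont_in_const|].
    assert (cf : cont_at (fun w => RtoC (fst w)) (s, 0)) by (apply (cont_in_fst _ (fun z => z)), cont_in_id).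
    assert (cp : forall (u v : R -> R) x, continuity_pt u x -> continuity_pt v x -> continuity_pt (fun x => u x * v x) x)
      by (intros; apply continuity_pt_mult; auto).
    assert (ci : forall x, continuity_pt (fun x => x) x) by (intros; apply derivable_continuous_pt, derivable_pt_id).
    assert (cc : forall c x, continuity_pt (fun _ => c) x) by (intros; apply continuity_pt_const; intros ? ?; auto).
    apply (cont_in_pair _ (fun z => (fst z * fst z - 1) / (fst z * fst z + 1)) (fun z => 2 * fst z / (fst z * fst z + 1))).
    + apply (cont_in_real _ (fun x => (x * x - 1) / (x * x + 1)) fst); auto. simpl.
      apply continuity_pt_div; [apply continuity_pt_minus|apply continuity_pt_plus|nra]; auto.
    + apply (cont_in_real _ (fun x => 2 * x / (x * x + 1)) fst); auto. simpl.
      apply continuity_pt_div; [|apply continuity_pt_plus|nra]; auto.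
Qed.

(** From a point [q] of the component at distance at least [eps], the ray leading away from [p]
    avoids [S], so the component would be unbounded. *)
Lemma component_interior_small S p eps : (forall z, S z -> Cdist z p < eps) -> 0 < eps -> in_interior S p ->
  forall q, component (fun z => ~ S z) p q -> Cdist q p < eps.
Proof.
  intros hS heps [nSp [M hM]] q hq. apply Rnot_le_lt. intros hle.
  set (r := fun s => (p + s * (q - p))%C).
  assert (dr : forall s, 1 <= s -> Cdist (r s) p = s * Cdist q p).
  { intros s hs. rewrite !Cdist_Cmod. unfold r. replace (p + s * (q - p) - p)%C with (s * (q - p))%C by ring.
    rewrite Cmod_mult, Cmod_R, Rabs_right by lra. auto. }
  assert (inB : forall s, 1 <= s -> component (fun z => ~ S z) p (r s)).
  { intros s hs.
    apply (component_maximal _ p (fun z => exists s, 1 <= s /\ r s = z) q); auto.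
    - apply rcont_image_connected; [intros a b t ha hb ht; lra|].
      intros t _. apply (rcont_of_cont _ everywhere (fun z => p + RtoC (fst z) * (q - p))%C); [intros; exact I|].
      apply cont_in_plus; [apply cont_in_const|]. apply cont_in_mult; [|apply cont_in_const].
      apply (cont_in_fst _ (fun z => z)), cont_in_id.
    - intros w [t [ht <-]] hs'. apply hS in hs'. rewrite dr in hs' by auto. nra.
    - exists 1. split; [lra|]. unfold r. ring.
    - exists s; auto. }
  pose proof (Cmod_ge_0 p).
  set (s := 1 + (Rmax M 0 + Cmod p + 1) / eps).
  pose proof (Rmax_l M 0). pose proof (Rmax_r M 0).
  assert (hs : 0 < (Rmax M 0 + Cmod p + 1) / eps) by (apply Rdiv_lt_0_compat; lra).
  assert (s1 : 1 <= s) by (unfold s; lra).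
  specialize (hM _ (inB s s1)). rewrite Cnorm_Cmod in hM.
  pose proof (dr s s1) as E. pose proof (Cmod_triangle (r s) (- p)%C) as T. rewrite Cmod_opp in T.
  rewrite Cdist_Cmod in E. unfold Cminus in E at 1.
  assert (Rmax M 0 + Cmod p + 1 <= s * Cdist q p).
  { apply Rle_trans with (s * eps).
    - unfold s. rewrite Rmult_plus_distr_r. unfold Rdiv. rewrite Rmult_assoc, Rinv_l by lra. lra.
    - apply Rmult_le_compat_l; lra. }
  lra.
Qed.

Lemma Cscale_mult r (z : C) : Cscale r z = (r * z)%C.
Proof. unfold Cscale, Cmult, RtoC; simpl. f_equal; ring. Qed.

Lemma Cmod_Cscale r z : 0 <= r -> Cmod (Cscale r z) = r * Cmod z.
Proof. intros hr. rewrite Cscale_mult, Cmod_mult, Cmod_R, Rabs_right; lra. Qed.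

Lemma periodic_param_eps S g p eps : periodic_param S g -> (forall z, S z -> Cdist z p < eps) -> 0 < eps.
Proof.
  intros [_ [_ [_ hS]]] h. assert (S (g 0)) by (apply hS; exists 0; auto). specialize (h _ H).
  pose proof (Cdist_pos (g 0) p). lra.
Qed.

(** [U] is the component of the preimage of [B] that contains the end of the radius; its relative
    boundary maps into [S]. The bound on [eps] keeps 0 outside [U] and off the preimage of [S]. *)
Lemma separating_lift Om phi alpha p S g eps :
  covering_map unit_disk Om phi -> Cmod alpha = 1 -> radial_limit phi alpha p ->
  periodic_param S g -> (forall z, S z -> Cdist z p < eps) -> in_interior S p -> eps <= Cdist (phi (RtoC 0)) p ->
  exists z0 O, disk_preimage phi S z0 /\ is_open O /\ O (RtoC 0) /\ (forall z, O z -> unit_disk z) /\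
    ~ near_in O alpha /\ (exists r, 0 <= r < 1 /\ ~ O (Cscale r alpha)) /\
    (forall z, unit_disk z -> closure O z -> ~ O z -> component (disk_preimage phi S) z0 z).
Proof.
  intros hc ha hr hg hS hin he0.
  assert (heps : 0 < eps) by (eapply periodic_param_eps; eauto).
  set (B := component (fun z => ~ S z) p).
  assert (cS : closed_set S) by (eapply periodic_param_closed; eauto).
  assert (oB : is_open B) by (apply component_open; exact cS).
  assert (Bp : B p) by (apply component_self; apply hin).
  assert (Bs : forall q, B q -> Cdist q p < eps) by (apply component_interior_small; auto).
  set (P := disk_preimage phi B).
  assert (cphi : continuous_on unit_disk phi) by apply hc.
  assert (oP : is_open P).
  { intros z [h1 h2]. destruct (oB _ h2) as [e [he k]]. destruct (cphi z h1 e he) as [d [hd k']].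
    destruct (open_unit_disk z h1) as [e1 [he1 k1]].
    exists (Rmin d e1). split; [apply Rmin_pos; auto|]. intros w hw.
    pose proof (Rmin_l d e1). pose proof (Rmin_r d e1).
    assert (unit_disk w) by (apply k1; lra). split; auto. apply k, k'; auto; lra. }
  destruct (oB p Bp) as [e [he k]]. destruct (hr e he) as [d0 [hd0 h0]].
  set (d := Rmin d0 1). assert (hd : 0 < d) by (apply Rmin_pos; lra).
  assert (d <= d0) by apply Rmin_l. assert (d <= 1) by apply Rmin_r.
  assert (tail : forall r, 1 - d < r < 1 -> P (Cscale r alpha)).
  { intros r hr'. split; [|apply k, h0; lra]. apply unit_disk_Cmod. rewrite Cmod_Cscale, ha by lra. lra. }
  set (u0 := Cscale (1 - d / 2) alpha).
  assert (Pu0 : P u0) by (apply tail; lra).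
  set (U := component P u0).
  assert (tailU : forall r, 1 - d < r < 1 -> U (Cscale r alpha)).
  { intros r hr'. apply (component_maximal P u0 (fun z => exists r, 1 - d < r < 1 /\ Cscale r alpha = z) u0).
    - apply component_self; auto.
    - apply rcont_image_connected; [intros a b t ha' hb' ht; lra|].
      intros t _. apply (rcont_of_cont _ everywhere (fun z => Cscale (fst z) alpha)); [intros; exact I|].
      apply cont_in_ext with (fun z => RtoC (fst z) * alpha)%C; [exact I|intros; apply Cscale_mult|].
      apply cont_in_mult; [|apply cont_in_const]. apply (cont_in_fst _ (fun z => z)), cont_in_id.
    - intros w [t [ht <-]]; auto.
    - exists (1 - d / 2). split; auto. lra.
    - exists r; auto. }
  assert (d00 : unit_disk (RtoC 0)) by (apply unit_disk_Cmod; rewrite Cmod_0; lra).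
  destruct (separating_component (disk_preimage phi S) U u0 (RtoC 0)) as [z0 [O [h1 [h2 [h3 [h4 [h5 h6]]]]]]]; auto.
  - intros z [hz _]; auto.
  - eapply preimage_closed; eauto.
  - eapply preimage_locally_connected; eauto.
  - apply component_open; auto.
  - apply component_connected.
  - apply component_self; auto.
  - intros z hz. apply component_sub in hz. apply hz.
  - intros z hz [_ hz2]. apply component_sub in hz. destruct hz as [_ hz].
    apply (component_sub _ _ _ hz); auto.
  - intros z hz1 hz2. destruct (classic (U z)) as [h|h]; auto. right. split; auto.
    apply NNPP. intros hn.
    assert (np : ~ P z) by (apply (component_boundary P u0 z oP); split; auto).
    apply (component_boundary (fun z => ~ S z) p (phi z) cS); auto. split.
    + intros e' he'. destruct (cphi z hz1 e' he') as [d' [hd' k']]. destruct (hz2 d' hd') as [w [hw1 hw2]].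
      apply component_sub in hw1. destruct hw1 as [hw1 hw3]. exists (phi w). split; auto.
    + intros hb. apply np. split; auto.
  - intros h. apply component_sub in h. destruct h as [_ h]. apply Bs in h. lra.
  - intros [_ h]. apply hS in h. lra.
  - exists z0, O. split; [exact h1|]. do 3 (split; [assumption|]). split.
    2:{ split; [|exact h6]. exists (1 - d / 2). split; [lra|]. intros h. apply (h5 _ h). apply tailU. lra. }
    intros [e1 [he1 ke1]]. set (r := 1 - Rmin d e1 / 2). pose proof (Rmin_l d e1). pose proof (Rmin_r d e1).
    pose proof (Rmin_pos d e1 hd he1).
    assert (hr1 : 1 - d < r < 1) by (unfold r; lra).
    apply (h5 (Cscale r alpha)); auto. apply ke1; [apply (tail r hr1)|].
    rewrite Cdist_Cmod, Cscale_mult. replace (r * alpha - alpha)%C with ((r - 1)%R * alpha)%C by (rewrite RtoC_minus; ring).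
    rewrite Cmod_mult, ha, Cmod_R, Rabs_left by lra. unfold r. lra.
Qed.

(** The radius starts in [O] and leaves it, so it crosses the separating component, whose base point
    can be moved onto the radius. There the lift of S can be compared with a lift of the radius when
    p is isolated. *)
Lemma separating_radius Om phi alpha p S g eps :
  covering_map unit_disk Om phi -> Cmod alpha = 1 -> radial_limit phi alpha p ->
  periodic_param S g -> (forall z, S z -> Cdist z p < eps) -> in_interior S p -> eps <= Cdist (phi (RtoC 0)) p ->
  exists r O, 0 <= r < 1 /\ disk_preimage phi S (Cscale r alpha) /\
    is_open O /\ O (RtoC 0) /\ (forall z, O z -> unit_disk z) /\ ~ near_in O alpha /\
    (forall z, unit_disk z -> closure O z -> ~ O z -> component (disk_preimage phi S) (Cscale r alpha) z).
Proof.
  intros hc ha hr hg hS hin he0.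
  destruct (separating_lift Om phi alpha p S g eps hc ha hr hg hS hin he0)
    as [z0 [O [h1 [h2 [h3 [h4 [h5 [[r1 [hr1 nr1]] h6]]]]]]]].
  assert (D : forall r, halfopen r -> unit_disk (Cscale r alpha)).
  { intros r [q1 q2]. apply unit_disk_Cmod. rewrite Cmod_Cscale, ha; lra. }
  assert (cont : forall r s, Cdist (Cscale r alpha) (Cscale s alpha) = Rabs (r - s)).
  { intros r s. rewrite Cdist_Cmod, !Cscale_mult. replace (r * alpha - s * alpha)%C with ((r - s)%R * alpha)%C
      by (rewrite RtoC_minus; ring). rewrite Cmod_mult, ha, Cmod_R. ring. }
  assert (hit : exists r, halfopen r /\ component (disk_preimage phi S) z0 (Cscale r alpha)).
  { apply NNPP. intros n. apply nr1.
    apply (interval_locally_constant halfopen (fun r => O (Cscale r alpha))) with 0.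
    - intros a b t ha' hb' ht. unfold halfopen in *. lra.
    - intros r hr'. destruct (classic (O (Cscale r alpha))) as [q|q].
      + destruct (h2 _ q) as [e [he k]]. exists e; split; auto. intros s s' _ _ _ hs' _. apply k. rewrite cont; auto.
      + assert (nc : ~ closure O (Cscale r alpha)) by (intros hcl; apply n; exists r; split; auto).
        apply not_all_ex_not in nc. destruct nc as [e nc]. apply imply_to_and in nc. destruct nc as [he nc].
        exists e; split; auto. intros s s' _ _ hs _ hO. exfalso. apply nc. exists (Cscale s alpha). rewrite cont; auto.
    - unfold halfopen; lra.
    - exact hr1.
    - replace (Cscale 0 alpha) with (RtoC 0); auto. rewrite Cscale_mult. ring. }
  destruct hit as [r [hr' hcomp]]. exists r, O. split; [exact hr'|].
  split; [apply component_sub in hcomp; exact hcomp|]. do 4 (split; [assumption|]).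
  intros z q1 q2 q3. apply component_trans with z0; [apply component_sym; auto|]. apply h6; auto.
Qed.

(** A connected set from alpha to 0 off the closure of [Sh] would stay on the side of [O], which
    fills no neighbourhood of alpha in the disk. *)
Lemma separates_from_side (O Sh : C -> Prop) alpha : is_open O -> O (RtoC 0) -> (forall z, O z -> unit_disk z) ->
  ~ near_in O alpha -> (forall z, unit_disk z -> closure O z -> ~ O z -> Sh z) ->
  Cmod alpha = 1 -> ~ closure Sh alpha -> ~ closure Sh (RtoC 0) ->
  separates (closure Sh) closed_unit_disk alpha C0.
Proof.
  intros oO O0 OD na bd ha n1 n2. unfold separates, closed_unit_disk. rewrite !Cnorm_Cmod. repeat split; auto.
  - lra.
  - change C0 with (RtoC 0). rewrite Cmod_0; lra.
  - intros [K [conK [hK [Ka K0]]]]. apply na.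
    apply (side_constant O Sh K oO bd conK) with (RtoC 0); auto.
    + intros z hz. destruct (hK z hz) as [h1 h2]. rewrite Cnorm_Cmod in h1. auto.
    + destruct (oO _ O0) as [e [he k]]. exists e. split; auto.
Qed.

(* Otherwise the maximum principle on O would bound |phi 0 - p| by eps. *)
Lemma single_cluster_impossible Om phi M alpha p S g eps z0 (O : C -> Prop) b :
  holomorphic_on unit_disk phi -> covering_map unit_disk Om phi -> (forall z, unit_disk z -> Cmod (phi z) <= M) ->
  Cmod alpha = 1 -> periodic_param S g -> (forall z, S z -> Cdist z p < eps) -> eps < Cdist (phi (RtoC 0)) p ->
  is_open O -> O (RtoC 0) -> (forall z, O z -> unit_disk z) -> ~ near_in O alpha ->
  (forall z, unit_disk z -> closure O z -> ~ O z -> component (disk_preimage phi S) z0 z) ->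
  Cmod b = 1 -> b <> alpha ->
  (forall z, closure (component (disk_preimage phi S) z0) z -> Cmod z = 1 -> z = b) -> False.
Proof.
  intros hf hc hM ha hg hS he0 oO O0 OD na bd hb hba hcl.
  set (Sh := component (disk_preimage phi S) z0) in *.
  assert (heps : 0 < eps) by (eapply periodic_param_eps; eauto).
  assert (K : Cmod (phi (RtoC 0) - p)%C <= eps).
  { apply (max_principle_except O (fun z => phi z - p)%C eps (M + Cmod p) b); auto.
    - exists 1. intros z hz. left. apply OD; auto.
    - intros z hz. destruct (hf z (OD z hz)) as [L hL]. eexists.
      apply (cderiv_plus phi (fun _ => - p)%C); [exact hL|apply cderiv_const].
    - intros h. apply OD, unit_disk_Cmod in h. lra.
    - intros z hz. specialize (hM z (OD z hz)). pose proof (Cmod_triangle (phi z) (- p)%C).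
      rewrite Cmod_opp in H. unfold Cminus. lra.
    - intros xi [hx1 hx2] hxb.
      destruct (Rle_lt_dec 1 (Cmod xi)) as [hge|hlt].
      (* A boundary point of [O] on the circle other than [b] would put the whole circle minus [b]
         on the side of [O], and alpha with it. *)
      + exfalso.
        assert (hx : Cmod xi = 1).
        { apply Rle_antisym; auto. apply le_epsilon. intros e he. destruct (hx1 e he) as [w [hw hd]].
          apply OD, unit_disk_Cmod in hw. pose proof (Cmod_dist_le w xi) as T. apply Rabs_le_between in T. lra. }
        assert (nc : forall z, Cmod z = 1 /\ z <> b -> Cmod z <= 1 /\ ~ closure Sh z).
        { intros z [h1 h2]. split; [lra|]. intros h. apply h2, hcl; auto. }
        apply na.
        apply (side_constant O Sh (fun z => Cmod z = 1 /\ z <> b) oO bd (circle_minus_point_connected b hb) nc) with xi; auto.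
        destruct (nc xi (conj hx hxb)) as [_ hn].
        apply not_all_ex_not in hn. destruct hn as [d hn]. apply imply_to_and in hn. destruct hn as [hd hn].
        destruct (hx1 d hd) as [y [hy1 hy2]].
        exists d. split; auto. intros w hw1 hw2.
        apply (ball_same_side O Sh xi d oO bd) with y; auto.
        intros v hv hs. apply hn. exists v; auto.
      + assert (ux : unit_disk xi) by (apply unit_disk_Cmod; auto).
        assert (hsx : Sh xi) by (apply bd; auto).
        apply component_sub in hsx. destruct hsx as [_ hsx]. apply hS in hsx.
        intros e he. assert (cphi : continuous_on unit_disk phi) by apply hc.
        destruct (cphi xi ux e he) as [d [hd k]]. exists d; split; auto. intros z hz hzx.
        specialize (k z (OD z hz) hzx). rewrite <- Cdist_Cmod. pose proof (Cdist_tri (phi z) (phi xi) p). lra. }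
  rewrite <- Cdist_Cmod in K. lra.
Qed.

(** * Lifts of a curve contained in Omega *)

Definition full_lift (phi : C -> C) (g gh : R -> C) : Prop :=
  (forall t, rcont allR gh t) /\ forall t, unit_disk (gh t) /\ phi (gh t) = g t.

Lemma rconvex_allR : rconvex allR.
Proof. intros ? ? ? _ _ _. exact I. Qed.

Lemma rcont_shift (gh : R -> C) c t : (forall t, rcont allR gh t) -> rcont allR (fun x => gh (x + c)) t.
Proof.
  intros h e he. destruct (h (t + c) e he) as [d [hd k]]. exists d; split; auto. intros s _ hs.
  apply k; [exact I|]. replace (s + c - (t + c)) with (s - t) by ring. auto.
Qed.

Lemma full_lift_agree Om phi g g' (h h' : R -> C) : covering_map unit_disk Om phi ->
  full_lift phi g h -> full_lift phi g' h' -> (forall t, g t = g' t) ->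
  forall s, h s = h' s -> forall t, h t = h' t.
Proof.
  intros hc [c1 h1] [c2 h2] E s Es t.
  apply (lift_unique unit_disk Om phi allR h h' hc rconvex_allR) with (s := s); auto; try exact I.
  - intros x _. apply h1.
  - intros x _. apply h2.
  - intros x _. destruct (h1 x) as [_ ->]. destruct (h2 x) as [_ ->]. auto.
Qed.

Lemma full_lift_shift phi g h c : full_lift phi g h -> full_lift phi (fun t => g (t + c)) (fun t => h (t + c)).
Proof. intros [c1 h1]. split; [intros; apply rcont_shift; auto|]. intros t. apply h1. Qed.

(** A coincidence of two values projects to s = t + k; the lift and its shift by [k] then agree at
    one parameter, hence everywhere. *)
Lemma full_lift_periodic Om phi S g h s t : covering_map unit_disk Om phi -> periodic_param S g ->
  full_lift phi g h -> h s = h t -> s <> t ->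
  exists k : Z, IZR k <> 0 /\ forall x, h (x + IZR k) = h x.
Proof.
  intros hc [cg [per [inj hS]]] hf E hne.
  assert (E2 : g s = g t).
  { destruct hf as [_ hf]. destruct (hf s) as [_ <-]. destruct (hf t) as [_ <-]. rewrite E; auto. }
  destruct (inj _ _ E2) as [k hk]. exists k. split; [intros h0; apply hne; lra|].
  apply (full_lift_agree Om phi (fun t => g (t + IZR k)) g _ h hc (full_lift_shift phi g h _ hf) hf (fun t => per t k) t).
  rewrite <- hk. auto.
Qed.

(** The image is that of a single period, hence closed and inside the open disk. *)
Lemma periodic_image_in_disk phi g h k : full_lift phi g h -> IZR k <> 0 -> (forall x, h (x + IZR k) = h x) ->
  forall z, closure (fun z => exists t, h t = z) z -> Cmod z < 1.
Proof.
  intros [ch hh] hk per z hz.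
  set (l := Rabs (IZR k)). assert (hl : 0 < l) by (apply Rabs_pos_lt; auto).
  set (p := fun x => h (x * l)).
  assert (cp : forall x, unit_interval x -> rcont unit_interval p x).
  { intros x _ e he. destruct (ch (x * l) e he) as [d [hd k']]. exists (d / l).
    split; [apply Rdiv_lt_0_compat; auto|]. intros y _ hy. apply k'; [exact I|].
    replace (y * l - x * l) with ((y - x) * l) by ring. rewrite Rabs_mult, (Rabs_right l) by lra.
    apply Rmult_lt_reg_r with (/ l); [apply Rinv_0_lt_compat; auto|]. rewrite Rmult_assoc, Rinv_r by lra. lra. }
  assert (perl : forall x (n : nat), h (x + INR n * l) = h x).
  { assert (p1 : forall x, h (x + l) = h x).
    { intros x. unfold l, Rabs. destruct (Rcase_abs (IZR k)); [|auto].
      rewrite <- (per (x + - IZR k)). f_equal. ring. }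
    intros x n. induction n as [|n IH]; [f_equal; simpl; ring|].
    rewrite <- IH, <- (p1 (x + INR n * l)), S_INR. f_equal. ring. }
  assert (perz : forall x (n : Z), h (x + IZR n * l) = h x).
  { intros x n. destruct (Z.le_gt_cases 0 n) as [h0|h0].
    - rewrite <- (Z2Nat.id n h0), <- INR_IZR_INZ. apply perl.
    - rewrite <- (perl (x + IZR n * l) (Z.to_nat (- n))), INR_IZR_INZ, Z2Nat.id, opp_IZR by lia. f_equal. ring. }
  assert (hc : exists x, unit_interval x /\ p x = z).
  { apply (closed_closure (fun z => exists x, unit_interval x /\ p x = z)); [apply path_image_closed; auto|].
    apply closure_mono with (fun z => exists t, h t = z); auto. intros w [t <-].
    pose proof (base_Int_part (t / l)) as hn. set (n := Int_part (t / l)) in *.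
    exists (t / l - IZR n). split; [unfold unit_interval; lra|]. unfold p.
    rewrite <- (perz t (- n)%Z). f_equal. rewrite opp_IZR. field. lra. }
  destruct hc as [x [_ <-]]. apply unit_disk_Cmod. apply hh.
Qed.

(** Otherwise values at parameters tending to infinity accumulate at a point of the disk. The
    passages through a flow box there are integer shifts of the same arc, and injectivity makes the
    shifts equal, so the parameters would stay bounded. *)
Lemma full_lift_proper Om phi S g h : covering_map unit_disk Om phi -> periodic_param S g ->
  full_lift phi g h -> (forall s t, h s = h t -> s = t) ->
  forall rho, rho < 1 -> exists B, forall t, B < Rabs t -> rho < Cmod (h t).
Proof.
  intros hc hg hf hinj rho hrho. apply NNPP. intros n.
  assert (W : forall B, exists t, B < Rabs t /\ Cmod (h t) <= rho).
  { intros B. apply NNPP. intros n'. apply n. exists B. intros t ht. apply Rnot_le_lt. intros hle.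
    apply n'. exists t; auto. }
  set (w := fun k : nat => epsilon (inhabits 0) (fun t => INR k < Rabs t /\ Cmod (h t) <= rho)).
  assert (hw : forall k, INR k < Rabs (w k) /\ Cmod (h (w k)) <= rho)
    by (intros k; apply (epsilon_spec (inhabits 0) _ (W (INR k)))).
  destruct (bolzano_weierstrass (fun k => h (w k)) rho) as [z hz]; [apply hw|].
  pose proof hg as [cg [per [inj hS]]]. pose proof hf as [ch hh].
  assert (zD : unit_disk z).
  { apply unit_disk_Cmod. apply Rle_lt_trans with rho; auto. apply le_epsilon. intros e he.
    destruct (hz e O he) as [k [_ hk]]. destruct (hw k) as [_ h2].
    pose proof (Cmod_dist_le (h (w k)) z) as T. apply Rabs_le_between in T. lra. }
  assert (zF : disk_preimage phi S z).
  { apply (preimage_closed Om phi S g hc hg z zD). intros e he. destruct (hz e O he) as [k [_ hk]].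
    exists (h (w k)). split; auto. destruct (hh (w k)) as [h1 h2]. split; auto. rewrite h2. apply hS. exists (w k); auto. }
  destruct zF as [_ zS]. pose proof (proj1 (hS _) zS) as [t E].
  destruct (flow_box Om phi S g z t hc hg zD (eq_sym E)) as [d [lam [r [hd [hr [l0 [h1 h2]]]]]]].
  assert (box : forall k, Cdist (h (w k)) z < r -> exists (m : Z) s, Rabs (s - t) < d /\ w k = s + IZR m /\
     forall y, Rabs (y - t) < d -> h (y + IZR m) = lam y).
  { intros k hk. destruct (hh (w k)) as [u1 u2].
    destruct (h2 (h (w k)) u1) as [s [hs Es]]; auto; [rewrite u2; apply hS; exists (w k); auto|].
    assert (E3 : g (w k) = g s) by (rewrite <- u2, <- Es; apply h1; auto).
    destruct (inj _ _ E3) as [m hm]. exists m, s. repeat split; auto. intros y hy.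
    apply (lift_unique unit_disk Om phi (fun s => Rabs (s - t) < d) (fun y => h (y + IZR m)) lam hc) with (s := s); auto.
    - intros a b v ha hb hv. apply Rabs_lt_between in ha, hb. apply Rabs_lt_between. lra.
    - intros v hv. apply rcont_sub with allR; [intros; exact I|]. apply rcont_shift; auto.
    - intros v hv. apply h1; auto.
    - intros v hv. apply hh.
    - intros v hv. apply h1; auto.
    - intros v hv. destruct (hh (v + IZR m)) as [_ ->]. destruct (h1 v hv) as [_ [_ [-> _]]]. apply per.
    - rewrite <- hm, Es. auto. }
  destruct (hz r O hr) as [k1 [_ hk1]]. destruct (box k1 hk1) as [m1 [s1 [a1 [b1 c1]]]].
  destruct (INR_unbounded (Rabs (w k1) + 2 * d)) as [N hN].
  destruct (hz r N hr) as [k2 [hN2 hk2]]. destruct (box k2 hk2) as [m2 [s2 [a2 [b2 c2]]]].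
  assert (tt : Rabs (t - t) < d) by (rewrite Rminus_diag, Rabs_R0; auto).
  assert (E12 : t + IZR m1 = t + IZR m2) by (apply hinj; rewrite c1, c2; auto).
  destruct (hw k2) as [q _]. apply le_INR in hN2.
  assert (Rabs (w k2) <= Rabs (w k1) + 2 * d); [|lra].
  replace (w k2) with (w k1 + (s2 - s1)) by lra.
  eapply Rle_trans; [apply Rabs_triang|]. apply Rplus_le_compat_l. apply Rabs_le.
  apply Rabs_lt_between in a1, a2. lra.
Qed.

(** The map [phi] is lifted through itself, the disk being convex. *)
Lemma deck_exists Om phi z0 z1 : holomorphic_on unit_disk phi -> covering_map unit_disk Om phi ->
  unit_disk z0 -> unit_disk z1 -> phi z0 = phi z1 ->
  exists T, holomorphic_on unit_disk T /\ (forall z, unit_disk z -> unit_disk (T z)) /\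
    (forall z, unit_disk z -> phi (T z) = phi z) /\ T z0 = z1.
Proof.
  intros hf hc h0 h1 E.
  destruct (convex_lift unit_disk Om phi unit_disk phi z0 z1 hc) as [T [cT [T0 hT]]]; auto.
  - apply convex_unit_disk.
  - apply hc.
  - apply hc.
  - exists T. repeat split; auto.
    + apply (covering_lift_holomorphic unit_disk Om phi unit_disk phi T); auto; apply open_unit_disk.
    + intros z hz. apply hT; auto.
    + intros z hz. apply hT; auto.
Qed.

Lemma deck_shift Om phi S g h T c : covering_map unit_disk Om phi -> periodic_param S g -> full_lift phi g h ->
  holomorphic_on unit_disk T -> (forall z, unit_disk z -> unit_disk (T z)) ->
  (forall z, unit_disk z -> phi (T z) = phi z) -> (forall t, g (t + c) = g t) ->
  forall s, T (h s) = h (s + c) -> forall t, T (h t) = h (t + c).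
Proof.
  intros hc hg [ch hh] hT TD Tphi gc s Es t.
  apply (full_lift_agree Om phi g (fun t => g (t + c)) (fun t => T (h t)) (fun t => h (t + c)) hc) with (s := s); auto.
  - split.
    + intros x. apply rcont_cont_at; auto. destruct (hT (h x) (proj1 (hh x))) as [L hL]. eapply cderiv_cont; exact hL.
    + intros x. destruct (hh x) as [h1 h2]. split; auto. rewrite Tphi; auto.
  - apply full_lift_shift. split; auto.
Qed.

(* pseudo-hyperbolic proximity forces euclidean proximity near the circle *)
Lemma pick_close c (a b : C) : Cmod a < 1 -> Cmod b < 1 -> 0 < c ->
  c * (Cmod (1 - Cconj a * b)%C * Cmod (1 - Cconj a * b)%C) <= (1 - Cmod a * Cmod a) * (1 - Cmod b * Cmod b) ->
  c * (Cmod (b - a)%C * Cmod (b - a)%C) <= 1 - Cmod a * Cmod a.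
Proof.
  intros ha hb hc H. rewrite pick_identity in H.
  pose proof (Cmod_ge_0 a). pose proof (Cmod_ge_0 b).
  assert (p1 : 0 <= 1 - Cmod a * Cmod a) by nra. assert (p2 : 0 <= 1 - Cmod b * Cmod b <= 1) by nra.
  set (x := 1 - Cmod a * Cmod a) in *. set (y := 1 - Cmod b * Cmod b) in *.
  assert (0 <= c * (x * y)) by (apply Rmult_le_pos; [lra|apply Rmult_le_pos; lra]).
  assert (x * y <= x) by nra. rewrite Rmult_plus_distr_l in H. lra.
Qed.

(** The hypothesis bounds the pseudo-hyperbolic distance of a and b away from 1; by Schwarz-Pick the
    same constant serves for their images. *)
Lemma pick_preserved (T : C -> C) c a b : holomorphic_on unit_disk T ->
  (forall z, unit_disk z -> unit_disk (T z)) -> unit_disk a -> unit_disk b -> 0 < c ->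
  c * (Cmod (1 - Cconj a * b)%C * Cmod (1 - Cconj a * b)%C) <= (1 - Cmod a * Cmod a) * (1 - Cmod b * Cmod b) ->
  c * (Cmod (1 - Cconj (T a) * T b)%C * Cmod (1 - Cconj (T a) * T b)%C) <=
    (1 - Cmod (T a) * Cmod (T a)) * (1 - Cmod (T b) * Cmod (T b)).
Proof.
  intros hT TD ha hb hc H. pose proof (schwarz_pick_ratio T a b hT TD ha hb) as S.
  assert (hd : 0 < Cmod (1 - Cconj a * b)%C).
  { apply Cmod_1_minus_pos; [left|]; apply unit_disk_Cmod; auto. }
  set (d := Cmod (1 - Cconj a * b)%C) in *. set (B := Cmod (1 - Cconj (T a) * T b)%C) in *.
  set (X := (1 - Cmod a * Cmod a) * (1 - Cmod b * Cmod b)) in *.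
  set (Y := (1 - Cmod (T a) * Cmod (T a)) * (1 - Cmod (T b) * Cmod (T b))) in *.
  assert (0 <= B * B) by nra. assert (0 < d * d) by nra.
  apply Rmult_le_reg_r with (d * d); auto.
  apply Rle_trans with (X * (B * B)); auto.
  replace (c * (B * B) * (d * d)) with (c * (d * d) * (B * B)) by ring. apply Rmult_le_compat_r; auto.
Qed.

Lemma unit_dist (b w : C) : Cmod b = 1 -> Cmod (1 - Cconj b * w)%C = Cmod (b - w)%C.
Proof.
  intros hb. replace (1 - Cconj b * w)%C with (Cconj b * (b - w))%C.
  - rewrite Cmod_mult, Cmod_conj, hb. ring.
  - replace (Cconj b * (b - w))%C with (b * Cconj b - Cconj b * w)%C by ring. rewrite unit_conj by auto. auto.
Qed.

Lemma one_minus_sq_pos (z : C) : Cmod z < 1 -> 0 < 1 - Cmod z * Cmod z.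
Proof. intros h. pose proof (Cmod_ge_0 z). nra. Qed.

Lemma cont_Cmod_pick z b : cont_at (fun x => RtoC (Cmod (1 - Cconj x * z)%C * Cmod (1 - Cconj x * z)%C)) b.
Proof.
  assert (c : cont_at (fun x => RtoC (Cmod (1 - Cconj x * z)%C)) b).
  { apply (cont_in_Cmod _ (fun x => 1 - Cconj x * z)%C). apply cont_in_minus; [apply cont_in_const|].
    apply cont_in_mult; [|apply cont_in_const]. apply (cont_in_conj _ (fun z => z)), cont_in_id. }
  apply (cont_in_Rmult _ (fun x => Cmod (1 - Cconj x * z)%C) (fun x => Cmod (1 - Cconj x * z)%C)); auto.
Qed.

Definition tends_infty (h : R -> C) (b : C) : Prop :=
  forall e, 0 < e -> exists B, forall t, B < t -> Cdist (h t) b < e.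

(* consecutive points of an orbit are pseudo-hyperbolically equidistant *)
Lemma orbit_close (T : C -> C) (h : R -> C) : holomorphic_on unit_disk T ->
  (forall z, unit_disk z -> unit_disk (T z)) -> (forall t, unit_disk (h t)) -> (forall t, T (h t) = h (t + 1)) ->
  exists c, 0 < c /\ forall n : nat,
    c * (Cmod (h (INR n + 1)%R - h (INR n))%C * Cmod (h (INR n + 1)%R - h (INR n))%C) <=
      1 - Cmod (h (INR n)) * Cmod (h (INR n)).
Proof.
  intros hT TD hD Th.
  assert (m : forall t, Cmod (h t) < 1) by (intros; apply unit_disk_Cmod; auto).
  set (q := Cmod (1 - Cconj (h 0) * h 1)%C).
  assert (hq : 0 < q) by (apply Cmod_1_minus_pos; auto; left; auto).
  set (c := (1 - Cmod (h 0) * Cmod (h 0)) * (1 - Cmod (h 1) * Cmod (h 1)) / (q * q)).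
  assert (hc : 0 < c).
  { apply Rdiv_lt_0_compat; [apply Rmult_lt_0_compat; apply one_minus_sq_pos; auto|nra]. }
  exists c; split; auto.
  assert (P : forall n : nat, c * (Cmod (1 - Cconj (h (INR n)) * h (INR n + 1)%R)%C * Cmod (1 - Cconj (h (INR n)) * h (INR n + 1)%R)%C) <=
     (1 - Cmod (h (INR n)) * Cmod (h (INR n))) * (1 - Cmod (h (INR n + 1)%R) * Cmod (h (INR n + 1)%R))).
  { induction n as [|n IH].
    - simpl. rewrite Rplus_0_l. fold q. unfold c. right. field. lra.
    - rewrite S_INR. rewrite <- (Th (INR n + 1)%R), <- (Th (INR n)) at 1.
      rewrite <- (Th (INR n + 1)%R), <- (Th (INR n)) at 1.
      pose proof (pick_preserved T c (h (INR n)) (h (INR n + 1)%R) hT TD (hD _) (hD _) hc IH) as Q.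
      rewrite !Th in Q |- *. exact Q. }
  intros n. apply pick_close; auto.
Qed.

(* T does not increase the horofunction |b - z|^2 / (1 - |z|^2) at a suitable limit point b of the
   orbit: this is the limit of the Schwarz-Pick inequality along orbit points tending to b. *)
Lemma orbit_converges (T : C -> C) (h : R -> C) : holomorphic_on unit_disk T ->
  (forall z, unit_disk z -> unit_disk (T z)) -> (forall t, unit_disk (h t)) -> (forall t, T (h t) = h (t + 1)) ->
  (forall t, rcont allR h t) ->
  (forall rho, rho < 1 -> exists B, forall t, B < Rabs t -> rho < Cmod (h t)) ->
  exists b, Cmod b = 1 /\ tends_infty h b.
Proof.
  intros hT TD hD Th ch prop.
  assert (m : forall t, Cmod (h t) < 1) by (intros; apply unit_disk_Cmod; auto).
  assert (mp : forall t, 0 < 1 - Cmod (h t) * Cmod (h t)) by (intros; apply one_minus_sq_pos; auto).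
  destruct (orbit_close T h hT TD hD Th) as [c [hc close]].
  (* The moduli tend to 1, so they cannot decrease from some index on; the limit point [b] is taken
     along indices whose next modulus is not smaller. *)
  assert (good : forall N : nat, exists n, (N <= n)%nat /\ Cmod (h (INR n)) <= Cmod (h (INR n + 1)%R)).
  { intros N. apply NNPP. intros no.
    assert (dec : forall k : nat, Cmod (h (INR (N + k))) <= Cmod (h (INR N))).
    { induction k as [|k IH]; [rewrite Nat.add_0_r; lra|].
      rewrite Nat.add_succ_r, S_INR. eapply Rle_trans; [|exact IH]. left. apply Rnot_le_lt. intros hle.
      apply no. exists (N + k)%nat. split; auto; lia. }
    destruct (prop (Cmod (h (INR N))) (m _)) as [B hB].
    destruct (INR_unbounded (Rabs B)) as [k hk].
    specialize (hB (INR (N + k))). rewrite Rabs_right in hB by (apply Rle_ge, pos_INR).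
    specialize (dec k). rewrite plus_INR in *. pose proof (pos_INR N). pose proof (Rle_abs B).
    specialize (hB ltac:(lra)). lra. }
  set (sg := fun N => epsilon (inhabits O) (fun n => (N <= n)%nat /\ Cmod (h (INR n)) <= Cmod (h (INR n + 1)%R))).
  assert (hsg : forall N, (N <= sg N)%nat /\ Cmod (h (INR (sg N))) <= Cmod (h (INR (sg N) + 1)))
    by (intros N; apply (epsilon_spec (inhabits O) _ (good N))).
  destruct (bolzano_weierstrass (fun N => h (INR (sg N))) 1) as [b hb]; [intros; left; auto|].
  assert (near : forall e rho, 0 < e -> rho < 1 -> exists n : nat, Cdist (h (INR n)) b < e /\ rho < Cmod (h (INR n)) /\
     Cmod (h (INR n)) <= Cmod (h (INR n + 1)%R)).
  { intros e rho he hrho. destruct (prop rho hrho) as [B hB]. destruct (INR_unbounded B) as [N hN].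
    destruct (hb e N he) as [k [hk1 hk2]]. destruct (hsg k) as [h1 h2].
    exists (sg k). repeat split; auto. apply hB. rewrite Rabs_right by (apply Rle_ge, pos_INR).
    assert (INR N <= INR (sg k)) by (apply le_INR; lia). lra. }
  assert (b1 : Cmod b = 1).
  { apply cond_eq. intros e he.
    destruct (near (e / 2) (1 - Rmin (e / 2) 1)) as [n [h1 [h2 _]]]; [lra|pose proof (Rmin_pos (e/2) 1 ltac:(lra) Rlt_0_1); lra|].
    pose proof (Rmin_l (e / 2) 1). pose proof (m (INR n)). pose proof (Cmod_dist_le (h (INR n)) b) as Q. apply Rabs_le_between in Q.
    apply Rabs_lt_between. lra. }
  assert (horo : forall z, unit_disk z ->
    Cmod (b - T z)%C * Cmod (b - T z)%C * (1 - Cmod z * Cmod z) <= Cmod (b - z)%C * Cmod (b - z)%C * (1 - Cmod (T z) * Cmod (T z))).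
  { intros z hz. rewrite <- (unit_dist b (T z)), <- (unit_dist b z) by auto.
    assert (mz : Cmod z < 1) by (apply unit_disk_Cmod; auto).
    assert (mTz : Cmod (T z) < 1) by (apply unit_disk_Cmod; auto).
    pose proof (one_minus_sq_pos z mz) as pz. pose proof (one_minus_sq_pos (T z) mTz) as pTz.
    pose proof (Cmod_ge_0 z). pose proof (Cmod_ge_0 (T z)).
    apply le_epsilon. intros e he.
    destruct (cont_Cmod_pick (T z) b (e / 2)) as [d1 [hd1 k1]]; [lra|].
    destruct (cont_Cmod_pick z b (e / 2)) as [d2 [hd2 k2]]; [lra|].
    set (d := Rmin d1 d2). assert (hd : 0 < d) by (apply Rmin_pos; auto).
    assert (dd1 : d <= d1) by apply Rmin_l. assert (dd2 : d <= d2) by apply Rmin_r. clearbody d.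
    (* So close to the circle that the orbit step from a to a' is shorter than d / 2. *)
    set (e' := Rmin (1 / 2) (c * (d / 2 * (d / 2)) / 2)).
    assert (he' : 0 < e') by (apply Rmin_pos; [lra|]; apply Rdiv_lt_0_compat; [|lra]; apply Rmult_lt_0_compat; nra).
    assert (e'1 : e' <= 1 / 2) by apply Rmin_l. assert (e'2 : e' <= c * (d / 2 * (d / 2)) / 2) by apply Rmin_r.
    clearbody e'.
    destruct (near (d / 2) (1 - e')) as [n [n1 [n2 n3]]]; [lra|lra|].
    set (a := h (INR n)) in *. set (a' := h (INR n + 1)%R) in *.
    assert (ma : Cmod a < 1) by apply m. assert (ma' : Cmod a' < 1) by apply m.
    assert (Ta : T a = a') by apply Th.
    specialize (close n). fold a a' in close. rewrite <- Cdist_Cmod in close.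
    assert (da : Cdist a' a < d / 2).
    { apply Rnot_le_lt. intros hle.
      assert (d / 2 * (d / 2) <= Cdist a' a * Cdist a' a) by (apply Rmult_le_compat; lra).
      assert (c * (d / 2 * (d / 2)) <= c * (Cdist a' a * Cdist a' a)) by (apply Rmult_le_compat_l; lra).
      pose proof (Cmod_ge_0 a). nra. }
    specialize (k1 a' I). specialize (k2 a I).
    pose proof (Cdist_tri a' a b) as T1. specialize (k1 ltac:(lra)). specialize (k2 ltac:(lra)).
    rewrite Cdist_Cmod, <- RtoC_minus, Cmod_R in k1, k2. apply Rabs_lt_between in k1, k2.
    pose proof (schwarz_pick_ratio T a z hT TD (hD _) hz) as S. rewrite Ta in S.
    pose proof (one_minus_sq_pos a ma) as pa. pose proof (one_minus_sq_pos a' ma') as pa'.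
    assert (paa : 1 - Cmod a' * Cmod a' <= 1 - Cmod a * Cmod a) by (pose proof (Cmod_ge_0 a); nra).
    set (X := Cmod (1 - Cconj a' * T z)%C * Cmod (1 - Cconj a' * T z)%C) in *.
    set (Y := Cmod (1 - Cconj a * z)%C * Cmod (1 - Cconj a * z)%C) in *.
    assert (Y0 : 0 <= Y) by (apply Rmult_le_pos; apply Cmod_ge_0).
    (* Here the choice of the indices enters: 1 - |a'|^2 <= 1 - |a|^2 lets these two factors be
       dropped. *)
    assert (S2 : (1 - Cmod z * Cmod z) * X <= (1 - Cmod (T z) * Cmod (T z)) * Y).
    { apply Rmult_le_reg_l with (1 - Cmod a * Cmod a); auto.
      apply Rle_trans with ((1 - Cmod a' * Cmod a') * (1 - Cmod (T z) * Cmod (T z)) * Y); [lra|].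
      rewrite <- Rmult_assoc. apply Rmult_le_compat_r; auto. apply Rmult_le_compat_r; lra. }
    set (X' := Cmod (1 - Cconj b * T z)%C * Cmod (1 - Cconj b * T z)%C) in *.
    set (Y' := Cmod (1 - Cconj b * z)%C * Cmod (1 - Cconj b * z)%C) in *.
    assert (q1 : X' * (1 - Cmod z * Cmod z) <= (X + e / 2) * (1 - Cmod z * Cmod z)) by (apply Rmult_le_compat_r; lra).
    assert (q2 : Y * (1 - Cmod (T z) * Cmod (T z)) <= (Y' + e / 2) * (1 - Cmod (T z) * Cmod (T z))) by (apply Rmult_le_compat_r; lra).
    assert (q3 : e / 2 * (1 - Cmod z * Cmod z) <= e / 2) by nra.
    assert (q4 : e / 2 * (1 - Cmod (T z) * Cmod (T z)) <= e / 2) by nra.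
    rewrite Rmult_plus_distr_r in q1, q2. rewrite (Rmult_comm _ X), (Rmult_comm _ Y) in S2.
    eapply Rle_trans; [exact q1|]. eapply Rle_trans; [apply Rplus_le_compat; [exact S2|exact q3]|].
    eapply Rle_trans; [apply Rplus_le_compat_r; exact q2|]. lra. }
  exists b. split; auto.
  (* The horofunction is bounded by some [H] on the first unit of the parameter, and [horo]
     transports the bound to every later unit. *)
  assert (exists H, 0 < H /\ forall t, 0 <= t <= 1 -> Cmod (b - h t)%C * Cmod (b - h t)%C <= H * (1 - Cmod (h t) * Cmod (h t)))
    as [H [hH h01]].
  { set (K := fun z => exists t, unit_interval t /\ h t = z).
    destruct (compact_lower_bound K (fun z => RtoC (1 - Cmod z * Cmod z)) 1) as [mu [hmu kmu]].
    - apply path_image_closed. intros t _. apply rcont_sub with allR; [intros; exact I|auto].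
    - intros z [t [_ <-]]. left; auto.
    - intros z _. apply (cont_in_Rplus K (fun _ => 1) (fun z => - (Cmod z * Cmod z))); [apply cont_in_const|].
      apply (cont_in_real K Ropp (fun z => Cmod z * Cmod z)).
      + apply continuity_pt_opp, derivable_continuous_pt, derivable_pt_id.
      + apply (cont_in_Rmult K Cmod Cmod); apply (cont_in_Cmod K (fun z => z)), cont_in_id.
    - intros z [t [_ <-]] E. apply RtoC_inj in E. specialize (mp t). lra.
    - exists (4 / mu). split; [apply Rdiv_lt_0_compat; lra|]. intros t ht.
      assert (kt : mu <= 1 - Cmod (h t) * Cmod (h t)).
      { specialize (kmu (h t)). rewrite Cmod_R, Rabs_right in kmu by (specialize (mp t); lra). apply kmu. exists t; auto. }
      assert (Cmod (b - h t)%C <= 2).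
      { pose proof (Cmod_triangle b (- h t)%C) as Q. rewrite Cmod_opp in Q. specialize (m t). unfold Cminus. lra. }
      pose proof (Cmod_ge_0 (b - h t)%C).
      apply Rle_trans with (2 * 2); [apply Rmult_le_compat; auto|].
      apply Rle_trans with (4 / mu * mu); [right; field; lra|]. apply Rmult_le_compat_l; [|auto].
      left. apply Rdiv_lt_0_compat; lra. }
  assert (hN : forall n : nat, forall t, INR n <= t <= INR n + 1 ->
    Cmod (b - h t)%C * Cmod (b - h t)%C <= H * (1 - Cmod (h t) * Cmod (h t))).
  { induction n as [|n IH]; intros t ht; [apply h01; simpl in ht; lra|].
    rewrite S_INR in ht. specialize (IH (t - 1) ltac:(lra)).
    pose proof (horo (h (t - 1)) (hD _)) as Q. rewrite Th in Q. replace (t - 1 + 1) with t in Q by ring.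
    pose proof (mp t). pose proof (mp (t - 1)).
    apply Rmult_le_reg_r with (1 - Cmod (h (t - 1)) * Cmod (h (t - 1))); auto.
    eapply Rle_trans; [exact Q|].
    replace (H * (1 - Cmod (h t) * Cmod (h t)) * (1 - Cmod (h (t - 1)) * Cmod (h (t - 1)))) with
      (H * (1 - Cmod (h (t - 1)) * Cmod (h (t - 1))) * (1 - Cmod (h t) * Cmod (h t))) by ring.
    apply Rmult_le_compat_r; lra. }
  assert (hall : forall t, 0 <= t -> Cmod (b - h t)%C * Cmod (b - h t)%C <= H * (1 - Cmod (h t) * Cmod (h t))).
  { intros t ht. pose proof (base_Int_part t) as hn.
    assert (0 <= Int_part t)%Z.
    { assert (IZR (-1) < IZR (Int_part t)) by lra. apply lt_IZR in H0. lia. }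
    apply (hN (Z.to_nat (Int_part t))). rewrite INR_IZR_INZ, Z2Nat.id by auto. lra. }
  (* Since 1 - |h t|^2 tends to 0, boundedness of the horofunction forces |b - h t| to 0. *)
  intros e he. set (r := Rmin (1 / 2) (e * e / (4 * H))).
  assert (hr : 0 < r) by (apply Rmin_pos; [lra|]; apply Rdiv_lt_0_compat; nra).
  assert (r1 : r <= 1 / 2) by apply Rmin_l.
  assert (r2 : r * (4 * H) <= e * e).
  { apply Rle_trans with (e * e / (4 * H) * (4 * H)); [apply Rmult_le_compat_r; [lra|apply Rmin_r]|right; field; lra]. }
  clearbody r.
  destruct (prop (1 - r)) as [B hB]; [lra|].
  exists (Rmax B 0). intros t ht. pose proof (Rmax_l B 0). pose proof (Rmax_r B 0).
  specialize (hB t). rewrite Rabs_right in hB by lra. specialize (hB ltac:(lra)).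
  specialize (hall t ltac:(lra)). rewrite Cdist_sym, Cdist_Cmod. pose proof (m t).
  apply Rnot_le_lt. intros hle.
  assert (e * e <= Cmod (b - h t)%C * Cmod (b - h t)%C) by (apply Rmult_le_compat; lra).
  assert (1 - Cmod (h t) * Cmod (h t) <= 2 * r) by nra.
  assert (H * (1 - Cmod (h t) * Cmod (h t)) <= H * (2 * r)) by (apply Rmult_le_compat_l; lra). nra.
Qed.

(** * Deck transformations fixing the end of the radius *)

(** The map of the disk onto the right half-plane that sends [al] to infinity; its real part is the
    Poisson kernel at [al], the reciprocal of the horofunction. *)
Definition cayley (al z : C) : C := ((al + z) / (al - z))%C.
Definition cayley_inv (al w : C) : C := (al * ((w - 1) / (w + 1)))%C.
Definition half_plane (w : C) : Prop := 0 < fst w.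

Lemma fst_Cdiv (a u : C) : u <> RtoC 0 -> fst (a / u)%C = fst (a * Cconj u)%C / (Cmod u * Cmod u).
Proof.
  intros hu. assert (h : 0 < Cmod u * Cmod u) by (apply Cmod_gt_0 in hu; nra).
  rewrite Cmod_sq in *. destruct a, u. unfold Cdiv, Cmult, Cinv, Cconj in *; simpl in *. field. nra.
Qed.

Lemma disk_sub_neq0 (al z : C) : Cmod al = 1 -> Cmod z < 1 -> (al - z)%C <> RtoC 0.
Proof. intros ha hz. apply Cminus_eq_contra. intros ->. lra. Qed.

Lemma fst_cayley (al z : C) : Cmod al = 1 -> Cmod z < 1 ->
  fst (cayley al z) = (1 - Cmod z * Cmod z) / (Cmod (al - z)%C * Cmod (al - z)%C).
Proof.
  intros ha hz. unfold cayley. rewrite fst_Cdiv by (apply disk_sub_neq0; auto). f_equal.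
  assert (E : 1 = Cmod al * Cmod al) by (rewrite ha; ring). rewrite E, !Cmod_sq.
  destruct al, z. unfold Cmult, Cconj, Cplus, Cminus, Copp; simpl. ring.
Qed.

Lemma cayley_half_plane (al z : C) : Cmod al = 1 -> Cmod z < 1 -> half_plane (cayley al z).
Proof.
  intros ha hz. unfold half_plane. rewrite fst_cayley by auto.
  pose proof (disk_sub_neq0 al z ha hz) as n. apply Cmod_gt_0 in n.
  apply Rdiv_lt_0_compat; [apply one_minus_sq_pos; auto|nra].
Qed.

Lemma half_plane_neq (w : C) : half_plane w -> (w + 1)%C <> RtoC 0.
Proof.
  unfold half_plane. intros hw E. apply (f_equal fst) in E. unfold Cplus, RtoC in E; simpl in E. lra.
Qed.

Lemma cayley_inv_disk (al w : C) : Cmod al = 1 -> half_plane w -> unit_disk (cayley_inv al w).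
Proof.
  intros ha hw. apply unit_disk_Cmod. unfold cayley_inv.
  pose proof (half_plane_neq w hw) as n. rewrite Cmod_mult, ha, Rmult_1_l, Cmod_div by auto.
  apply Cmod_gt_0 in n. apply Rmult_lt_reg_r with (Cmod (w + 1)%C); auto.
  unfold Rdiv. rewrite Rmult_assoc, Rinv_l, Rmult_1_r, Rmult_1_l by lra.
  apply Rsqr_incrst_0; try apply Cmod_ge_0. unfold Rsqr. rewrite !Cmod_sq. unfold half_plane in hw.
  destruct w; unfold Cminus, Cplus, Copp, RtoC; simpl in *. nra.
Qed.

Lemma cayley_inv_cayley (al z : C) : Cmod al = 1 -> Cmod z < 1 -> cayley_inv al (cayley al z) = z.
Proof.
  intros ha hz. unfold cayley_inv, cayley. pose proof (disk_sub_neq0 al z ha hz) as n.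
  assert (a0 : al <> RtoC 0) by (apply Cmod_gt_0; lra).
  assert (n2 : (al + z + (al - z))%C <> RtoC 0).
  { replace (al + z + (al - z))%C with (2 * al)%C by ring. apply Cmult_neq_0; auto.
    intros E. apply RtoC_inj in E. lra. }
  field. repeat split; auto.
Qed.

Lemma cayley_cayley_inv (al w : C) : Cmod al = 1 -> half_plane w -> cayley al (cayley_inv al w) = w.
Proof.
  intros ha hw. unfold cayley_inv, cayley. pose proof (half_plane_neq w hw) as n.
  assert (a0 : al <> RtoC 0) by (apply Cmod_gt_0; lra).
  assert (n2 : (al * (w + 1) - al * (w - 1))%C <> RtoC 0).
  { replace (al * (w + 1) - al * (w - 1))%C with (2 * al)%C by ring. apply Cmult_neq_0; auto.
    intros E. apply RtoC_inj in E. lra. }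
  field. repeat split; auto.
Qed.

Lemma open_half_plane : is_open half_plane.
Proof.
  intros w hw. exists (fst w). split; auto. intros y hy. unfold half_plane in *.
  pose proof (Cdist_fst y w) as T. apply Rabs_le_between in T. lra.
Qed.

Lemma holomorphic_cayley_inv al : holomorphic_on half_plane (cayley_inv al).
Proof.
  intros w hw. eexists. unfold cayley_inv.
  apply (cderiv_mult (fun _ => al) (fun w => (w - 1) / (w + 1))%C); [apply cderiv_const|].
  apply (cderiv_mult (fun w => w - 1)%C (fun w => / (w + 1))%C).
  - apply (cderiv_plus (fun w => w) (fun _ => - RtoC 1)%C); [apply cderiv_id|apply cderiv_const].
  - apply (cderiv_inv (fun w => w + 1)%C); [apply half_plane_neq; auto|].
    apply (cderiv_plus (fun w => w) (fun _ => RtoC 1)); [apply cderiv_id|apply cderiv_const].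
Qed.

Lemma holomorphic_cayley al : Cmod al = 1 -> holomorphic_on unit_disk (cayley al).
Proof.
  intros ha z hz. apply unit_disk_Cmod in hz. eexists. unfold cayley.
  apply (cderiv_mult (fun z => al + z)%C (fun z => / (al - z))%C).
  - apply (cderiv_plus (fun _ => al) (fun z => z)); [apply cderiv_const|apply cderiv_id].
  - apply (cderiv_inv (fun z => al - z)%C); [apply disk_sub_neq0; auto|].
    apply (cderiv_plus (fun _ => al) (fun z => - z)%C); [apply cderiv_const|].
    apply cderiv_ext with (fun z => - RtoC 1 * z)%C; [intros; ring|]. apply cderiv_scal.
Qed.

Lemma holomorphic_comp (U V : C -> Prop) f g : holomorphic_on U f -> holomorphic_on V g ->
  (forall z, U z -> V (f z)) -> holomorphic_on U (fun z => g (f z)).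
Proof.
  intros hf hg H z hz. destruct (hf z hz) as [L hL]. destruct (hg (f z) (H z hz)) as [L' hL'].
  eexists. apply (cderiv_comp f g z L L'); auto.
Qed.

(** A large disk tangent to the imaginary axis at 0 contains both points; constancy on disks thus
    becomes constancy on the half-plane. *)
Lemma half_plane_balls (a b : C) : half_plane a -> half_plane b -> exists c r,
  Cdist a c < r /\ Cdist b c < r /\ forall z, Cdist z c < r -> half_plane z.
Proof.
  unfold half_plane. intros ha hb.
  assert (K : forall w : C, 0 < fst w -> forall r, (Cmod w * Cmod w) / fst w < r -> Cdist w (RtoC r) < r).
  { intros w hw r hr. assert (hm : Cmod w * Cmod w < r * fst w).
    { apply Rmult_lt_compat_r with (r := fst w) in hr; auto. unfold Rdiv in hr.
      rewrite Rmult_assoc, Rinv_l in hr by lra. lra. }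
    assert (r0 : 0 < r) by (pose proof (Cmod_ge_0 w); nra).
    rewrite Cdist_Cmod. apply Rsqr_incrst_0; [|apply Cmod_ge_0|lra]. unfold Rsqr. rewrite Cmod_sq in *.
    destruct w; unfold Cminus, Cplus, Copp, RtoC; simpl in *. nra. }
  set (r := Rmax (Cmod a * Cmod a / fst a) (Cmod b * Cmod b / fst b) + 1).
  exists (RtoC r), r. repeat split.
  - apply K; auto. unfold r. pose proof (Rmax_l (Cmod a * Cmod a / fst a) (Cmod b * Cmod b / fst b)). lra.
  - apply K; auto. unfold r. pose proof (Rmax_r (Cmod a * Cmod a / fst a) (Cmod b * Cmod b / fst b)). lra.
  - intros z hz. pose proof (Cdist_fst z (RtoC r)) as T. apply Rabs_le_between in T. simpl in T. lra.
Qed.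

(** The real part of L v vanishes for the directions v = 1 and v = i, which gives both coordinates
    of [L]. *)
Lemma cderiv_real_part_zero (f : C -> C) z r L : 0 < r -> (forall w, Cdist w z < r -> fst (f w) = 0) ->
  is_cderiv f z L -> L = RtoC 0.
Proof.
  intros hr H hL. rewrite is_cderiv_Cmod in hL.
  assert (K : forall v : C, Cmod v = 1 -> fst (L * v)%C = 0).
  { intros v hv. apply cond_eq. intros e he. destruct (hL (e / 2)) as [d [hd h]]; [lra|].
    set (s := Rmin d r / 2). pose proof (Rmin_pos d r hd hr). pose proof (Rmin_l d r). pose proof (Rmin_r d r).
    set (w := (z + s * v)%C).
    assert (E : (w - z)%C = (s * v)%C) by (unfold w; ring).
    assert (Es : Cmod (w - z)%C = s) by (rewrite E, Cmod_mult, hv, Cmod_R, Rabs_right; unfold s; lra).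
    specialize (h w). rewrite Es in h. specialize (h ltac:(unfold s; lra)).
    pose proof (Cmod_fst (f w - f z - L * (w - z))%C) as Q.
    assert (F : fst (f w - f z - L * (w - z))%C = - (s * fst (L * v)%C)).
    { rewrite E. replace (fst (f w - f z - L * (s * v))%C) with (fst (f w) - fst (f z) - s * fst (L * v)%C).
      - rewrite !H; [ring|rewrite Cdist_refl; auto|rewrite Cdist_Cmod, Es; unfold s; lra].
      - unfold Cminus, Cplus, Copp, Cmult, RtoC; simpl. ring. }
    rewrite F, Rabs_Ropp, Rabs_mult, (Rabs_right s) in Q by (unfold s; lra).
    rewrite Rminus_0_r. apply Rmult_lt_reg_l with s; [unfold s; lra|]. assert (0 < s) by (unfold s; lra). nra. }
  pose proof (K (RtoC 1) Cmod_1) as k1. pose proof (K Ci Cmod_Ci) as k2.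
  destruct L as [x y]. unfold Cmult, Ci, RtoC in *; simpl in *. f_equal; lra.
Qed.

(* The horofunction at alpha is multiplied by a constant: compare Schwarz-Pick for T and its inverse
   along the orbit tending to alpha. *)
Lemma deck_horofunction (T T' : C -> C) (h : R -> C) al : Cmod al = 1 ->
  holomorphic_on unit_disk T -> (forall z, unit_disk z -> unit_disk (T z)) ->
  holomorphic_on unit_disk T' -> (forall z, unit_disk z -> unit_disk (T' z)) ->
  (forall z, unit_disk z -> T' (T z) = z) ->
  (forall t, unit_disk (h t)) -> (forall t, T (h t) = h (t + 1)) -> tends_infty h al ->
  exists lam, 0 < lam /\ forall z, unit_disk z -> fst (cayley al (T z)) = lam * fst (cayley al z).
Proof.
  intros ha hT TD hT' TD' TT hD Th lim.
  set (X := fun (a z : C) => (1 - Cmod z * Cmod z) * (Cmod (1 - Cconj a * T z)%C * Cmod (1 - Cconj a * T z)%C)).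
  set (Y := fun (a z : C) => (1 - Cmod (T z) * Cmod (T z)) * (Cmod (1 - Cconj a * z)%C * Cmod (1 - Cconj a * z)%C)).
  (* Schwarz-Pick for [T] and for its inverse are opposite inequalities, hence an equality; [cross]
     then eliminates the factors that depend on a alone. *)
  assert (E : forall a z, unit_disk a -> unit_disk z ->
    (1 - Cmod a * Cmod a) * X (T a) z = (1 - Cmod (T a) * Cmod (T a)) * Y a z).
  { intros a z ha' hz. pose proof (schwarz_pick_ratio T a z hT TD ha' hz) as S1.
    pose proof (schwarz_pick_ratio T' (T a) (T z) hT' TD' (TD a ha') (TD z hz)) as S2.
    rewrite !TT in S2 by auto. unfold X, Y. lra. }
  assert (cross : forall a z z', unit_disk a -> unit_disk z -> unit_disk z' -> X (T a) z * Y a z' = X (T a) z' * Y a z).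
  { intros a z z' ha' hz hz'. pose proof (E a z ha' hz) as E1. pose proof (E a z' ha' hz') as E2.
    assert (p1 : 0 < 1 - Cmod a * Cmod a) by (apply one_minus_sq_pos, unit_disk_Cmod; auto).
    assert (p2 : 0 < 1 - Cmod (T a) * Cmod (T a)) by (apply one_minus_sq_pos, unit_disk_Cmod; auto).
    apply Rmult_eq_reg_l with ((1 - Cmod a * Cmod a) * (1 - Cmod (T a) * Cmod (T a))); [|nra].
    replace ((1 - Cmod a * Cmod a) * (1 - Cmod (T a) * Cmod (T a)) * (X (T a) z * Y a z')) with
      (((1 - Cmod a * Cmod a) * X (T a) z) * ((1 - Cmod (T a) * Cmod (T a)) * Y a z')) by ring.
    rewrite E1, <- E2. ring. }
  assert (cX : forall z, cont_at (fun a => RtoC (X a z)) al).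
  { intros z. apply (cont_in_Rmult _ (fun _ => 1 - Cmod z * Cmod z)); [apply cont_in_const|apply cont_Cmod_pick]. }
  assert (cY : forall z, cont_at (fun a => RtoC (Y a z)) al).
  { intros z. apply (cont_in_Rmult _ (fun _ => 1 - Cmod (T z) * Cmod (T z))); [apply cont_in_const|apply cont_Cmod_pick]. }
  (* Limit of [cross] with a = h t and T a = h (t + 1), both tending to [al]. *)
  assert (lcross : forall z z', unit_disk z -> unit_disk z' -> X al z * Y al z' = X al z' * Y al z).
  { intros z z' hz hz'. apply RtoC_inj. apply Cdist_eq0. apply Rle_antisym; [|apply Cdist_pos].
    apply le_epsilon. intros e he.
    (* both sides as functions of the pair (T a, a), near (al, al) *)
    assert (P : forall z z', exists d, 0 < d /\ forall a b, Cdist a al < d -> Cdist b al < d ->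
        Cdist (RtoC (X a z * Y b z')) (RtoC (X al z * Y al z')) < e / 2).
    { intros y y'. set (A := Rabs (X al y) + Rabs (Y al y') + 1).
      pose proof (Rabs_pos (X al y)) as P1. pose proof (Rabs_pos (Y al y')) as P2.
      set (e' := Rmin 1 (e / (4 * A))). assert (hA : 0 < A) by (unfold A; lra).
      assert (he' : 0 < e') by (apply Rmin_pos; [lra|apply Rdiv_lt_0_compat; lra]).
      assert (e1 : e' <= 1) by apply Rmin_l.
      assert (e2 : e' * (4 * A) <= e).
      { apply Rle_trans with (e / (4 * A) * (4 * A)); [apply Rmult_le_compat_r; [lra|apply Rmin_r]|right; field; lra]. }
      destruct (cX y e' he') as [d1 [hd1 k1]]. destruct (cY y' e' he') as [d2 [hd2 k2]].
      exists (Rmin d1 d2). split; [apply Rmin_pos; auto|]. intros a b ha' hb'.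
      pose proof (Rmin_l d1 d2). pose proof (Rmin_r d1 d2).
      specialize (k1 a I ltac:(lra)). specialize (k2 b I ltac:(lra)).
      rewrite Cdist_Cmod, <- RtoC_minus, Cmod_R in *.
      set (x := X a y) in *. set (x0 := X al y) in *. set (v := Y b y') in *. set (v0 := Y al y') in *.
      replace (x * v - x0 * v0) with ((x - x0) * (v - v0) + ((x - x0) * v0 + x0 * (v - v0))) by ring.
      eapply Rle_lt_trans; [apply Rabs_triang|]. eapply Rle_lt_trans; [apply Rplus_le_compat_l, Rabs_triang|].
      rewrite !Rabs_mult. pose proof (Rabs_pos (x - x0)). pose proof (Rabs_pos (v - v0)).
      assert (Rabs (x - x0) * Rabs (v - v0) <= e' * 1) by (apply Rmult_le_compat; lra).
      assert (Rabs (x - x0) * Rabs v0 <= e' * Rabs v0) by (apply Rmult_le_compat_r; lra).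
      assert (Rabs x0 * Rabs (v - v0) <= Rabs x0 * e') by (apply Rmult_le_compat_l; lra).
      assert (e' * A = e' * Rabs x0 + e' * Rabs v0 + e') by (unfold A; ring).
      assert (0 < e' * A) by (apply Rmult_lt_0_compat; auto). lra. }
    destruct (P z z') as [d1 [hd1 k1]]. destruct (P z' z) as [d2 [hd2 k2]].
    destruct (lim (Rmin d1 d2)) as [B hB]; [apply Rmin_pos; auto|].
    pose proof (Rmin_l d1 d2). pose proof (Rmin_r d1 d2).
    set (t := B + 1). pose proof (hB t ltac:(unfold t; lra)) as b1. pose proof (hB (t + 1) ltac:(unfold t; lra)) as b2.
    specialize (k1 (h (t + 1)) (h t) ltac:(lra) ltac:(lra)). specialize (k2 (h (t + 1)) (h t) ltac:(lra) ltac:(lra)).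
    rewrite <- (Th t) in k1, k2. rewrite (cross (h t) z z') in k1 by auto.
    match goal with |- Cdist ?u ?v <= _ => match type of k1 with Cdist ?w _ < _ =>
      pose proof (Cdist_tri u w v) as Q; rewrite (Cdist_sym u w) in Q end end. lra. }
  assert (d0 : unit_disk (RtoC 0)) by (apply unit_disk_Cmod; rewrite Cmod_0; lra).
  assert (posX : forall z, unit_disk z -> 0 < X al z).
  { intros z hz. apply Rmult_lt_0_compat; [apply one_minus_sq_pos, unit_disk_Cmod; auto|].
    rewrite unit_dist by auto. assert (0 < Cmod (al - T z)%C); [|nra].
    apply Cmod_gt_0, disk_sub_neq0; auto. apply unit_disk_Cmod; auto. }
  assert (posY : forall z, unit_disk z -> 0 < Y al z).
  { intros z hz. apply Rmult_lt_0_compat; [apply one_minus_sq_pos, unit_disk_Cmod; auto|].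
    rewrite unit_dist by auto. assert (0 < Cmod (al - z)%C); [|nra].
    apply Cmod_gt_0, disk_sub_neq0; auto. apply unit_disk_Cmod; auto. }
  exists (Y al (RtoC 0) / X al (RtoC 0)). pose proof (posX _ d0). pose proof (posY _ d0).
  split; [apply Rdiv_lt_0_compat; auto|]. intros z hz.
  assert (mz : Cmod z < 1) by (apply unit_disk_Cmod; auto).
  assert (mTz : Cmod (T z) < 1) by (apply unit_disk_Cmod; auto).
  rewrite !fst_cayley by auto. pose proof (lcross z (RtoC 0) hz d0) as L.
  pose proof (disk_sub_neq0 al z ha mz) as n1. pose proof (disk_sub_neq0 al (T z) ha mTz) as n2.
  apply Cmod_gt_0 in n1, n2.
  unfold X at 1 in L. unfold Y at 2 in L. rewrite !unit_dist in L by auto.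
  set (u := Cmod (al - z)%C) in *. set (v := Cmod (al - T z)%C) in *.
  set (x0 := X al (RtoC 0)) in *. set (y0 := Y al (RtoC 0)) in *.
  set (A := 1 - Cmod (T z) * Cmod (T z)) in *. set (B := 1 - Cmod z * Cmod z) in *.
  replace (A / (v * v)) with (x0 * (A * (u * u)) / (v * v * (u * u) * x0)) by (field; lra).
  rewrite <- L. field. lra.
Qed.

(** In the half-plane the difference of the deck transformation and lam w is holomorphic with real
    part 0, hence an imaginary constant. *)
Lemma deck_affine (T T' : C -> C) (h : R -> C) al : Cmod al = 1 ->
  holomorphic_on unit_disk T -> (forall z, unit_disk z -> unit_disk (T z)) ->
  holomorphic_on unit_disk T' -> (forall z, unit_disk z -> unit_disk (T' z)) ->
  (forall z, unit_disk z -> T' (T z) = z) ->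
  (forall t, unit_disk (h t)) -> (forall t, T (h t) = h (t + 1)) -> tends_infty h al ->
  exists lam b, 0 < lam /\ forall w, half_plane w -> cayley al (T (cayley_inv al w)) = (lam * w + (0%R, b))%C.
Proof.
  intros ha hT TD hT' TD' TT hD Th lim.
  destruct (deck_horofunction T T' h al ha hT TD hT' TD' TT hD Th lim) as [lam [hl H]].
  set (f := fun w => (cayley al (T (cayley_inv al w)) + - lam * w)%C).
  assert (hf : forall w, half_plane w -> exists L, is_cderiv f w L).
  { assert (h1 : holomorphic_on half_plane (fun w => T (cayley_inv al w))).
    { apply (holomorphic_comp half_plane unit_disk); auto; [apply holomorphic_cayley_inv|].
      intros w hw. apply cayley_inv_disk; auto. }
    assert (h2 : holomorphic_on half_plane (fun w => cayley al (T (cayley_inv al w)))).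
    { apply (holomorphic_comp half_plane unit_disk (fun w => T (cayley_inv al w)) (cayley al)); auto.
      - apply holomorphic_cayley; auto.
      - intros w hw. apply TD, cayley_inv_disk; auto. }
    intros w hw. destruct (h2 w hw) as [L hL]. eexists.
    apply (cderiv_plus (fun w => cayley al (T (cayley_inv al w))) (fun w => - lam * w)%C); [exact hL|apply cderiv_scal]. }
  assert (f0 : forall w, half_plane w -> fst (f w) = 0).
  { intros w hw. unfold f. pose proof (cayley_inv_disk al w ha hw) as dw.
    pose proof (H _ dw) as E. rewrite cayley_cayley_inv in E by auto.
    set (u := cayley al (T (cayley_inv al w))) in *. clearbody u.
    unfold Cplus, Copp, Cmult, RtoC; simpl. rewrite E. ring. }
  assert (fc : forall a b, half_plane a -> half_plane b -> f a = f b).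
  { intros a b ha' hb'. destruct (half_plane_balls a b ha' hb') as [c [r [h1 [h2 h3]]]].
    apply (cderiv_zero_const f c r); auto. intros z hz. destruct (hf z (h3 z hz)) as [L hL].
    destruct (open_half_plane z (h3 z hz)) as [e [he k]].
    rewrite (cderiv_real_part_zero f z e L) in hL; auto. }
  assert (one : half_plane (RtoC 1)) by (unfold half_plane; simpl; lra).
  exists lam, (snd (f (RtoC 1))). split; auto. intros w hw.
  replace (0%R, snd (f (RtoC 1))) with (f w).
  - unfold f. ring.
  - rewrite (fc w (RtoC 1)) by auto. pose proof (f0 _ one). destruct (f (RtoC 1)); simpl in *. subst; auto.
Qed.

Lemma rect_closed (x0 x1 y : R) : closed_set (fun z : C => x0 <= fst z <= x1 /\ Rabs (snd z) <= y).
Proof.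
  apply closure_closed. intros z hz. repeat split.
  - apply le_epsilon. intros e he. destruct (hz e he) as [w [[h1 h2] h3]]. pose proof (Cdist_fst w z) as T. apply Rabs_le_between in T. lra.
  - apply le_epsilon. intros e he. destruct (hz e he) as [w [[h1 h2] h3]]. pose proof (Cdist_fst w z) as T. apply Rabs_le_between in T. lra.
  - apply le_epsilon. intros e he. destruct (hz e he) as [w [[h1 h2] h3]]. pose proof (Cdist_snd w z) as T.
    replace (snd z) with (snd w - (snd w - snd z)) by ring. eapply Rle_trans; [apply Rabs_triang|].
    rewrite Rabs_Ropp. lra.
Qed.

Lemma rect_lower_bound (f : C -> C) x0 x1 y : 0 < x0 ->
  (forall w, half_plane w -> cont_at f w) -> (forall w, half_plane w -> f w <> RtoC 0) ->
  exists m, 0 < m /\ forall z, x0 <= fst z <= x1 -> Rabs (snd z) <= y -> m <= Cmod (f z).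
Proof.
  intros hx cf nz.
  destruct (compact_lower_bound (fun z : C => x0 <= fst z <= x1 /\ Rabs (snd z) <= y) f (x1 + y)) as [m [hm km]].
  - apply rect_closed.
  - intros z [h1 h2]. eapply Rle_trans; [apply Cmod_le_fst_snd|]. rewrite (Rabs_right (fst z)) by lra. lra.
  - intros z [h1 h2]. apply cont_at_in, cf. unfold half_plane; lra.
  - intros z [h1 h2]. apply nz. unfold half_plane; lra.
  - exists m. split; auto.
Qed.

Lemma cayley_inv_real al x : 0 < x -> cayley_inv al (RtoC x) = Cscale (1 - 2 / (x + 1)) al.
Proof.
  intros hx. unfold cayley_inv. rewrite Cscale_mult.
  replace ((x - 1) / (x + 1))%C with (RtoC (1 - 2 / (x + 1))); [ring|].
  assert (x + 1 <> 0) by lra.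
  assert (hC : (RtoC x + RtoC 1)%C <> 0) by (rewrite <- RtoC_plus; intros E; apply RtoC_inj in E; lra).
  rewrite RtoC_minus, RtoC_div, RtoC_plus by auto. field. exact hC.
Qed.

Lemma radial_half_plane phi al p : radial_limit phi al p -> forall e, 0 < e -> exists X, 0 < X /\
  forall x, X <= x -> Cdist (phi (cayley_inv al (RtoC x))) p < e.
Proof.
  intros hr e he. destruct (hr e he) as [d [hd k]]. exists (2 / d).
  assert (0 < 2 / d) by (apply Rdiv_lt_0_compat; lra). split; auto. intros x hx.
  rewrite cayley_inv_real by lra. apply k.
  assert (h1 : 0 < 2 / (x + 1)) by (apply Rdiv_lt_0_compat; lra).
  assert (h2 : 2 / (x + 1) < d); [|lra].
  apply Rmult_lt_reg_r with (x + 1); [lra|]. unfold Rdiv. rewrite Rmult_assoc, Rinv_l by lra.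
  assert (2 / d * d = 2) by (field; lra). nra.
Qed.

(** Schwarz-Pick at the centre of the disk of radius x about x, after dividing [f] by a bound: a
    vertical step y costs at most a constant times |y| / x. *)
Lemma half_plane_oscillation (f : C -> C) M x y : holomorphic_on half_plane f ->
  (forall w, half_plane w -> Cmod (f w) <= M) -> Rabs y < x ->
  Cdist (f (x, y)) (f (RtoC x)) <= 2 * (Rabs M + 1) * (Rabs y / x).
Proof.
  intros hf hM hy. pose proof (Rabs_pos y). assert (hx : 0 < x) by lra.
  set (N := Rabs M + 1). assert (hN : 0 < N) by (unfold N; pose proof (Rabs_pos M); lra).
  set (T := fun z => (f (x + x * z) / N)%C).
  assert (inH : forall z, unit_disk z -> half_plane (x + x * z)%C).
  { intros z hz. apply unit_disk_Cmod in hz. pose proof (Cmod_fst z) as Q. apply Rabs_le_between in Q.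
    unfold half_plane, Cplus, Cmult, RtoC; simpl. nra. }
  assert (N0 : RtoC N <> 0) by (intros E; apply RtoC_inj in E; lra).
  assert (TD : forall z, unit_disk z -> unit_disk (T z)).
  { intros z hz. apply unit_disk_Cmod. unfold T. rewrite Cmod_div, Cmod_R, (Rabs_right N) by (auto; lra).
    pose proof (hM _ (inH z hz)). pose proof (Rle_abs M).
    apply Rmult_lt_reg_r with N; auto. unfold Rdiv. rewrite Rmult_assoc, Rinv_l by lra. unfold N in *. lra. }
  assert (hT : holomorphic_on unit_disk T).
  { intros z hz. destruct (hf _ (inH z hz)) as [L hL]. eexists.
    apply (cderiv_mult (fun z => f (x + x * z)%C) (fun _ => / N)%C); [|apply cderiv_const].
    apply (cderiv_comp (fun z => x + x * z)%C f); [|exact hL].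
    apply (cderiv_plus (fun _ => RtoC x) (fun z => x * z)%C); [apply cderiv_const|apply cderiv_scal]. }
  assert (d0 : unit_disk (RtoC 0)) by (apply unit_disk_Cmod; rewrite Cmod_0; lra).
  set (z := (0%R, y / x) : C).
  assert (mz : Cmod z = Rabs y / x).
  { unfold z. replace (0%R, y / x) with (Ci * RtoC (y / x))%C
      by (unfold Ci, Cmult, RtoC; simpl; f_equal; ring).
    rewrite Cmod_mult, Cmod_Ci, Cmod_R, Rmult_1_l. unfold Rdiv. rewrite Rabs_mult, Rabs_inv, (Rabs_right x) by lra. auto. }
  assert (dz : unit_disk z).
  { apply unit_disk_Cmod. rewrite mz. apply Rmult_lt_reg_r with x; auto. unfold Rdiv. rewrite Rmult_assoc, Rinv_l; lra. }
  pose proof (schwarz_pick T (RtoC 0) z hT TD d0 dz) as S.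
  replace (z - 0)%C with z in S by ring. rewrite mz in S.
  replace (1 - Cconj 0 * z)%C with (RtoC 1) in S
    by (replace (Cconj 0) with (RtoC 0) by (unfold Cconj, RtoC; simpl; f_equal; ring); ring).
  rewrite Cmod_1, Rmult_1_r in S.
  assert (B : Cmod (1 - Cconj (T (RtoC 0)) * T z)%C <= 2).
  { pose proof (Cmod_triangle 1 (- (Cconj (T (RtoC 0)) * T z))%C) as Q. rewrite Cmod_opp, Cmod_1, Cmod_mult, Cmod_conj in Q.
    pose proof (proj1 (unit_disk_Cmod _) (TD _ d0)). pose proof (proj1 (unit_disk_Cmod _) (TD _ dz)).
    pose proof (Cmod_ge_0 (T (RtoC 0))). pose proof (Cmod_ge_0 (T z)). unfold Cminus. nra. }
  assert (E : (T z - T (RtoC 0))%C = ((f (x, y) - f (RtoC x)) / N)%C).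
  { unfold T. replace (x + x * z)%C with ((x, y) : C).
    - replace (x + x * 0)%C with (RtoC x) by ring. field; auto.
    - unfold z, Cplus, Cmult, RtoC; simpl. f_equal; field; lra. }
  rewrite E, Cmod_div, Cmod_R, (Rabs_right N), <- Cdist_Cmod in S by (auto; lra).
  assert (0 <= Rabs y / x) by (rewrite <- mz; apply Cmod_ge_0).
  assert (S2 : Cdist (f (x, y)) (f (RtoC x)) / N <= Rabs y / x * 2) by nra.
  apply Rmult_le_compat_r with (r := N) in S2; [|lra]. unfold Rdiv in S2 at 1.
  rewrite Rmult_assoc, Rinv_l in S2 by lra. lra.
Qed.

(** The set Re cayley > 1 is a horodisk, that is, a disk inside the unit disk that touches the
    circle at [al]. *)
Lemma horoball_boundary al xi : Cmod al = 1 -> xi <> al ->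
  boundary (fun z => unit_disk z /\ 1 < fst (cayley al z)) xi -> Cmod xi < 1 /\ fst (cayley al xi) = 1.
Proof.
  intros ha hne [h1 h2].
  assert (hle : Cmod xi <= 1).
  { apply le_epsilon. intros e he. destruct (h1 e he) as [w [[hw _] hd]]. apply unit_disk_Cmod in hw.
    pose proof (Cmod_dist_le w xi) as T. apply Rabs_le_between in T. lra. }
  assert (nz : (al - xi)%C <> RtoC 0) by (apply Cminus_eq_contra; auto).
  assert (cc : cont_at (cayley al) xi).
  { unfold cayley. apply cont_in_div; auto.
    - apply cont_in_plus; [apply cont_in_const|apply cont_in_id].
    - apply cont_in_minus; [apply cont_in_const|apply cont_in_id]. }
  assert (ge : 1 <= fst (cayley al xi)).
  { apply le_epsilon. intros e he. destruct (cc e he) as [d [hd k]]. destruct (h1 d hd) as [w [[_ hw] hwd]].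
    specialize (k w I hwd). pose proof (Cdist_fst (cayley al w) (cayley al xi)) as T. apply Rabs_le_between in T. lra. }
  assert (E : fst (cayley al xi) * (Cmod (al - xi)%C * Cmod (al - xi)%C) = 1 - Cmod xi * Cmod xi).
  { unfold cayley. rewrite fst_Cdiv by auto. apply Cmod_gt_0 in nz. unfold Rdiv.
    rewrite Rmult_assoc, Rinv_l, Rmult_1_r by nra.
    assert (E : 1 = Cmod al * Cmod al) by (rewrite ha; ring). rewrite E, !Cmod_sq.
    destruct al, xi. unfold Cmult, Cconj, Cplus, Cminus, Copp; simpl. ring. }
  assert (lt : Cmod xi < 1).
  { apply Cmod_gt_0 in nz. pose proof (Cmod_ge_0 xi). apply Rnot_le_lt. intros h.
    assert (0 < fst (cayley al xi) * (Cmod (al - xi)%C * Cmod (al - xi)%C)) by (apply Rmult_lt_0_compat; nra). nra. }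
  split; auto. apply Rle_antisym; auto. apply Rnot_lt_le. intros h. apply h2. split; auto. apply unit_disk_Cmod; auto.
Qed.

(* In the half-plane with alpha at infinity the deck transformation is w -> lam w + ib.  If lam > 1,
   phi takes on the radius the values it takes on a compact set; if lam = 1, phi is periodic, tends to p
   at infinity and so omits no value near p other than p. *)
Lemma end_not_radial Om phi M (T T' : C -> C) (h : R -> C) al p : Cmod al = 1 ->
  holomorphic_on unit_disk phi -> (forall z, unit_disk z -> Om (phi z)) -> (forall z, unit_disk z -> Cmod (phi z) <= M) ->
  radial_limit phi al p -> ~ Om p -> (forall e, 0 < e -> exists q, ~ Om q /\ q <> p /\ Cdist q p < e) ->
  holomorphic_on unit_disk T -> (forall z, unit_disk z -> unit_disk (T z)) ->
  holomorphic_on unit_disk T' -> (forall z, unit_disk z -> unit_disk (T' z)) ->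
  (forall z, unit_disk z -> T' (T z) = z) -> (forall z, unit_disk z -> phi (T z) = phi z) ->
  (forall t, unit_disk (h t)) -> (forall t, T (h t) = h (t + 1)) -> h 0 <> h 1 -> tends_infty h al -> False.
Proof.
  intros ha hphi hOm hM hr np acc hT TD hT' TD' TT Tphi hD Th h01 lim.
  destruct (deck_affine T T' h al ha hT TD hT' TD' TT hD Th lim) as [lam [b [hl aff]]].
  set (f := fun w => phi (cayley_inv al w)).
  assert (md : forall w, half_plane w -> unit_disk (cayley_inv al w)) by (intros; apply cayley_inv_disk; auto).
  assert (hf : holomorphic_on half_plane f).
  { apply (holomorphic_comp half_plane unit_disk (cayley_inv al) phi); auto. apply holomorphic_cayley_inv. }
  assert (cf : forall w, half_plane w -> cont_at f w).
  { intros w hw. destruct (hf w hw) as [L hL]. eapply cderiv_cont; exact hL. }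
  assert (fOm : forall w, half_plane w -> Om (f w)) by (intros w hw; apply hOm, md; auto).
  assert (per : forall w, half_plane w -> f (lam * w + (0%R, b))%C = f w).
  { intros w hw. unfold f. rewrite <- aff by auto.
    rewrite cayley_inv_cayley; auto. apply unit_disk_Cmod, TD, md; auto. }
  assert (cw : forall q, ~ Om q -> (forall w, half_plane w -> cont_at (fun w => f w - q)%C w) /\
     forall w, half_plane w -> (f w - q)%C <> RtoC 0).
  { intros q hq. split.
    - intros w hw. apply cont_in_minus; [auto|apply cont_in_const].
    - intros w hw E. apply Ceq_minus in E. apply hq. rewrite <- E. auto. }
  set (w := fun n : nat => cayley al (h (INR n))).
  assert (mh : forall t, Cmod (h t) < 1) by (intros; apply unit_disk_Cmod; auto).
  assert (wS : forall n, w (S n) = (lam * w n + (0%R, b))%C).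
  { intros n. unfold w. rewrite S_INR, <- Th. rewrite <- (cayley_inv_cayley al (h (INR n))) at 1 by auto.
    apply aff. apply cayley_half_plane; auto. }
  (* For lam < 1 the orbit of the affine map would stay in the disk of radius [K], but h t -> al
     means that it goes to infinity. *)
  assert (lam1 : 1 <= lam).
  { apply Rnot_lt_le. intros hlt.
    set (K := Rmax (Cmod (w O)) (Rabs b / (1 - lam))).
    assert (KK : forall n, Cmod (w n) <= K).
    { induction n as [|n IH]; [apply Rmax_l|]. rewrite wS. eapply Rle_trans; [apply Cmod_triangle|].
      rewrite Cmod_mult, Cmod_R, (Rabs_right lam) by lra.
      assert (Cmod (0%R, b) <= Rabs b).
      { eapply Rle_trans; [apply Cmod_R_sum|]. rewrite Rabs_R0. lra. }
      assert (Rabs b <= K * (1 - lam)).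
      { apply Rle_trans with (Rabs b / (1 - lam) * (1 - lam)); [right; field; lra|].
        apply Rmult_le_compat_r; [lra|apply Rmax_r]. }
      nra. }
    assert (K0 : 0 <= K) by (eapply Rle_trans; [apply Cmod_ge_0|apply (KK O)]).
    destruct (lim (/ (K + 1))) as [B hB]; [apply Rinv_0_lt_compat; lra|].
    destruct (INR_unbounded B) as [n hn]. specialize (hB (INR n) hn). specialize (KK n). unfold w, cayley in KK.
    assert (nz : (al - h (INR n))%C <> RtoC 0) by (apply disk_sub_neq0; auto).
    rewrite Cmod_div in KK by auto. rewrite Cdist_sym, Cdist_Cmod in hB. apply Cmod_gt_0 in nz.
    set (d := Cmod (al - h (INR n))%C) in *.
    assert (hd : d * (K + 1) < 1).
    { apply Rmult_lt_compat_r with (r := K + 1) in hB; [|lra]. rewrite Rinv_l in hB by lra. auto. }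
    assert (d1 : d <= 1) by nra.
    assert (top : 1 <= Cmod (al + h (INR n))%C).
    { pose proof (Cmod_triangle (al + h (INR n))%C (al - h (INR n))%C) as Q. fold d in Q.
      replace (al + h (INR n) + (al - h (INR n)))%C with (2 * al)%C in Q by ring.
      rewrite Cmod_mult, ha, Cmod_R, Rabs_right in Q by lra. lra. }
    apply Rmult_le_compat_r with (r := d) in KK; [|lra]. unfold Rdiv in KK. rewrite Rmult_assoc, Rinv_l in KK by lra.
    nra. }
  destruct (Rle_lt_or_eq_dec _ _ lam1) as [lgt|leq].
  - set (Bc := Rabs b / (lam - 1)).
    assert (hBc : Rabs b = Bc * (lam - 1)) by (unfold Bc; field; lra).
    assert (B0 : 0 <= Bc) by (apply Rmult_le_pos; [apply Rabs_pos|left; apply Rinv_0_lt_compat; lra]).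
    (* [N] bounds the number of applications of the inverse map that bring the real part into
       [1, lam]; the bound Bc = |b| / (lam - 1) on imaginary parts is preserved by each. *)
    assert (red : forall N y, 1 <= fst y < lam ^ N -> Rabs (snd y) <= Bc ->
       exists y', 1 <= fst y' <= lam /\ Rabs (snd y') <= Bc /\ f y' = f y).
    { induction N as [|N IH]; intros y hy1 hy2; [simpl in hy1; lra|].
      destruct (Rle_lt_dec (fst y) lam) as [hle|hlt]; [exists y; repeat split; auto; lra|].
      set (v := (fst y / lam, (snd y - b) / lam) : C).
      assert (Ev : (lam * v + (0%R, b))%C = y).
      { unfold v, Cmult, Cplus, RtoC; destruct y; simpl. f_equal; field; lra. }
      destruct (IH v) as [y' [q1 [q2 q3]]].
      - unfold v; simpl in *. split; apply Rmult_le_reg_r with lam || apply Rmult_lt_reg_r with lam; auto; try lra;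
          unfold Rdiv; rewrite Rmult_assoc, Rinv_l by lra; lra.
      - unfold v; simpl. unfold Rdiv. rewrite Rabs_mult, Rabs_inv, (Rabs_right lam) by lra.
        apply Rmult_le_reg_r with lam; auto. rewrite Rmult_assoc, Rinv_l, Rmult_1_r by lra.
        eapply Rle_trans; [apply Rabs_triang|]. rewrite Rabs_Ropp. lra.
      - exists y'. repeat split; auto; try lra. rewrite q3, <- (per v), Ev; auto.
        unfold half_plane, v; simpl. apply Rdiv_lt_0_compat; lra. }
    destruct (cw p np) as [c1 c2].
    destruct (rect_lower_bound (fun w => f w - p)%C 1 lam Bc Rlt_0_1 c1 c2) as [m [hm km]].
    destruct (radial_half_plane phi al p hr m hm) as [X [hX kX]].
    set (x := Rmax X 1). pose proof (Rmax_l X 1). pose proof (Rmax_r X 1).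
    destruct (Pow_x_infinity lam) with (b := x + 1) as [N hN]; [rewrite Rabs_right; lra|].
    specialize (hN N (Nat.le_refl _)). rewrite Rabs_right in hN by (left; apply pow_lt; lra).
    destruct (red N (RtoC x)) as [y' [q1 [q2 q3]]].
    + unfold x in *; simpl; lra.
    + simpl. rewrite Rabs_R0; auto.
    + specialize (km y' q1 q2). rewrite q3 in km. specialize (kX x ltac:(auto)).
      rewrite <- Cdist_Cmod in km. unfold f in km. lra.
  - subst lam.
    (* Otherwise the deck transformation would be the identity, and h 0 = h 1. *)
    assert (b0 : b <> 0).
    { intros ->. apply h01. assert (E : w 1%nat = w 0%nat).
      { rewrite wS. unfold Cplus, Cmult, RtoC; destruct (w 0%nat); simpl. f_equal; ring. }
      unfold w in E. simpl in E.
      rewrite <- (cayley_inv_cayley al (h 0)), <- (cayley_inv_cayley al (h 1)), E by auto. auto. }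
    assert (perZ : forall y (k : Z), half_plane y -> f (fst y, snd y + b * IZR k) = f y).
    { assert (perN : forall y (n : nat), half_plane y -> f (fst y, snd y + b * INR n) = f y).
      { intros y n hy. induction n as [|n IH].
        - f_equal. destruct y; simpl. f_equal; ring.
        - rewrite <- IH, <- (per (fst y, snd y + b * INR n)) by auto. f_equal.
          rewrite S_INR. unfold Cplus, Cmult, RtoC; simpl. f_equal; ring. }
      intros y k hy. destruct (Z.le_gt_cases 0 k) as [h0|h0].
      - rewrite <- (Z2Nat.id k h0), <- INR_IZR_INZ. apply perN; auto.
      - rewrite <- (perN (fst y, snd y + b * IZR k) (Z.to_nat (- k))) by auto. f_equal. simpl.
        rewrite INR_IZR_INZ, Z2Nat.id, opp_IZR by lia. destruct y; simpl. f_equal; ring. }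
    assert (red : forall y, half_plane y -> exists v, Rabs v <= Rabs b /\ f (fst y, v) = f y).
    { intros y hy. pose proof (base_Int_part (snd y / b)) as hn. set (n := Int_part (snd y / b)) in *.
      exists (snd y + b * IZR (- n)). split; [|apply perZ; auto].
      rewrite opp_IZR. replace (snd y + b * - IZR n) with (b * (snd y / b - IZR n)) by (field; auto).
      rewrite Rabs_mult. rewrite <- (Rmult_1_r (Rabs b)) at 2. apply Rmult_le_compat_l; [apply Rabs_pos|].
      apply Rabs_le; lra. }
    destruct (cw p np) as [c1 c2].
    destruct (rect_lower_bound (fun w => f w - p)%C 1 1 (Rabs b) Rlt_0_1 c1 c2) as [m1 [hm1 km1]].
    (* An omitted value q <> p within [m] of p has distance at least m1 - m = m from the values of
       [f] on Re w = 1, where |f - p| >= m1. *)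
    set (m := m1 / 2). assert (hm : 0 < m) by (unfold m; lra).
    destruct (acc m hm) as [q [nq [hqp hqm]]].
    assert (dq : 0 < Cdist q p) by (apply Cdist_neq_pos; auto). set (dd := Cdist q p) in *.
    assert (hfM : forall w, half_plane w -> Cmod (f w) <= M) by (intros; apply hM, md; auto).
    destruct (radial_half_plane phi al p hr (dd / 4)) as [X1 [hX1 kX1]]; [lra|].
    set (N := 2 * (Rabs M + 1)). assert (hN : 0 < N) by (unfold N; pose proof (Rabs_pos M); lra).
    pose proof (Rabs_pos_lt b b0) as pb.
    set (X2 := N * Rabs b / (dd / 4)).
    set (X := Rmax (Rmax X1 X2) (Rabs b + 1)).
    assert (XX1 : X1 <= X) by (eapply Rle_trans; [apply Rmax_l|apply Rmax_l]).
    assert (XX2 : X2 <= X) by (eapply Rle_trans; [apply Rmax_r|apply Rmax_l]).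
    assert (XX3 : Rabs b + 1 <= X) by apply Rmax_r.
    (* Modulo the period the imaginary part is at most |b|, so far to the right [f] is as close to p
       as on the real axis, up to the oscillation bound. *)
    assert (far : forall y, X <= fst y -> Cdist (f y) p < dd / 4 + dd / 2).
    { intros y hy. destruct (red y) as [v [hv Ev]]; [unfold half_plane; lra|]. rewrite <- Ev.
      pose proof (half_plane_oscillation f M (fst y) v hf hfM ltac:(lra)) as O1. fold N in O1.
      specialize (kX1 (fst y) ltac:(lra)). fold (f (RtoC (fst y))) in kX1.
      assert (N * (Rabs v / fst y) <= dd / 4).
      { unfold Rdiv at 1. rewrite <- Rmult_assoc. apply Rmult_le_reg_r with (fst y); [lra|].
        rewrite Rmult_assoc, Rinv_l, Rmult_1_r by lra.
        assert (N * Rabs v <= N * Rabs b) by (apply Rmult_le_compat_l; lra).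
        assert (N * Rabs b = X2 * (dd / 4)) by (unfold X2; field; lra).
        assert (X2 * (dd / 4) <= fst y * (dd / 4)) by (apply Rmult_le_compat_r; lra). lra. }
      pose proof (Cdist_tri (f (fst y, v)) (f (RtoC (fst y))) p). lra. }
    destruct (cw q nq) as [c3 c4].
    destruct (rect_lower_bound (fun w => f w - q)%C 1 X (Rabs b) Rlt_0_1 c3 c4) as [m2 [hm2 km2]].
    set (mu := Rmin m2 (dd / 4)). assert (hmu : 0 < mu) by (apply Rmin_pos; lra).
    (* A crude positive bound: it makes 1 / (phi - q) bounded on the horodisk, so that [al] may be
       the exceptional point. *)
    assert (low : forall y, 1 <= fst y -> mu <= Cmod (f y - q)%C).
    { intros y hy. destruct (Rle_lt_dec (fst y) X) as [hle|hlt].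
      - destruct (red y) as [v [hv Ev]]; [unfold half_plane; lra|]. rewrite <- Ev.
        eapply Rle_trans; [apply Rmin_l|]. apply km2; simpl; auto.
      - specialize (far y ltac:(lra)). eapply Rle_trans; [apply Rmin_r|]. rewrite <- Cdist_Cmod.
        pose proof (Cdist_tri q (f y) p) as Q. fold dd in Q. rewrite (Cdist_sym q (f y)) in Q. lra. }
    set (G := fun z => unit_disk z /\ 1 < fst (cayley al z)).
    assert (phif : forall z, Cmod z < 1 -> phi z = f (cayley al z)).
    { intros z hz. unfold f. rewrite cayley_inv_cayley; auto. }
    assert (nzq : forall z, unit_disk z -> (phi z - q)%C <> RtoC 0).
    { intros z hz E. apply Ceq_minus in E. apply nq. rewrite <- E. auto. }
    (* The values on the boundary of the horodisk force |phi - q| >= m inside; on the radius this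
       contradicts phi -> p and |q - p| < m. *)
    assert (key : forall z, G z -> Cmod (/ (phi z - q))%C <= / m).
    { apply (max_principle_except G (fun z => / (phi z - q))%C (/ m) (/ mu) al).
      - apply Rinv_0_lt_compat; auto.
      - intros z [h1 h2]. destruct (holomorphic_cayley al ha z h1) as [L hL].
        destruct (cderiv_cont _ _ _ hL (fst (cayley al z) - 1)) as [d [hd k]]; [lra|].
        destruct (open_unit_disk z h1) as [e1 [he1 k1]].
        exists (Rmin d e1). split; [apply Rmin_pos; auto|]. intros y hy.
        pose proof (Rmin_l d e1). pose proof (Rmin_r d e1). split; [apply k1; lra|].
        specialize (k y I ltac:(lra)). pose proof (Cdist_fst (cayley al y) (cayley al z)) as Q. apply Rabs_le_between in Q. lra.
      - exists 1. intros z [h1 _]. left; auto.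
      - intros z [h1 h2]. destruct (hphi z h1) as [L hL]. eexists.
        apply (cderiv_inv (fun z => phi z - q)%C); [auto|].
        apply (cderiv_plus phi (fun _ => - q)%C); [exact hL|apply cderiv_const].
      - intros [h1 _]. apply unit_disk_Cmod in h1. lra.
      - intros z [h1 h2]. rewrite Cmod_inv by auto. apply Rinv_le_contravar; auto.
        apply unit_disk_Cmod in h1. rewrite phif by auto. apply low. lra.
      - intros xi hxi hne e he. destruct (horoball_boundary al xi ha hne hxi) as [h1 h2].
        assert (ux : unit_disk xi) by (apply unit_disk_Cmod; auto).
        assert (bd : m <= Cmod (phi xi - q)%C).
        { rewrite phif by auto.
          destruct (red (cayley al xi)) as [v [hv Ev]]; [unfold half_plane; lra|].
          rewrite h2 in Ev. specialize (km1 (1, v) ltac:(simpl; lra) hv). rewrite Ev in km1.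
          rewrite <- Cdist_Cmod in km1 |- *. pose proof (Cdist_tri (f (cayley al xi)) q p) as Q. fold dd in Q.
          unfold m in *. lra. }
        assert (cF : cont_at (fun z => / (phi z - q))%C xi).
        { apply cont_in_inv; auto. apply cont_in_minus; [|apply cont_in_const].
          destruct (hphi xi ux) as [L hL]. eapply cderiv_cont; exact hL. }
        destruct (cF e he) as [d [hd k]]. exists d; split; auto. intros z _ hz. specialize (k z I hz).
        pose proof (Cmod_dist_le (/ (phi z - q))%C (/ (phi xi - q))%C) as Q. apply Rabs_le_between in Q.
        assert (Cmod (/ (phi xi - q))%C <= / m) by (rewrite Cmod_inv by auto; apply Rinv_le_contravar; auto). lra. }
    destruct (radial_half_plane phi al p hr (m - dd)) as [X3 [hX3 kX3]]; [lra|].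
    set (x := Rmax X3 2). pose proof (Rmax_l X3 2). pose proof (Rmax_r X3 2).
    assert (hx : half_plane (RtoC x)) by (unfold half_plane; simpl; unfold x; lra).
    assert (gx : G (cayley_inv al (RtoC x))).
    { split; [apply md; auto|]. rewrite cayley_cayley_inv by auto. simpl. unfold x; lra. }
    specialize (key _ gx). specialize (kX3 x ltac:(auto)). destruct gx as [gx _].
    rewrite Cmod_inv in key by auto.
    assert (m <= Cmod (phi (cayley_inv al (RtoC x)) - q)%C).
    { apply Rnot_lt_le. intros hlt. assert (0 < Cmod (phi (cayley_inv al (RtoC x)) - q)%C) by (apply Cmod_gt_0; auto).
      apply Rinv_lt_contravar in hlt; [lra|]. apply Rmult_lt_0_compat; auto. }
    rewrite <- Cdist_Cmod in H1. pose proof (Cdist_tri (phi (cayley_inv al (RtoC x))) p q) as Q.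
    rewrite (Cdist_sym p q) in Q. fold dd in Q. lra.
Qed.

(** * Non-isolated boundary points *)

(** If p were in Omega, the end of the radius would lie in one sheet over a neighbourhood of p and
    converge to the preimage of p in that sheet, an inner point of the disk. *)
Lemma radial_limit_not_in Om phi alpha p : covering_map unit_disk Om phi -> Cmod alpha = 1 ->
  radial_limit phi alpha p -> ~ Om p.
Proof.
  intros hc ha hr hp.
  destruct (covering_even unit_disk Om phi p hc hp) as [V [T [W [oV [hV [_ E]]]]]].
  destruct (oV p hV) as [e [he k]]. destruct (hr e he) as [d0 [hd0 h0]].
  set (d := Rmin d0 1). assert (hd : 0 < d) by (apply Rmin_pos; lra).
  assert (dd0 : d <= d0) by apply Rmin_l. assert (dd1 : d <= 1) by apply Rmin_r.
  set (J := fun r => 1 - d < r < 1).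
  assert (hJ : forall r, J r -> unit_disk (Cscale r alpha) /\ V (phi (Cscale r alpha))).
  { intros r hr'. unfold J in hr'. split; [|apply k, h0; lra]. apply unit_disk_Cmod. rewrite Cmod_Cscale, ha; lra. }
  assert (cJ : forall r, J r -> rcont J (fun r => Cscale r alpha) r).
  { intros r _ e' he'. exists e'. split; auto. intros s _ hs. rewrite Cdist_Cmod, !Cscale_mult.
    replace (s * alpha - r * alpha)%C with ((s - r)%R * alpha)%C by (rewrite RtoC_minus; ring).
    rewrite Cmod_mult, ha, Cmod_R. lra. }
  pose proof E as [oW [WU [dis [ex [WV sec]]]]].
  assert (J0 : J (1 - d / 2)) by (unfold J; lra).
  destruct (hJ _ J0) as [u0 v0]. destruct (ex _ u0 v0) as [i hi].
  destruct (sec i) as [s [cs [hs1 hs2]]].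
  assert (all : forall r, J r -> W i (Cscale r alpha)).
  { intros r hr'. apply (sheet_stays unit_disk phi V T W J (fun r => Cscale r alpha) i E) with (s := 1 - d / 2); auto.
    intros a b t h1 h2 h3. unfold J in *. lra. }
  destruct (hs1 p hV) as [sp _]. apply WU, unit_disk_Cmod in sp.
  set (m := (1 - Cmod (s p)) / 2). assert (hm : 0 < m) by (unfold m; lra).
  destruct (cs p hV m) as [d1 [hd1 k1]]; [exact hm|].
  destruct (hr d1 hd1) as [d2 [hd2 k2]].
  set (r := 1 - Rmin (Rmin d d2) m / 2).
  pose proof (Rmin_l (Rmin d d2) m). pose proof (Rmin_r (Rmin d d2) m). pose proof (Rmin_l d d2). pose proof (Rmin_r d d2).
  pose proof (Rmin_pos _ _ (Rmin_pos d d2 hd hd2) hm).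
  assert (Jr : J r) by (unfold J, r; lra).
  specialize (k1 (phi (Cscale r alpha)) (proj2 (hJ r Jr)) (k2 r ltac:(unfold r; lra))).
  rewrite hs2 in k1 by auto. pose proof (Cmod_dist_le (Cscale r alpha) (s p)) as Q. apply Rabs_le_between in Q.
  rewrite Cmod_Cscale, ha in Q by (unfold r; lra). unfold r, m in *. lra.
Qed.

Lemma covering_bounded Om phi : covering_map unit_disk Om phi -> is_bounded Om ->
  exists M, forall z, unit_disk z -> Cmod (phi z) <= M.
Proof.
  intros hc [M hM]. exists M. intros z hz. rewrite <- Cnorm_Cmod. apply hM, hc; auto.
Qed.

Lemma omitted_value Om phi M c : holomorphic_on unit_disk phi -> covering_map unit_disk Om phi ->
  (forall z, unit_disk z -> Cmod (phi z) <= M) -> ~ Om c ->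
  holomorphic_on unit_disk (fun z => phi z - c)%C /\
  (forall z, unit_disk z -> Cmod (phi z - c)%C <= M + Cmod c) /\
  (forall z, unit_disk z -> (phi z - c)%C <> RtoC 0).
Proof.
  intros hf hc hM nc. repeat split.
  - intros z hz. destruct (hf z hz) as [L hL]. eexists.
    apply (cderiv_plus phi (fun _ => - c)%C); [exact hL|apply cderiv_const].
  - intros z hz. specialize (hM z hz). pose proof (Cmod_triangle (phi z) (- c)%C) as Q. rewrite Cmod_opp in Q.
    unfold Cminus. lra.
  - intros z hz E. apply Ceq_minus in E. apply nc. rewrite <- E. apply hc; auto.
Qed.

Lemma koebe_covering Om phi M c : holomorphic_on unit_disk phi -> covering_map unit_disk Om phi ->
  (forall z, unit_disk z -> Cmod (phi z) <= M) -> ~ Om c ->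
  forall eta, 0 < eta -> exists eps, 0 < eps /\ forall J (g : R -> C) s t, rconvex J -> J s -> J t ->
    (forall x, J x -> rcont J g x) -> (forall x, J x -> unit_disk (g x) /\ Cdist (phi (g x)) c < eps) ->
    Cdist (g s) (g t) < eta.
Proof.
  intros hf hc hM nc eta heta. destruct (omitted_value Om phi M c hf hc hM nc) as [h1 [h2 h3]].
  destruct (koebe _ _ h1 h2 h3 eta heta) as [eps [heps k]]. exists eps. split; auto.
  intros J g s t hJ hs ht cg hg.
  assert (K : forall x, unit_interval x -> J (s + x * (t - s))).
  { intros x hx. unfold unit_interval in hx. destruct (Rle_lt_dec s t).
    - apply (hJ s t); auto. assert (0 <= x * (t - s) <= t - s) by nra. lra.
    - apply (hJ t s); auto. assert (t - s <= x * (t - s) <= 0) by nra. lra. }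
  replace (g s) with (g (s + 0 * (t - s))) by (f_equal; ring).
  replace (g t) with (g (s + 1 * (t - s))) by (f_equal; ring).
  apply (k (fun x => g (s + x * (t - s)))).
  - intros x hx e he. destruct (cg _ (K x hx) e he) as [r [hr kr]]. pose proof (Rabs_pos (t - s)).
    exists (r / (Rabs (t - s) + 1)). split; [apply Rdiv_lt_0_compat; lra|]. intros y hy hyx. apply kr; auto.
    replace (s + y * (t - s) - (s + x * (t - s))) with ((y - x) * (t - s)) by ring.
    rewrite Rabs_mult. apply Rle_lt_trans with (r / (Rabs (t - s) + 1) * Rabs (t - s)).
    + apply Rmult_le_compat_r; lra.
    + apply Rmult_lt_reg_r with (Rabs (t - s) + 1); [lra|].
      replace (r / (Rabs (t - s) + 1) * Rabs (t - s) * (Rabs (t - s) + 1)) with (r * Rabs (t - s)) by (field; lra). nra.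
  - intros x hx. destruct (hg _ (K x hx)) as [q1 q2]. split; auto. rewrite <- Cdist_Cmod. auto.
Qed.

(** * Open arcs with both ends on the circle *)

Definition open_arc (A : C -> Prop) (G : R -> C) (b0 b1 : C) : Prop :=
  (forall t, open_interval t -> rcont open_interval G t) /\ (forall t, open_interval t -> unit_disk (G t)) /\
  (forall s t, open_interval s -> open_interval t -> G s = G t -> s = t) /\
  ends_at G b1 /\ ends_at (fun t => G (1 - t)) b0 /\ Cmod b0 = 1 /\ Cmod b1 = 1 /\
  (forall z, A z <-> exists t, open_interval t /\ G t = z).

Lemma line_open_arc (A : C -> Prop) (h : R -> C) b0 b1 :
  (forall t, rcont allR h t) -> (forall t, unit_disk (h t)) -> (forall s t, h s = h t -> s = t) ->
  tends_infty h b1 -> tends_infty (fun t => h (- t)) b0 -> Cmod b0 = 1 -> Cmod b1 = 1 ->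
  (forall z, A z <-> exists t, h t = z) -> exists G, open_arc A G b0 b1.
Proof.
  intros ch hD inj l1 l0 m0 m1 hA. pose proof PI_RGT_0 as hpi.
  (* An increasing bijection of (0, 1) onto the line, odd about 1/2, so that s -> 1 - s corresponds
     to t -> -t. *)
  set (th := fun s => tan (PI * (s - 1 / 2))).
  assert (rg : forall s, open_interval s -> - (PI / 2) < PI * (s - 1 / 2) < PI / 2).
  { intros s hs. unfold open_interval in hs. split; nra. }
  assert (ath : forall s, open_interval s -> atan (th s) = PI * (s - 1 / 2)) by (intros s hs; apply atan_tan; auto).
  assert (th_neg : forall s, th (1 - s) = - th s).
  { intros s. unfold th. rewrite <- tan_neg. apply (f_equal tan). field. }
  assert (hend : forall (k : R -> C) b, tends_infty k b -> ends_at (fun s => k (th s)) b).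
  { intros k b hk e he. destruct (hk e he) as [B hB]. pose proof (atan_bound B) as hb.
    assert (q : atan B / PI < 1 / 2) by (apply Rmult_lt_reg_r with PI; auto; unfold Rdiv; rewrite Rmult_assoc, Rinv_l; lra).
    exists (Rmin (1 / 2 - atan B / PI) 1). split; [apply Rmin_pos; lra|]. intros t ht. apply hB.
    pose proof (Rmin_l (1 / 2 - atan B / PI) 1). pose proof (Rmin_r (1 / 2 - atan B / PI) 1).
    apply Rnot_le_lt. intros hle.
    assert (ot : open_interval t) by (unfold open_interval; lra).
    assert (atan (th t) <= atan B).
    { destruct (Rle_lt_or_eq_dec _ _ hle) as [hl| ->]; [left; apply atan_increasing; auto|lra]. }
    rewrite ath in H1 by auto.
    assert (t - 1 / 2 <= atan B / PI).
    { apply Rmult_le_reg_l with PI; auto. replace (PI * (atan B / PI)) with (atan B) by (field; lra). lra. }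
    lra. }
  exists (fun s => h (th s)). repeat split; auto.
  - intros s hs e he. destruct (ch (th s) e he) as [d [hd k]].
    assert (ct : continuity_pt th s).
    { unfold th. apply (continuity_pt_comp (fun s => PI * (s - 1 / 2)) tan).
      - apply continuity_pt_mult; [apply continuity_pt_const; intros ? ?; auto|].
        apply continuity_pt_minus; [apply derivable_continuous_pt, derivable_pt_id|apply continuity_pt_const; intros ? ?; auto].
      - apply derivable_continuous_pt, derivable_pt_tan. specialize (rg s hs). lra. }
    destruct (continuity_pt_bound th s ct d hd) as [d' [hd' k']]. exists d'; split; auto.
    intros t _ ht. apply k; [exact I|auto].
  - intros s t hs ht E. apply inj in E. pose proof (ath s hs) as E1. pose proof (ath t ht) as E2. rewrite E, E2 in E1.
    apply Rmult_eq_reg_l in E1; lra.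
  - intros e he. destruct (hend (fun t => h (- t)) b0 l0 e he) as [d [hd k]]. exists d; split; auto. intros t ht.
    rewrite th_neg. auto.
  - intros hz. apply hA in hz. destruct hz as [t <-]. exists (1 / 2 + atan t / PI). pose proof (atan_bound t) as hb. split.
    + unfold open_interval. assert (- (1 / 2) < atan t / PI < 1 / 2); [|lra].
      split; apply Rmult_lt_reg_r with PI; auto; unfold Rdiv; rewrite ?Rmult_assoc, ?Rinv_l by lra; lra.
    + f_equal. unfold th. replace (PI * (1 / 2 + atan t / PI - 1 / 2)) with (atan t) by (field; lra). apply tan_atan.
  - intros [t [_ <-]]. apply hA. exists (th t). auto.
Qed.

Lemma ends_at_reparam (G : R -> C) b : ends_at G b -> ends_at (fun t => G ((1 + t) / 2)) b.
Proof.
  intros h e he. destruct (h e he) as [d [hd k]]. exists d; split; auto. intros t ht. apply k. lra.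
Qed.

Lemma lindelof_open (phi : C -> C) M alpha a p (G : R -> C) : Cmod alpha = 1 ->
  holomorphic_on unit_disk phi -> (forall z, unit_disk z -> Cmod (phi z) <= M) -> radial_limit phi alpha p ->
  (forall t, open_interval t -> rcont open_interval G t) -> (forall t, open_interval t -> unit_disk (G t)) ->
  ends_at G alpha -> ends_at (fun t => phi (G t)) a -> a = p.
Proof.
  intros ha hf hM hr cG hG e1 e2.
  apply (lindelof phi M alpha a p (fun t => G ((1 + t) / 2))); auto.
  - intros t ht e he. unfold halfopen in *.
    destruct (cG ((1 + t) / 2)) with (e := e) as [d [hd k]]; [unfold open_interval; lra|auto|].
    exists d; split; auto. intros s hs hst. apply k; [unfold open_interval; lra|].
    replace ((1 + s) / 2 - (1 + t) / 2) with ((s - t) / 2) by field. unfold Rdiv. rewrite Rabs_mult, (Rabs_right (/ 2)) by lra. lra.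
  - intros t ht. apply hG. unfold halfopen, open_interval in *. lra.
  - apply ends_at_reparam; auto.
  - apply (ends_at_reparam (fun t => phi (G t))); auto.
Qed.

(* the case where S leaves Omega: both ends of the lift are asymptotic paths *)
Lemma crosscut_open_arc Om phi M alpha p S g t0 z0 gh x0 : is_open Om -> holomorphic_on unit_disk phi ->
  covering_map unit_disk Om phi -> (forall z, unit_disk z -> Cmod (phi z) <= M) -> Cmod alpha = 1 -> radial_limit phi alpha p ->
  periodic_param S g -> ~ S p -> unit_disk z0 -> phi z0 = g t0 -> max_lift Om phi g t0 z0 gh -> ~ Om (g x0) ->
  exists G b0 b1, open_arc (component (disk_preimage phi S) z0) G b0 b1 /\ b0 <> alpha /\ b1 <> alpha.
Proof.
  intros oOm hf hc hM ha hr hg nSp hz0 E0 hm nx0.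
  pose proof hm as [_ [cgh hgh]]. pose proof hg as [cg [per [inj hS]]].
  assert (Om0 : Om (g t0)) by (rewrite <- E0; apply hc; auto).
  destruct (lift_dom_interval Om S g t0 x0 oOm hg Om0 nx0) as [a [b [hab [hba [na [nb hdom]]]]]].
  set (G := fun s => gh (a + s * (b - a))).
  assert (inJ : forall s, open_interval s -> lift_dom Om g t0 (a + s * (b - a))).
  { intros s hs. apply hdom. unfold open_interval in hs. split; nra. }
  assert (cG : forall t, open_interval t -> rcont open_interval G t).
  { intros t ht e he. destruct (cgh _ (inJ t ht) e he) as [d [hd k]]. exists (d / (b - a)).
    split; [apply Rdiv_lt_0_compat; lra|]. intros s hs hst. apply k; auto.
    replace (a + s * (b - a) - (a + t * (b - a))) with ((s - t) * (b - a)) by ring.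
    rewrite Rabs_mult, (Rabs_right (b - a)) by lra.
    apply Rmult_lt_compat_r with (r := b - a) in hst; [|lra]. unfold Rdiv in hst. rewrite Rmult_assoc, Rinv_l in hst by lra. lra. }
  assert (GD : forall t, open_interval t -> unit_disk (G t)) by (intros t ht; apply hgh; auto).
  assert (Gphi : forall t, open_interval t -> phi (G t) = g (a + t * (b - a))) by (intros t ht; apply hgh; auto).
  assert (cG' : forall t, open_interval t -> rcont open_interval (fun t => G (1 - t)) t).
  { intros t ht e he. destruct (cG (1 - t)) with (e := e) as [d [hd k]]; [unfold open_interval in *; lra|auto|].
    exists d; split; auto. intros s hs hst. apply k; [unfold open_interval in *; lra|].
    replace (1 - s - (1 - t)) with (- (s - t)) by ring. rewrite Rabs_Ropp. auto. }
  assert (GD' : forall t, open_interval t -> unit_disk (G (1 - t))) by (intros t ht; apply GD; unfold open_interval in *; lra).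
  assert (lim1 : ends_at (fun t => phi (G t)) (g b)).
  { intros e he. destruct (cg b e he) as [d [hd k]]. exists (Rmin (d / (b - a)) 1).
    split; [apply Rmin_pos; [apply Rdiv_lt_0_compat; lra|lra]|]. intros t ht.
    pose proof (Rmin_l (d / (b - a)) 1). pose proof (Rmin_r (d / (b - a)) 1).
    rewrite Gphi by (unfold open_interval; lra). apply k; [exact I|].
    replace (a + t * (b - a) - b) with (- ((1 - t) * (b - a))) by ring.
    rewrite Rabs_Ropp, Rabs_right by nra.
    assert (d / (b - a) * (b - a) = d) by (field; lra). nra. }
  assert (lim0 : ends_at (fun t => phi (G (1 - t))) (g a)).
  { intros e he. destruct (cg a e he) as [d [hd k]]. exists (Rmin (d / (b - a)) 1).
    split; [apply Rmin_pos; [apply Rdiv_lt_0_compat; lra|lra]|]. intros t ht.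
    pose proof (Rmin_l (d / (b - a)) 1). pose proof (Rmin_r (d / (b - a)) 1).
    rewrite Gphi by (unfold open_interval; lra). apply k; [exact I|].
    replace (a + (1 - t) * (b - a) - a) with ((1 - t) * (b - a)) by ring.
    rewrite Rabs_right by nra.
    assert (d / (b - a) * (b - a) = d) by (field; lra). nra. }
  assert (asym : forall (H : R -> C) c, ~ Om c -> (forall t, open_interval t -> rcont open_interval H t) ->
     (forall t, open_interval t -> unit_disk (H t)) -> ends_at (fun t => phi (H t)) c -> exists b, Cmod b = 1 /\ ends_at H b).
  { intros H c nc cH HD lH. destruct (omitted_value Om phi M c hf hc hM nc) as [q1 [q2 q3]].
    apply (asymptotic_end (fun z => phi z - c)%C (M + Cmod c)); auto.
    intros e he. destruct (lH e he) as [d [hd k]]. exists d; split; auto. intros t ht. specialize (k t ht).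
    rewrite Cdist_Cmod in *. replace (phi (H t) - c - 0)%C with (phi (H t) - c)%C by ring. auto. }
  destruct (asym G (g b) nb cG GD lim1) as [b1 [m1 e1]].
  destruct (asym (fun t => G (1 - t)) (g a) na cG' GD' lim0) as [b0 [m0 e0]].
  assert (ngp : forall t, g t <> p) by (intros t E; apply nSp, hS; exists t; auto).
  exists G, b0, b1. split; [|split].
  - repeat split; auto.
    + intros s t hs ht E. assert (E2 : g (a + s * (b - a)) = g (a + t * (b - a))) by (rewrite <- !Gphi, E; auto).
      destruct (inj _ _ E2) as [k hk].
      (* The parameter interval has length at most 1, so two of its inner points that differ by an
         integer coincide. *)
      assert (K : -1 < IZR k < 1).
      { unfold open_interval in *. assert (IZR k = (s - t) * (b - a)) by lra. split; nra. }
      destruct K as [k1 k2]. apply lt_IZR in k1, k2. assert (k = 0%Z) by lia. subst k.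
      assert (s * (b - a) = t * (b - a)) by lra. apply Rmult_eq_reg_r in H; lra.
    + intros hz. apply (max_lift_component Om phi S g t0 z0 gh hc hg hz0 E0 hm) in hz. destruct hz as [t [ht <-]].
      apply hdom in ht. exists ((t - a) / (b - a)). split.
      * unfold open_interval. split; [apply Rdiv_lt_0_compat; lra|].
        apply Rmult_lt_reg_r with (b - a); [lra|]. unfold Rdiv. rewrite Rmult_assoc, Rinv_l; lra.
      * unfold G. f_equal. field. lra.
    + intros [t [ht <-]]. apply (max_lift_component Om phi S g t0 z0 gh hc hg hz0 E0 hm).
      exists (a + t * (b - a)). split; auto.
  (* An end at alpha would, by Lindelof, make the value g a on the curve equal to p, which is not on
     S. *)
  - intros ->. apply (ngp a). apply (lindelof_open phi M alpha (g a) p (fun t => G (1 - t))); auto.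
  - intros ->. apply (ngp b). apply (lindelof_open phi M alpha (g b) p G); auto.
Qed.

Lemma max_lift_full Om phi S g t0 z0 gh : covering_map unit_disk Om phi -> periodic_param S g ->
  unit_disk z0 -> phi z0 = g t0 -> max_lift Om phi g t0 z0 gh -> (forall t, Om (g t)) ->
  full_lift phi g gh /\ forall w, component (disk_preimage phi S) z0 w <-> exists t, gh t = w.
Proof.
  intros hc hg hz0 E0 hm all. pose proof hm as [_ [cgh hgh]].
  assert (dom : forall t, lift_dom Om g t0 t) by (intros t x _; auto). split.
  - split; [intros t; apply rcont_sub with (lift_dom Om g t0); auto|auto].
  - intros w. rewrite (max_lift_component Om phi S g t0 z0 gh hc hg hz0 E0 hm). split.
    + intros [t [_ E]]. exists t; auto.
    + intros [t E]. exists t; auto.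
Qed.

Lemma opp_neq_self (al : C) : Cmod al = 1 -> (- al)%C <> al.
Proof.
  intros ha E. assert (E2 : (al + al)%C = RtoC 0) by (rewrite <- E at 1; ring).
  assert (Cmod (al + al)%C = 2).
  { replace (al + al)%C with (2 * al)%C by ring. rewrite Cmod_mult, ha, Cmod_R, Rabs_right; lra. }
  rewrite E2, Cmod_0 in H. lra.
Qed.

(* the case S inside Omega: the ends are the fixed points of the deck transformation along the lift *)
Lemma loop_open_arc Om phi M alpha p S g t0 z0 gh : holomorphic_on unit_disk phi ->
  covering_map unit_disk Om phi -> (forall z, unit_disk z -> Cmod (phi z) <= M) -> Cmod alpha = 1 -> radial_limit phi alpha p ->
  (forall e, 0 < e -> exists q, ~ Om q /\ q <> p /\ Cdist q p < e) ->
  periodic_param S g -> unit_disk z0 -> phi z0 = g t0 -> max_lift Om phi g t0 z0 gh -> (forall t, Om (g t)) ->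
  (forall s t, gh s = gh t -> s = t) ->
  exists G b0 b1, open_arc (component (disk_preimage phi S) z0) G b0 b1 /\ b0 <> alpha /\ b1 <> alpha.
Proof.
  intros hf hc hM ha hr acc hg hz0 E0 hm all hinj.
  destruct (max_lift_full Om phi S g t0 z0 gh hc hg hz0 E0 hm all) as [hfl comp].
  pose proof hfl as [ch hh]. pose proof hg as [cg [per [inj hS]]].
  assert (np : ~ Om p) by (eapply radial_limit_not_in; eauto).
  assert (hD : forall t, unit_disk (gh t)) by (intros; apply hh).
  assert (g1 : forall t, g (t + 1) = g t) by (intros t; apply (per t 1%Z)).
  assert (gm1 : forall t, g (t + -1) = g t) by (intros t; apply (per t (-1)%Z)).
  assert (E01 : phi (gh 0) = phi (gh 1)).
  { destruct (hh 0) as [_ ->]. destruct (hh 1) as [_ ->]. rewrite <- (g1 0). f_equal. ring. }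
  (* [T] advances the lift by one turn of S and [T'] moves it back; uniqueness of lifts makes them
     inverse to each other. *)
  destruct (deck_exists Om phi (gh 0) (gh 1) hf hc (hD 0) (hD 1) E01) as [T [hT [TD [Tphi T0]]]].
  destruct (deck_exists Om phi (gh 1) (gh 0) hf hc (hD 1) (hD 0) (eq_sym E01)) as [T' [hT' [TD' [Tphi' T0']]]].
  assert (Th : forall t, T (gh t) = gh (t + 1)).
  { apply (deck_shift Om phi S g gh T 1 hc hg hfl hT TD Tphi g1 0). rewrite Rplus_0_l. auto. }
  assert (Th' : forall t, T' (gh t) = gh (t + -1)).
  { apply (deck_shift Om phi S g gh T' (-1) hc hg hfl hT' TD' Tphi' gm1 1). rewrite T0'. f_equal. ring. }
  assert (cT : forall F, holomorphic_on unit_disk F -> continuous_on unit_disk F).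
  { intros F hF. apply cont_on_intro. intros z hz. destruct (hF z hz) as [L hL]. apply cont_at_in. eapply cderiv_cont; exact hL. }
  assert (invT : forall A B, holomorphic_on unit_disk A -> holomorphic_on unit_disk B ->
     (forall z, unit_disk z -> unit_disk (A z)) -> (forall z, unit_disk z -> unit_disk (B z)) ->
     (forall z, unit_disk z -> phi (A z) = phi z) -> (forall z, unit_disk z -> phi (B z) = phi z) ->
     B (A (gh 1)) = gh 1 -> forall z, unit_disk z -> B (A z) = z).
  { intros A B hA hB AD BD Ap Bp E.
    apply (convex_lift_unique unit_disk Om phi unit_disk (fun z => B (A z)) (fun z => z) (gh 1) hc convex_unit_disk); auto.
    - apply cT. apply (holomorphic_comp unit_disk unit_disk A B); auto.
    - apply cont_on_intro. intros z _. apply cont_in_id.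
    - intros z hz. rewrite Bp, Ap; auto. }
  assert (TT : forall z, unit_disk z -> T' (T z) = z).
  { apply (invT T T'); auto. rewrite Th, Th'. f_equal. ring. }
  assert (TT' : forall z, unit_disk z -> T (T' z) = z).
  { apply (invT T' T); auto. rewrite Th', Th. f_equal. ring. }
  pose proof (full_lift_proper Om phi S g gh hc hg hfl hinj) as prop.
  set (hn := fun t => gh (- t)).
  assert (Thn : forall t, T' (hn t) = hn (t + 1)).
  { intros t. unfold hn. rewrite Th'. f_equal. ring. }
  assert (chn : forall t, rcont allR hn t).
  { intros t e he. destruct (ch (- t) e he) as [d [hd k]]. exists d; split; auto. intros s _ hs.
    apply k; [exact I|]. replace (- s - - t) with (- (s - t)) by ring. rewrite Rabs_Ropp; auto. }
  assert (propn : forall rho, rho < 1 -> exists B, forall t, B < Rabs t -> rho < Cmod (hn t)).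
  { intros rho hrho. destruct (prop rho hrho) as [B hB]. exists B. intros t ht. apply hB. rewrite Rabs_Ropp; auto. }
  destruct (orbit_converges T gh hT TD hD Th ch prop) as [b1 [m1 l1]].
  destruct (orbit_converges T' hn hT' TD' (fun t => hD (- t)) Thn chn propn) as [b0 [m0 l0]].
  destruct (line_open_arc (component (disk_preimage phi S) z0) gh b0 b1 ch hD hinj l1 l0 m0 m1 comp) as [G hG].
  exists G, b0, b1. split; auto.
  assert (phiOm : forall z, unit_disk z -> Om (phi z)) by apply hc.
  split; intros ->.
  - apply (end_not_radial Om phi M T' T hn alpha p); auto.
    + intros t. apply hD.
    + intros E. apply hinj in E. lra.
  - apply (end_not_radial Om phi M T T' gh alpha p); auto.
    intros E. apply hinj in E. lra.
Qed.

(* A lift that closes up would stay away from the circle, which the choice of the component forbids. *)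
Lemma lift_injective Om phi M alpha p S g eps t0 z0 gh (O : C -> Prop) : holomorphic_on unit_disk phi ->
  covering_map unit_disk Om phi -> (forall z, unit_disk z -> Cmod (phi z) <= M) -> Cmod alpha = 1 ->
  periodic_param S g -> (forall z, S z -> Cdist z p < eps) -> eps < Cdist (phi (RtoC 0)) p ->
  is_open O -> O (RtoC 0) -> (forall z, O z -> unit_disk z) -> ~ near_in O alpha ->
  (forall z, unit_disk z -> closure O z -> ~ O z -> component (disk_preimage phi S) z0 z) ->
  unit_disk z0 -> phi z0 = g t0 -> max_lift Om phi g t0 z0 gh -> (forall t, Om (g t)) ->
  forall s t, gh s = gh t -> s = t.
Proof.
  intros hf hc hM ha hg hS he0 oO O0 OD na bd hz0 E0 hm all s t E. apply NNPP. intros hne.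
  destruct (max_lift_full Om phi S g t0 z0 gh hc hg hz0 E0 hm all) as [hfl comp].
  destruct (full_lift_periodic Om phi S g gh s t hc hg hfl E hne) as [k [hk per]].
  (* The closure of a closed lift misses the circle, so any circle point other than alpha can serve
     as the exceptional point. *)
  apply (single_cluster_impossible Om phi M alpha p S g eps z0 O (- alpha)%C hf hc hM ha hg hS he0 oO O0 OD na bd).
  - rewrite Cmod_opp; auto.
  - apply opp_neq_self; auto.
  - intros z hz m1. exfalso.
    pose proof (periodic_image_in_disk phi g gh k hfl hk per z) as Q.
    assert (Cmod z < 1); [|lra]. apply Q. apply closure_mono with (component (disk_preimage phi S) z0); auto.
    intros w hw. apply comp; auto.
Qed.

Lemma nonisolated_case Om phi M alpha p S g eps : is_open Om -> holomorphic_on unit_disk phi ->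
  covering_map unit_disk Om phi -> (forall z, unit_disk z -> Cmod (phi z) <= M) -> Cmod alpha = 1 -> radial_limit phi alpha p ->
  (forall e, 0 < e -> exists q, ~ Om q /\ q <> p /\ Cdist q p < e) ->
  periodic_param S g -> (forall z, S z -> Cdist z p < eps) -> in_interior S p -> eps < Cdist (phi (RtoC 0)) p ->
  exists z0, disk_preimage phi S z0 /\ is_arc (closure (component (disk_preimage phi S) z0)) /\
    separates (closure (component (disk_preimage phi S) z0)) closed_unit_disk alpha C0.
Proof.
  intros oOm hf hc hM ha hr acc hg hS hin he0.
  destruct (separating_radius Om phi alpha p S g eps hc ha hr hg hS hin (Rlt_le _ _ he0))
    as [r [O [hr' [Fz0 [oO [O0 [OD [na bd]]]]]]]].
  set (z0 := Cscale r alpha) in *. destruct Fz0 as [hz0 Sz0].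
  pose proof hg as [_ [_ [_ hgS]]]. pose proof (proj1 (hgS _) Sz0) as [t0 E]. symmetry in E.
  destruct (max_lift_exists Om phi S g z0 t0 hc hg hz0 E) as [gh hm].
  assert (exists G b0 b1, open_arc (component (disk_preimage phi S) z0) G b0 b1 /\ b0 <> alpha /\ b1 <> alpha)
    as [G [b0 [b1 [[a1 [a2 [a3 [a4 [a5 [a6 [a7 a8]]]]]]] [n0 n1]]]]].
  { destruct (classic (forall t, Om (g t))) as [all|nall].
    - apply (loop_open_arc Om phi M alpha p S g t0 z0 gh); auto.
      apply (lift_injective Om phi M alpha p S g eps t0 z0 gh O); auto.
    - apply not_all_ex_not in nall. destruct nall as [x0 nx0].
      apply (crosscut_open_arc Om phi M alpha p S g t0 z0 gh x0); auto. apply hin. }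
  destruct (open_arc_closure _ G b0 b1 a1 a2 a3 a4 a5 a6 a7 a8) as [cl [arc _]].
  assert (Sh1 : forall z, component (disk_preimage phi S) z0 z -> Cmod z < 1).
  { intros z hz. apply component_sub in hz. apply unit_disk_Cmod, hz. }
  assert (bne : b0 <> b1).
  { intros <-. apply (single_cluster_impossible Om phi M alpha p S g eps z0 O b0 hf hc hM ha hg hS he0 oO O0 OD na bd a6 n0).
    intros z hz m1. apply cl in hz. destruct hz as [hz|[hz|hz]]; auto. apply Sh1 in hz. lra. }
  exists z0. split; [split; auto|]. split; [auto|].
  apply (separates_from_side O); auto.
  - intros hcl. apply cl in hcl. destruct hcl as [h|[h|h]]; try congruence. apply Sh1 in h. lra.
  - intros hcl. apply cl in hcl. destruct hcl as [h|[h|h]].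
    + apply component_sub in h. destruct h as [_ h]. apply hS in h. lra.
    + rewrite <- h, Cmod_0 in a6. lra.
    + rewrite <- h, Cmod_0 in a7. lra.
Qed.

Lemma component_diameter Om phi M p : holomorphic_on unit_disk phi -> covering_map unit_disk Om phi ->
  (forall z, unit_disk z -> Cmod (phi z) <= M) -> ~ Om p ->
  forall eta, 0 < eta -> exists eps, 0 < eps /\ forall S g z0, periodic_param S g ->
    (forall z, S z -> Cdist z p < eps) -> disk_preimage phi S z0 ->
    forall z w, component (disk_preimage phi S) z0 z -> component (disk_preimage phi S) z0 w -> Cdist z w < eta.
Proof.
  intros hf hc hM np eta heta. destruct (koebe_covering Om phi M p hf hc hM np eta heta) as [eps [heps k]].
  exists eps. split; auto. intros S g z0 hg hS [hz0 Sz0] z w hz hw.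
  pose proof hg as [_ [_ [_ hgS]]]. pose proof (proj1 (hgS _) Sz0) as [t0 E]. symmetry in E.
  destruct (max_lift_exists Om phi S g z0 t0 hc hg hz0 E) as [gh hm].
  pose proof (max_lift_component Om phi S g t0 z0 gh hc hg hz0 E hm) as comp.
  apply comp in hz, hw. destruct hz as [s [hs <-]]. destruct hw as [t [ht <-]]. destruct hm as [_ [cgh hgh]].
  apply (k (lift_dom Om g t0) gh s t); auto; [apply lift_dom_convex|].
  intros x hx. destruct (hgh x hx) as [q1 q2]. split; auto. rewrite q2. apply hS, hgS. exists x; auto.
Qed.

(** * Isolated boundary points *)

(** The exponential maps [left_half (ln e)] onto the punctured disk of radius e about 0. *)
Definition left_half (b : R) (w : C) : Prop := fst w < b.

Lemma convex_left_half b : convex (left_half b).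
Proof.
  intros x y t hx hy ht. unfold left_half, seg, Cplus, Cmult, Cminus, Copp, RtoC in *; simpl.
  replace (fst x + (t * (fst y + - fst x) - 0 * (snd y + - snd x))) with ((1 - t) * fst x + t * fst y) by ring.
  destruct (Rle_lt_dec t (1 / 2)); nra.
Qed.

Lemma open_left_half b : is_open (left_half b).
Proof.
  intros z hz. unfold left_half in *. exists (b - fst z). split; [lra|]. intros w hw.
  pose proof (Cdist_fst w z) as h. apply Rabs_le_between in h. lra.
Qed.

Lemma left_half_cexp e w : 0 < e -> left_half (ln e) w <-> Cmod (cexp w) < e.
Proof.
  intros he. unfold left_half. rewrite Cmod_cexp. split; intros h.
  - rewrite <- (exp_ln e he). apply exp_increasing; auto.
  - apply exp_lt_inv. rewrite exp_ln; auto.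
Qed.

Lemma cderiv_shift_cexp (p w : C) : is_cderiv (fun z => p + cexp z)%C w (cexp w).
Proof.
  apply cderiv_val with (0 + cexp w)%C; [|ring].
  apply (cderiv_plus (fun _ => p) cexp); [apply cderiv_const|apply cderiv_cexp].
Qed.

(** The punctured disk is the image of a half-plane under p + exp, so connectedness of the
    half-plane suffices; Omega is relatively open and closed there, as any boundary point of it
    within distance [e] of p is p itself. *)
Lemma isolated_punctured_disk Om (p u : C) e : is_open Om -> (forall q, boundary Om q -> Cdist q p < e -> q = p) ->
  Om u -> u <> p -> Cdist u p < e -> forall q, q <> p -> Cdist q p < e -> Om q.
Proof.
  intros oOm iso Ou up ue q qp qe.
  assert (he : 0 < e) by (pose proof (Cdist_pos q p); lra).
  assert (lg : forall v, v <> p -> Cdist v p < e -> exists w, left_half (ln e) w /\ (p + cexp w)%C = v).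
  { intros v hv hve. destruct (cexp_surj (v - p)%C) as [w hw]; [intros E; apply hv, Ceq_minus; auto|].
    exists w. split; [apply left_half_cexp; auto; rewrite hw, <- Cdist_Cmod; auto|]. rewrite hw. ring. }
  destruct (lg u up ue) as [w0 [hw0 E0]]. destruct (lg q qp qe) as [w [hw E]].
  rewrite <- E. apply (connected_locally_constant (left_half (ln e)) (fun w => Om (p + cexp w)%C)) with w0; auto.
  - apply convex_connected, convex_left_half.
  - intros z hz.
    assert (cz : cont_at (fun z => p + cexp z)%C z) by (eapply cderiv_cont; apply cderiv_shift_cexp).
    assert (dz : Cdist (p + cexp z)%C p = Cmod (cexp z)) by (rewrite Cdist_Cmod; f_equal; ring).
    destruct (classic (Om (p + cexp z)%C)) as [h|h].
    + destruct (oOm _ h) as [r [hr k]]. destruct (cz r hr) as [d [hd kd]]. exists d; split; auto.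
      intros x y _ _ _ hy _. apply k, kd; [exact I|auto].
    + assert (nc : ~ closure Om (p + cexp z)%C).
      { intros hcl. apply (cexp_neq0 z). rewrite (iso (p + cexp z)%C) in dz.
        - rewrite Cdist_refl in dz. apply Cmod_eq_0; auto.
        - split; auto.
        - rewrite dz. apply left_half_cexp; auto. }
      apply not_all_ex_not in nc. destruct nc as [r nc]. apply imply_to_and in nc. destruct nc as [hr nc].
      destruct (cz r hr) as [d [hd kd]]. exists d; split; auto.
      intros x y _ _ hx _ hO. exfalso. apply nc. eexists; split; [exact hO|]. apply kd; [exact I|auto].
  - rewrite E0; auto.
Qed.

(* the universal covering of the punctured disk at p, factored through phi *)
Lemma isolated_half_plane Om phi alpha p e : is_open Om -> holomorphic_on unit_disk phi ->
  covering_map unit_disk Om phi -> Cmod alpha = 1 -> radial_limit phi alpha p -> 0 < e ->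
  (forall q, boundary Om q -> Cdist q p < e -> q = p) ->
  exists psi r1, 0 <= r1 < 1 /\ holomorphic_on (left_half (ln e)) psi /\
    (forall w, left_half (ln e) w -> unit_disk (psi w) /\ phi (psi w) = (p + cexp w)%C) /\
    (forall r, r1 <= r < 1 -> exists w, left_half (ln e) w /\ psi w = Cscale r alpha).
Proof.
  intros oOm hf hc ha hr he iso.
  assert (np : ~ Om p) by (eapply radial_limit_not_in; eauto).
  destruct (hr e he) as [d0 [hd0 h0]]. set (d := Rmin d0 1). assert (hd : 0 < d) by (apply Rmin_pos; lra).
  assert (dd0 : d <= d0) by apply Rmin_l. assert (dd1 : d <= 1) by apply Rmin_r.
  set (r1 := 1 - d / 2). assert (hr1 : 0 <= r1 < 1) by (unfold r1; lra).
  assert (near : forall r, r1 <= r < 1 -> Cdist (phi (Cscale r alpha)) p < e).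
  { intros r hr'. apply h0. unfold r1 in hr'. lra. }
  assert (D : forall r, r1 <= r < 1 -> unit_disk (Cscale r alpha)).
  { intros r hr'. apply unit_disk_Cmod. rewrite Cmod_Cscale, ha; lra. }
  assert (nep : forall r, r1 <= r < 1 -> phi (Cscale r alpha) <> p).
  { intros r hr' E. apply np. rewrite <- E. apply hc; auto. }
  assert (R1 : r1 <= r1 < 1) by lra.
  assert (inOm : forall w, left_half (ln e) w -> Om (p + cexp w)%C).
  { intros w hw. apply (isolated_punctured_disk Om p (phi (Cscale r1 alpha)) e); auto.
    - apply hc; auto.
    - intros E. apply (cexp_neq0 w). replace (cexp w) with (p + cexp w - p)%C by ring. rewrite E. ring.
    - rewrite Cdist_Cmod. replace (p + cexp w - p)%C with (cexp w) by ring. apply left_half_cexp; auto. }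
  destruct (cexp_surj (phi (Cscale r1 alpha) - p)%C) as [w1 E1]; [intros E; apply (nep r1 R1), Ceq_minus; auto|].
  assert (hw1 : left_half (ln e) w1) by (apply left_half_cexp; auto; rewrite E1, <- Cdist_Cmod; auto).
  assert (hq : holomorphic_on (left_half (ln e)) (fun w => p + cexp w)%C).
  { intros w _. exists (cexp w). apply cderiv_shift_cexp. }
  destruct (convex_lift unit_disk Om phi (left_half (ln e)) (fun w => p + cexp w)%C w1 (Cscale r1 alpha) hc)
    as [psi [cpsi [psi1 hpsi]]]; auto.
  { apply convex_left_half. }
  { apply cont_on_intro. intros z hz. apply cont_at_in. eapply cderiv_cont; apply cderiv_shift_cexp. }
  { rewrite E1. toC; ring. }
  exists psi, r1. split; [auto|]. split; [|split; [auto|]].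
  { apply (covering_lift_holomorphic unit_disk Om phi (left_half (ln e)) (fun w => p + cexp w)%C psi); auto;
      [apply open_unit_disk|apply open_left_half]. }
  set (J := fun r => r1 <= r < 1).
  set (X := fun z : C => J (fst z)).
  assert (cvX : convex X).
  { intros x y t hx hy ht. unfold X, J, seg, Cplus, Cmult, Cminus, Copp, RtoC in *; simpl.
    replace (fst x + (t * (fst y + - fst x) - 0 * (snd y + - snd x))) with ((1 - t) * fst x + t * fst y) by ring.
    split; [nra|]. destruct (Rle_lt_dec t (1 / 2)); nra. }
  assert (cs : forall z, cont_at (fun z => Cscale (fst z) alpha) z).
  { intros z. apply cont_in_ext with (fun z => RtoC (fst z) * alpha)%C; [exact I|intros; apply Cscale_mult|].
    apply cont_in_mult; [|apply cont_in_const]. apply (cont_in_fst _ (fun z => z)), cont_in_id. }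
  assert (cphi : continuous_on unit_disk phi) by apply hc.
  (* A logarithm [ell] of phi - p along the end of the radius, starting at [w1]. Then psi after ell
     and the radius are lifts of the same path with the same start, so [psi] takes every value on
     that end. *)
  destruct (convex_lift everywhere (fun z => z <> RtoC 0) cexp X (fun z => phi (Cscale (fst z) alpha) - p)%C (r1, 0) w1 covering_cexp)
    as [ell [cell [ell1 hell]]]; auto.
  { apply cont_on_intro. intros z hz. apply cont_in_minus; [|apply cont_in_const].
    apply (cont_in_comp X unit_disk (fun z => Cscale (fst z) alpha) phi); [intros w hw; apply D, hw|apply cont_at_in, cs|].
    apply cont_on_in; [auto|apply D, hz]. }
  { intros x hx E. apply (nep (fst x) hx), Ceq_minus; auto. }
  { exact I. }
  assert (inH : forall r, J r -> left_half (ln e) (ell (r, 0))).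
  { intros r hr'. apply left_half_cexp; auto. destruct (hell (r, 0) hr') as [_ ->]. rewrite <- Cdist_Cmod. apply near; auto. }
  intros r hr'. exists (ell (r, 0)). split; [apply inH; auto|].
  apply (lift_unique unit_disk Om phi J (fun r => psi (ell (r, 0))) (fun r => Cscale r alpha) hc) with (s := r1); auto.
  - intros a b t h1 h2 h3. unfold J in *. lra.
  - intros t ht. apply (rcont_comp J (left_half (ln e)) (fun r => ell (r, 0)) psi); auto.
    + apply (rcont_of_cont J X ell); [intros s hs; exact hs|]. apply cont_on_in; auto.
    + apply cont_on_in; auto.
  - intros t ht. apply (rcont_of_cont J everywhere (fun z => Cscale (fst z) alpha)); [intros; exact I|apply cs].
  - intros t ht. apply hpsi; auto.
  - intros t ht. destruct (hpsi _ (inH t ht)) as [_ ->]. destruct (hell (t, 0) ht) as [_ ->]. cbn [fst]. toC. ring.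
  - simpl. rewrite ell1. auto.
Qed.

(** A point far to the left is joined by a segment to a point v that [psi] sends to a point of the
    radius close to alpha; along the segment the distance of phi(psi) from p is |exp| < eps, and
    Koebe's lemma applies. *)
Lemma half_plane_end Om phi M alpha p e psi r1 : holomorphic_on unit_disk phi ->
  covering_map unit_disk Om phi -> (forall z, unit_disk z -> Cmod (phi z) <= M) -> Cmod alpha = 1 ->
  radial_limit phi alpha p -> r1 < 1 -> continuous_on (left_half (ln e)) psi ->
  (forall w, left_half (ln e) w -> unit_disk (psi w) /\ phi (psi w) = (p + cexp w)%C) ->
  (forall r, r1 <= r < 1 -> exists w, left_half (ln e) w /\ psi w = Cscale r alpha) ->
  forall eta, 0 < eta -> exists c, forall w, left_half (ln e) w -> left_half c w -> Cdist (psi w) alpha < eta.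
Proof.
  intros hf hc hM ha hr hr1 cpsi hpsi rad eta heta.
  assert (np : ~ Om p) by (eapply radial_limit_not_in; eauto).
  destruct (koebe_covering Om phi M p hf hc hM np (eta / 2)) as [eps [heps k]]; [lra|].
  destruct (hr eps heps) as [d [hd hdd]].
  exists (ln eps). intros w hw hwe.
  (* The radius point at distance m / 2 from alpha is close to alpha, in the range of [psi], and has
     phi within [eps] of p. *)
  set (m := Rmin (Rmin d eta) (Rmin 1 (1 - r1))).
  assert (hm : 0 < m) by (repeat apply Rmin_pos; lra).
  assert (m <= d /\ m <= eta /\ m <= 1 /\ m <= 1 - r1) as [m1 [m2 [m3 m4]]].
  { unfold m. pose proof (Rmin_l (Rmin d eta) (Rmin 1 (1 - r1))). pose proof (Rmin_r (Rmin d eta) (Rmin 1 (1 - r1))).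
    pose proof (Rmin_l d eta). pose proof (Rmin_r d eta). pose proof (Rmin_l 1 (1 - r1)). pose proof (Rmin_r 1 (1 - r1)). lra. }
  set (r := 1 - m / 2).
  destruct (rad r) as [v [hv Ev]]; [unfold r; lra|].
  assert (hve : left_half (ln eps) v).
  { apply left_half_cexp; auto. replace (cexp v) with (p + cexp v - p)%C by ring.
    rewrite <- Cdist_Cmod. destruct (hpsi v hv) as [_ <-]. rewrite Ev. apply hdd. unfold r. lra. }
  assert (K : Cdist (psi w) (psi v) < eta / 2).
  { replace (psi w) with (psi (seg w v 0)) by (rewrite seg_0; auto).
    replace (psi v) with (psi (seg w v 1)) by (rewrite seg_1; auto).
    apply (k unit_interval (fun t => psi (seg w v t))).
    - apply rconvex_unit_interval.
    - unfold unit_interval; lra.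
    - unfold unit_interval; lra.
    - intros t ht. apply (rcont_comp unit_interval (left_half (ln e)) (seg w v) psi).
      + intros s hs. apply convex_left_half; auto.
      + apply rcont_seg.
      + apply cont_on_in; auto. apply convex_left_half; auto.
    - intros t ht. destruct (hpsi (seg w v t)) as [h1 h2]; [apply convex_left_half; auto|]. split; auto.
      rewrite h2, Cdist_Cmod. replace (p + cexp (seg w v t) - p)%C with (cexp (seg w v t)) by ring.
      apply left_half_cexp; auto. apply convex_left_half; auto. }
  pose proof (Cdist_tri (psi w) (psi v) alpha) as T. rewrite Ev in *.
  assert (Q : Cdist (Cscale r alpha) alpha = m / 2).
  { rewrite Cdist_Cmod, Cscale_mult. replace (r * alpha - alpha)%C with ((r - 1)%R * alpha)%C by (rewrite RtoC_minus; ring).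
    rewrite Cmod_mult, ha, Cmod_R, Rabs_left by (unfold r; lra). unfold r. lra. }
  lra.
Qed.

(* Schwarz-Pick on the disk of radius s + tau about w - s *)
Lemma half_plane_shift b (psi : C -> C) s tau : holomorphic_on (left_half b) psi ->
  (forall w, left_half b w -> unit_disk (psi w)) -> 0 < s -> 0 < tau ->
  exists c, 0 < c /\ forall w, fst w + tau <= b ->
    c * (Cmod (psi (w - s)%C - psi w)%C * Cmod (psi (w - s)%C - psi w)%C) <= 1 - Cmod (psi w) * Cmod (psi w).
Proof.
  (* When the unit disk is mapped affinely onto the disk of radius s + tau about w - s, the points w
     - s and w correspond to 0 and [a]; so their pseudo-hyperbolic distance [a] does not depend on
     w. *)
  intros hpsi hD hs ht. set (a := s / (s + tau)).
  assert (ha : 0 < a < 1).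
  { unfold a. split; [apply Rdiv_lt_0_compat; lra|]. apply Rmult_lt_reg_r with (s + tau); [lra|].
    unfold Rdiv. rewrite Rmult_assoc, Rinv_l; lra. }
  assert (ea : (s + tau) * a = s) by (unfold a; field; lra).
  exists (1 - a * a). split; [nra|]. intros w hw.
  set (aff := fun z => (w - s + (s + tau)%R * z)%C).
  assert (inL : forall z, unit_disk z -> left_half b (aff z)).
  { intros z hz. apply unit_disk_Cmod in hz. pose proof (Cmod_fst z) as Q. apply Rabs_le_between in Q.
    unfold left_half, aff, Cplus, Cminus, Cmult, Copp, RtoC; simpl.
    assert ((s + tau) * fst z < s + tau) by nra. lra. }
  assert (dff : holomorphic_on unit_disk aff).
  { intros z _. eexists. apply (cderiv_plus (fun _ => w - s)%C (fun z => (s + tau)%R * z)%C); [apply cderiv_const|].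
    apply (cderiv_mult (fun _ => RtoC (s + tau)) (fun z => z)); [apply cderiv_const|apply cderiv_id]. }
  assert (hT : holomorphic_on unit_disk (fun z => psi (aff z))) by (apply (holomorphic_comp unit_disk (left_half b)); auto).
  assert (Ea : aff (RtoC a) = w).
  { unfold aff. rewrite <- RtoC_mult, ea. ring. }
  assert (E0 : aff (RtoC 0) = (w - s)%C) by (unfold aff; ring).
  assert (Da : unit_disk (RtoC a)) by (apply unit_disk_Cmod; rewrite Cmod_R, Rabs_right; lra).
  assert (D0 : unit_disk (RtoC 0)) by (apply unit_disk_Cmod; rewrite Cmod_0; lra).
  pose proof (hD _ (inL _ Da)) as u1. pose proof (hD _ (inL _ D0)) as u0.
  pose proof (pick_preserved (fun z => psi (aff z)) (1 - a * a) (RtoC a) (RtoC 0) hT (fun z hz => hD _ (inL z hz)) Da D0) as Q.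
  cbv beta in Q. rewrite Ea, E0 in *. apply pick_close; [apply unit_disk_Cmod; auto|apply unit_disk_Cmod; auto|nra|].
  apply Q; [nra|]. replace (1 - Cconj (RtoC a) * RtoC 0)%C with (RtoC 1) by ring.
  rewrite !Cmod_R, Rabs_R0, Rabs_R1, (Rabs_right a) by lra. lra.
Qed.

(** The real part of the curve may stay bounded below, so the curve itself need not run to the left.
    Translated by s it lies where [psi] is near alpha, and psi(h t) is at bounded hyperbolic
    distance from psi(h t - s); as psi(h t) approaches the circle the two become close. *)
Lemma half_plane_curve_end b b' (psi : C -> C) alpha (h : R -> C) : holomorphic_on (left_half b) psi ->
  (forall w, left_half b w -> unit_disk (psi w)) ->
  (forall eta, 0 < eta -> exists c, forall w, left_half b w -> left_half c w -> Cdist (psi w) alpha < eta) ->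
  b' < b -> (forall t, left_half b' (h t)) ->
  (forall rho, rho < 1 -> exists B, forall t, B < Rabs t -> rho < Cmod (psi (h t))) ->
  forall e, 0 < e -> exists B, forall t, B < Rabs t -> Cdist (psi (h t)) alpha < e.
Proof.
  intros hpsi hD hend hb hh prop e he. destruct (hend (e / 2)) as [c0 hc0]; [lra|].
  set (s := Rmax 1 (b' - c0)). assert (1 <= s) by apply Rmax_l. assert (b' - c0 <= s) by apply Rmax_r.
  destruct (half_plane_shift b psi s (b - b') hpsi hD) as [c [hc kc]]; [lra|lra|].
  (* Gives 1 - |psi(h t)|^2 < c e^2 / 4, hence a euclidean distance from psi(h t - s) below e /
     2. *)
  destruct (prop (1 - c * (e * e) / 8)) as [B hB].
  { assert (0 < c * (e * e)) by (apply Rmult_lt_0_compat; nra). lra. }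
  exists B. intros t ht. specialize (hB t ht). specialize (hh t). unfold left_half in *.
  assert (fs : fst (h t - s)%C = fst (h t) - s) by (unfold Cminus, Cplus, Copp, RtoC; simpl; ring).
  specialize (kc (h t) ltac:(lra)).
  assert (h0 : Cdist (psi (h t - s)%C) alpha < e / 2) by (apply hc0; rewrite fs; lra).
  assert (u : Cmod (psi (h t)) < 1) by (apply unit_disk_Cmod, hD; lra).
  rewrite <- Cdist_Cmod in kc. pose proof (Cdist_pos (psi (h t - s)%C) (psi (h t))) as P.
  pose proof (Cdist_tri (psi (h t)) (psi (h t - s)%C) alpha) as T. rewrite (Cdist_sym (psi (h t)) (psi (h t - s)%C)) in T.
  set (x := Cdist (psi (h t - s)%C) (psi (h t))) in *. set (y := Cmod (psi (h t))) in *.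
  assert (0 <= y) by apply Cmod_ge_0.
  assert (Q : 1 - y * y < c * (e * e) / 4) by nra.
  assert (x * x < e / 2 * (e / 2)).
  { apply Rmult_lt_reg_l with c; auto. lra. }
  assert (x < e / 2) by nra. lra.
Qed.

(** Composing the half-plane map [psi] with a logarithm of g - p gives back the lift of S, since
    both are lifts of [g] through the same point of the radius; the limit of [psi] is thereby
    carried to the ends of the lift. *)
Lemma isolated_case Om phi M alpha p e0 : is_open Om -> holomorphic_on unit_disk phi ->
  covering_map unit_disk Om phi -> (forall z, unit_disk z -> Cmod (phi z) <= M) -> Cmod alpha = 1 -> radial_limit phi alpha p ->
  0 < e0 -> (forall q, boundary Om q -> Cdist q p < e0 -> q = p) ->
  exists eps, 0 < eps /\ forall S g, periodic_param S g -> (forall z, S z -> Om z) ->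
    (forall z, S z -> Cdist z p < eps) -> in_interior S p ->
    exists z0, disk_preimage phi S z0 /\ is_simple_closed_curve (closure (component (disk_preimage phi S) z0)) /\
      (forall z, closure (component (disk_preimage phi S) z0) z /\ unit_circle z <-> z = alpha).
Proof.
  intros oOm hf hc hM ha hr he0 iso.
  assert (np : ~ Om p) by (eapply radial_limit_not_in; eauto).
  destruct (isolated_half_plane Om phi alpha p e0 oOm hf hc ha hr he0 iso) as [psi [r1 [hr1 [hpsi [lpsi rad]]]]].
  assert (cpsi : continuous_on (left_half (ln e0)) psi).
  { apply cont_on_intro. intros z hz. destruct (hpsi z hz) as [L hL]. apply cont_at_in. eapply cderiv_cont; exact hL. }
  destruct (omitted_value Om phi M p hf hc hM np) as [hf1 [_ hf3]].
  (* On |z| <= r1 the distance of phi from p is at least [m]; so for eps < m the base point on the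
     radius lies beyond [r1], in the part covered by [psi]. *)
  destruct (zero_free_lower_bound (fun z => phi z - p)%C r1) as [m [hm km]]; [|auto|lra|].
  { intros z hz. destruct (hf1 z hz) as [L hL]. eapply cderiv_cont; exact hL. }
  assert (d00 : unit_disk (RtoC 0)) by (apply unit_disk_Cmod; rewrite Cmod_0; lra).
  assert (h0 : m <= Cdist (phi (RtoC 0)) p) by (rewrite Cdist_Cmod; apply km; rewrite Cmod_0; lra).
  set (eps := Rmin m e0 / 2). pose proof (Rmin_l m e0). pose proof (Rmin_r m e0). pose proof (Rmin_pos m e0 hm he0).
  assert (heps : 0 < eps) by (unfold eps; lra).
  exists eps. split; auto. intros S g hg SOm hS hin.
  assert (he : eps < Cdist (phi (RtoC 0)) p) by (unfold eps; lra).
  destruct (separating_radius Om phi alpha p S g eps hc ha hr hg hS hin (Rlt_le _ _ he))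
    as [r [O [hr' [Fz0 [oO [O0 [OD [na bd]]]]]]]].
  set (z0 := Cscale r alpha) in *. pose proof Fz0 as [hz0 Sz0].
  pose proof hg as [cg [_ [_ hgS]]]. pose proof (proj1 (hgS _) Sz0) as [t0 E]. symmetry in E.
  destruct (max_lift_exists Om phi S g z0 t0 hc hg hz0 E) as [gh hgh].
  assert (Sg : forall t, S (g t)) by (intros t; apply hgS; exists t; auto).
  assert (all : forall t, Om (g t)) by auto.
  assert (inj : forall s t, gh s = gh t -> s = t).
  { apply (lift_injective Om phi M alpha p S g eps t0 z0 gh O); auto. }
  destruct (max_lift_full Om phi S g t0 z0 gh hc hg hz0 E hgh all) as [hfl comp].
  assert (r1r : r1 <= r).
  { apply Rnot_lt_le. intros hlt. specialize (km z0). specialize (hS _ Sz0). rewrite Cdist_Cmod in hS.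
    assert (m <= Cmod (phi z0 - p)%C); [|unfold eps in hS; lra]. apply km. unfold z0. rewrite Cmod_Cscale, ha; lra. }
  destruct (rad r) as [w0 [hw0 Ew0]]; [lra|].
  destruct (convex_lift everywhere (fun z => z <> RtoC 0) cexp everywhere (fun z => g (fst z) - p)%C (t0, 0) w0 covering_cexp)
    as [F [cF [F0 hF]]].
  { intros ? ? ? _ _ _. exact I. }
  { apply cont_on_intro. intros z _. apply cont_in_minus; [|apply cont_in_const].
    apply cont_in_sub with (fun z => allR (fst z)); [intros; exact I|]. apply (cont_of_rcont allR g), cg. }
  { intros x _ Ex. apply Ceq_minus in Ex. apply (proj1 hin). rewrite <- Ex. auto. }
  { exact I. }
  { exact I. }
  { cbn [fst]. rewrite <- E. destruct (lpsi w0 hw0) as [_ Q]. rewrite Ew0 in Q. fold z0 in Q. rewrite Q. toC. ring. }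
  set (gH := fun t => F (t, 0)).
  assert (eH : forall t, cexp (gH t) = (g t - p)%C) by (intros t; apply (hF (t, 0) I)).
  assert (lH : forall t, left_half (ln eps) (gH t)).
  { intros t. apply left_half_cexp; auto. rewrite eH, <- Cdist_Cmod. auto. }
  assert (lne : ln eps < ln e0) by (apply ln_increasing; auto; unfold eps; lra).
  assert (lH0 : forall t, left_half (ln e0) (gH t)) by (intros t; specialize (lH t); unfold left_half in *; lra).
  assert (agree : forall t, gh t = psi (gH t)).
  { apply (full_lift_agree Om phi g g gh (fun t => psi (gH t)) hc hfl) with (s := t0); auto.
    - split.
      + intros t. apply (rcont_comp allR (left_half (ln e0)) gH psi); auto; [|apply cont_on_in; auto].
        apply (rcont_of_cont allR everywhere F); [intros; exact I|]. apply cont_on_in; auto. exact I.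
      + intros t. destruct (lpsi _ (lH0 t)) as [q1 q2]. split; auto. rewrite q2, eH. ring.
    - destruct hgh as [-> _]. unfold gH. rewrite F0. auto. }
  pose proof (full_lift_proper Om phi S g gh hc hg hfl inj) as prop.
  assert (lim : forall e, 0 < e -> exists B, forall t, B < Rabs t -> Cdist (gh t) alpha < e).
  { intros e hpe.
    destruct (half_plane_curve_end (ln e0) (ln eps) psi alpha gH hpsi) with (e := e) as [B hB]; auto.
    - intros w hw. apply lpsi; auto.
    - intros eta heta. apply (half_plane_end Om phi M alpha p e0 psi r1); auto. lra.
    - intros rho hrho. destruct (prop rho hrho) as [B hB]. exists B. intros t ht. rewrite <- agree. auto.
    - exists B. intros t ht. rewrite agree. auto. }
  destruct (line_open_arc (component (disk_preimage phi S) z0) gh alpha alpha) as [G [a1 [a2 [a3 [a4 [a5 [a6 [a7 a8]]]]]]]]; auto.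
  { apply hfl. }
  { intros t. apply hfl. }
  { intros e hpe. destruct (lim e hpe) as [B hB]. exists B. intros t ht. apply hB.
    pose proof (Rle_abs t). lra. }
  { intros e hpe. destruct (lim e hpe) as [B hB]. exists B. intros t ht. apply hB.
    rewrite Rabs_Ropp. pose proof (Rle_abs t). lra. }
  destruct (open_arc_closure _ G alpha alpha a1 a2 a3 a4 a5 a6 a7 a8) as [cl [_ scc]].
  exists z0. split; [auto|]. split; [auto|]. intros z. unfold unit_circle. rewrite Cnorm_Cmod. split.
  - intros [hz hz1]. apply cl in hz. destruct hz as [hz|[hz|hz]]; auto.
    apply component_sub in hz. destruct hz as [hz _]. apply unit_disk_Cmod in hz. lra.
  - intros ->. split; auto. apply cl; auto.
Qed.

Theorem theorem2p6 (Omega : CC -> Prop) (phi : CC -> CC) (alpha p : CC) :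
  is_open Omega -> is_connected Omega -> is_bounded Omega ->
  holomorphic_on unit_disk phi -> covering_map unit_disk Omega phi ->
  unit_circle alpha -> radial_limit phi alpha p ->
  (~ isolated_in (boundary Omega) p ->
   forall eta, 0 < eta -> exists eps, 0 < eps /\
     forall S : CC -> Prop, is_simple_closed_curve S ->
       (forall z, S z -> Cdist z p < eps) -> in_interior S p ->
       exists z0, disk_preimage phi S z0 /\
         is_arc (closure (component (disk_preimage phi S) z0)) /\
         separates (closure (component (disk_preimage phi S) z0))
                   closed_unit_disk alpha C0 /\
         (forall z w, component (disk_preimage phi S) z0 z ->
                      component (disk_preimage phi S) z0 w -> Cdist z w < eta))
  /\
  (isolated_in (boundary Omega) p ->
   forall eta, 0 < eta -> exists eps, 0 < eps /\
     forall S : CC -> Prop, is_simple_closed_curve S -> (forall z, S z -> Omega z) ->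
       (forall z, S z -> Cdist z p < eps) -> in_interior S p ->
       exists z0, disk_preimage phi S z0 /\
         is_simple_closed_curve (closure (component (disk_preimage phi S) z0)) /\
         (forall z, closure (component (disk_preimage phi S) z0) z /\ unit_circle z
                    <-> z = alpha) /\
         (forall z w, component (disk_preimage phi S) z0 z ->
                      component (disk_preimage phi S) z0 w -> Cdist z w < eta)).
Proof.
  intros oOm _ bOm hf hc hcirc hr.
  assert (ha : Cmod alpha = 1) by (rewrite <- Cnorm_Cmod; exact hcirc).
  destruct (covering_bounded Omega phi hc bOm) as [M hM].
  assert (np : ~ Omega p) by (eapply radial_limit_not_in; eauto).
  assert (bp : boundary Omega p).
  { split; auto. intros e he. destruct (hr e he) as [d [hd k]].
    pose proof (Rmin_l d 1). pose proof (Rmin_r d 1). pose proof (Rmin_pos d 1 hd Rlt_0_1).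
    exists (phi (Cscale (1 - Rmin d 1 / 2) alpha)). split; [|apply k; lra].
    apply hc, unit_disk_Cmod. rewrite Cmod_Cscale, ha; lra. }
  split.
  - intros niso eta heta.
    assert (acc : forall e, 0 < e -> exists q, ~ Omega q /\ q <> p /\ Cdist q p < e).
    { intros e he. apply NNPP. intros n. apply niso. split; auto. exists e. split; auto. intros q [_ hq] hqe.
      apply NNPP. intros hne. apply n. exists q. auto. }
    destruct (component_diameter Omega phi M p hf hc hM np eta heta) as [eps [heps k]].
    assert (h0 : 0 < Cdist (phi (RtoC 0)) p).
    { apply Cdist_neq_pos. intros E. apply np. rewrite <- E. apply hc, unit_disk_Cmod. rewrite Cmod_0. lra. }
    pose proof (Rmin_l eps (Cdist (phi (RtoC 0)) p / 2)). pose proof (Rmin_r eps (Cdist (phi (RtoC 0)) p / 2)).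
    (* Half the distance, because [nonisolated_case] asks for a radius strictly below |phi 0 -
       p|. *)
    exists (Rmin eps (Cdist (phi (RtoC 0)) p / 2)). split; [apply Rmin_pos; lra|].
    intros S hS small hin. destruct (simple_closed_curve_param S hS) as [g hg].
    destruct (nonisolated_case Omega phi M alpha p S g (Cdist (phi (RtoC 0)) p / 2)) as [z0 [h1 [h2 h3]]]; auto.
    + intros z hz. specialize (small z hz). lra.
    + lra.
    + exists z0. split; [exact h1|]. split; [exact h2|]. split; [exact h3|].
      apply (k S g z0 hg); auto. intros z hz. specialize (small z hz). lra.
  - intros [_ [e0 [he0 iso]]] eta heta.
    destruct (component_diameter Omega phi M p hf hc hM np eta heta) as [eps [heps k]].
    destruct (isolated_case Omega phi M alpha p e0 oOm hf hc hM ha hr he0 iso) as [eps1 [heps1 k1]].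
    pose proof (Rmin_l eps eps1). pose proof (Rmin_r eps eps1).
    exists (Rmin eps eps1). split; [apply Rmin_pos; lra|].
    intros S hS SOm small hin. destruct (simple_closed_curve_param S hS) as [g hg].
    destruct (k1 S g hg SOm) as [z0 [h1 [h2 h3]]]; auto.
    + intros z hz. specialize (small z hz). lra.
    + exists z0. split; [exact h1|]. split; [exact h2|]. split; [exact h3|].
      apply (k S g z0 hg); auto. intros z hz. specialize (small z hz). lra.
Qed.
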